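(* Let $n\ge4$, $\alpha\in(0,1)$ and $V,\Theta<\infty$. There exists $C=C(n,\alpha,V,\Theta)$ with the following property. Let $K>0$ and let $X:\mathcal M\times[0,T)\to\mathbb S_K^{n+1}$ be a solution to mean curvature flow with initial condition in the class $\mathcal C_K^n(\alpha,V,\Theta)$. Then \[ |\nabla^2A|^2\le C(H^6+K^3)\quad\text{in}\quad\mathcal M\times[\lambda_0K^{-1},T), \] where $\lambda_0$ is defined by \[ \Lambda_0/2:=\tfrac{1}{n-2+\alpha}\Theta+2(2-\alpha),\qquad \mathrm e^{2n\lambda_0}:=1+\tfrac{n}{n+\Lambda_0}. \]
   Context: $\mathbb S^{n+1}_K$ is the round sphere of dimension $n+1$ and constant sectional curvature $K>0$. A solution to mean curvature flow is a smooth family of immersions $X(\cdot,t):\mathcal M\to\mathbb S_K^{n+1}$ of a closed $n$-manifold with $\partial_tX=-H\nu$, where $\nu$ is a unit normal field, $A(u,v)=\langle D_u\nu,v\rangle$ is the second fundamental form of $X(\cdot,t)$ and $H=\operatorname{tr}A$ its mean curvature. $\nabla^2A$ is the second covariant derivative of $A$ with respect to the Levi-Civita connection of the induced metric at time $t$. Given $n\ge3$, $K>0$, $\alpha\in(0,1)$, $V<\infty$, $\Theta<\infty$, the class $\mathcal C^n_K(\alpha,V,\Theta)$ consists of the (properly, hence compactly) immersed hypersurfaces $X:\mathcal M^n\to\mathbb S_K^{n+1}$ satisfying (1) $\max_{\mathcal M}\big(|A|^2-\frac{1}{n-2+\alpha}H^2\big)\le 2(2-\alpha)K$; (2) $\mu(\mathcal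 M)\le VK^{-n/2}$, where $\mu$ is the measure of the induced metric; (3) $\max_{\mathcal M}H^2\le\Theta K$. *)

(* Defs.v *)
From HB Require Import structures.
From mathcomp Require Import all_boot all_order all_algebra.
From mathcomp Require Import all_classical all_reals all_analysis.
Set Implicit Arguments.
Unset Strict Implicit.
Unset Printing Implicit Defensive.
Import Order.TTheory GRing.Theory Num.Theory.
Import numFieldNormedType.Exports.
Local Open Scope classical_set_scope.
Local Open Scope ring_scope.

Definition iter_derive (R : realType) (E F : normedModType R)
    (vs : seq E) (f : E -> F) : E -> F :=
  foldr (fun v g => 'D_v g) f vs.

(* For finite-dimensional E this is C^oo on the open set U: all iterated
   directional derivatives along constant vectors exist and are continuous. *)
Definition smooth_open (R : realType) (E F : normedModType R)
    (U : set E) (f : E -> F) : Prop :=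
  forall (vs : seq E) (x : E), U x ->
    {for x, continuous (iter_derive vs f)} /\
    forall v, derivable (iter_derive vs f) x v.

(* Smoothness on a set D that need not be open, through local smooth
   extensions; used for U x [0, T), where it is smoothness up to t = 0. *)
Definition smooth_on (R : realType) (E F : normedModType R)
    (D : set E) (f : E -> F) : Prop :=
  forall x, D x -> exists (W : set E) (g : E -> F),
    [/\ open W, W x, smooth_open W g & forall y, W y -> D y -> g y = f y].

(* [param] inverts [coord] on [dom]; values of [coord] outside [dom], and of
   [param] outside the image of [dom], are irrelevant. *)
Record chart (R : realType) (n : nat) (M : topologicalType) := Chart {
  dom : set M;
  coord : M -> 'rV[R]_n;
  param : 'rV[R]_n -> M;
  open_dom : open dom;
  open_codom : open (coord @` dom);
  coordK : forall p, dom p -> param (coord p) = p;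
  coord_cont : forall p, dom p -> {for p, continuous coord};
  param_cont : forall u, (coord @` dom) u -> {for u, continuous param}
}.

(* Second countability follows from compactness.  The point of the carrier is
   only there because measurable types are pointed; connectedness is not
   assumed. *)
Record closedManifold (R : realType) (n : nat) := ClosedManifold {
  carrier :> ptopologicalType;
  atlas : set (chart R n carrier);
  compact_carrier : compact [set: carrier];
  hausdorff_carrier : hausdorff_space carrier;
  atlas_cover : forall p : carrier, exists2 c, atlas c & dom c p;
  atlas_compat : forall c c', atlas c -> atlas c' ->
        smooth_open (coord c @` (dom c `&` dom c')) (coord c' \o param c)
}.

Definition dotp (R : realType) (m : nat) (u v : 'rV[R]_m) : R :=
  \sum_i u 0 i * v 0 i.

(* Geometry of a parametrised hypersurface f in the sphere, with unit normal N
   along f, in the coordinates u.  A covariant r-tensor is the family of its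
   components T_(s_1 ... s_r).  The rows of the Jacobian 'J f u are the partial
   derivatives of f. *)

Definition tensor (R : realType) (n r : nat) :=
  r.-tuple 'I_n -> 'rV[R]_n -> R.

Definition partial (R : realType) (n : nat) (i : 'I_n) (h : 'rV[R]_n -> R) :
    'rV[R]_n -> R :=
  'D_(delta_mx 0 i : 'rV[R]_n) h.

Definition metric (R : realType) (n m : nat) (f : 'rV[R]_n -> 'rV[R]_m)
    (u : 'rV[R]_n) : 'M[R]_n :=
  'J f u *m ('J f u)^T.

Definition christoffel (R : realType) (n m : nat) (f : 'rV[R]_n -> 'rV[R]_m)
    (k i j : 'I_n) (u : 'rV[R]_n) : R :=
  2^-1 * \sum_l invmx (metric f u) k l *
    (partial i (fun w => metric f w j l) u
     + partial j (fun w => metric f w i l) u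
     - partial l (fun w => metric f w i j) u).

(* The new index comes first:
   (nabla T)_(k s) = d_k T_s - \sum_a \sum_l Gamma^l_(k s_a) T_(s[a := l]). *)
Definition covd (R : realType) (n m r : nat) (f : 'rV[R]_n -> 'rV[R]_m)
    (T : tensor R n r) : tensor R n r.+1 :=
  fun ks u =>
    let k := thead ks in
    let s : r.-tuple 'I_n := behead_tuple ks in
    partial k (T s) u
    - \sum_(a < r) \sum_l christoffel f l k (tnth s a) u *
        T [tuple if b == a then l else tnth s b | b < r] u.

Definition tensor_norm2 (R : realType) (n m r : nat)
    (f : 'rV[R]_n -> 'rV[R]_m) (T : tensor R n r) (u : 'rV[R]_n) : R :=
  \sum_(s : r.-tuple 'I_n) \sum_(s' : r.-tuple 'I_n)
    (\prod_(a < r) invmx (metric f u) (tnth s a) (tnth s' a)) *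
    T s u * T s' u.

(* <D_i N, d_j f>: the ambient derivative of N may replace the one of the
   sphere, since they differ by a multiple of f, which is normal to d_j f. *)
Definition sff_mx (R : realType) (n m : nat) (f N : 'rV[R]_n -> 'rV[R]_m)
    (u : 'rV[R]_n) : 'M[R]_n :=
  'J N u *m ('J f u)^T.

Definition sff (R : realType) (n m : nat) (f N : 'rV[R]_n -> 'rV[R]_m) :
    tensor R n 2 :=
  fun s u => sff_mx f N u (tnth s ord0) (tnth s ord_max).

Definition mean_curv (R : realType) (n m : nat) (f N : 'rV[R]_n -> 'rV[R]_m)
    (u : 'rV[R]_n) : R :=
  \tr (invmx (metric f u) *m sff_mx f N u).

(* Integral over R^n of a nonnegative Borel function, by Tonelli. *)
Fixpoint integral_rV (R : realType) (n : nat) :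
    ('rV[R]_n -> \bar R) -> \bar R :=
  match n with
  | 0%N => fun h => h 0
  | n'.+1 => fun h =>
      (\int[@lebesgue_measure R]_(x in [set: R])
         integral_rV (fun v : 'rV[R]_n' => h (row_mx (x%:M : 'rV[R]_1) v)))%E
  end.

Definition borel (M : ptopologicalType) := g_sigma_algebraType (@open M).

(* This determines mu, since finitely many chart domains cover M. *)
Definition induced_measure (R : realType) (n m : nat) (M : closedManifold R n)
    (F : M -> 'rV[R]_m) (mu : {measure set (borel M) -> \bar R}) : Prop :=
  forall c : chart R n M, atlas c ->
  forall B : set (borel M), measurable B -> B `<=` dom c ->
    mu B = integral_rV (fun u =>
      (\1_(coord c @` B) u * Num.sqrt (\det (metric (F \o param c) u)))%:E).

(* The round sphere of dimension n + 1 and curvature K is realised as the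
   sphere of radius K^(-1/2) in R^(n+2). *)
Definition sphere (R : realType) (n : nat) (K : R) : set 'rV[R]_n.+2 :=
  [set x | dotp x x = K^-1].

(* A choice, over the domain of each chart, of a unit normal field; a global
   unit normal field is the case in which it does not depend on the chart.
   The quantities H nu, H^2, |A|^2, |nabla^2 A|^2 are invariant under
   nu |-> - nu. *)
Definition normals (R : realType) (n : nat) (M : closedManifold R n) :=
  chart R n M -> M -> 'rV[R]_n.+2.

Definition is_immersion (R : realType) (n : nat) (M : closedManifold R n)
    (K : R) (F : M -> 'rV[R]_n.+2) : Prop :=
  (forall p, sphere K (F p)) /\
  forall c : chart R n M, atlas c ->
    smooth_open (coord c @` dom c) (F \o param c) /\
    forall p, dom c p -> row_free ('J (F \o param c) (coord c p)).

Definition is_unit_normal (R : realType) (n : nat) (M : closedManifold R n)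
    (F : M -> 'rV[R]_n.+2) (nu : normals M) : Prop :=
  forall c : chart R n M, atlas c ->
    smooth_open (coord c @` dom c) (nu c \o param c) /\
    forall p, dom c p ->
      [/\ dotp (nu c p) (nu c p) = 1,
          dotp (nu c p) (F p) = 0 &
          nu c p *m ('J (F \o param c) (coord c p))^T = 0].

(* |A|^2, H and |nabla^2 A|^2 at the point p of the domain of c. *)
Definition A2 (R : realType) (n : nat) (M : closedManifold R n)
    (F : M -> 'rV[R]_n.+2) (nu : normals M) (c : chart R n M) (p : M) : R :=
  tensor_norm2 (F \o param c) (sff (F \o param c) (nu c \o param c))
    (coord c p).

Definition Hc (R : realType) (n : nat) (M : closedManifold R n)
    (F : M -> 'rV[R]_n.+2) (nu : normals M) (c : chart R n M) (p : M) : R :=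
  mean_curv (F \o param c) (nu c \o param c) (coord c p).

Definition nabla2A2 (R : realType) (n : nat) (M : closedManifold R n)
    (F : M -> 'rV[R]_n.+2) (nu : normals M) (c : chart R n M) (p : M) : R :=
  tensor_norm2 (F \o param c)
    (covd (F \o param c)
      (covd (F \o param c) (sff (F \o param c) (nu c \o param c))))
    (coord c p).

(* F, with normals nu, belongs to C^n_K(alpha, V, Theta). *)
Definition in_class (R : realType) (n : nat) (K alpha V Theta : R)
    (M : closedManifold R n) (F : M -> 'rV[R]_n.+2) (nu : normals M) : Prop :=
  [/\ is_immersion K F /\ is_unit_normal F nu,
      forall c p, atlas c -> dom c p ->
        A2 F nu c p - (n%:R - 2 + alpha)^-1 * Hc F nu c p ^+ 2
          <= 2 * (2 - alpha) * K,
      exists2 mu : {measure set (borel M) -> \bar R},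
        induced_measure F mu &
        (mu [set: M] <= (V * K `^ (- (n%:R / 2)))%:E)%E &
      forall c p, atlas c -> dom c p -> Hc F nu c p ^+ 2 <= Theta * K].

Definition times (R : realType) (T : \bar R) : set R :=
  [set t | 0 <= t /\ (t%:E < T)%E].

Definition smooth_family (R : realType) (n m : nat) (M : closedManifold R n)
    (T : \bar R) (c : chart R n M) (Y : R -> M -> 'rV[R]_m) : Prop :=
  smooth_on ((coord c @` dom c) `*` times T)
    (fun z : 'rV[R]_n * R => Y z.2 (param c z.1)).

(* The time derivative is taken within [0, T), hence one-sided at t = 0. *)
Definition is_mcf (R : realType) (n : nat) (K : R) (M : closedManifold R n)
    (T : \bar R) (X : R -> M -> 'rV[R]_n.+2) (nu : R -> normals M) : Prop :=
  [/\ forall c : chart R n M, atlas c ->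
        smooth_family T c X /\ smooth_family T c (fun t => nu t c),
      forall t, times T t ->
        is_immersion K (X t) /\ is_unit_normal (X t) (nu t) &
      forall t, times T t -> forall (c : chart R n M) p, atlas c -> dom c p ->
        (s - t)^-1 *: (X s p - X t p) @[s --> within (times T) t^']
          --> - Hc (X t) (nu t) c p *: nu t c p].

Definition Lambda0 (R : realType) (n : nat) (alpha Theta : R) : R :=
  2 * ((n%:R - 2 + alpha)^-1 * Theta + 2 * (2 - alpha)).

(* Main.v *)
(** Ambient components reduce everything to the scalar maximum principle.  With
    [D_a = g^ij (d_j X_a) d_i] the second fundamental form is [A_ab = D_a nu_b],
    tensors become families of functions indexed by the coordinates of
    [R^(n+2)], their norms are sums of squares that do not depend on the chart
    or on the sign of [nu], and the commutators of [D_a] with [D_b] and with the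
    time derivative are explicit.

    The pinching [|A|^2 <= a H^2 + b K], [a = 1 / (n - 2 + alpha)],
    [b = 2 (2 - alpha)], is preserved.  As [n >= 4], there is [c] with
    [a < c < 3 / (n + 2)]; then [g = c H^2 - |A|^2 + (b + 1) K] is comparable to
    [H^2 + K], and [3 |DH|^2 <= (n + 2) |nabla A|^2] gives
    [(d_t - Lap) g >= 2 kappa |DA|^2 - C g^2] with [kappa > 0].  Consequently
    [K (t - t0) |DA|^2 - f g^2] has no first zero when [f] is large, so that
    [|DA|^2 <= C g^2] after a time of order [1 / K], and then the same argument
    for [K (t - t0) |DDA|^2 + N g |DA|^2 - f g^3] gives [|DDA|^2 <= C g^3].
    Two time windows of length [lambda0 / (3 K)] fit before
    [t >= lambda0 / K].  Finally [nabla^2 A] is the pullback of a tensor bounded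
    by [|DDA|] and lower order terms. *)

Require Import Defs.
From HB Require Import structures.
From mathcomp Require Import all_boot all_order all_algebra.
From mathcomp Require Import all_classical all_reals all_analysis.
From mathcomp Require Import ring lra.
(* Restores [coord] and other names shadowed by MathComp. *)
Import Defs.
Set Implicit Arguments.
Unset Strict Implicit.
Unset Printing Implicit Defensive.
Import Order.TTheory GRing.Theory Num.Theory.
Import numFieldNormedType.Exports.
Local Open Scope classical_set_scope.
Local Open Scope ring_scope.

(** * Smooth functions *)

(** The evolution equations are identities in an abstract commutative ring with derivations. A chart
    of the flow supplies an instance, in which evaluation at a space-time point is a ring morphism
    to the reals. Constants are chosen uniformly over all such instances, and measuring every jet in
    powers of [sqrt g] makes them independent of [K] and of the flow. Two features of the
    definitions shape the rest. The normal is given chart by chart, up to sign, so only expressions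
    even in it are functions on the whole manifold, and maxima are taken of these alone. Smoothness
    at time 0 means extension to an open set of space-time, on which the flow equations are known
    only for positive times; identities that rest on them reach time 0 by continuity. A value of [c]
    exists because [3 (n - 2 + alpha) > n + 2] amounts to [2 n + 3 alpha > 8]. In the gradient
    estimate the term in [|Dg|^2] coming from [g^2] is not small; the first-order condition at the
    maximum point is what lets [|DDA|^2] absorb it. *)

Section SmoothOpen.
Variables (R : realType) (E F : normedModType R).
Implicit Types (U : set E) (f g : E -> F) (v w : E).

Lemma near_open U f g x : open U -> U x -> (forall y, U y -> f y = g y) ->
  \near x, f x = g x.
Proof. by move=> oU Ux fg; apply: filterS (open_nbhs_nbhs (conj oU Ux)) => y /fg. Qed.

Lemma near_eq_continuous f g x : (\near x, f x = g x) ->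
  {for x, continuous f} -> {for x, continuous g}.
Proof.
move=> fg; rewrite /prop_for /continuous_at -(nbhs_singleton fg).
by apply: cvg_trans; exact: near_eq_cvg.
Qed.

Lemma iter_derive_rcons vs v f : iter_derive (rcons vs v) f = iter_derive vs ('D_v f).
Proof. by rewrite /iter_derive foldr_rcons. Qed.

Lemma iter_derive_eq U f g vs x : open U -> (forall y, U y -> f y = g y) -> U x ->
  iter_derive vs f x = iter_derive vs g x.
Proof.
move=> oU fg; elim: vs x => [|v vs IH] x Ux /=; first exact: fg.
by apply: near_eq_derive; apply: near_open oU Ux _ => y Uy; exact: IH.
Qed.

Lemma smooth_openS U V f : U `<=` V -> smooth_open V f -> smooth_open U f.
Proof. by move=> UV sf vs x /UV; exact: sf. Qed.

Lemma smooth_open_eq U f g : open U -> (forall y, U y -> f y = g y) ->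
  smooth_open U f -> smooth_open U g.
Proof.
move=> oU fg sf vs x Ux; have [cf df] := sf vs x Ux.
have nfg : \near x, iter_derive vs f x = iter_derive vs g x.
  by apply: (near_open oU Ux) => y Uy; exact: iter_derive_eq oU fg Uy.
split; last by move=> v; exact: (near_eq_derivable nfg (df v)).
exact: near_eq_continuous nfg cf.
Qed.

Lemma smooth_open_derive U f v : smooth_open U f -> smooth_open U ('D_v f).
Proof. by move=> sf vs x Ux; rewrite -iter_derive_rcons; exact: sf. Qed.

Lemma smooth_open_cont U f x : smooth_open U f -> U x -> {for x, continuous f}.
Proof. by move=> sf Ux; have [] := sf [::] x Ux. Qed.

Lemma smooth_open_derivable U f x v : smooth_open U f -> U x -> derivable f x v.
Proof. by move=> sf Ux; have [_] := sf [::] x Ux. Qed.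

(** An iterated derivative of a member of [C] agrees on [U] with a member of [C], by induction on
    the list of directions. Agreement on [U] is enough because [U] is open: derivatives at its
    points see nothing outside. *)
Lemma smooth_open_coind (C : (E -> F) -> Prop) U f : open U ->
  (forall f, C f -> forall x, U x -> {for x, continuous f} /\ forall v, derivable f x v) ->
  (forall f v, C f -> exists2 g, C g & forall x, U x -> 'D_v f x = g x) ->
  C f -> smooth_open U f.
Proof.
move=> oU C1 C2 Cf vs x Ux.
have [g Cg fg] : exists2 g, C g & forall x, U x -> iter_derive vs f x = g x.
  elim: vs => [|v vs [g Cg fg]]; first by exists f.
  have [h Ch gh] := C2 g v Cg; exists h => // y Uy /=.
  by rewrite -gh//; apply: near_eq_derive; exact: near_open oU Uy _.
have [cg dg] := C1 g Cg x Ux.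
have ngf : \near x, g x = iter_derive vs f x.
  by apply: near_open oU Ux _ => y Uy; rewrite fg.
split; last by move=> v; exact: (near_eq_derivable ngf (dg v)).
exact: near_eq_continuous ngf cg.
Qed.

Lemma smooth_open_cst U (k : F) : open U -> smooth_open U (cst k).
Proof.
move=> oU; apply: (@smooth_open_coind (fun f => exists k, f = cst k)) => //.
- by move=> _ [c ->] x Ux; split; [exact: cvg_cst|move=> v; exact: derivable_cst].
- move=> _ v [c ->]; exists (cst 0); first by exists 0.
  by move=> x Ux; rewrite derive_cst.
- by exists k.
Qed.

End SmoothOpen.

Section SmoothReal.
Variables (R : realType) (E : normedModType R) (U : set E).
Hypothesis oU : open U.

(** A class made for [smooth_open_coind]: derivatives of sums, products and inverses are again such
    expressions in smooth functions, so no formula for higher derivatives of a product has to be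
    written. *)
Inductive smooth_gen : (E -> R) -> Prop :=
| gen_base f : smooth_open U f -> smooth_gen f
| gen_add f g : smooth_gen f -> smooth_gen g -> smooth_gen (f + g)
| gen_mul f g : smooth_gen f -> smooth_gen g -> smooth_gen (f * g)
| gen_inv f : smooth_gen f -> (forall x, U x -> f x != 0) ->
    smooth_gen (fun x => (f x)^-1).

Lemma smooth_gen_smooth f : smooth_gen f -> smooth_open U f.
Proof.
apply: smooth_open_coind => //.
- move=> {}f; elim => {f} [f sf|f g _ IHf _ IHg|f g _ IHf _ IHg|f _ IHf f0] x Ux.
  + by split; [exact: smooth_open_cont sf Ux|move=> v; exact: smooth_open_derivable sf Ux].
  + have [cf df] := IHf x Ux; have [cg dg] := IHg x Ux.
    by split; [exact: continuousD|move=> v; exact: derivableD].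
  + have [cf df] := IHf x Ux; have [cg dg] := IHg x Ux.
    by split; [exact: continuousM|move=> v; exact: derivableM].
  + have [cf df] := IHf x Ux.
    by split; [apply: cvgV => //; exact: f0|move=> v; apply: derivableV => //; exact: f0].
- suff H : forall h, smooth_gen h -> (forall x v, U x -> derivable h x v) /\
     forall v, exists2 g, smooth_gen g & forall x, U x -> 'D_v h x = g x.
    by move=> h v /H[].
  move=> h; elim => {f h} [f sf|f g _ [df Df] _ [dg Dg]|f g gf [df Df] gg [dg Dg]|f gf [df Df] f0]; split.
  + by move=> x v; exact: smooth_open_derivable.
  + by move=> v; exists ('D_v f) => //; apply: gen_base; exact: smooth_open_derive.
  + by move=> x v Ux; apply: derivableD; [exact: df|exact: dg].
  + move=> v; have [f' gf' ff'] := Df v; have [g' gg' gg'E] := Dg v.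
    exists (f' + g'); first exact: gen_add.
    by move=> x Ux; rewrite deriveD ?ff' ?gg'E//; [exact: df|exact: dg].
  + by move=> x v Ux; apply: derivableM; [exact: df|exact: dg].
  + move=> v; have [f' gf' ff'] := Df v; have [g' gg' gg'E] := Dg v.
    exists (f * g' + g * f'); first by apply: gen_add; exact: gen_mul.
    by move=> x Ux; rewrite deriveM ?ff' ?gg'E//; [exact: df|exact: dg].
  + by move=> x v Ux; apply: derivableV; [exact: f0|exact: df].
  + move=> v; have [f' gf' ff'] := Df v.
    exists ((cst (-1) * ((fun x => (f x)^-1) * (fun x => (f x)^-1))) * f').
      apply: gen_mul => //; apply: gen_mul.
        by apply: gen_base; exact: smooth_open_cst.
      by apply: gen_mul; exact: gen_inv.
    move=> x Ux; rewrite deriveV ?ff'//; [|exact: f0|exact: df].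
    rewrite /GRing.scale/= -[in RHS]/((-1 * ((f x)^-1 * (f x)^-1)) * f' x).
    by rewrite mulN1r expr2 invfM.
Qed.

Lemma smooth_openD (f g : E -> R) : smooth_open U f -> smooth_open U g -> smooth_open U (f + g).
Proof. by move=> sf sg; apply/smooth_gen_smooth/gen_add; exact: gen_base. Qed.

Lemma smooth_openM (f g : E -> R) : smooth_open U f -> smooth_open U g -> smooth_open U (f * g).
Proof. by move=> sf sg; apply/smooth_gen_smooth/gen_mul; exact: gen_base. Qed.

Lemma smooth_openN (f : E -> R) : smooth_open U f -> smooth_open U (- f).
Proof.
move=> sf; have -> : - f = cst (-1) * f.
  by apply/funext => x; rewrite -[RHS]/(-1 * f x) mulN1r.
have sc : smooth_open U (cst (-1) : E -> R) by exact: smooth_open_cst.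
exact: smooth_openM sc sf.
Qed.

Lemma smooth_openV (f : E -> R) : smooth_open U f -> (forall x, U x -> f x != 0) ->
  smooth_open U (fun x => (f x)^-1).
Proof. by move=> sf f0; apply/smooth_gen_smooth/gen_inv => //; exact: gen_base. Qed.

End SmoothReal.

Section Coordinates.
Variables (R : realType) (E : normedModType R) (m : nat).

Lemma smooth_open_coord (U : set E) (f : E -> 'rV[R]_m) b : open U ->
  smooth_open U f -> smooth_open U (fun x => f x 0 b).
Proof.
move=> oU sf.
apply: (@smooth_open_coind _ _ _
   (fun h => exists2 f : E -> 'rV[R]_m, smooth_open U f & h = fun x => f x 0 b)) => //.
- move=> _ [g sg ->] x Ux; split.
    exact: (continuous_comp (smooth_open_cont sg Ux) (@coord_continuous R 1 m 0 b (g x))).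
  by move=> v; have /derivable_mxP := smooth_open_derivable (v := v) sg Ux.
- move=> _ v [g sg ->]; exists (fun x => 'D_v g x 0 b).
    by exists ('D_v g); [exact: smooth_open_derive|].
  by move=> x Ux; rewrite (derive_mx (smooth_open_derivable (v := v) sg Ux)) mxE.
- by exists f.
Qed.

End Coordinates.

(** * Mean value theorem along lines and symmetry of second derivatives *)

Section Lines.
Variables (R : realType) (E : normedModType R).

Lemma is_derive_line (F : normedModType R) (f : E -> F) (x v : E) (s : R) :
  derivable f (s *: v + x) v ->
  is_derive s 1 (fun s : R => f (s *: v + x)) ('D_v f (s *: v + x)).
Proof.
move=> df.
have e : (fun h : R => h^-1 *: (((fun s : R => f (s *: v + x)) \o shift s) (h *: 1) - f (s *: v + x)))
   = (fun h : R => h^-1 *: ((f \o shift (s *: v + x)) (h *: v) - f (s *: v + x))).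
  by apply/funext => h /=; rewrite [h *: 1]mulr1 scalerDl addrA.
by apply: DeriveDef; rewrite /derivable /derive e.
Qed.

Lemma MVT_line_gt0 (f : E -> R) (x v : E) (a : R) : 0 < a ->
  (forall s : R, 0 <= s <= a -> derivable f (s *: v + x) v) ->
  exists2 s : R, 0 < s < a & f (a *: v + x) - f x = a * 'D_v f (s *: v + x).
Proof.
move=> a0 df; pose phi s : R := f (s *: v + x).
have dphi (s : R) : 0 <= s <= a -> is_derive s 1 phi ('D_v f (s *: v + x)).
  by move=> /df; exact: is_derive_line.
have phi0 : phi 0 = f x by rewrite /phi scale0r add0r.
have [|||s sI e] := @MVT _ phi (fun s => 'D_v f (s *: v + x)) 0 a => //.
+ by move=> s; rewrite in_itv/= => /andP[s0 sa]; apply: dphi; rewrite !ltW.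
+ by apply: (@derivable_within_continuous R R phi) => s; rewrite in_itv/= => /dphi [].
+ exists s; first by move: sI; rewrite in_itv.
  by rewrite -phi0 -/(phi a) e subr0 mulrC.
Qed.

Lemma MVT_line (f : E -> R) (x v : E) (a : R) :
  (forall s : R, `|s| <= `|a| -> derivable f (s *: v + x) v) ->
  exists2 s : R, `|s| <= `|a| & f (a *: v + x) - f x = a * 'D_v f (s *: v + x).
Proof.
move=> df.
have [a0|a0|->] := ltgtP a 0; last first.
- by exists 0 => //; rewrite scale0r add0r subrr mul0r.
- have [|s /andP[s0 sa] e] := MVT_line_gt0 (f := f) (x := x) (v := v) a0.
    by move=> s /andP[s0 sa]; apply: df; rewrite !ger0_norm// ltW.
  by exists s => //; rewrite !ger0_norm ?ltW.
- have na0 : 0 < - a by rewrite oppr_gt0.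
  have [|s /andP[s0 sa] e] := MVT_line_gt0 (f := f) (x := a *: v + x) (v := v) na0.
    move=> s /andP[s0 sa]; rewrite addrA -scalerDl; apply: df.
    by rewrite [leRHS]ltr0_norm// ler_norml; apply/andP; split; move: a0 s0 sa; clear; lra.
  exists (s + a).
    by rewrite [leRHS]ltr0_norm// ler_norml; apply/andP; split; move: a0 s0 sa; clear; lra.
  move: e; rewrite !addrA -!scalerDl addNr scale0r add0r => e.
  by rewrite -[LHS]opprB e mulNr opprK.
Qed.

Lemma translate_quotient (F : normedModType R) (f : E -> F) (z x v : E) :
  (fun h : R => h^-1 *: (((fun y => f (z + y)) \o shift x) (h *: v) - f (z + x)))
  = (fun h : R => h^-1 *: ((f \o shift (z + x)) (h *: v) - f (z + x))).
Proof. by apply/funext => h /=; rewrite addrCA. Qed.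

Lemma derive_translate (F : normedModType R) (f : E -> F) (z x v : E) :
  'D_v (fun y => f (z + y)) x = 'D_v f (z + x).
Proof. by rewrite /derive translate_quotient. Qed.

Lemma derivable_translate (F : normedModType R) (f : E -> F) (z x v : E) :
  derivable f (z + x) v -> derivable (fun y => f (z + y)) x v.
Proof. by rewrite /derivable translate_quotient. Qed.

Local Opaque derive.

(** The difference in direction [w] is put into [psi]; the mean value theorem is applied to [psi]
    along [v], then to ['D_v f] along [w]. *)
Lemma second_difference (U : set E) (f : E -> R) (x v w : E) (h : R) :
  smooth_open U f ->
  (forall s t : R, `|s| <= `|h| -> `|t| <= `|h| -> U (t *: w + (s *: v + x))) ->
  exists s t : R, [/\ `|s| <= `|h|, `|t| <= `|h| &
    f (h *: w + (h *: v + x)) - f (h *: v + x) - (f (h *: w + x) - f x)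
    = h ^+ 2 * 'D_w ('D_v f) (t *: w + (s *: v + x))].
Proof.
move=> sf box.
have b0 (s : R) : `|s| <= `|h| -> U (s *: v + x).
  by move=> sh; have := box s 0 sh; rewrite scale0r add0r normr0; apply.
pose psi y := f (h *: w + y) - f y.
have dpsi (s : R) : `|s| <= `|h| -> derivable psi (s *: v + x) v.
  move=> sh; apply: derivableB.
    by apply: derivable_translate; apply: smooth_open_derivable sf _; exact: box.
  by apply: smooth_open_derivable sf _; exact: b0.
have [s sh es] := MVT_line dpsi.
have [|t th et] := @MVT_line ('D_v f) (s *: v + x) w h.
  move=> t th; apply: (@smooth_open_derivable _ _ _ U).
    exact: smooth_open_derive.
  exact: box.
exists s, t; split => //.
have -> : f (h *: w + (h *: v + x)) - f (h *: v + x) - (f (h *: w + x) - f x) =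
   psi (h *: v + x) - psi x by [].
rewrite es /psi deriveB.
- by rewrite derive_translate et expr2 mulrA.
- by apply: derivable_translate; apply: smooth_open_derivable sf _; exact: box.
- by apply: smooth_open_derivable sf _; exact: b0.
Qed.

(** Schwarz's argument: the second difference is symmetric in the two directions, so one mixed
    derivative at some point near [x] equals the other at another such point, and continuity brings
    both to [x]. *)
Lemma deriveC (U : set E) (f : E -> R) (x v w : E) : open U ->
  smooth_open U f -> U x -> 'D_v ('D_w f) x = 'D_w ('D_v f) x.
Proof.
move=> oU sf Ux.
suff H v' w' : 'D_v' ('D_w' f) x <= 'D_w' ('D_v' f) x by apply: le_anti; apply/andP; split; apply: H.
move: v' w' => {}v {}w; apply/ler_addgt0Pl => e e0.
have s1 : smooth_open U ('D_v ('D_w f)) by do 2!apply: smooth_open_derive.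
have s2 : smooth_open U ('D_w ('D_v f)) by do 2!apply: smooth_open_derive.
have e20 : 0 < e / 2 by rewrite divr_gt0.
have /cvgrPdist_lt/(_ _ e20) n1 := smooth_open_cont s1 Ux.
have /cvgrPdist_lt/(_ _ e20) n2 := smooth_open_cont s2 Ux.
have nU : \near x, U x by exact: open_nbhs_nbhs.
have /nbhs_ballP[d /= d0 B] : nbhs x [set y | [/\ `|'D_v ('D_w f) x - 'D_v ('D_w f) y| < e / 2,
   `|'D_w ('D_v f) x - 'D_w ('D_v f) y| < e / 2 & U y]].
  refine (filterS3 _ (fun y p q r => And3 p q r) n1 n2 nU).
(* Small enough for the parallelogram spanned by [h *: v] and [h *: w] to stay in the ball of radius
   [d]; the added 1 keeps the denominator positive. *)
pose h := d / (`|v| + `|w| + 1).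
have n0 : 0 < `|v| + `|w| + 1 by rewrite ltr_wpDl// addr_ge0.
have h0 : 0 < h by rewrite divr_gt0.
have Bh (s t : R) : `|s| <= `|h| -> `|t| <= `|h| -> ball x d (t *: w + (s *: v + x)).
  rewrite (gtr0_norm h0) => sh th; rewrite -ball_normE /= addrA opprD addrCA subrr addr0 normrN.
  rewrite (le_lt_trans (ler_normD _ _))// !normrZ.
  have : `|t| * `|w| + `|s| * `|v| <= h * `|w| + h * `|v|.
    by rewrite lerD// ler_wpM2r.
  move=> /le_lt_trans; apply.
  have -> : d = h * (`|v| + `|w| + 1) by rewrite /h divfK// gt_eqF.
  by rewrite -mulrDr ltr_pM2l// addrC ltrDl.
have [s [t [sh th est]]] := second_difference sf (fun s t sh th => let: And3 _ _ u := B _ (Bh s t sh th) in u).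
have Bh' (s' t' : R) : `|s'| <= `|h| -> `|t'| <= `|h| -> ball x d (t' *: v + (s' *: w + x)).
  by move=> *; rewrite addrCA; exact: Bh.
have [s' [t' [sh' th' est']]] := second_difference sf (fun s t sh th => let: And3 _ _ u := B _ (Bh' s t sh th) in u).
have eq1 : 'D_w ('D_v f) (t *: w + (s *: v + x)) = 'D_v ('D_w f) (t' *: v + (s' *: w + x)).
  apply: (@mulfI _ (h ^+ 2)); first by rewrite expf_neq0 ?gt_eqF.
  apply: (etrans (esym est)); apply: (etrans _ est'); rewrite (addrCA (h *: v) (h *: w) x).
  by move: (f (h *: w + (h *: v + x))) (f (h *: v + x)) (f (h *: w + x)) (f x); clear => p a b q; ring.
have aux (a b z : R) : `|b - z| < e / 2 -> `|a - z| < e / 2 -> a <= b + e.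
  by rewrite !ltr_norml => /andP[a1 _] /andP[_ a2]; apply: ltW; move: a1 a2; clear; lra.
have [_ q1 _] := B _ (Bh s t sh th).
have [q2 _ _] := B _ (Bh' s' t' sh' th').
have q1' := eq_ind _ (fun z => is_true (`|'D_w ('D_v f) x - z| < e / 2)) q1 _ eq1.
by rewrite addrC; exact: aux q1' q2.
Qed.

End Lines.

Local Transparent derive.

(** * Frechet differentiability from directional derivatives *)

Section DifferentiableRow.
Variables (R : realType) (n : nat).
Local Notation V := 'rV[R]_n.
Local Notation e_ i := (delta_mx 0 i : V).

Definition linear_form (c : 'I_n -> R) (h : V) : R := \sum_i h 0 i * c i.

Lemma linear_form_linear c : linear (linear_form c : V -> R).
Proof.
move=> a u w; rewrite /linear_form scaler_sumr -big_split /=.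
by apply: eq_bigr => i _; rewrite !mxE mulrDl -mulrA.
Qed.

HB.instance Definition _ c :=
  GRing.isLinear.Build R V R _ (linear_form c) (linear_form_linear c).

Lemma linear_form_continuous c : continuous (linear_form c : V -> R).
Proof.
have -> : linear_form c = \sum_i (fun h : V => h 0 i * c i).
  by apply/funext => h; rewrite fct_sumE.
elim/big_ind: _ => [|f g cf cg|i _] x; first exact: (@cst_continuous V R 0 x).
- by apply: continuousD; [exact: cf|exact: cg].
- apply: (@continuousM R V (fun h => h 0 i) (cst (c i)) x); last exact: cst_continuous.
  exact: (@coord_continuous R 1 n 0 i x).
Qed.

(** The points [head_row h k + x], for [k] from 0 to [n], lead from [x] to [h + x] by changing one
    coordinate at a time. *)
Definition head_row (h : V) (k : nat) : V := \sum_(i < n | (i < k)%N) h 0 i *: e_ i.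

Lemma head_rowE h k j : head_row h k 0 j = if (j < k)%N then h 0 j else 0.
Proof.
rewrite /head_row summxE; case: ifPn => jk.
  rewrite (bigD1 j)//= !mxE !eqxx mulr1 big1 ?addr0// => i /andP[_ ij].
  by rewrite !mxE eqxx/= eq_sym (negbTE ij) mulr0.
rewrite big1// => i ik; rewrite !mxE eqxx/=.
by case: eqP => [ji|_]; rewrite ?mulr0//; move: jk; rewrite ji ik.
Qed.

Lemma head_row_full h : head_row h n = h.
Proof. by apply/rowP => j; rewrite head_rowE ltn_ord. Qed.

Lemma head_rowS h k (kn : (k < n)%N) :
  head_row h k.+1 = h 0 (Ordinal kn) *: e_ (Ordinal kn) + head_row h k.
Proof.
apply/rowP => j; rewrite mxE !head_rowE !mxE eqxx/= ltnS leq_eqVlt.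
case: (eqVneq j (Ordinal kn)) => [->|jk] /=; first by rewrite eqxx ltnn mulr1 addr0.
suff /negbTE -> : val j != k by rewrite mulr0 add0r.
by apply: contraNneq jk => jk; apply/eqP/val_inj.
Qed.

Lemma rV_norm_lt (h : V) d : 0 < d -> (forall j, `|h 0 j| < d) -> `|h| < d.
Proof.
move=> d0 hd; rewrite /Num.Def.normr/= mx_normrE; apply: bigmax_lt => //= -[i j] _.
by rewrite ord1 hd.
Qed.

Lemma coord_norm_le (h : V) j : `|h 0 j| <= `|h|.
Proof. by rewrite [leRHS]/Num.Def.normr/= mx_normrE; exact: (le_bigmax _ _ (0, j)). Qed.

(** Each step of the path through the points [head_row h k + x] is a mean value theorem along one
    basis vector, and the partial derivative at the intermediate point is within [eta] of its value
    at [x]. *)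
Lemma smooth_first_order (U : set V) (f : V -> R) (x : V) : open U ->
  smooth_open U f -> U x -> forall eps, 0 < eps -> \forall h \near (0 : V),
  `|f (h + x) - f x - linear_form (fun i => 'D_(e_ i) f x) h| <= eps * `|h|.
Proof.
move=> oU sf Ux eps eps0.
have N0 : 0 < n.+1%:R :> R by rewrite ltr0n.
(* Each of the [n] steps contributes an error of at most [eta] times the norm of [h]; dividing by
   [n + 1] instead of [n] covers [n = 0]. *)
pose eta := eps / n.+1%:R.
have eta0 : 0 < eta by rewrite divr_gt0.
have near_D : \forall y \near x, forall i, `|'D_(e_ i) f x - 'D_(e_ i) f y| < eta.
  refine (@filter_forall V 'I_n (fun i y => `|'D_(e_ i) f x - 'D_(e_ i) f y| < eta) (nbhs x) _ _) => i.
  have s1 : smooth_open U ('D_(e_ i) f) by exact: smooth_open_derive.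
  by have /cvgrPdist_lt/(_ _ eta0) := smooth_open_cont s1 Ux.
have nU : \near x, U x by exact: open_nbhs_nbhs.
have : nbhs x [set y | U y /\ forall i, `|'D_(e_ i) f x - 'D_(e_ i) f y| < eta].
  exact: (filterS2 _ (fun y p q => conj p q) nU near_D).
move=> /nbhs_ballP[d /= d0 B].
apply/nbhs_ballP; exists d => //= h; rewrite -ball_normE/= sub0r normrN => hd.
have aux (z : V) : (forall j, `|z 0 j| <= `|h|) -> ball x d (z + x).
  move=> zh; rewrite -ball_normE/= opprD addrCA subrr addr0 normrN.
  by apply: rV_norm_lt => // j; exact: le_lt_trans (zh j) hd.
suff H k : (k <= n)%N -> `|f (head_row h k + x) - f x
    - \sum_(i < n | (i < k)%N) h 0 i * 'D_(e_ i) f x| <= k%:R * (eta * `|h|).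
  have := H n (leqnn n); rewrite head_row_full /linear_form.
  rewrite (eq_bigl predT) => [|i]; last by rewrite ltn_ord.
  move=> /le_trans; apply; rewrite mulrA ler_wpM2r//.
  rewrite /eta mulrCA ger_pMr// ler_pdivrMr// mul1r ler_nat; exact: leqnSn.
elim: k => [_|k IH kn].
  rewrite /head_row !big_pred0// add0r !subrr normr0 mul0r; exact: lexx.
pose i := Ordinal kn.
have hk j s : `|s| <= `|h 0 i| -> `|(s *: e_ i + head_row h k) 0 j| <= `|h|.
  move=> sh; rewrite mxE head_rowE !mxE eqxx/=.
  case: (eqVneq j i) => [->|ji]; first by rewrite /= ltnn addr0 mulr1 (le_trans sh)// coord_norm_le.
  by rewrite mulr0 add0r; case: ifP => _; rewrite ?normr0// coord_norm_le.
have inB s : `|s| <= `|h 0 i| -> ball x d (s *: e_ i + (head_row h k + x)).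
  by move=> sh; rewrite addrA; apply: aux => j; exact: hk.
have [|s sh es] := @MVT_line _ _ f (head_row h k + x) (e_ i) (h 0 i).
  by move=> s sh; apply: smooth_open_derivable sf _; have [] := B _ (inB s sh).
rewrite (head_rowS h kn) -/i -[h 0 i *: _ + _ + x]addrA.
rewrite (bigD1 i) ?ltnSn//=.
rewrite (eq_bigl (fun j : 'I_n => (j < k)%N)); last first.
  move=> j; rewrite ltnS leq_eqVlt -[j == i]/(val j == k).
  by case: (eqVneq (val j) k) => [->|]; rewrite ?ltnn //= andbT.
have [_ /(_ i) Bs] := B _ (inB s sh).
have {}IH := IH (ltnW kn).
set D := 'D_(e_ i) f x in Bs *; set D' := 'D_(e_ i) f _ in es Bs.
set P := f (h 0 i *: _ + _) in es *.
set p := f (head_row h k + x) in es IH *; set q := f x in IH *.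
have {es}-> : P = h 0 i * D' + p by rewrite -es subrK.
set S := \sum_(_ < n | _) _ in IH *.
have -> : h 0 i * D' + p - q - (h 0 i * D + S) = - (h 0 i * (D - D')) + (p - q - S) by ring.
rewrite (le_trans (ler_normD _ _))// normrN normrM -[k.+1]addn1 natrD mulrDl mul1r addrC lerD//.
rewrite mulrC ler_pM//; [exact: ltW|exact: coord_norm_le].
Qed.

Lemma smooth_open_diff (U : set V) (f : V -> R) (x : V) : open U ->
  smooth_open U f -> U x -> differentiable f x /\
  'd f x = linear_form (fun i => 'D_(e_ i) f x) :> (V -> R).
Proof.
move=> oU sf Ux; set c := fun i => _.
have ex : f \o shift x = cst (f x) + (linear_form c : {linear V -> R}) +o_ (0 : V) id.
  apply/eqaddoP => eps eps0.
  have := smooth_first_order oU sf Ux eps0; apply: filterS => h /= H.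
  by rewrite opprD addrA.
have cl := @linear_form_continuous c.
have dE := @diff_unique R V R f (linear_form c) x cl ex.
split=> //; apply/diff_locallyP; rewrite dE; split => //.
Qed.

End DifferentiableRow.

Section Jacobian.
Variables (R : realType) (n m : nat).
Local Notation V := 'rV[R]_n.
Local Notation e_ i := (delta_mx 0 i : V).

Lemma smooth_open_diff_rV (U : set V) (f : V -> 'rV[R]_m) (x : V) : open U ->
  smooth_open U f -> U x -> differentiable f x.
Proof.
move=> oU sf Ux.
have -> : f = \sum_(b < m) (fun y => f y 0 b *: (delta_mx 0 b : 'rV[R]_m)).
  by apply/funext => y; rewrite fct_sumE; exact: row_sum_delta.
apply: differentiable_sum => b; apply: differentiableZl.
have sb := smooth_open_coord b oU sf.
by have [] := smooth_open_diff oU sb Ux.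
Qed.

Lemma jacobianE (U : set V) (f : V -> 'rV[R]_m) (x : V) i b : open U ->
  smooth_open U f -> U x -> 'J f x i b = 'D_(e_ i) (fun y => f y 0 b) x.
Proof.
move=> oU sf Ux.
have dJ := deriveEjacobian (e_ i) (smooth_open_diff_rV oU sf Ux).
have := derive_mx (smooth_open_derivable (v := e_ i) sf Ux).
by rewrite dJ -rowE => /matrixP/(_ 0 b); rewrite !mxE.
Qed.

Lemma derive_directionE (U : set V) (f : V -> R) (x v : V) : open U ->
  smooth_open U f -> U x -> 'D_v f x = \sum_i v 0 i * 'D_(e_ i) f x.
Proof.
move=> oU sf Ux; have [df dE] := smooth_open_diff oU sf Ux.
by rewrite deriveE// dE.
Qed.

End Jacobian.

Section Chain.
Variables (R : realType) (n m : nat).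

Lemma derive_compE (W : set 'rV[R]_n) (U : set 'rV[R]_m) (tau : 'rV[R]_n -> 'rV[R]_m)
    (f : 'rV[R]_m -> R) (x v : 'rV[R]_n) : open W -> open U ->
  smooth_open W tau -> smooth_open U f -> W x -> U (tau x) ->
  'D_v (f \o tau) x =
    \sum_j 'D_v (fun y => tau y 0 j) x * 'D_(delta_mx 0 j : 'rV[R]_m) f (tau x).
Proof.
move=> oW oU st sf Wx Ux.
have dt := smooth_open_diff_rV oW st Wx.
have [df dE] := smooth_open_diff oU sf Ux.
have dt' : differentiable tau x := dt.
rewrite deriveE; last exact: differentiable_comp.
rewrite diff_comp// /comp dE -deriveE//.
rewrite (derive_mx (smooth_open_derivable (v := v) st Wx)).
by apply: eq_bigr => j _; rewrite mxE.
Qed.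

End Chain.

(** * Derivatives at a maximum *)

Section MaximumTest.
Variables (R : realType) (E : normedModType R).

(** A second derivative positive at [x] would be positive near [x]; two applications of the mean
    value theorem, starting from ['D_v f x = 0], would then give a point of the line where [f]
    exceeds [f x]. *)
Lemma local_max_derive (U : set E) (f : E -> R) (x v : E) : open U ->
  smooth_open U f -> U x -> (forall y, U y -> f y <= f x) ->
  'D_v f x = 0 /\ 'D_v ('D_v f) x <= 0.
Proof.
move=> oU sf Ux mx.
have line_in (W : set E) : open W -> W x -> exists2 d : R, 0 < d &
    forall s : R, `|s| < d -> W (s *: v + x).
  move=> oW Wx; have /nbhs_ballP[d /= d0 B] : nbhs x W by exact: open_nbhs_nbhs.
  have n0 : 0 < `|v| + 1 by rewrite ltr_wpDl.
  exists (d / (`|v| + 1)); first by rewrite divr_gt0.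
  move=> s sd; apply: B; rewrite -ball_normE/= opprD addrCA subrr addr0 normrN normrZ.
  have [->|s0] := eqVneq s 0; first by rewrite normr0 mul0r.
  by move: sd; rewrite ltr_pdivlMr// mulrDr mulr1; apply: le_lt_trans; rewrite lerDl.
have [d d0 dU] := line_in U oU Ux.
have Dv0 : 'D_v f x = 0.
  pose phi s : R := f (s *: v + x).
  have dphi (s : R) : `|s| < d -> is_derive s 1 phi ('D_v f (s *: v + x)).
    by move=> /dU sU; apply: is_derive_line; exact: smooth_open_derivable sf sU.
  have d0' : is_derive (0 : R) 1 phi 0.
    apply: (@derive1_at_max R phi (- d) d 0).
    - by rewrite ge0_cp// ltW.
    - by move=> s; rewrite in_itv/= -ltr_norml => /dphi [].
    - by rewrite in_itv/= oppr_lt0 d0.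
    - move=> s; rewrite in_itv/= -ltr_norml => /dU.
      by rewrite /phi scale0r add0r; exact: mx.
  have [|_ e1] := dphi 0; first by rewrite normr0.
  have [_ e2] := d0'.
  by rewrite -e2 e1 scale0r add0r.
split=> //; rewrite leNgt; apply/negP => c0.
have sDD : smooth_open U ('D_v ('D_v f)) by do 2 apply: smooth_open_derive.
have sD : smooth_open U ('D_v f) by apply: smooth_open_derive.
have /cvgrPdist_lt/(_ _ c0) n1 := smooth_open_cont sDD Ux.
move/nbhs_ballP : n1 => [d1 /= d10 B].
have [d2 d20 dB] := line_in (ball x d1) (ball_open x d1) (ballxx x d10).
(* Within [d] the line stays in [U]; within [d2] it stays where the second derivative is
   positive. *)
pose s := Num.min d d2 / 2.
have m0 : 0 < Num.min d d2 by rewrite lt_min d0 d20.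
have s0 : 0 < s by rewrite divr_gt0.
have sm : s < Num.min d d2 by rewrite ltr_pdivrMr// mulr_natr mulr2n ltrDl.
have sd t : 0 <= t <= s -> `|t| < d /\ `|t| < d2.
  move=> /andP[t0 ts]; rewrite ger0_norm//.
  by move: (le_lt_trans ts sm); rewrite lt_min => /andP[].
have [|t1 /andP[t10 t1s] e1] := MVT_line_gt0 (f := f) (x := x) (v := v) s0.
  by move=> t /sd[/dU tU _]; exact: smooth_open_derivable sf tU.
have [|t2 /andP[t20 t2s] e2] := MVT_line_gt0 (f := 'D_v f) (x := x) (v := v) t10.
  move=> t /andP[t0 tt1]; have [|/dU tU _] := sd t; first by rewrite t0 (le_trans tt1)// ltW.
  exact: smooth_open_derivable sD tU.
have [|/dU _ /dB/B] := sd t2; first by rewrite ltW//= (le_trans (ltW t2s))// ltW.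
have [|/dU/mx fs _] := sd s; first by rewrite lexx ltW.
have {}e2 : 'D_v f (t1 *: v + x) = t1 * 'D_v ('D_v f) (t2 *: v + x) by rewrite -e2 Dv0 subr0.
have := eq_ind _ (fun z => f (s *: v + x) - f x = s * z) e1 _ e2.
move: c0 fs; move: ('D_v ('D_v f) (t2 *: v + x)) ('D_v ('D_v f) x) => z c c0 fs e3.
rewrite ltr_norml => /andP[_ zc].
have z0 : 0 < z by move: zc; clear; lra.
have : 0 < s * (t1 * z) by rewrite !mulr_gt0.
by rewrite -e3 subr_gt0 ltNge fs.
Qed.

End MaximumTest.

(** * The ring of smooth functions on an open set *)

Record opens (R : realType) (E : normedModType R) :=
  Opens { oset : set E; oset_open : open oset }.

(* Functions are normalised to 0 outside the open set, so that equality in the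
   ring is equality on the open set. *)
Record smooth_fun (R : realType) (E : normedModType R) (O : opens E) := SmoothFun {
  smooth_fun_val :> E -> R;
  smooth_fun_smooth : smooth_open (oset O) smooth_fun_val;
  smooth_fun_out : forall x, ~ oset O x -> smooth_fun_val x = 0
}.

Section SmoothRing.
Variables (R : realType) (E : normedModType R) (O : opens E).
Local Notation S := (smooth_fun O).
Local Notation U := (oset O).
Let oO : open U := @oset_open _ _ O.

Lemma smooth_fun_eq (f g : S) : (forall x, U x -> f x = g x) -> f = g.
Proof.
case: f g => [f sf f0] [g sg g0] /= fg.
have e : f = g.
  by apply/funext => x; have [/fg//|Ox] := pselect (U x); rewrite f0// g0.
by subst g; congr SmoothFun; exact: Prop_irrelevance.
Qed.

Definition extend0 (f : E -> R) : E -> R := fun x => if pselect (U x) then f x else 0.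

Lemma extend0E f x : U x -> extend0 f x = f x.
Proof. by rewrite /extend0; case: pselect. Qed.

Lemma extend0_smooth f : smooth_open U f -> smooth_open U (extend0 f).
Proof. by apply: smooth_open_eq => // x Ox; rewrite extend0E. Qed.

Lemma extend0_out f x : ~ U x -> extend0 f x = 0.
Proof. by rewrite /extend0; case: pselect. Qed.

Definition smk f (sf : smooth_open U f) : S :=
  SmoothFun (extend0_smooth sf) (@extend0_out f).

Lemma smkE f (sf : smooth_open U f) x : U x -> smk sf x = f x.
Proof. exact: extend0E. Qed.

Definition scst (k : R) : S := smk (smooth_open_cst (k : R) oO).
Definition sadd (f g : S) : S := smk (smooth_openD oO (smooth_fun_smooth f) (smooth_fun_smooth g)).
Definition sopp (f : S) : S := smk (smooth_openN oO (smooth_fun_smooth f)).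
Definition smul (f g : S) : S := smk (smooth_openM oO (smooth_fun_smooth f) (smooth_fun_smooth g)).
Definition sder (v : E) (f : S) : S := smk (smooth_open_derive v (smooth_fun_smooth f)).

HB.instance Definition _ := gen_eqMixin S.
HB.instance Definition _ := gen_choiceMixin S.

Lemma saddE (f g : S) x : U x -> sadd f g x = f x + g x.
Proof. exact: smkE. Qed.
Lemma soppE (f : S) x : U x -> sopp f x = - f x.
Proof. exact: smkE. Qed.
Lemma smulE (f g : S) x : U x -> smul f g x = f x * g x.
Proof. exact: smkE. Qed.
Lemma scstE k x : U x -> scst k x = k.
Proof. exact: smkE. Qed.
Lemma sderE v (f : S) x : U x -> sder v f x = 'D_v f x.
Proof. exact: smkE. Qed.

Fact saddA : associative sadd.
Proof. by move=> f g h; apply: smooth_fun_eq => x Ux; rewrite !saddE// addrA. Qed.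
Fact saddC : commutative sadd.
Proof. by move=> f g; apply: smooth_fun_eq => x Ux; rewrite !saddE// addrC. Qed.
Fact sadd0 : left_id (scst 0) sadd.
Proof. by move=> f; apply: smooth_fun_eq => x Ux; rewrite saddE// scstE// add0r. Qed.
Fact saddN : left_inverse (scst 0) sopp sadd.
Proof. by move=> f; apply: smooth_fun_eq => x Ux; rewrite saddE// soppE// scstE// addNr. Qed.

HB.instance Definition _ := GRing.isZmodule.Build S saddA saddC sadd0 saddN.

Lemma smooth_funD (f g : S) x : U x -> (f + g) x = f x + g x.
Proof. exact: saddE. Qed.
Lemma smooth_funN (f : S) x : U x -> (- f) x = - f x.
Proof. exact: soppE. Qed.
Lemma smooth_fun0 x : U x -> (0 : S) x = 0.
Proof. exact: scstE. Qed.

Fact smulA : associative smul.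
Proof. by move=> f g h; apply: smooth_fun_eq => x Ox; rewrite !smulE// mulrA. Qed.
Fact smulC : commutative smul.
Proof. by move=> f g; apply: smooth_fun_eq => x Ox; rewrite !smulE// mulrC. Qed.
Fact smul1 : left_id (scst 1) smul.
Proof. by move=> f; apply: smooth_fun_eq => x Ox; rewrite smulE// scstE// mul1r. Qed.
Fact smulDl : left_distributive smul +%R.
Proof. by move=> f g h; apply: smooth_fun_eq => x Ox; rewrite !(smooth_funD, smulE)// mulrDl. Qed.

HB.instance Definition _ := GRing.Zmodule_isComPzRing.Build S smulA smulC smul1 smulDl.

Lemma smooth_funM (f g : S) x : U x -> (f * g) x = f x * g x.
Proof. exact: smulE. Qed.
Lemma smooth_fun1 x : U x -> (1 : S) x = 1.
Proof. exact: scstE. Qed.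

Lemma smooth_fun_sum (I : Type) (r : seq I) (P : pred I) (F : I -> S) x : U x ->
  (\sum_(i <- r | P i) F i) x = \sum_(i <- r | P i) F i x.
Proof.
move=> Ox; elim/big_ind2: _ => [|f a g b <- <-|//]; first exact: smooth_fun0.
by rewrite smooth_funD.
Qed.

Lemma smooth_funX (f : S) k x : U x -> (f ^+ k) x = f x ^+ k.
Proof.
by move=> Ox; elim: k => [|k IH]; rewrite ?expr0 ?smooth_fun1// !exprS smooth_funM// IH.
Qed.

Lemma smooth_funMn (f : S) k x : U x -> (f *+ k) x = f x *+ k.
Proof.
by move=> Ox; elim: k => [|k IH]; rewrite ?mulr0n ?smooth_fun0// !mulrS smooth_funD// IH.
Qed.

Lemma smooth_fun_natr k x : U x -> (k%:R : S) x = k%:R.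
Proof. by move=> Ox; rewrite smooth_funMn// smooth_fun1. Qed.

Lemma sderivable (f : S) v x : U x -> derivable f x v.
Proof. exact: smooth_open_derivable (smooth_fun_smooth f). Qed.

Lemma derive_eq_on (f g : E -> R) v x : U x -> (forall y, U y -> f y = g y) ->
  'D_v f x = 'D_v g x.
Proof. by move=> Ox fg; apply: near_eq_derive; exact: near_open oO Ox fg. Qed.

Lemma sderD v (f g : S) : sder v (f + g) = sder v f + sder v g.
Proof.
apply: smooth_fun_eq => x Ox; rewrite smooth_funD// !sderE//.
rewrite -(deriveD (@sderivable f v x Ox) (@sderivable g v x Ox)).
by apply: derive_eq_on => // y Oy; rewrite smooth_funD.
Qed.

Lemma sderM v (f g : S) : sder v (f * g) = sder v f * g + f * sder v g.
Proof.
apply: smooth_fun_eq => x Ox; rewrite smooth_funD// !smooth_funM// !sderE//.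
rewrite addrC [X in _ + X]mulrC.
have <- := deriveM (@sderivable f v x Ox) (@sderivable g v x Ox).
by apply: derive_eq_on => // y Oy; rewrite smooth_funM.
Qed.

Lemma sder_cst v k : sder v (scst k) = 0.
Proof.
apply: smooth_fun_eq => x Ox; rewrite sderE// smooth_fun0//.
rewrite (@derive_eq_on _ (cst k) v x Ox) ?derive_cst// => y Oy.
by rewrite scstE.
Qed.

Lemma sderC v w (f : S) : sder v (sder w f) = sder w (sder v f).
Proof.
have aux a b x : U x -> sder a (sder b f) x = 'D_a ('D_b f) x.
  move=> Ox; rewrite sderE//; apply: derive_eq_on => // y Oy; exact: sderE.
apply: smooth_fun_eq => x Ox; apply: (etrans (aux v w x Ox)); apply: (etrans _ (esym (aux w v x Ox))).
exact: (deriveC v w oO (smooth_fun_smooth f) Ox).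
Qed.

Lemma smooth_fun_inv (f : S) : (forall x, U x -> f x != 0) -> {g : S | g * f = 1}.
Proof.
move=> f0; exists (smk (smooth_openV oO (smooth_fun_smooth f) f0)).
by apply: smooth_fun_eq => x Ox; rewrite smooth_funM// smkE// smooth_fun1// mulVf// f0.
Qed.

Lemma scstM a b : scst (a * b) = scst a * scst b.
Proof. by apply: smooth_fun_eq => x Ox; rewrite smooth_funM// !scstE. Qed.
End SmoothRing.

(** * Structure equations and evolution equations *)

Section Derivations.
Variable S : comPzRingType.

Definition derivation (d : S -> S) :=
  {morph d : f g / f + g} /\ forall f g, d (f * g) = d f * g + f * d g.

Variable d : S -> S.
Hypothesis dd : derivation d.

Lemma derD f g : d (f + g) = d f + d g. Proof. exact: dd.1. Qed.
Lemma derM f g : d (f * g) = d f * g + f * d g. Proof. exact: dd.2. Qed.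
Lemma der0 : d 0 = 0.
Proof. by apply: (addrI (d 0)); rewrite -derD !addr0. Qed.
Lemma derN f : d (- f) = - d f.
Proof. by apply: (addrI (d f)); rewrite -derD !subrr der0. Qed.
Lemma derB f g : d (f - g) = d f - d g. Proof. by rewrite derD derN. Qed.
Lemma der1 : d 1 = 0.
Proof. by apply: (addrI (d 1)); rewrite addr0 -[in RHS](mulr1 1) derM mulr1 mul1r. Qed.
Lemma derMn f k : d (f *+ k) = d f *+ k.
Proof. by elim: k => [|k IH]; rewrite ?mulr0n ?der0// !mulrS derD IH. Qed.
Lemma der_nat k : d k%:R = 0. Proof. by rewrite derMn der1 mul0rn. Qed.
Lemma der_sum (I : Type) (s : seq I) (Q : pred I) F :
  d (\sum_(i <- s | Q i) F i) = \sum_(i <- s | Q i) d (F i).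
Proof. by apply: (big_morph d derD der0). Qed.
Lemma derX2 f : d (f ^+ 2) = f * d f *+ 2.
Proof. by rewrite expr2 derM; ring. Qed.

End Derivations.

Section Contraction.
Variables (S : comPzRingType) (m : nat).
Implicit Types (x y : 'I_m -> S).

Lemma sum_deltal y (a : 'I_m) : \sum_b (b == a)%:R * y b = y a.
Proof.
rewrite (bigD1 a)//= eqxx mul1r big1 ?addr0// => b /negbTE->.
by rewrite mul0r.
Qed.

Lemma sum_deltalC y (a : 'I_m) : \sum_b (a == b)%:R * y b = y a.
Proof. by rewrite -[RHS](sum_deltal y a); apply: eq_bigr => b _; rewrite eq_sym. Qed.

End Contraction.

(* The fields are the structure equations of a hypersurface with unit normal
   [nu] moving by mean curvature in the sphere of curvature [r ^ 2], where [xi]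
   is [r] times the position vector and [D a] is the tangential gradient in
   the direction of the [a]-th ambient basis vector. *)
Record structure_equations (S : comPzRingType) (n m : nat) (D : 'I_m -> S -> S)
    (T : S -> S) (r : S) (nu xi : 'I_m -> S) : Prop := StructureEquations {
  seD : forall a, derivation (D a);
  seT : derivation T;
  seDr : forall a, D a r = 0;
  seTr : T r = 0;
  se_dim : m = n.+2;
  se_nunu : \sum_a nu a * nu a = 1;
  se_xixi : \sum_a xi a * xi a = 1;
  se_nuxi : \sum_a nu a * xi a = 0;
  se_nuD : forall f, \sum_a nu a * D a f = 0;
  se_xiD : forall f, \sum_a xi a * D a f = 0;
  se_Dxi : forall a b, D a (xi b) = r * ((a == b)%:R - nu a * nu b - xi a * xi b);
  se_sym : forall a b, D a (nu b) = D b (nu a);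
  se_comm : forall a b f, D a (D b f) - D b (D a f) =
    nu a * (\sum_d D b (nu d) * D d f) - nu b * (\sum_d D a (nu d) * D d f)
    + r * (xi a * D b f - xi b * D a f);
  se_Tcomm : forall a f, T (D a f) - D a (T f) =
    (\sum_e D e (nu e)) * (\sum_d D a (nu d) * D d f)
    - nu a * \sum_d D d (\sum_e D e (nu e)) * D d f;
  se_Tnu : forall b, T (nu b) = D b (\sum_e D e (nu e)) + r * (\sum_e D e (nu e)) * xi b
}.

Section Evolution.
Variables (S : comPzRingType) (n m : nat) (D : 'I_m -> S -> S) (T : S -> S).
Variables (r : S) (nu xi : 'I_m -> S).
Hypothesis se : structure_equations n D T r nu xi.
Implicit Types (f g : S) (a b c e : 'I_m).

Let dD a := seD se a.
Let dT := seT se.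

(** Components of the orthogonal projection of the ambient space onto the tangent space, the normal
    space being spanned by [nu] and [xi]. *)
Definition proj a b : S := (a == b)%:R - nu a * nu b - xi a * xi b.
Definition curv a b : S := D a (nu b).
Definition meanc : S := \sum_e curv e e.
Definition curv2 : S := \sum_a \sum_b curv a b ^+ 2.
Definition lap f : S := \sum_e D e (D e f).
Definition heat f : S := T f - lap f.
Definition shape a f : S := \sum_d curv a d * D d f.
Definition shape2 a f : S := \sum_b curv a b * shape b f.
Definition curv_hess f : S := \sum_b \sum_d curv b d * D b (D d f).
Definition grad2 f g : S := \sum_e D e f * D e g.
(** The commutator of [heat] with [D a], by [heat_D]. Its second-order terms carry a factor [nu a]
    or [xi a], so they vanish when [a] is contracted with a tangential index. *)
Definition heat_comm a f : S :=
  shape2 a f *+ 2 + nu a * curv_hess f *+ 2 - (n%:R - 2%:R) * r ^+ 2 * D a f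
  + r * xi a * lap f *+ 2.

Local Notation A := curv.
Local Notation H := meanc.

Lemma curvC a b : A a b = A b a. Proof. exact: se_sym se a b. Qed.
Lemma nu_curv b : \sum_a nu a * A a b = 0. Proof. exact: se_nuD se _. Qed.
Lemma xi_curv b : \sum_a xi a * A a b = 0. Proof. exact: se_xiD se _. Qed.
Lemma curv_nu a : \sum_b A a b * nu b = 0.
Proof. by rewrite -[RHS](nu_curv a); apply: eq_bigr => b _; rewrite curvC mulrC. Qed.
Lemma curv_xi a : \sum_b A a b * xi b = 0.
Proof. by rewrite -[RHS](xi_curv a); apply: eq_bigr => b _; rewrite curvC mulrC. Qed.

Lemma projC a b : proj a b = proj b a.
Proof. by rewrite /proj eq_sym; ring. Qed.

Lemma proj_tangent y a : \sum_b nu b * y b = 0 -> \sum_b xi b * y b = 0 ->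
  \sum_b proj a b * y b = y a.
Proof.
move=> y1 y2.
have -> : \sum_b proj a b * y b = \sum_b ((a == b)%:R * y b)
   - nu a * (\sum_b nu b * y b) - xi a * (\sum_b xi b * y b).
  rewrite !mulr_sumr -!sumrB; apply: eq_bigr => b _; rewrite /proj; ring.
by rewrite y1 y2 !mulr0 !subr0 sum_deltalC.
Qed.

Lemma proj_D a f : \sum_b proj a b * D b f = D a f.
Proof. by apply: (@proj_tangent (fun b => D b f)); [exact: se_nuD se _|exact: se_xiD se _]. Qed.

Lemma trace_proj : \sum_a proj a a = n%:R.
Proof.
rewrite /proj !sumrB (se_nunu se) (se_xixi se).
have -> : \sum_(a < m) (a == a)%:R = m%:R :> S.
  under eq_bigr do rewrite eqxx.
  by rewrite sumr_const card_ord.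
rewrite (se_dim se) -addn2 natrD; ring.
Qed.

Lemma D_xi a b : D a (xi b) = r * proj a b. Proof. exact: se_Dxi se a b. Qed.

(** Differentiates the orthogonality of [nu] to the gradient. Thus [D a (D b f)] is not tangential
    in [b], but its normal components are of first order in [f]. *)
Lemma nu_DD a f : \sum_b nu b * D a (D b f) = - shape a f.
Proof.
have := congr1 (D a) (se_nuD se f).
rewrite (der0 (dD a)) (der_sum (dD a)).
under eq_bigr do rewrite (derM (dD a)).
by rewrite big_split/= addrC => /eqP; rewrite addr_eq0 => /eqP.
Qed.

Lemma xi_DD a f : \sum_b xi b * D a (D b f) = - (r * D a f).
Proof.
have := congr1 (D a) (se_xiD se f).
rewrite (der0 (dD a)) (der_sum (dD a)).
under eq_bigr do rewrite (derM (dD a)) D_xi -mulrA.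
by rewrite big_split/= -mulr_sumr proj_D addrC => /eqP; rewrite addr_eq0 => /eqP.
Qed.

Lemma nu_Dcurv a b : \sum_c nu c * D a (A b c) = - \sum_c A a c * A b c.
Proof.
have := congr1 (D a) (curv_nu b).
rewrite (der0 (dD a)) (der_sum (dD a)).
under eq_bigr do rewrite (derM (dD a)) [X in X + _]mulrC.
rewrite big_split/= => /eqP; rewrite addr_eq0 => /eqP->; congr (- _).
by apply: eq_bigr => c _; rewrite mulrC.
Qed.

Lemma commE a b f : D a (D b f) = D b (D a f) + nu a * shape b f - nu b * shape a f
    + r * (xi a * D b f - xi b * D a f).
Proof.
have := se_comm se a b f; rewrite -/(shape a f) -/(shape b f) => /eqP.
by rewrite subr_eq => /eqP ->; ring.
Qed.

(** Codazzi: [D a (nu b) = D b (nu a)], and exchanging [D a] with [D b] leaves [D b (A a a)], whose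
    sum is [D b H], up to the curvature terms of the commutator. *)
Lemma lap_nu b : lap (nu b) = D b H - nu b * curv2 - r * H * xi b.
Proof.
rewrite /lap.
have e a : D a (D a (nu b)) = D b (A a a) + nu a * shape b (nu a) - nu b * shape a (nu a)
    + r * (xi a * A b a - xi b * A a a).
  by rewrite [D a (nu b)](curvC a b) commE.
under eq_bigr do rewrite e.
rewrite !big_split/= -(der_sum (dD b)) -/H.
rewrite sumrN -!mulr_sumr.
have -> : \sum_a nu a * shape b (nu a) = 0.
  have -> : \sum_a nu a * shape b (nu a) = \sum_d A b d * (\sum_a A d a * nu a).
    under eq_bigr do rewrite mulr_sumr.
    rewrite exchange_big; apply: eq_bigr => d _; rewrite mulr_sumr.
    by apply: eq_bigr => a _; rewrite -/(A d a); ring.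
  by rewrite big1// => d _; rewrite curv_nu mulr0.
have -> : \sum_a shape a (nu a) = curv2.
  apply: eq_bigr => a _; apply: eq_bigr => d _.
  by rewrite -/(A d a) (curvC d a) expr2.
rewrite sumrB -mulr_sumr -/H.
have -> : \sum_a xi a * A b a = 0.
  by rewrite -[RHS](curv_xi b); apply: eq_bigr => a _; rewrite mulrC.
ring.
Qed.

Lemma heat_nu b : heat (nu b) = curv2 * nu b + r * H * xi b *+ 2.
Proof. by rewrite /heat lap_nu (se_Tnu se) -/H; ring. Qed.

(** The divergence of [A] is [lap nu], that is the gradient of [H] up to multiples of [nu] and [xi],
    and these vanish against the gradient of [f]. *)
Lemma div_shape f : \sum_b D b (shape b f) = grad2 H f + curv_hess f.
Proof.
rewrite /shape.
have -> : \sum_b D b (\sum_d A b d * D d f) =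
    \sum_d lap (nu d) * D d f + curv_hess f.
  under eq_bigr do rewrite (der_sum (dD _)).
  under eq_bigr do under eq_bigr do rewrite (derM (dD _)).
  under eq_bigr do rewrite big_split/=.
  rewrite big_split/=; congr (_ + _).
  by rewrite exchange_big; apply: eq_bigr => d _; rewrite mulr_suml.
congr (_ + _); under eq_bigr do rewrite lap_nu.
have -> : \sum_d (D d H - nu d * curv2 - r * H * xi d) * D d f =
  grad2 H f - curv2 * (\sum_d nu d * D d f) - r * H * (\sum_d xi d * D d f).
  rewrite /grad2 !mulr_sumr -!sumrB; apply: eq_bigr => d _; ring.
by rewrite (se_nuD se) (se_xiD se); ring.
Qed.

(** The time part is [se_Tcomm]. For the Laplacian, [e] moves [D a] outwards past two copies of
    [D b]; in the sum over [b] the terms with [nu b] or [xi b] either vanish or lose an order by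
    [nu_DD] and [xi_DD]. *)
Lemma heat_D a f : heat (D a f) = D a (heat f) + heat_comm a f.
Proof.
rewrite /heat (derB (dD a)).
have /eqP := se_Tcomm se a f; rewrite -/H -/(shape a f) subr_eq => /eqP ->.
rewrite {1}/lap.
have e b : D b (D b (D a f)) = D a (D b (D b f))
   + (A b b * shape a f + nu b * D b (shape a f) - A a b * shape b f - nu a * D b (shape b f)
      + (r ^+ 2 * proj b b * D a f + r * (xi b * D b (D a f))
         - r ^+ 2 * (proj a b * D b f) - r * xi a * D b (D b f)))
   + (nu b * shape a (D b f) - nu a * shape b (D b f)
      + (r * (xi b * D a (D b f)) - r * xi a * D b (D b f))).
  rewrite [in LHS](commE b a f) !(derD (dD b), derN (dD b), derM (dD b)) !D_xi (seDr se).
  rewrite [D b (D a (D b f))]commE -/(A b b) -/(A b a) (curvC b a) (projC b a); ring.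
rewrite (eq_bigr _ (fun b _ => e b)).
rewrite !(big_split, sumrN)/= -(der_sum (dD a)) -/(lap f).
rewrite -!mulr_sumr -!mulr_suml -!mulr_sumr trace_proj.
rewrite (se_nuD se) (se_xiD se) proj_D div_shape xi_DD -/H -/(lap f).
have -> : \sum_b nu b * shape a (D b f) = - shape2 a f.
  have -> : \sum_b nu b * shape a (D b f) = \sum_d A a d * (\sum_b nu b * D d (D b f)).
    under eq_bigr do rewrite mulr_sumr.
    rewrite exchange_big; apply: eq_bigr => d _; rewrite mulr_sumr.
    by apply: eq_bigr => b _; ring.
  by rewrite -sumrN; apply: eq_bigr => d _; rewrite nu_DD mulrN.
have -> : \sum_b shape b (D b f) = curv_hess f.
  rewrite /shape /curv_hess exchange_big; apply: eq_bigr => d _.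
  by apply: eq_bigr => b _; rewrite curvC.
rewrite -/(shape2 a f) /heat_comm -/(grad2 H f); ring.
Qed.

Lemma lapD f g : lap (f + g) = lap f + lap g.
Proof. by rewrite /lap -big_split; apply: eq_bigr => e _; rewrite !(derD (dD e)). Qed.

Lemma lap_derivationM f g : lap (f * g) = f * lap g + g * lap f + grad2 f g *+ 2.
Proof.
rewrite /lap /grad2 !mulr_sumr -sumrMnl -!big_split; apply: eq_bigr => e _ /=.
by rewrite !(derM (dD e), derD (dD e)); ring.
Qed.

Lemma heatD f g : heat (f + g) = heat f + heat g.
Proof. by rewrite /heat lapD (derD dT); ring. Qed.

Lemma heat0 : heat 0 = 0.
Proof. by apply: (addrI (heat 0)); rewrite -heatD !addr0. Qed.

Lemma heatN f : heat (- f) = - heat f.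
Proof. by apply: (addrI (heat f)); rewrite -heatD !subrr heat0. Qed.

Lemma heat_sum (I : Type) (s : seq I) (F : I -> S) :
  heat (\sum_(i <- s) F i) = \sum_(i <- s) heat (F i).
Proof. by apply: (big_morph heat heatD heat0). Qed.

Lemma heatM f g : heat (f * g) = f * heat g + g * heat f - grad2 f g *+ 2.
Proof. by rewrite /heat lap_derivationM (derM dT); ring. Qed.

Lemma heat_sqr f : heat (f ^+ 2) = f * heat f *+ 2 - grad2 f f *+ 2.
Proof. by rewrite expr2 heatM; ring. Qed.

Lemma heat_const k : (forall a, D a k = 0) -> T k = 0 -> heat k = 0.
Proof.
move=> Dk Tk; rewrite /heat Tk /lap big1 ?subr0// => e _.
by rewrite Dk (der0 (dD e)).
Qed.

(** * Evolution of the second fundamental form and the Codazzi tensor *)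

Definition curv_sq a b : S := \sum_d A a d * A b d.
Definition trace4 : S := \sum_a \sum_b curv_sq a b ^+ 2.
Definition jet2 : S := \sum_e \sum_a \sum_b D e (A a b) ^+ 2.
(** The tangential part of [D e (A a b)], that is the covariant derivative of [A]: the normal
    components in [a] and [b], known from [nu_DD] and [xi_DD], are removed. *)
Definition codazzi e a b : S :=
  D e (A a b) + nu a * curv_sq e b + nu b * curv_sq e a
  + r * (xi a * A e b + xi b * A e a).
Definition codazzi2 : S := \sum_e \sum_a \sum_b codazzi e a b ^+ 2.

Lemma curv_sqC a b : curv_sq a b = curv_sq b a.
Proof. by apply: eq_bigr => d _; rewrite mulrC. Qed.

Lemma shape_nu a b : shape a (nu b) = curv_sq a b.
Proof. by apply: eq_bigr => d _; rewrite -/(A d b) (curvC d b). Qed.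

Lemma nu_curv_sq b : \sum_a nu a * curv_sq b a = 0.
Proof.
have -> : \sum_a nu a * curv_sq b a = \sum_d A b d * (\sum_a nu a * A a d).
  under eq_bigr do rewrite mulr_sumr.
  rewrite exchange_big; apply: eq_bigr => d _; rewrite mulr_sumr.
  by apply: eq_bigr => a _ /=; ring.
by rewrite big1// => d _; rewrite nu_curv mulr0.
Qed.

Lemma xi_curv_sq b : \sum_a xi a * curv_sq b a = 0.
Proof.
have -> : \sum_a xi a * curv_sq b a = \sum_d A b d * (\sum_a xi a * A a d).
  under eq_bigr do rewrite mulr_sumr.
  rewrite exchange_big; apply: eq_bigr => d _; rewrite mulr_sumr.
  by apply: eq_bigr => a _ /=; ring.
by rewrite big1// => d _; rewrite xi_curv mulr0.
Qed.

Lemma heat_curv a c : heat (A a c) =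
  D a curv2 * nu c + curv2 * A a c + (r * D a H * xi c + r ^+ 2 * H * proj a c) *+ 2
  + heat_comm a (nu c).
Proof.
rewrite heat_D heat_nu; congr (_ + _).
rewrite !(derD (dD a), derMn (dD a), derM (dD a)) D_xi (seDr se) -/(A a c); ring.
Qed.

Lemma curv_sum_nu c : \sum_a A a c * nu a = 0.
Proof. by rewrite -[RHS](nu_curv c); apply: eq_bigr => a _; rewrite mulrC. Qed.

Lemma curv_sum_xi c : \sum_a A a c * xi a = 0.
Proof. by rewrite -[RHS](xi_curv c); apply: eq_bigr => a _; rewrite mulrC. Qed.

Lemma curv_hess_nu : \sum_a nu a * curv_hess (nu a) = - \sum_a shape2 a (nu a).
Proof.
have -> : \sum_a nu a * curv_hess (nu a) =
    \sum_b \sum_d A b d * (\sum_a nu a * D b (A d a)).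
  under eq_bigr do rewrite mulr_sumr.
  rewrite exchange_big; apply: eq_bigr => b _ /=.
  under eq_bigr do rewrite mulr_sumr.
  rewrite exchange_big; apply: eq_bigr => d _ /=; rewrite mulr_sumr.
  by apply: eq_bigr => a _; ring.
rewrite -sumrN; apply: eq_bigr => a _; rewrite -sumrN; apply: eq_bigr => b _.
by rewrite nu_Dcurv shape_nu curv_sqC mulrN; congr (- (_ * _)); exact: curv_sqC.
Qed.

Lemma xi_lap_nu : \sum_a xi a * lap (nu a) = - (r * H).
Proof.
have -> : \sum_a xi a * lap (nu a) =
   \sum_a xi a * D a H - curv2 * (\sum_a nu a * xi a) - r * H * (\sum_a xi a * xi a).
  rewrite [curv2 * _]mulr_sumr [r * H * _]mulr_sumr -!sumrB; apply: eq_bigr => a _; rewrite lap_nu; ring.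
by rewrite (se_xiD se) (se_nuxi se) (se_xixi se); ring.
Qed.

(** The trace of [heat_curv]. The [curv_hess] terms meet [nu a] and cancel the [shape2] terms; the
    Laplacian term meets [xi a] and turns into a multiple of [H]. *)
Lemma heat_meanc : heat H = (curv2 + n%:R * r ^+ 2) * H.
Proof.
rewrite {1}/meanc heat_sum.
have -> : \sum_a heat (A a a) = \sum_a nu a * D a curv2 + curv2 * H
   + (r * (\sum_a xi a * D a H) + r ^+ 2 * H * (\sum_a proj a a)) *+ 2
   + ((\sum_a shape2 a (nu a)) *+ 2 + (\sum_a nu a * curv_hess (nu a)) *+ 2
      - (n%:R - 2%:R) * r ^+ 2 * H + r * (\sum_a xi a * lap (nu a)) *+ 2).
  rewrite [curv2 * H]mulr_sumr [r * (\sum_a xi a * D a H)]mulr_sumr [r ^+ 2 * H * _]mulr_sumr.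
  rewrite [_ * r ^+ 2 * H]mulr_sumr [r * (\sum_a xi a * lap _)]mulr_sumr.
  rewrite -!big_split -!sumrMnl -!big_split -sumrB -!big_split /=.
  apply: eq_bigr => a _; rewrite heat_curv /heat_comm -/(A a a); ring.
rewrite (se_nuD se) (se_xiD se) trace_proj curv_hess_nu xi_lap_nu; ring.
Qed.

(** [jet2] sums the squares of all ambient components of [D e (A a b)], the normal ones included;
    [trace4], the trace of the fourth power of [A], will cancel against these in [heat_curv2]. *)
Lemma heat_curv2_jet : heat curv2 = curv2 ^+ 2 *+ 2 + r ^+ 2 * H ^+ 2 *+ 4 + trace4 *+ 4
  - (n%:R - 2%:R) * r ^+ 2 * curv2 *+ 2 - jet2 *+ 2.
Proof.
have proj_curv : \sum_a \sum_c A a c * proj a c = H.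
  apply: eq_bigr => a _.
  have h1 : \sum_c nu c * A a c = 0.
    by rewrite -[RHS](curv_nu a); apply: eq_bigr => c _; rewrite mulrC.
  have h2 : \sum_c xi c * A a c = 0.
    by rewrite -[RHS](curv_xi a); apply: eq_bigr => c _; rewrite mulrC.
  rewrite -[RHS](@proj_tangent (fun c => A a c) a h1 h2).
  by apply: eq_bigr => c _; rewrite mulrC.
have shape4 : \sum_a \sum_c A a c * shape2 a (nu c) = trace4.
  rewrite exchange_big; apply: eq_bigr => c _ /=.
  under eq_bigr do rewrite mulr_sumr.
  rewrite exchange_big; apply: eq_bigr => b _ /=.
  rewrite expr2 {1}/curv_sq mulr_suml; apply: eq_bigr => a _.
  by rewrite shape_nu curv_sqC (curvC c a) (curvC b a); ring.
have e a c : heat (A a c ^+ 2) = D a curv2 * (A a c * nu c) *+ 2 + curv2 * A a c ^+ 2 *+ 2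
   + r * D a H * (A a c * xi c) *+ 4 + r ^+ 2 * H * (A a c * proj a c) *+ 4
   + (A a c * shape2 a (nu c)) *+ 4 + curv_hess (nu c) * (A a c * nu a) *+ 4
   - (n%:R - 2%:R) * r ^+ 2 * A a c ^+ 2 *+ 2 + r * lap (nu c) * (A a c * xi a) *+ 4
   - grad2 (A a c) (A a c) *+ 2.
  by rewrite heat_sqr heat_curv /heat_comm -/(A a c); ring.
rewrite {1}/curv2 heat_sum; under eq_bigr do rewrite heat_sum.
under eq_bigr do under eq_bigr do rewrite e.
under eq_bigr do rewrite !(big_split, sumrN, sumrMnl)/= -!mulr_sumr curv_nu curv_xi.
rewrite !(big_split, sumrN, sumrMnl)/= -!mulr_sumr proj_curv shape4.
have -> : \sum_a \sum_c curv_hess (nu c) * (A a c * nu a) = 0.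
  rewrite exchange_big big1// => c _ /=; rewrite -mulr_sumr curv_sum_nu; ring.
have -> : \sum_a \sum_c r * lap (nu c) * (A a c * xi a) = 0.
  rewrite exchange_big big1// => c _ /=; rewrite -mulr_sumr curv_sum_xi; ring.
have -> : \sum_a \sum_c grad2 (A a c) (A a c) = jet2.
  rewrite /jet2 [RHS]exchange_big; apply: eq_bigr => a _ /=.
  by rewrite [RHS]exchange_big; apply: eq_bigr => c _ /=; apply: eq_bigr => e' _; rewrite expr2.
rewrite -/curv2 big1 => [|a _]; last by rewrite mulr0.
rewrite big1 => [|a _]; last by rewrite mulr0.
ring.
Qed.

Lemma codazziCr e a b : codazzi e a b = codazzi e b a.
Proof. by rewrite /codazzi curvC; ring. Qed.

Lemma codazziCl e a b : codazzi e a b = codazzi a e b.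
Proof.
rewrite /codazzi [D e (A a b)](commE e a (nu b)) !shape_nu (curvC e a) (curv_sqC e a).
rewrite -/(A a b) -/(A e b); ring.
Qed.

Lemma sum_nu_codazzi e b : \sum_a nu a * codazzi e a b = 0.
Proof.
have -> : \sum_a nu a * codazzi e a b = \sum_a nu a * D e (A a b)
  + curv_sq e b * (\sum_a nu a * nu a) + nu b * (\sum_a nu a * curv_sq e a)
  + r * (A e b * (\sum_a nu a * xi a) + xi b * (\sum_a nu a * A e a)).
  rewrite !mulr_sumr -!big_split mulr_sumr -!big_split /=.
  by apply: eq_bigr => a _; rewrite /codazzi; ring.
rewrite (se_nunu se) (se_nuxi se) nu_curv_sq.
rewrite [X in X + _ + _ + _](nu_DD e (nu b)) shape_nu.
have -> : \sum_a nu a * A e a = 0.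
  by rewrite -[RHS](nu_curv e); apply: eq_bigr => a _; rewrite (curvC e a).
ring.
Qed.

Lemma sum_xi_codazzi e b : \sum_a xi a * codazzi e a b = 0.
Proof.
have -> : \sum_a xi a * codazzi e a b = \sum_a xi a * D e (A a b)
  + curv_sq e b * (\sum_a nu a * xi a) + nu b * (\sum_a xi a * curv_sq e a)
  + r * (A e b * (\sum_a xi a * xi a) + xi b * (\sum_a xi a * A e a)).
  rewrite !mulr_sumr -!big_split mulr_sumr -!big_split /=.
  by apply: eq_bigr => a _; rewrite /codazzi; ring.
rewrite (se_xixi se) (se_nuxi se) xi_curv_sq.
rewrite [X in X + _ + _ + _](xi_DD e (nu b)) -/(A e b).
have -> : \sum_a xi a * A e a = 0.
  by rewrite -[RHS](xi_curv e); apply: eq_bigr => a _; rewrite (curvC e a).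
ring.
Qed.

Lemma trace_codazzi e : \sum_a codazzi e a a = D e H.
Proof.
have -> : \sum_a codazzi e a a = \sum_a D e (A a a) + (\sum_a nu a * curv_sq e a) *+ 2
    + r * (\sum_a xi a * A a e) *+ 2.
  rewrite mulr_sumr -!sumrMnl -!big_split /=; apply: eq_bigr => a _.
  by rewrite /codazzi (curvC e a); ring.
by rewrite nu_curv_sq xi_curv -(der_sum (dD e)) -/H; ring.
Qed.

(** Pythagoras: the normal part of [D e (A a b)] contributes [trace4] and [r ^+ 2 * curv2] once for
    each of the indices [a] and [b]. *)
Lemma codazzi2E : codazzi2 = jet2 - trace4 *+ 2 - r ^+ 2 * curv2 *+ 2.
Proof.
have e e' a b : codazzi e' a b ^+ 2 = D e' (A a b) * codazzi e' a b
   + curv_sq e' b * (nu a * codazzi e' a b) + curv_sq e' a * (nu b * codazzi e' b a)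
   + r * A e' b * (xi a * codazzi e' a b) + r * A e' a * (xi b * codazzi e' b a).
  by rewrite (codazziCr e' b a) /codazzi; ring.
have e2 e' a b : D e' (A a b) * codazzi e' a b = D e' (A a b) ^+ 2
   + curv_sq e' b * (nu a * D e' (A a b)) + curv_sq e' a * (nu b * D e' (A b a))
   + r * A e' b * (xi a * D e' (A a b)) + r * A e' a * (xi b * D e' (A b a)).
  by rewrite /codazzi (curvC b a); ring.
have jet_nu e' b : \sum_a nu a * D e' (A a b) = - curv_sq e' b.
  by rewrite -shape_nu -nu_DD.
have jet_xi e' b : \sum_a xi a * D e' (A a b) = - (r * A e' b) by rewrite -xi_DD.
(* A pair of identities, one for each position of the contracted index; rewriting uses the one that
   matches. *)
have sum0 (F : 'I_m -> 'I_m -> S) (G : 'I_m -> 'I_m -> 'I_m -> S) (h : 'I_m -> 'I_m -> S) :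
    (forall e' b, \sum_a G e' a b = h e' b) ->
    (\sum_e' \sum_a \sum_b F e' b * G e' a b = \sum_e' \sum_b F e' b * h e' b)
  * (\sum_e' \sum_a \sum_b F e' a * G e' b a = \sum_e' \sum_b F e' b * h e' b).
  move=> Gh; split; apply: eq_bigr => e' _.
    by rewrite exchange_big; apply: eq_bigr => b _ /=; rewrite -mulr_sumr Gh.
  by apply: eq_bigr => b _ /=; rewrite -mulr_sumr Gh.
have sum00 (F : 'I_m -> 'I_m -> S) : \sum_e' \sum_b F e' b * 0 = 0.
  by rewrite big1// => e' _; rewrite big1// => b _; rewrite mulr0.
rewrite /codazzi2; under eq_bigr do under eq_bigr do under eq_bigr do rewrite e.
under eq_bigr do under eq_bigr do rewrite !big_split/=.
under eq_bigr do rewrite !big_split/=.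
rewrite !big_split/= !(sum0 _ _ _ sum_nu_codazzi) !(sum0 _ _ _ sum_xi_codazzi) !sum00 !addr0.
under eq_bigr do under eq_bigr do under eq_bigr do rewrite e2.
under eq_bigr do under eq_bigr do rewrite !big_split/=.
under eq_bigr do rewrite !big_split/=.
rewrite !big_split/= !(sum0 _ _ _ jet_nu) !(sum0 _ _ _ jet_xi) -/jet2.
have -> : \sum_e' \sum_b curv_sq e' b * - curv_sq e' b = - trace4.
  rewrite -sumrN; apply: eq_bigr => e' _; rewrite -sumrN; apply: eq_bigr => b _; ring.
have -> : \sum_e' \sum_b r * A e' b * - (r * A e' b) = - (r ^+ 2 * curv2).
  rewrite mulr_sumr -sumrN; apply: eq_bigr => e' _.
  rewrite mulr_sumr -sumrN; apply: eq_bigr => b _; ring.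
ring.
Qed.

(** On passing from [jet2] to [codazzi2] the [trace4] terms cancel and the factor [n - 2] becomes
    [n]. *)
Lemma heat_curv2 : heat curv2 =
  curv2 ^+ 2 *+ 2 + r ^+ 2 * H ^+ 2 *+ 4 - n%:R * r ^+ 2 * curv2 *+ 2 - codazzi2 *+ 2.
Proof. rewrite heat_curv2_jet codazzi2E; ring. Qed.

(* The pure-trace part of the totally symmetric tensor [codazzi] is
   [1 / (n + 2)] times the tensor subtracted here. *)
Lemma codazzi_kato :
  \sum_e \sum_a \sum_b ((n%:R + 2%:R) * codazzi e a b
     - (D e H * proj a b + D a H * proj e b + D b H * proj e a)) ^+ 2
  = (n%:R + 2%:R) ^+ 2 * codazzi2 - 3%:R * (n%:R + 2%:R) * \sum_e D e H ^+ 2.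
Proof.
set c := n%:R + 2%:R; pose h e := D e H.
pose E e a b := h e * proj a b + h a * proj e b + h b * proj e a.
have proj_cod e : \sum_a \sum_b proj a b * codazzi e a b = h e.
  rewrite /h -trace_codazzi; apply: eq_bigr => a _.
  under eq_bigr do rewrite codazziCr.
  apply: (@proj_tangent (fun b => codazzi e b a)); first exact: sum_nu_codazzi.
  exact: sum_xi_codazzi.
have proj_h a : \sum_b proj a b * h b = h a by exact: proj_D.
have proj_proj a b : \sum_d proj a d * proj d b = proj a b.
  rewrite (@proj_tangent (fun d => proj d b))// /proj.
    have -> : \sum_b0 nu b0 * ((b0 == b)%:R - nu b0 * nu b - xi b0 * xi b) =
      \sum_d (d == b)%:R * nu d - nu b * (\sum_d nu d * nu d) - xi b * (\sum_d nu d * xi d).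
      rewrite [nu b * _]mulr_sumr [xi b * _]mulr_sumr -!sumrB; apply: eq_bigr => d _; ring.
    rewrite (se_nunu se) (se_nuxi se) sum_deltal; ring.
  have -> : \sum_b0 xi b0 * ((b0 == b)%:R - nu b0 * nu b - xi b0 * xi b) =
    \sum_d (d == b)%:R * xi d - nu b * (\sum_d nu d * xi d) - xi b * (\sum_d xi d * xi d).
    rewrite [nu b * _]mulr_sumr [xi b * _]mulr_sumr -!sumrB; apply: eq_bigr => d _; ring.
  rewrite (se_xixi se) (se_nuxi se) sum_deltal; ring.
have EB : \sum_e \sum_a \sum_b E e a b * codazzi e a b = 3%:R * \sum_e h e ^+ 2.
  have e1 : \sum_e \sum_a \sum_b h e * proj a b * codazzi e a b = \sum_e h e ^+ 2.
    apply: eq_bigr => e _; rewrite expr2 -[in X in _ = _ * X](proj_cod e) mulr_sumr.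
    by apply: eq_bigr => a _; rewrite mulr_sumr; apply: eq_bigr => b _; rewrite mulrA.
  have e2 : \sum_e \sum_a \sum_b h a * proj e b * codazzi e a b = \sum_e h e ^+ 2.
    rewrite exchange_big -[RHS]e1; apply: eq_bigr => a _ /=.
    by apply: eq_bigr => e _; apply: eq_bigr => b _; rewrite codazziCl.
  have e3 : \sum_e \sum_a \sum_b h b * proj e a * codazzi e a b = \sum_e h e ^+ 2.
    rewrite -[RHS]e2; apply: eq_bigr => e _; rewrite exchange_big.
    by apply: eq_bigr => a _; apply: eq_bigr => b _; rewrite codazziCr.
  have -> : 3%:R * \sum_e h e ^+ 2 = \sum_e h e ^+ 2 + \sum_e h e ^+ 2 + \sum_e h e ^+ 2.
    by ring.
  rewrite -{1}e1 -{1}e2 -{1}e3 -!big_split; apply: eq_bigr => e _ /=.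
  rewrite -!big_split; apply: eq_bigr => a _ /=.
  rewrite -!big_split; apply: eq_bigr => b _ /=; rewrite /E; ring.
have EE : \sum_e \sum_a \sum_b E e a b ^+ 2 = 3%:R * c * \sum_e h e ^+ 2.
  have e0 e : \sum_a \sum_b proj a b * E e a b = c * h e.
    have -> : \sum_a \sum_b proj a b * E e a b = h e * (\sum_a \sum_b proj a b * proj b a)
       + \sum_a (h a * \sum_b proj e b * proj b a)
       + \sum_a (proj e a * \sum_b proj a b * h b).
      rewrite mulr_sumr -!big_split; apply: eq_bigr => a _ /=.
      rewrite !mulr_sumr -!big_split; apply: eq_bigr => b _ /=.
      by rewrite /E (projC b a); ring.
    under eq_bigr do rewrite proj_proj.
    under [X in _ + X + _]eq_bigr do rewrite proj_proj mulrC.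
    under [X in _ + _ + X]eq_bigr do rewrite proj_h.
    by rewrite trace_proj proj_h /c; ring.
  have e1 : \sum_e \sum_a \sum_b h e * proj a b * E e a b = c * \sum_e h e ^+ 2.
    rewrite mulr_sumr; apply: eq_bigr => e _; rewrite expr2 mulrCA -[in X in _ = _ * X](e0 e) mulr_sumr.
    by apply: eq_bigr => a _; rewrite mulr_sumr; apply: eq_bigr => b _; rewrite mulrA.
  have e2 : \sum_e \sum_a \sum_b h a * proj e b * E e a b = c * \sum_e h e ^+ 2.
    rewrite exchange_big -[RHS]e1; apply: eq_bigr => a _ /=.
    by apply: eq_bigr => e _; apply: eq_bigr => b _; rewrite /E (projC e a); ring.
  have e3 : \sum_e \sum_a \sum_b h b * proj e a * E e a b = c * \sum_e h e ^+ 2.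
    rewrite -[RHS]e2; apply: eq_bigr => e _; rewrite exchange_big.
    by apply: eq_bigr => a _; apply: eq_bigr => b _; rewrite /E (projC b a); ring.
  have -> : 3%:R * c * \sum_e h e ^+ 2 =
    c * \sum_e h e ^+ 2 + c * \sum_e h e ^+ 2 + c * \sum_e h e ^+ 2 by ring.
  rewrite -{1}e1 -{1}e2 -{1}e3 -!big_split; apply: eq_bigr => e _ /=.
  rewrite -!big_split; apply: eq_bigr => a _ /=.
  rewrite -!big_split; apply: eq_bigr => b _ /=; rewrite /E; ring.
have -> : c ^+ 2 * codazzi2 - 3%:R * c * \sum_e h e ^+ 2 = c ^+ 2 * codazzi2
   - (c *+ 2) * (\sum_e \sum_a \sum_b E e a b * codazzi e a b)
   + \sum_e \sum_a \sum_b E e a b ^+ 2.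
  by rewrite EB EE; ring.
rewrite /codazzi2 !mulr_sumr -sumrB -big_split; apply: eq_bigr => e _ /=.
rewrite !mulr_sumr -sumrB -big_split; apply: eq_bigr => a _ /=.
rewrite !mulr_sumr -sumrB -big_split; apply: eq_bigr => b _ /=.
by rewrite -/(E e a b); ring.
Qed.

End Evolution.

(** * Coordinate flows *)

(* Here [d i] and [T] are the coordinate derivatives in space and time, [X] is
   the position vector, [ri] is [1 / r] and [gi] is the inverse metric. *)
Record coordinate_flow (S : comPzRingType) (n m : nat) (d : 'I_n -> S -> S)
    (T : S -> S) (r ri : S) (X nu : 'I_m -> S) (gi : 'I_n -> 'I_n -> S) : Prop :=
  CoordinateFlow {
  cf_two : forall f : S, f *+ 2 = 0 -> f = 0;
  cf_d : forall i, derivation (d i);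
  cf_T : derivation T;
  cf_dC : forall i j f, d i (d j f) = d j (d i f);
  cf_dT : forall i f, d i (T f) = T (d i f);
  cf_rri : r * ri = 1;
  cf_dr : forall i, d i r = 0;
  cf_Tr : T r = 0;
  cf_dim : m = n.+2;
  cf_giC : forall i j, gi i j = gi j i;
  cf_gi : forall i k, \sum_j gi i j * (\sum_a d j (X a) * d k (X a)) = (i == k)%:R;
  cf_nunu : \sum_a nu a * nu a = 1;
  cf_XX : r ^+ 2 * (\sum_a X a * X a) = 1;
  cf_nuX : \sum_a nu a * X a = 0;
  cf_nudX : forall i, \sum_a nu a * d i (X a) = 0;
  cf_proj : forall a b, \sum_i (\sum_j gi i j * d j (X a)) * d i (X b) =
    (a == b)%:R - nu a * nu b - r ^+ 2 * X a * X b;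
  cf_TX : forall b, T (X b) =
    - (\sum_a \sum_i (\sum_j gi i j * d j (X a)) * d i (nu a)) * nu b
}.

Section CoordinateFlow.
Variables (S : comPzRingType) (n m : nat) (d : 'I_n -> S -> S) (T : S -> S).
Variables (r ri : S) (X nu : 'I_m -> S) (gi : 'I_n -> 'I_n -> S).
Hypothesis cf : coordinate_flow d T r ri X nu gi.
Implicit Types (f : S) (a b c : 'I_m) (i j k : 'I_n).

Let dd := cf_d cf.
Let dT := cf_T cf.

(** The components of the tangent frame dual to the coordinate vectors [d k X], see [frame_dual]. *)
Definition frame i a : S := \sum_j gi i j * d j (X a).
Definition tgrad a f : S := \sum_i frame i a * d i f.
Definition unit_pos a : S := r * X a.

Local Notation D := tgrad.
Local Notation xi := unit_pos.
Local Notation H := (\sum_a D a (nu a)).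

Lemma derivation_tgrad a : derivation (D a).
Proof.
split=> f g; rewrite /tgrad.
  by rewrite -big_split; apply: eq_bigr => i _; rewrite (derD (dd i)) mulrDr.
rewrite mulr_suml mulr_sumr -big_split; apply: eq_bigr => i _ /=.
by rewrite (derM (dd i)); ring.
Qed.
Let dD := derivation_tgrad.

Lemma frame_dual i k : \sum_a frame i a * d k (X a) = (i == k)%:R.
Proof.
rewrite -(cf_gi cf i k) /frame.
under eq_bigr do rewrite mulr_suml.
rewrite exchange_big; apply: eq_bigr => j _; rewrite mulr_sumr.
by apply: eq_bigr => a _; rewrite mulrA.
Qed.

Lemma d_tgrad i f : \sum_a d i (X a) * D a f = d i f.
Proof.
rewrite /tgrad; under eq_bigr do rewrite mulr_sumr.
rewrite exchange_big -[RHS](sum_deltal (fun k => d k f)); apply: eq_bigr => k _ /=.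
by rewrite -(frame_dual k i) mulr_suml; apply: eq_bigr => a _; ring.
Qed.

Lemma vector_tgrad (z : 'I_n -> S) f :
  \sum_i z i * d i f = \sum_a (\sum_i z i * d i (X a)) * D a f.
Proof.
under [RHS]eq_bigr do rewrite mulr_suml.
rewrite exchange_big; apply: eq_bigr => i _ /=; rewrite -(d_tgrad i f) mulr_sumr.
by apply: eq_bigr => a _; rewrite mulrA.
Qed.

Lemma normal_frame (y : 'I_m -> S) f : (forall i, \sum_a y a * d i (X a) = 0) ->
  \sum_a y a * D a f = 0.
Proof.
move=> y0; rewrite /tgrad; under eq_bigr do rewrite mulr_sumr.
rewrite exchange_big big1// => i _ /=.
have -> : \sum_a y a * (frame i a * d i f) = (\sum_j gi i j * (\sum_a y a * d j (X a))) * d i f.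
  rewrite mulr_suml; under [RHS]eq_bigr do rewrite mulr_sumr mulr_suml.
  rewrite exchange_big; apply: eq_bigr => a _ /=; rewrite /frame mulr_suml mulr_sumr.
  by apply: eq_bigr => j _; ring.
by rewrite big1 ?mul0r// => j _; rewrite y0 mulr0.
Qed.

(** Differentiating the norm gives twice the sum in question; [cf_two] removes the factor. *)
Lemma derivation_unit (dl : S -> S) (y : 'I_m -> S) (s : S) : derivation dl -> dl s = 0 ->
  \sum_a y a * y a = s -> \sum_a y a * dl (y a) = 0.
Proof.
move=> hdl dc /(congr1 dl); rewrite dc (der_sum hdl) => e.
apply: (cf_two cf); rewrite -[RHS]e -sumrMnl; apply: eq_bigr => a _.
by rewrite (derM hdl); ring.
Qed.

Lemma d_const i f : r ^+ 2 * f = 1 -> d i f = 0.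
Proof.
move=> h; have : d i (r ^+ 2 * f) = 0 by rewrite h (der1 (dd i)).
rewrite (derM (dd i)) (derX2 (dd i)) (cf_dr cf) mulr0 mul0rn mul0r add0r => e.
have -> : d i f = ri ^+ 2 * (r ^+ 2 * d i f).
  by rewrite mulrA -exprMn [ri * r]mulrC (cf_rri cf) expr1n mul1r.
by rewrite e mulr0.
Qed.

Lemma X_dX i : \sum_a X a * d i (X a) = 0.
Proof. by apply: derivation_unit (dd i) _ erefl; apply: d_const; exact: cf_XX cf. Qed.

Lemma nu_dnu i : \sum_a nu a * d i (nu a) = 0.
Proof. by apply: (derivation_unit (s := 1)) (dd i) _ (cf_nunu cf); exact: der1. Qed.

Lemma nu_Tnu : \sum_a nu a * T (nu a) = 0.
Proof. by apply: (derivation_unit (s := 1)) dT _ (cf_nunu cf); exact: der1. Qed.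

Lemma nu_D f : \sum_a nu a * D a f = 0.
Proof. exact: normal_frame (cf_nudX cf). Qed.

Lemma xi_D f : \sum_a xi a * D a f = 0.
Proof.
apply: normal_frame => i; rewrite /unit_pos -[RHS](mulr0 r) -[in RHS](X_dX i) mulr_sumr.
by apply: eq_bigr => a _; rewrite mulrA.
Qed.

Lemma D_X a b : D a (X b) = (a == b)%:R - nu a * nu b - xi a * xi b.
Proof. by rewrite /tgrad (cf_proj cf) /unit_pos; ring. Qed.

Lemma Dr a : D a r = 0.
Proof. by rewrite /tgrad big1// => i _; rewrite (cf_dr cf) mulr0. Qed.

Lemma D_unit_pos a b : D a (xi b) = r * ((a == b)%:R - nu a * nu b - xi a * xi b).
Proof. by rewrite -D_X /unit_pos (derM (dD a)) Dr; ring. Qed.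

(** By [D_X] the projections onto the tangent space, onto [nu] and onto [xi] add up to the
    identity. *)
Lemma tangent_decomposition (y : 'I_m -> S) b : y b =
  \sum_j frame j b * (\sum_c d j (X c) * y c)
  + nu b * (\sum_c nu c * y c) + xi b * (\sum_c xi c * y c).
Proof.
have -> : \sum_j frame j b * (\sum_c d j (X c) * y c) = \sum_c D b (X c) * y c.
  under eq_bigr do rewrite mulr_sumr.
  rewrite exchange_big; apply: eq_bigr => c _; rewrite /tgrad mulr_suml.
  by apply: eq_bigr => j _; ring.
rewrite !mulr_sumr -!big_split -[LHS](sum_deltalC y) /=.
by apply: eq_bigr => c _; rewrite D_X; ring.
Qed.

Lemma xi_dnu i : \sum_c xi c * d i (nu c) = 0.
Proof.
have := congr1 (d i) (cf_nuX cf); rewrite (der0 (dd i)) (der_sum (dd i)).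
under eq_bigr do rewrite (derM (dd i)) [X in X + _]mulrC.
rewrite big_split/= (cf_nudX cf) addr0 => e.
by rewrite -[RHS](mulr0 r) -[in RHS]e mulr_sumr; apply: eq_bigr => c _; rewrite /unit_pos mulrA.
Qed.

Lemma sff_sym i j : \sum_c d i (X c) * d j (nu c) = \sum_c d j (X c) * d i (nu c).
Proof.
have aux k l : \sum_c d k (X c) * d l (nu c) = - \sum_c nu c * d l (d k (X c)).
  have := congr1 (d l) (cf_nudX cf k); rewrite (der0 (dd l)) (der_sum (dd l)).
  under eq_bigr do rewrite (derM (dd l)) [X in X + _]mulrC.
  by rewrite big_split/= => /eqP; rewrite addr_eq0 => /eqP.
by rewrite !aux; congr (- _); apply: eq_bigr => c _; rewrite (cf_dC cf).
Qed.

Lemma D_nu a b : D a (nu b) =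
  \sum_i \sum_j frame i a * frame j b * (\sum_c d j (X c) * d i (nu c)).
Proof.
rewrite /tgrad; apply: eq_bigr => i _.
rewrite [d i (nu b)](tangent_decomposition (fun b => d i (nu b)) b) nu_dnu xi_dnu.
rewrite !mulr0 !addr0 mulr_sumr; apply: eq_bigr => j _; ring.
Qed.

Lemma D_nuC a b : D a (nu b) = D b (nu a).
Proof.
rewrite !D_nu exchange_big; apply: eq_bigr => j _; apply: eq_bigr => i _.
by rewrite sff_sym; ring.
Qed.

Lemma sum_DX_D a f : \sum_c D a (X c) * D c f = D a f.
Proof.
have -> : \sum_c D a (X c) * D c f = \sum_c (a == c)%:R * D c f
   - nu a * (\sum_c nu c * D c f) - xi a * (\sum_c xi c * D c f).
  by rewrite !mulr_sumr -!sumrB; apply: eq_bigr => c _; rewrite D_X; ring.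
by rewrite nu_D xi_D sum_deltalC; ring.
Qed.

(** Since the [d i] commute, the second-order terms cancel and the commutator is a tangential vector
    field. It is therefore determined by its values on the position functions [X c]. *)
Lemma comm_vector a b f : D a (D b f) - D b (D a f) =
  \sum_c (D a (D b (X c)) - D b (D a (X c))) * D c f.
Proof.
have e g : D a (D b g) - D b (D a g) = \sum_i (D a (frame i b) - D b (frame i a)) * d i g.
  have e1 a' b' : D a' (D b' g) = \sum_i D a' (frame i b') * d i g
      + \sum_i \sum_j frame i b' * frame j a' * d i (d j g).
    rewrite {2}/tgrad (der_sum (dD a')) -big_split; apply: eq_bigr => i _ /=.
    rewrite (derM (dD a')); congr (_ + _); rewrite [D a' (d i g)]/tgrad mulr_sumr.
    by apply: eq_bigr => j _; rewrite (cf_dC cf j i); ring.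
  rewrite !e1 [X in _ + X - _]exchange_big.
  have -> : \sum_j \sum_i frame i b * frame j a * d i (d j g) =
     \sum_i \sum_j frame i a * frame j b * d i (d j g).
    by apply: eq_bigr => i _; apply: eq_bigr => j _; rewrite (cf_dC cf i j); ring.
  by under [RHS]eq_bigr do rewrite mulrBl; rewrite sumrB; ring.
by rewrite e vector_tgrad; apply: eq_bigr => c _; rewrite e.
Qed.

Lemma Tcomm_vector a f : T (D a f) - D a (T f) =
  \sum_c (T (D a (X c)) - D a (T (X c))) * D c f.
Proof.
have e g : T (D a g) - D a (T g) = \sum_i T (frame i a) * d i g.
  rewrite /tgrad (der_sum dT) -sumrB; apply: eq_bigr => i _.
  by rewrite (derM dT) (cf_dT cf); ring.
by rewrite e vector_tgrad; apply: eq_bigr => c _; rewrite e.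
Qed.

Lemma T_X b : T (X b) = - H * nu b. Proof. exact: cf_TX cf b. Qed.

(** The components of [T nu] along [nu], along [xi] and along the tangent vectors come from
    differentiating in time the three relations [nu . nu = 1], [nu . X = 0] and [nu . d j X = 0]. *)
Lemma T_nu b : T (nu b) = D b H + r * H * xi b.
Proof.
rewrite [LHS](tangent_decomposition (fun b => T (nu b)) b) nu_Tnu mulr0 addr0.
have -> : \sum_c xi c * T (nu c) = r * H.
  have := congr1 T (cf_nuX cf); rewrite (der0 dT) (der_sum dT).
  under eq_bigr do rewrite (derM dT) T_X [T _ * _]mulrC.
  rewrite big_split/= => e0.
  have {}e0 : \sum_c X c * T (nu c) = H.
    apply/eqP; rewrite -subr_eq0 -[X in _ == X]e0; apply/eqP; congr (_ + _).
    have -> : \sum_c nu c * (- H * nu c) = - H * (\sum_c nu c * nu c).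
      by rewrite [RHS]mulr_sumr; apply: eq_bigr => c _; ring.
    by rewrite (cf_nunu cf) mulr1.
  by rewrite -[in RHS]e0 mulr_sumr; apply: eq_bigr => c _; rewrite /unit_pos mulrA.
congr (_ + _); last by ring.
rewrite [RHS]/tgrad; apply: eq_bigr => j _; congr (_ * _).
have := congr1 T (cf_nudX cf j); rewrite (der0 dT) (der_sum dT).
under eq_bigr do rewrite (derM dT) -(cf_dT cf) T_X (derM (dd j)) (derN (dd j)) [T _ * _]mulrC.
rewrite big_split/= => e0.
apply/eqP; rewrite -subr_eq0 -[X in _ == X]e0; apply/eqP; congr (_ + _).
have -> : \sum_c nu c * (- d j H * nu c + - H * d j (nu c)) =
   - d j H * (\sum_c nu c * nu c) - H * (\sum_c nu c * d j (nu c)).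
  rewrite [- d j H * _]mulr_sumr [X in _ - X]mulr_sumr -sumrB.
  by apply: eq_bigr => c _; ring.
by rewrite (cf_nunu cf) nu_dnu mulr1 mulr0 subr0.
Qed.

Lemma T_unit_pos b : T (xi b) = - (r * H * nu b).
Proof. by rewrite /unit_pos (derM dT) (cf_Tr cf) T_X; ring. Qed.

Lemma flow_structure_equations : structure_equations n D T r nu xi.
Proof.
have xixi : \sum_a xi a * xi a = 1.
  rewrite -(cf_XX cf) mulr_sumr; apply: eq_bigr => a _; rewrite /unit_pos; ring.
have nuxi : \sum_a nu a * xi a = 0.
  by rewrite -[RHS](mulr0 r) -[in RHS](cf_nuX cf) mulr_sumr; apply: eq_bigr => a _; rewrite /unit_pos; ring.
split; [exact: dD|exact: dT|exact: Dr|exact: cf_Tr cf|exact: cf_dim cf|exact: cf_nunu cf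
  |exact: xixi|exact: nuxi|exact: nu_D|exact: xi_D|exact: D_unit_pos|exact: D_nuC| | |exact: T_nu].
- move=> a b f; rewrite comm_vector.
  have e c : D a (D b (X c)) - D b (D a (X c)) =
      nu a * D b (nu c) - nu b * D a (nu c) + r * (xi a * D b (X c) - xi b * D a (X c)).
    have e1 a' b' : D a' (D b' (X c)) = - (D a' (nu b') * nu c + nu b' * D a' (nu c))
        - r * (((a' == b')%:R - nu a' * nu b' - xi a' * xi b') * xi c + xi b' * D a' (X c)).
      have h (k : bool) : D a' k%:R = 0 by exact: der_nat.
      rewrite D_X !(derB (dD a')) h (derM (dD a') (nu b')) (derM (dD a') (xi b')) !D_unit_pos -!D_X; ring.
    by rewrite !e1 (D_nuC b a) (eq_sym b a); ring.
  under eq_bigr do rewrite e.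
  have -> : \sum_c (nu a * D b (nu c) - nu b * D a (nu c)
        + r * (xi a * D b (X c) - xi b * D a (X c))) * D c f =
     nu a * (\sum_c D b (nu c) * D c f) - nu b * (\sum_c D a (nu c) * D c f)
     + r * (xi a * (\sum_c D b (X c) * D c f) - xi b * (\sum_c D a (X c) * D c f)).
    rewrite !mulr_sumr -!sumrB mulr_sumr -big_split; apply: eq_bigr => c _ /=; ring.
  by rewrite !sum_DX_D.
- move=> a f; rewrite Tcomm_vector.
  have e c : T (D a (X c)) - D a (T (X c)) = D a H * nu c - T (nu a) * nu c
      - nu a * (D c H + r * H * xi c) + H * D a (nu c)
      + r * H * (nu a * xi c + xi a * nu c).
    have h (k : bool) : T k%:R = 0 by exact: der_nat.
    rewrite D_X !(derB dT) h (derM dT (nu a)) (derM dT (xi a)) !T_unit_pos T_X (derM (dD a)) (derN (dD a)) (T_nu c).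
    ring.
  under eq_bigr do rewrite e.
  have -> : \sum_c (D a H * nu c - T (nu a) * nu c - nu a * (D c H + r * H * xi c)
       + H * D a (nu c) + r * H * (nu a * xi c + xi a * nu c)) * D c f =
     (D a H - T (nu a) + r * H * xi a) * (\sum_c nu c * D c f)
     - nu a * (\sum_c D c H * D c f) + H * (\sum_c D a (nu c) * D c f).
    rewrite [(_ + _) * _]mulr_sumr [nu a * _]mulr_sumr [H * (\sum_c _ * _)]mulr_sumr.
    rewrite -sumrB -big_split; apply: eq_bigr => c _ /=; ring.
  by rewrite nu_D; ring.
Qed.

End CoordinateFlow.

(** * Evaluation and charts *)

Section Evaluation.
Variables (R : realType) (E : normedModType R) (O : opens E) (x : E).
Hypothesis Ox : oset O x.

Definition sev (_ : oset O x) (f : smooth_fun O) : R := f x.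

Fact sev_zmod : zmod_morphism (sev Ox).
Proof. by move=> f g; rewrite /sev smooth_funD// smooth_funN. Qed.
Fact sev_monoid : monoid_morphism (sev Ox).
Proof. by split=> [|f g]; rewrite /sev ?smooth_fun1// smooth_funM. Qed.

HB.instance Definition _ := GRing.isZmodMorphism.Build _ _ _ sev_zmod.
HB.instance Definition _ := GRing.isMonoidMorphism.Build _ _ _ sev_monoid.

End Evaluation.

Section Projection.
Variables (R : realFieldType) (n : nat).
Variables (J : 'M[R]_(n, n.+2)) (G : 'M[R]_n) (nu xi : 'rV[R]_n.+2).

(* The difference of the two sides is a symmetric idempotent of trace 0. *)
Lemma projection_decomposition : G *m (J *m J^T) = 1%:M -> G^T = G ->
  nu *m nu^T = 1%:M -> xi *m xi^T = 1%:M -> nu *m xi^T = 0 ->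
  nu *m J^T = 0 -> xi *m J^T = 0 ->
  J^T *m G *m J = 1%:M - nu^T *m nu - xi^T *m xi.
Proof.
move=> GJ GT nn xx nx nJ xJ.
have JJ : J *m J^T *m G = 1%:M by apply: mulmx1C.
have xn : xi *m nu^T = 0 by rewrite -[LHS]trmxK trmx_mul trmxK nx trmx0.
have Jn : J *m nu^T = 0 by rewrite -[LHS]trmxK trmx_mul trmxK nJ trmx0.
have Jx : J *m xi^T = 0 by rewrite -[LHS]trmxK trmx_mul trmxK xJ trmx0.
pose Q := 1%:M - nu^T *m nu - xi^T *m xi - J^T *m G *m J.
have QT : Q^T = Q.
  rewrite /Q !(linearB, linearD) /= !trmx_mul !trmxK GT trmx1.
  by rewrite !mulmxA.
have Qn : Q *m nu^T = 0.
  by rewrite /Q !mulmxBl mul1mx -!mulmxA nn xn Jn !mulmx0 mulmx1 subrr !subr0.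
have Qx : Q *m xi^T = 0.
  by rewrite /Q !mulmxBl mul1mx -!mulmxA nx xx Jx !mulmx0 mulmx1 !subr0 subrr.
have QJ : Q *m J^T = 0.
  rewrite /Q !mulmxBl mul1mx -!mulmxA nJ xJ GJ !mulmx0 mulmx1; by rewrite !subr0 subrr.
have QQ : Q *m Q = Q by rewrite {2}/Q !mulmxBr mulmx1 !mulmxA Qn Qx QJ !mul0mx !subr0.
have trQ : \tr Q = 0.
  rewrite /Q !raddfB /= mxtrace1 -[nu^T *m nu]/(mulmx nu^T nu).
  rewrite (mxtrace_mulC nu^T nu) (mxtrace_mulC xi^T xi) nn xx -mulmxA (mxtrace_mulC J^T).
  rewrite -mulmxA GJ !mxtrace1 -[n.+2]addn2 natrD; ring.
suff Q0 : Q = 0 by apply/esym/eqP; rewrite -subr_eq0; apply/eqP.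
have sq : \sum_i \sum_j Q i j ^+ 2 = 0.
  rewrite -[RHS]trQ -[in RHS]QQ; apply: eq_bigr => i _.
  rewrite [RHS]mxE; apply: eq_bigr => j _.
  by have /matrixP/(_ j i) := QT; rewrite mxE expr2 => {2}->.
apply/matrixP => i j; rewrite [RHS]mxE; apply/eqP; rewrite -sqrf_eq0; apply/eqP.
have sq0 k : 0 <= \sum_l Q k l ^+ 2 by apply: sumr_ge0 => l _; exact: sqr_ge0.
have /psumr_eq0P := sq; move=> /(_ (fun k _ => sq0 k)) /(_ i isT).
by move=> /psumr_eq0P; apply => // l _; exact: sqr_ge0.
Qed.

End Projection.

Section ChartFlow.
Variables (R : realType) (n : nat).
Local Notation E := ('rV[R]_n * R)%type.

Definition sdir (i : 'I_n) : E := (delta_mx 0 i, 0).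
Definition tdir : E := (0, 1).

Definition met (F : E -> 'rV[R]_n.+2) (z : E) : 'M[R]_n :=
  \matrix_(i, j) \sum_b 'D_(sdir i) (fun y => F y 0 b) z * 'D_(sdir j) (fun y => F y 0 b) z.

Definition trace_sff (F N : E -> 'rV[R]_n.+2) (z : E) : R :=
  \sum_a \sum_i (\sum_j invmx (met F z) i j * 'D_(sdir j) (fun y => F y 0 a) z)
    * 'D_(sdir i) (fun y => N y 0 a) z.

Record immersed_pair (O : opens E) (F N : E -> 'rV[R]_n.+2) : Prop := ImmersedPair {
  ip_F : smooth_open (oset O) F;
  ip_N : smooth_open (oset O) N;
  ip_met : forall z, oset O z -> met F z \in unitmx
}.

Record chart_flow (K : R) (O : opens E) (F N : E -> 'rV[R]_n.+2) : Prop := ChartFlow {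
  fl_K : 0 < K;
  fl_pair : immersed_pair O F N;
  fl_FF : forall z, oset O z -> dotp (F z) (F z) = K^-1;
  fl_NN : forall z, oset O z -> dotp (N z) (N z) = 1;
  fl_NF : forall z, oset O z -> dotp (N z) (F z) = 0;
  fl_NdF : forall z i, oset O z ->
    \sum_b N z 0 b * 'D_(sdir i) (fun y => F y 0 b) z = 0;
  fl_dt : forall z b, oset O z ->
    'D_tdir (fun y => F y 0 b) z = - trace_sff F N z * N z 0 b
}.

Section PairFunctions.
Variables (O : opens E) (F N : E -> 'rV[R]_n.+2).
Hypothesis ip : immersed_pair O F N.
Local Notation S := (smooth_fun O).

Let oO := @oset_open _ _ O.

Definition posS (b : 'I_n.+2) : S := smk (smooth_open_coord b oO (ip_F ip)).
Definition norS (b : 'I_n.+2) : S := smk (smooth_open_coord b oO (ip_N ip)).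
Definition metS : 'M[S]_n :=
  \matrix_(i, j) \sum_b sder (sdir i) (posS b) * sder (sdir j) (posS b).

Lemma sder_posS v b z : oset O z -> sder v (posS b) z = 'D_v (fun y => F y 0 b) z.
Proof.
move=> Oz; apply: (etrans (sderE v (posS b) Oz)).
by apply: (derive_eq_on (O := O)) Oz _ => y Oy; exact: smkE.
Qed.

Lemma sder_norS v b z : oset O z -> sder v (norS b) z = 'D_v (fun y => N y 0 b) z.
Proof.
move=> Oz; apply: (etrans (sderE v (norS b) Oz)).
by apply: (derive_eq_on (O := O)) Oz _ => y Oy; exact: smkE.
Qed.

Lemma metS_val z (Oz : oset O z) : map_mx (sev Oz) metS = met F z.
Proof.
apply/matrixP => i j; rewrite mxE mxE [RHS]mxE.
rewrite /sev (smooth_fun_sum _ _ _ Oz); apply: eq_bigr => b _.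
by rewrite (smooth_funM _ _ Oz); congr (_ * _); exact: sder_posS.
Qed.

Lemma det_metS_neq0 z : oset O z -> (\det metS) z != 0.
Proof.
move=> Oz; rewrite -[X in X != 0]/(sev Oz (\det metS)) -det_map_mx metS_val.
by rewrite -unitfE -unitmxE; exact: (ip_met ip Oz).
Qed.

(** Inverting only the determinant and using the adjugate keeps the entries of the inverse metric in
    the ring of smooth functions. *)
Definition inv_det : S := sval (smooth_fun_inv det_metS_neq0).
Definition invmetS : 'M[S]_n := inv_det *: \adj metS.

Lemma invmetSK : invmetS *m metS = 1%:M.
Proof.
rewrite /invmetS -scalemxAl mul_adj_mx scale_scalar_mx.
by rewrite (svalP (smooth_fun_inv det_metS_neq0)).
Qed.

Lemma invmetS_val z (Oz : oset O z) : map_mx (sev Oz) invmetS = invmx (met F z).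
Proof.
have mu := ip_met ip Oz.
have := congr1 (map_mx (sev Oz)) invmetSK.
rewrite map_mxM map_mx1 metS_val => e.
by rewrite -[LHS]mulmx1 -(mulmxV mu) mulmxA e mul1mx.
Qed.

Lemma invmetSE i j z : oset O z -> invmetS i j z = invmx (met F z) i j.
Proof. by move=> Oz; rewrite -(invmetS_val Oz) [RHS]mxE. Qed.

Lemma metS_sym : metS^T = metS.
Proof.
apply/matrixP => i j; rewrite [LHS]mxE [LHS]mxE [RHS]mxE.
by apply: eq_bigr => b _; exact: mulrC.
Qed.

Lemma invmetS_sym i j : invmetS i j = invmetS j i.
Proof.
have T : invmetS^T = invmetS by rewrite /invmetS linearZ /= trmx_adj metS_sym.
by have /matrixP/(_ j i) := T; rewrite mxE.
Qed.

End PairFunctions.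

Variables (K : R) (O : opens E) (F N : E -> 'rV[R]_n.+2).
Hypothesis fl : chart_flow K O F N.
Let ip := fl_pair fl.

(** The substantial field is the completeness relation [cf_proj]: it is [projection_decomposition]
    at each point, applied to the Jacobian, to [N] and to [sqrt K] times [F]. *)
Lemma chart_coordinate_flow :
  coordinate_flow (fun i => @sder R E O (sdir i)) (sder tdir)
    (scst O (Num.sqrt K)) (scst O (Num.sqrt K)^-1) (posS ip) (norS ip)
    (fun i j => invmetS ip i j).
Proof.
have K0 := fl_K fl.
have sK0 : 0 < Num.sqrt K by rewrite sqrtr_gt0.
have posE b z : oset O z -> posS ip b z = F z 0 b by exact: smkE.
have norE b z : oset O z -> norS ip b z = N z 0 b by exact: smkE.
split.
- move=> f f0; apply: smooth_fun_eq => z Oz.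
  have := congr1 (fun g : smooth_fun O => g z) f0; rewrite (smooth_funMn _ _ Oz) smooth_fun0//.
  by move=> /eqP; rewrite mulrn_eq0/= => /eqP.
- by move=> i; split=> f g; [exact: sderD|exact: sderM].
- by split=> f g; [exact: sderD|exact: sderM].
- by move=> i j f; exact: sderC.
- by move=> i f; exact: sderC.
- by rewrite -scstM mulfV ?gt_eqF.
- by move=> i; exact: sder_cst.
- exact: sder_cst.
- by [].
- exact: invmetS_sym.
- move=> i k; have /matrixP/(_ i k) := invmetSK ip; rewrite mxE [in RHS]mxE => <-.
  by apply: eq_bigr => j _; congr (_ * _); rewrite [RHS]mxE.
- apply: smooth_fun_eq => z Oz; rewrite smooth_fun_sum// smooth_fun1// -(fl_NN fl Oz).
  by apply: eq_bigr => b _; rewrite smooth_funM// norE.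
- apply: smooth_fun_eq => z Oz; rewrite smooth_funM// smooth_fun1// smooth_funX//.
  rewrite scstE// sqr_sqrtr ?ltW// smooth_fun_sum//.
  have -> : \sum_i (posS ip i * posS ip i) z = K^-1.
    by rewrite -(fl_FF fl Oz); apply: eq_bigr => b _; rewrite smooth_funM// posE.
  by rewrite mulfV ?gt_eqF.
- apply: smooth_fun_eq => z Oz; rewrite smooth_fun_sum// smooth_fun0//.
  apply: etrans (fl_NF fl Oz).
  by apply: eq_bigr => b _; rewrite smooth_funM// norE// posE.
- move=> i; apply: smooth_fun_eq => z Oz; rewrite smooth_fun_sum// smooth_fun0//.
  apply: etrans (fl_NdF fl i Oz); apply: eq_bigr => b _.
  by rewrite smooth_funM// norE// (sder_posS ip _ _ Oz).
- move=> a b; apply: smooth_fun_eq => z Oz.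
  pose J : 'M[R]_(n, n.+2) := \matrix_(i, a) 'D_(sdir i) (fun y => F y 0 a) z.
  have JJ : J *m J^T = met F z.
    by apply/matrixP => i j; rewrite !mxE; apply: eq_bigr => c _; rewrite !mxE.
  have GT : (invmx (met F z))^T = invmx (met F z).
    by apply/matrixP => i j; rewrite mxE -!(invmetSE ip)// invmetS_sym.
  have dotE (x y : 'rV[R]_n.+2) : x *m y^T = (dotp x y)%:M.
    apply/matrixP => i j; rewrite !ord1 !mxE/=.
    by apply: eq_bigr => c _; rewrite !mxE.
  have NJ : N z *m J^T = 0.
    apply/rowP => i; rewrite !mxE -[RHS](fl_NdF fl i Oz).
    by apply: eq_bigr => c _; rewrite !mxE.
  have FJ : F z *m J^T = 0.
    apply/rowP => i; rewrite !mxE.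
    have FFS : \sum_b posS ip b * posS ip b = scst O K^-1.
      apply: smooth_fun_eq => y Oy; rewrite scstE// smooth_fun_sum// -(fl_FF fl Oy).
      by apply: eq_bigr => c _; rewrite smooth_funM// posE.
    have := congr1 (fun g => sder (sdir i) g z) FFS.
    have dsum : sder (sdir i) (\sum_b posS ip b * posS ip b)
        = (\sum_b posS ip b * sder (sdir i) (posS ip b)) *+ 2.
      have hd : derivation (@sder R E O (sdir i)).
        by split=> f g; [exact: sderD|exact: sderM].
      rewrite (der_sum hd) -sumrMnl; apply: eq_bigr => c _.
      by rewrite (derM hd); ring.
    rewrite dsum sder_cst smooth_fun0// smooth_funMn// => /eqP; rewrite mulrn_eq0/= => /eqP e.
    apply: etrans e; rewrite smooth_fun_sum//; apply: eq_bigr => c _.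
    by rewrite smooth_funM// posE// (sder_posS ip _ _ Oz) !mxE.
  pose xi := Num.sqrt K *: F z.
  have := @projection_decomposition _ _ J (invmx (met F z)) (N z) xi.
  rewrite JJ mulVmx ?(ip_met ip)//.
  have -> : N z *m (N z)^T = 1%:M by rewrite dotE (fl_NN fl Oz).
  have -> : N z *m xi^T = 0.
    by rewrite linearZ /= -scalemxAr dotE (fl_NF fl Oz) raddf0 scaler0.
  have -> : xi *m xi^T = 1%:M.
    rewrite linearZ /= -scalemxAl -scalemxAr dotE (fl_FF fl Oz) scalerA -expr2.
    by rewrite sqr_sqrtr ?ltW// scale_scalar_mx mulfV ?gt_eqF.
  have -> : xi *m J^T = 0 by rewrite -scalemxAl FJ scaler0.
  move=> /(_ erefl GT erefl erefl erefl NJ erefl) /matrixP/(_ a b) e.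
  have r2 : (scst O (Num.sqrt K) ^+ 2) z = K by rewrite smooth_funX// scstE// sqr_sqrtr ?ltW.
  rewrite [RHS]smooth_funD// [in RHS]smooth_funD// !smooth_funN// smooth_fun_natr//.
  rewrite (smooth_funM (norS ip a))// (smooth_funM (_ * posS ip a))// (smooth_funM (_ ^+ 2))// r2.
  rewrite !norE// !posE//.
  have -> : (a == b)%:R - N z 0 a * N z 0 b - K * F z 0 a * F z 0 b =
      (1%:M - (N z)^T *m N z - xi^T *m xi) a b.
    rewrite !mxE !big_ord1 !mxE -[in LHS](sqr_sqrtr (ltW K0)); ring.
  rewrite -e mxE smooth_fun_sum//; apply: eq_bigr => i _.
  rewrite smooth_funM// (sder_posS ip _ _ Oz) smooth_fun_sum// !mxE; congr (_ * _).
  apply: eq_bigr => j _; rewrite smooth_funM// (sder_posS ip _ _ Oz) invmetSE// !mxE mulrC.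
  by have /matrixP/(_ i j) := GT; rewrite mxE => ->.
- move=> b; apply: smooth_fun_eq => z Oz.
  rewrite (sder_posS ip _ _ Oz) (fl_dt fl b Oz) smooth_funM// smooth_funN// norE//; congr (- _ * _).
  rewrite smooth_fun_sum//; apply: eq_bigr => a _; rewrite smooth_fun_sum//.
  apply: eq_bigr => i _; rewrite smooth_funM// (sder_norS ip _ _ Oz); congr (_ * _).
  rewrite smooth_fun_sum//; apply: eq_bigr => j _.
  by rewrite smooth_funM// (sder_posS ip _ _ Oz) invmetSE.
Qed.

End ChartFlow.

(** * Orders of magnitude *)

(* A solution evaluated at a space-time point; [rho] is the curvature scale
   there and [x], [y], [z] are the scale-invariant sizes of the first, second
   and third derivatives of the curvature. *)
Record flow_point (R : rcfType) (n m : nat) (c0 : R) := FlowPoint {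
  fpS : comPzRingType;
  fpD : 'I_m -> fpS -> fpS;
  fpT : fpS -> fpS;
  fpr : fpS;
  fpnu : 'I_m -> fpS;
  fpxi : 'I_m -> fpS;
  fp_se : structure_equations n fpD fpT fpr fpnu fpxi;
  fpev : {rmorphism fpS -> R};
  rho : R;
  fpx : R;
  fpy : R;
  fpz : R;
  rho_gt0 : 0 < rho;
  fpx_ge0 : 0 <= fpx;
  fpy_ge0 : 0 <= fpy;
  fpz_ge0 : 0 <= fpz;
  fp_r : `|fpev fpr| <= c0 * rho;
  fp_A : forall a b, `|fpev (fpD a (fpnu b))| <= c0 * rho;
  fp_DA : forall e a b, `|fpev (fpD e (fpD a (fpnu b)))| <= rho ^+ 2 * fpx;
  fp_DDA : forall f e a b, `|fpev (fpD f (fpD e (fpD a (fpnu b))))| <= rho ^+ 3 * fpy;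
  fp_DDDA : forall k f e a b,
    `|fpev (fpD k (fpD f (fpD e (fpD a (fpnu b)))))| <= rho ^+ 4 * fpz
}.

Section Classes.
Variables (R : rcfType) (n m : nat) (c0 : R).
Local Notation ctx := (@flow_point R n m c0).

(** [weight p i] dominates every monomial in [x], [y], [z] of differential order at most [i], where
    these count 1, 2 and 3; this is the source of [weightM]. All indices above 3 share the last
    value. *)
Definition weight (p : ctx) (i : nat) : R :=
  match i with
  | 0 => 1
  | 1 => 1 + fpx p
  | 2 => (1 + fpx p) ^+ 2 + fpy p
  | _ => (1 + fpx p) ^+ 3 + (1 + fpx p) * fpy p + fpz p
  end.

Lemma weight_ge1 p i : 1 <= weight p i.
Proof.
have x0 := fpx_ge0 p; have y0 := fpy_ge0 p; have z0 := fpz_ge0 p.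
by case: i => [|[|[|i]]] /=; nra.
Qed.

Lemma weight_ge0 p i : 0 <= weight p i.
Proof. exact: le_trans ler01 (weight_ge1 p i). Qed.

Lemma scale_ge0 (p : ctx) k : 0 <= rho p ^+ k.
Proof. by rewrite exprn_ge0// ltW// rho_gt0. Qed.

Lemma weight_mono p i : weight p i <= weight p i.+1.
Proof.
have x0 := fpx_ge0 p; have y0 := fpy_ge0 p; have z0 := fpz_ge0 p.
by case: i => [|[|[|i]]] /=; nra.
Qed.

Lemma weightM p i j : (i + j <= 3)%N -> weight p i * weight p j <= weight p (i + j).
Proof.
have x0 := fpx_ge0 p; have y0 := fpy_ge0 p; have z0 := fpz_ge0 p.
by case: i => [|[|[|[|i]]]]; case: j => [|[|[|[|j]]]] //= _; nra.
Qed.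

(* [order_le p j i k C f]: the derivatives of [f] of order [l <= j] are bounded
   at [p] by [C * rho ^+ (k + l) * weight (i + l)]. *)
Fixpoint order_le (p : ctx) (j i k : nat) (C : R) (f : fpS p) : Prop :=
  `|fpev p f| <= C * rho p ^+ k * weight p i /\
  match j with
  | 0 => True
  | j'.+1 => forall a, order_le j' i.+1 k.+1 C (fpD a f)
  end.

Lemma order_le_ev p j i k C (f : fpS p) : order_le j i k C f ->
  `|fpev p f| <= C * rho p ^+ k * weight p i.
Proof. by case: j => [|j] []. Qed.

Lemma order_le_C_ge0 p j i k C (f : fpS p) : order_le j i k C f -> 0 <= C.
Proof.
move=> /order_le_ev/(le_trans (normr_ge0 _)).
rewrite -mulrA pmulr_lge0// mulr_gt0 ?exprn_gt0 ?rho_gt0//.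
by rewrite (lt_le_trans ltr01)// weight_ge1.
Qed.

Lemma order_leC p j i k C C' (f : fpS p) : C <= C' -> order_le j i k C f ->
  order_le j i k C' f.
Proof.
move=> CC'; elim: j i k f => [|j IH] i k f /= [h1 h2]; split => //.
- rewrite (le_trans h1)// -!mulrA ler_wpM2r// mulr_ge0 ?exprn_ge0 ?ltW ?rho_gt0//.
  by rewrite (lt_le_trans ltr01)// weight_ge1.
- rewrite (le_trans h1)// -!mulrA ler_wpM2r// mulr_ge0 ?exprn_ge0 ?ltW ?rho_gt0//.
  by rewrite (lt_le_trans ltr01)// weight_ge1.
- by move=> a; exact: IH.
Qed.

Lemma order_le_j p j i k C (f : fpS p) : order_le j.+1 i k C f -> order_le j i k C f.
Proof.
elim: j i k f => [|j IH] i k f [h1 h2]; split => //.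
by move=> a; apply: IH; exact: h2.
Qed.

Lemma order_le_i p j i k C (f : fpS p) : order_le j i k C f -> order_le j i.+1 k C f.
Proof.
move=> h; have C0 := order_le_C_ge0 h; elim: j i k f h => [|j IH] i k f [h1 h2]; split.
- rewrite (le_trans h1)// ler_wpM2l ?weight_mono// mulr_ge0// exprn_ge0// ltW//.
  exact: rho_gt0.
- by [].
- rewrite (le_trans h1)// ler_wpM2l ?weight_mono// mulr_ge0// exprn_ge0// ltW//.
  exact: rho_gt0.
- by move=> a; apply: IH; exact: h2.
Qed.

Lemma order_leD p j i k C C' (f g : fpS p) : order_le j i k C f ->
  order_le j i k C' g -> order_le j i k (C + C') (f + g).
Proof.
elim: j i k f g => [|j IH] i k f g [f1 f2] [g1 g2]; split => //.
- by rewrite rmorphD/= (le_trans (ler_normD _ _))// !mulrDl lerD.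
- by rewrite rmorphD/= (le_trans (ler_normD _ _))// !mulrDl lerD.
- by move=> a; rewrite (derD (seD (fp_se p) a)); apply: IH; [exact: f2|exact: g2].
Qed.

Lemma order_leN p j i k C (f : fpS p) : order_le j i k C f -> order_le j i k C (- f).
Proof.
elim: j i k f => [|j IH] i k f [f1 f2]; split => //; rewrite ?rmorphN ?normrN//.
by move=> a; rewrite (derN (seD (fp_se p) a)); apply: IH; exact: f2.
Qed.

Lemma order_le0 p j i k C (f : fpS p) : (forall a, fpD a f = 0) -> 0 <= C ->
  `|fpev p f| <= C * rho p ^+ k * weight p i -> order_le j i k C f.
Proof.
move=> Df C0 h; case: j => [|j]; split => // a; rewrite Df.
have z0 i' k' : `|fpev p 0| <= C * rho p ^+ k' * weight p i'.
  by rewrite rmorph0 normr0 !mulr_ge0 ?scale_ge0 ?weight_ge0.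
elim: j i.+1 k.+1 a => [|j IH] i' k' a; split => // b.
by rewrite (der0 (seD (fp_se p) b)); exact: IH.
Qed.

(** Each use of the product rule doubles the number of terms, whence [2 ^+ j]; the bound on
    [i + i' + j] keeps the products of weights in the range of [weightM]. *)
Lemma order_leM p j i i' k k' C C' (f g : fpS p) : (i + i' + j <= 3)%N ->
  order_le j i k C f -> order_le j i' k' C' g ->
  order_le j (i + i') (k + k') (2 ^+ j * (C * C')) (f * g).
Proof.
elim: j i i' k k' f g => [|j IH] i i' k k' f g le3 hf hg;
  have C0 := order_le_C_ge0 hf; have C0' := order_le_C_ge0 hg.
- case: hf hg => [f1 _] [g1 _]; split => //; rewrite expr0 mul1r rmorphM normrM.
  apply: le_trans (ler_pM (normr_ge0 _) (normr_ge0 _) f1 g1) _.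
  rewrite [leLHS](_ : _ = C * C' * rho p ^+ (k + k') * (weight p i * weight p i')); last first.
    by rewrite exprD; ring.
  apply: ler_wpM2l; first by rewrite !mulr_ge0 ?scale_ge0.
  by apply: weightM; rewrite addn0 in le3.
- have [f1 f2] := hf; have [g1 g2] := hg.
  have hf' := order_le_j hf; have hg' := order_le_j hg.
  split.
    have le3' : (i + i' + j <= 3)%N by apply: leq_trans le3; rewrite leq_add2l.
    have := order_le_ev (IH _ _ _ _ _ _ le3' hf' hg'); move/le_trans; apply.
    rewrite -mulrA -[leRHS]mulrA ler_wpM2r ?mulr_ge0 ?scale_ge0 ?weight_ge0//.
    by rewrite ler_wpM2r ?mulr_ge0// exprS ler_peMl ?exprn_ge0// ler1n.
  move=> a; rewrite (derM (seD (fp_se p) a)) exprS mulr_natl mulr2n mulrDl.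
  apply: order_leD.
    by rewrite -!addSn; apply: IH => //; [rewrite addSn addSnnS|exact: f2].
  by rewrite -!addnS; apply: IH => //; [rewrite addnS addSnnS|exact: g2].
Qed.

(** The constant precedes the point: a bound on an expression built from the data of a [flow_point]
    depends on [n], [m] and [c0] but not on the solution. *)
Definition bounded_order (j i k : nat) (f : forall p : ctx, fpS p) : Prop :=
  exists C, forall p, order_le j i k C (f p).

Lemma boundedD j i k f g : bounded_order j i k f -> bounded_order j i k g ->
  bounded_order j i k (fun p => f p + g p).
Proof. by move=> [C hf] [C' hg]; exists (C + C') => p; exact: order_leD. Qed.

Lemma boundedN j i k f : bounded_order j i k f -> bounded_order j i k (fun p => - f p).
Proof. by move=> [C hf]; exists C => p; exact: order_leN. Qed.

Lemma boundedB j i k f g : bounded_order j i k f -> bounded_order j i k g ->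
  bounded_order j i k (fun p => f p - g p).
Proof. by move=> hf hg; apply: boundedD => //; exact: boundedN. Qed.

Lemma bounded0 j i k : bounded_order j i k (fun p => 0).
Proof.
exists 0 => p; apply: order_le0 => //; first by move=> a; rewrite (der0 (seD (fp_se p) a)).
by rewrite rmorph0 normr0 !mul0r.
Qed.

Lemma bounded_sum j i k (F : 'I_m -> forall p : ctx, fpS p) :
  (forall a, bounded_order j i k (F a)) -> bounded_order j i k (fun p => \sum_a F a p).
Proof.
move=> hF; elim: (index_enum _) => [|a s [C IH]].
  by have [C h] := bounded0 j i k; exists C => p; rewrite big_nil.
have [C' h'] := hF a.
by exists (C' + C) => p; rewrite big_cons; exact: order_leD.
Qed.

Lemma boundedMn j i k f l : bounded_order j i k f -> bounded_order j i k (fun p => f p *+ l).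
Proof.
move=> hf; elim: l => [|l [C IH]].
  by have [C h] := bounded0 j i k; exists C => p; rewrite mulr0n.
by have [C' h'] := hf; exists (C' + C) => p; rewrite mulrS; exact: order_leD.
Qed.

Lemma boundedM j i i' k k' f g : (i + i' + j <= 3)%N -> bounded_order j i k f ->
  bounded_order j i' k' g -> bounded_order j (i + i') (k + k') (fun p => f p * g p).
Proof. by move=> le3 [C hf] [C' hg]; exists (2 ^+ j * (C * C')) => p; exact: order_leM. Qed.

Lemma bounded_D j i k f a : bounded_order j.+1 i k f ->
  bounded_order j i.+1 k.+1 (fun p => fpD a (f p)).
Proof. by move=> [C hf]; exists C => p; have [_] := hf p; exact. Qed.

Lemma bounded_j j i k f : bounded_order j.+1 i k f -> bounded_order j i k f.
Proof. by move=> [C hf]; exists C => p; exact: order_le_j. Qed.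

Lemma bounded_i j i k f : bounded_order j i k f -> bounded_order j i.+1 k f.
Proof. by move=> [C hf]; exists C => p; exact: order_le_i. Qed.

Lemma bounded_eq j i k f g : (forall p, f p = g p) -> bounded_order j i k f ->
  bounded_order j i k g.
Proof. by move=> fg [C hf]; exists C => p; rewrite -fg. Qed.

Local Notation nu a := (fun p : ctx => fpnu p a).
Local Notation xi a := (fun p : ctx => fpxi p a).
Local Notation r := (fun p : ctx => fpr p).
Local Notation A a b := (fun p : ctx => curv (@fpD _ _ _ _ p) (fpnu p) a b).

Lemma unit_vector_le1 (p : ctx) (y : 'I_m -> fpS p) a : \sum_a y a * y a = 1 ->
  `|fpev p (y a)| <= 1.
Proof.
move=> /(congr1 (fpev p)); rewrite rmorph1 rmorph_sum (bigD1 a)//= rmorphM -expr2 => e.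
have : fpev p (y a) ^+ 2 <= 1.
  by rewrite -e lerDl sumr_ge0// => b _; rewrite rmorphM -expr2; exact: sqr_ge0.
by move: (fpev p (y a)) => t t1; rewrite ler_norml; apply/andP; split; nra.
Qed.

Hypothesis c0_ge0 : 0 <= c0.

Lemma bounded_r j : bounded_order j 0 1 r.
Proof.
exists c0 => p; apply: order_le0 => //; first exact: seDr (fp_se p).
by rewrite expr1 mulr1; exact: fp_r.
Qed.

Lemma bounded_curv a b : bounded_order 3 0 1 (A a b).
Proof.
have hw (p : ctx) (k i : nat) (t w s : R) : t <= rho p ^+ k * w -> 0 <= w -> w <= s ->
    t <= (c0 + 1) * rho p ^+ k * s.
  move=> h w0 ws; rewrite (le_trans h)// -mulrA.
  have rk : 0 <= rho p ^+ k by rewrite exprn_ge0// ltW// rho_gt0.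
  have : rho p ^+ k * w <= rho p ^+ k * s by rewrite ler_wpM2l.
  have : 0 <= c0 * (rho p ^+ k * s) by rewrite !mulr_ge0// (le_trans w0).
  by nra.
(* [c0] serves the curvature itself; the summand 1 serves its derivatives, bounded with constant 1
   in [fp_DA], [fp_DDA] and [fp_DDDA]. *)
exists (c0 + 1) => p.
have x0 := fpx_ge0 p; have y0 := fpy_ge0 p; have z0 := fpz_ge0 p.
have w1 : fpx p <= weight p 1 by rewrite /=; nra.
have w2 : fpy p <= weight p 2 by rewrite /=; nra.
have w3 : fpz p <= weight p 3.
  by rewrite /= lerDr addr_ge0 ?exprn_ge0 ?mulr_ge0// addr_ge0.
split => [|e].
  rewrite expr1 mulr1 (le_trans (fp_A p a b))// mulrDl lerDl mul1r ltW//.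
  exact: rho_gt0.
split => [|f]; first exact: hw (fp_DA p e a b) x0 w1.
split => [|k]; first exact: hw (fp_DDA p f e a b) y0 w2.
by split => //; exact: hw (fp_DDDA p k f e a b) z0 w3.
Qed.

Lemma bounded_nu b : bounded_order 3 0 0 (nu b).
Proof.
have h a : bounded_order 2 1 1 (A a b).
  by apply: bounded_i; apply: bounded_j; exact: bounded_curv.
have [C hC] : exists C, forall p a, order_le 2 1 1 C (A a b p).
  have [C hC] := fin_all_exists h; exists (\sum_a C a) => p a; apply: order_leC (hC a p).
  rewrite (bigD1 a)//= lerDl sumr_ge0// => a' _.
  exact: order_le_C_ge0 (hC a' p).
exists (C + 1) => p; split.
  rewrite expr0 !mulr1 (le_trans (unit_vector_le1 b (se_nunu (fp_se p))))//.
  rewrite lerDr; exact: order_le_C_ge0 (hC p b).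
by move=> a; apply: order_leC (hC p a); rewrite lerDl.
Qed.

Lemma boundedW j i k f : (j <= 3)%N -> bounded_order 3 i k f -> bounded_order j i k f.
Proof.
case: j => [|[|[|[|j]]]] // _ h; repeat first [exact: h | apply: bounded_j].
Qed.

Lemma bounded_proj j a b : (j <= 3)%N -> (forall b, bounded_order j 0 0 (xi b)) ->
  bounded_order j 0 0 (fun p => proj (fpnu p) (fpxi p) a b).
Proof.
move=> j3 hxi; have hnu b' := boundedW j3 (bounded_nu b').
apply: boundedB; last exact: (boundedM (i := 0) (i' := 0) (k := 0) (k' := 0)).
apply: boundedB; last exact: (boundedM (i := 0) (i' := 0) (k := 0) (k' := 0)).
exists 1 => p; apply: order_le0 => //; first by move=> e; rewrite (der_nat (seD (fp_se p) e)).
by rewrite rmorph_nat expr0 !mulr1; case: eqP; rewrite ?normr1 ?normr0.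
Qed.

(** A bootstrap: the derivative of [xi] is [r] times a projection that contains [xi], so control of
    [j] derivatives gives control of [j + 1]. *)
Lemma bounded_xi b : bounded_order 3 0 0 (xi b).
Proof.
have step j : (j < 3)%N -> (forall b, bounded_order j 0 0 (xi b)) ->
    forall b, bounded_order j.+1 0 0 (xi b).
  move=> j3 hj b'.
  have h a : bounded_order j 1 1 (fun p => fpD a (fpxi p b')).
    apply: (bounded_eq (f := fun p => fpr p * proj (fpnu p) (fpxi p) a b')).
      by move=> p; rewrite (D_xi (fp_se p)).
    apply: bounded_i; apply: (boundedM (i := 0) (i' := 0) (k := 1) (k' := 0)).
    - by rewrite !add0n ltnW.
    - exact: bounded_r.
    - by apply: bounded_proj hj; exact: ltnW.
  have [C hC] := fin_all_exists h; exists (\sum_a C a + 1) => p; split.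
    rewrite expr0 !mulr1 (le_trans (unit_vector_le1 b' (se_xixi (fp_se p))))//.
    by rewrite lerDr sumr_ge0// => a _; exact: order_le_C_ge0 (hC a p).
  move=> a; apply: order_leC (hC a p).
  rewrite (bigD1 a)//= -addrA lerDl addr_ge0// sumr_ge0// => a' _.
  exact: order_le_C_ge0 (hC a' p).
have base b' : bounded_order 0 0 0 (xi b').
  exists 1 => p; split => //.
  by rewrite expr0 !mulr1 (unit_vector_le1 b' (se_xixi (fp_se p))).
exact: (step 2%N isT (step 1%N isT (step 0%N isT base))).
Qed.

Lemma boundedMp j i i' k k' l f g : (i + i' + j <= 3)%N -> (k + k' = l)%N ->
  bounded_order j i k f ->
  bounded_order j i' k' g -> bounded_order j (i + i') l (fun p => f p * g p).
Proof. by move=> le3 <-; exact: boundedM. Qed.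

Local Notation H := (fun p : ctx => meanc (@fpD _ _ _ _ p) (fpnu p)).
Local Notation K2 := (fun p : ctx => curv2 (@fpD _ _ _ _ p) (fpnu p)).
Local Notation heatp p f := (heat (@fpD _ _ _ _ p) (@fpT _ _ _ _ p) f).

Lemma bounded_meanc : bounded_order 3 0 1 H.
Proof. by apply: bounded_sum => a; exact: bounded_curv. Qed.

Lemma bounded_curv2 : bounded_order 3 0 2 K2.
Proof.
apply: bounded_sum => a; apply: bounded_sum => b.
apply: (bounded_eq (f := fun p => A a b p * A a b p)); first by move=> p; rewrite expr2.
by apply: (boundedM (i := 0) (i' := 0) (k := 1) (k' := 1)) => //; exact: bounded_curv.
Qed.

Lemma bounded_heat_nu b : bounded_order 3 0 2 (fun p => heatp p (fpnu p b)).
Proof.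
apply: bounded_eq; first by move=> p; rewrite (heat_nu (fp_se p)).
apply: boundedD.
  apply: (boundedM (i := 0) (i' := 0) (k := 2) (k' := 0)) => //; [exact: bounded_curv2|exact: bounded_nu].
apply: boundedMn; apply: (boundedM (i := 0) (i' := 0) (k := 2) (k' := 0)) => //; last exact: bounded_xi.
by apply: (boundedM (i := 0) (i' := 0) (k := 1) (k' := 1)) => //; [exact: bounded_r|exact: bounded_meanc].
Qed.

(** The commutator involves only first and second derivatives of [f], with coefficients built from
    the curvature, [nu], [xi] and [r]. Relative to [D f] it costs one order of differentiation and
    two powers of the scale. *)
Lemma bounded_heat_comm j i k a f : (i + j <= 2)%N ->
  (forall b, bounded_order j.+1 i k (fun p => fpD b (f p))) ->
  bounded_order j i.+1 k.+2
    (fun p => heat_comm n (@fpD _ _ _ _ p) (fpr p) (fpnu p) (fpxi p) a (f p)).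
Proof.
move=> ij hf.
have j3 : (j <= 3)%N by apply: leq_trans (leqnSn 2); apply: leq_trans ij; exact: leq_addl.
have le i' : (i' <= i.+1)%N -> (0 + i' + j <= 3)%N.
  by move=> h; rewrite add0n; apply: leq_trans (leq_add h (leqnn j)) _; rewrite addSn.
have hf0 b := bounded_j (hf b).
have hA a' b' := boundedW j3 (bounded_curv a' b').
have hr := @bounded_r j.
have hr2 : bounded_order j 0 2 (fun p => fpr p ^+ 2).
  apply: (bounded_eq (f := fun p => fpr p * fpr p)); first by move=> p; rewrite expr2.
  by apply: (boundedM (i := 0) (i' := 0) (k := 1) (k' := 1)).
have hshape b : bounded_order j i k.+1 (fun p => shape (@fpD _ _ _ _ p) (fpnu p) b (f p)).
  apply: bounded_sum => d.
  by apply: (boundedMp (i := 0) (i' := i) (k := 1) (k' := k)) => //; apply: le.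
have hshape2 : bounded_order j i k.+2 (fun p => shape2 (@fpD _ _ _ _ p) (fpnu p) a (f p)).
  apply: bounded_sum => b.
  by apply: (boundedMp (i := 0) (i' := i) (k := 1) (k' := k.+1)) => //; apply: le.
have hDD b d : bounded_order j i.+1 k.+1 (fun p => fpD b (fpD d (f p))).
  exact: bounded_D (hf d).
have hhess : bounded_order j i.+1 k.+2 (fun p => curv_hess (@fpD _ _ _ _ p) (fpnu p) (f p)).
  apply: bounded_sum => b; apply: bounded_sum => d.
  by apply: (boundedMp (i := 0) (i' := i.+1) (k := 1) (k' := k.+1)) => //; apply: le.
have hlap : bounded_order j i.+1 k.+1 (fun p => lap (@fpD _ _ _ _ p) (f p)).
  by apply: bounded_sum => b.
apply: boundedD; last first.
  apply: boundedMn.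
  apply: (boundedMp (i := 0) (i' := i.+1) (k := 1) (k' := k.+1)) => //; try by apply: le.
  apply: (boundedMp (i := 0) (i' := 0) (k := 1) (k' := 0)) => //.
  exact: boundedW (bounded_xi a).
apply: boundedB; last first.
  apply: bounded_i.
  apply: (boundedMp (i := 0) (i' := i) (k := 2) (k' := k)) => //; try by apply: le.
  apply: (boundedMp (i := 0) (i' := 0) (k := 0) (k' := 2)) => //.
  exists `|n%:R - 2%:R| => p; apply: order_le0 => //.
    by move=> e; rewrite (derB (seD (fp_se p) e)) !(der_nat (seD (fp_se p) e)) subrr.
  by rewrite rmorphB /= !rmorph_nat expr0 !mulr1.
apply: boundedD; first by apply: boundedMn; exact: bounded_i.
apply: boundedMn; apply: (boundedMp (i := 0) (i' := i.+1) (k := 0) (k' := k.+2)) => //.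
  try by apply: le.
exact: boundedW (bounded_nu a).
Qed.

(** Here and in the next two lemmas the preceding bound on [heat] is differentiated once and a
    commutator is added: the number of controlled derivatives drops by one, the order and the scale
    rise by one. *)
Lemma bounded_heat_curv a b : bounded_order 2 1 3 (fun p => heatp p (A a b p)).
Proof.
apply: bounded_eq; first by move=> p; rewrite (heat_D (fp_se p) a (fpnu p b)).
apply: boundedD; first by apply: bounded_D; exact: bounded_heat_nu.
apply: (bounded_heat_comm (k := 1)) => // d; exact: bounded_curv.
Qed.

Lemma bounded_heat_Dcurv e a b : bounded_order 1 2 4 (fun p => heatp p (fpD e (A a b p))).
Proof.
apply: bounded_eq; first by move=> p; rewrite (heat_D (fp_se p) e).
apply: boundedD; first by apply: bounded_D; exact: bounded_heat_curv.
apply: (bounded_heat_comm (k := 2)) => // d; apply: bounded_D; exact: bounded_curv.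
Qed.

Lemma bounded_heat_DDcurv f e a b :
  bounded_order 0 3 5 (fun p => heatp p (fpD f (fpD e (A a b p)))).
Proof.
apply: bounded_eq; first by move=> p; rewrite (heat_D (fp_se p) f).
apply: boundedD; first by apply: bounded_D; exact: bounded_heat_Dcurv.
apply: (bounded_heat_comm (k := 3)) => // d.
by apply: bounded_D; apply: bounded_D; exact: bounded_curv.
Qed.

Lemma bounded_curv_sq a b :
  bounded_order 3 0 2 (fun p => curv_sq (@fpD _ _ _ _ p) (fpnu p) a b).
Proof.
apply: bounded_sum => d.
by apply: (boundedM (i := 0) (i' := 0) (k := 1) (k' := 1)) => //; exact: bounded_curv.
Qed.

Lemma bounded_codazzi e a b : bounded_order 2 1 2
  (fun p => codazzi (@fpD _ _ _ _ p) (fpr p) (fpnu p) (fpxi p) e a b).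
Proof.
have b2 i k f : bounded_order 3 i k f -> bounded_order 2 i k f by exact: bounded_j.
have hnu a' := b2 _ _ _ (bounded_nu a').
have hxi a' := b2 _ _ _ (bounded_xi a').
have hA a' b' := b2 _ _ _ (bounded_curv a' b').
have hS a' b' := b2 _ _ _ (bounded_curv_sq a' b').
apply: boundedD; last first.
  apply: bounded_i; apply: (boundedM (i := 0) (i' := 0) (k := 1) (k' := 1)) => //.
    exact: bounded_r.
  by apply: boundedD; apply: (boundedM (i := 0) (i' := 0) (k := 0) (k' := 1)).
apply: boundedD; last first.
  by apply: bounded_i; apply: (boundedM (i := 0) (i' := 0) (k := 0) (k' := 2)).
apply: boundedD; last first.
  by apply: bounded_i; apply: (boundedM (i := 0) (i' := 0) (k := 0) (k' := 2)).
by apply: bounded_D; exact: bounded_curv.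
Qed.

End Classes.

(** * Estimates at a contact point *)

Section RealInequalities.
Variable R : rcfType.
Implicit Types (C kappa lam x y z s k gam del : R).

Lemma cauchy_schwarz (I : finType) (f g : I -> R) :
  (\sum_i f i * g i) ^+ 2 <= (\sum_i f i ^+ 2) * (\sum_i g i ^+ 2).
Proof.
set F := \sum_i f i ^+ 2; set G := \sum_i g i ^+ 2; set P := \sum_i _.
have F0 : 0 <= F by apply: sumr_ge0 => i _; exact: sqr_ge0.
have h t : 0 <= F * t ^+ 2 - P * t *+ 2 + G.
  have -> : F * t ^+ 2 - P * t *+ 2 + G = \sum_i (f i * t - g i) ^+ 2.
    rewrite /F /P /G !mulr_suml -sumrMnl -sumrB -big_split.
    by apply: eq_bigr => i _ /=; ring.
  by apply: sumr_ge0 => i _; exact: sqr_ge0.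
have [F00|Fn0] := eqVneq F 0.
  have : P = 0.
    rewrite /P big1// => i _.
    have /psumr_eq0P/(_ i isT)/eqP : \sum_i f i ^+ 2 = 0 by exact: F00.
    by rewrite sqrf_eq0 => /(_ _)/eqP ->; rewrite ?mul0r// => j _; exact: sqr_ge0.
  by move=> ->; rewrite F00 expr0n/= mul0r.
have Fp : 0 < F by rewrite lt_def Fn0.
(* The point where the quadratic polynomial is smallest. *)
have := h (P / F).
have -> : F * (P / F) ^+ 2 - P * (P / F) *+ 2 + G = G - P ^+ 2 / F by field.
by rewrite subr_ge0 ler_pdivrMr// mulrC.
Qed.

Lemma ler_norm_sqr (x y : R) : 0 <= y -> x ^+ 2 <= y ^+ 2 -> `|x| <= y.
Proof. by move=> y0 xy; rewrite -(ger0_norm y0) -!sqrtr_sqr ler_wsqrtr. Qed.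

(** The maximum point inequality for [K (t - t0) |DA|^2 - f g^2], made scale-invariant: [s] is
    [K (t - t0)], [k] is [K / g], [x] and [y] are the sizes of [DA] and [DDA], [del] is that of
    [Dg], and [gam] is the heat operator on [g]. The term [2 f del^2] is absorbed by [- 2 y^2]
    through [del * x <= y]; then [- 4 kappa x^4] beats the remaining cubic growth in [x]. *)
Lemma gradient_algebra C kappa lam : 0 <= C -> 0 < kappa -> 0 < lam ->
  exists M : R, forall (k s x y gam del f : R),
    k <= 1 -> 0 <= s <= lam -> 0 <= x -> 0 <= y -> 0 <= del ->
    f = s * x ^+ 2 -> del * x <= y -> del ^+ 2 <= C * x ^+ 2 ->
    2 * kappa * x ^+ 2 - C <= gam ->
    0 <= k * x ^+ 2 + s * (- 2 * y ^+ 2 + C * (x * ((1 + x) ^+ 2 + y)))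
         - f * (2 * gam - 2 * del ^+ 2) ->
    f <= M.
Proof.
move=> C0 kappa0 lam0.
pose C2 := C ^+ 2 + C * (C + 1) + 4 * C + 2 * C.
have C20 : 0 <= C2 by rewrite /C2; nra.
(* Chosen for the Young inequality [C2 * x <= kappa * x ^+ 2 + B]. *)
pose B := C2 ^+ 2 / kappa.
have B0 : 0 <= B by rewrite divr_ge0 ?sqr_ge0// ltW.
exists (lam + (1 + lam * B) / kappa) => k s x y gam del f k1 /andP[s0 sl] x0 y0 d0 fE dxy dC gamC H.
have M0 : 0 <= (1 + lam * B) / kappa by rewrite divr_ge0 ?(ltW kappa0)// addr_ge0// mulr_ge0// ltW.
have [x1|/ltW x1] := leP x 1.
  rewrite fE; have : s * x ^+ 2 <= s * 1 by rewrite ler_wpM2l// expr2; nra.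
  by move: M0 sl; lra.
have dx : del <= (C + 1) * x.
  rewrite leNgt; apply/negP => h.
  have : ((C + 1) * x) ^+ 2 < del ^+ 2 by rewrite ltr_pXn2r// nnegrE mulr_ge0// addr_ge0.
  rewrite exprMn; have : 0 <= x ^+ 2 by exact: sqr_ge0.
  by move: dC; set X := x ^+ 2; nra.
have h1 : - 2 * y ^+ 2 + 2 * (x ^+ 2 * del ^+ 2) + C * (x * y) <=
    C ^+ 2 * x ^+ 2 + C * ((C + 1) * x ^+ 3).
  (* In terms of this nonnegative excess, [- 2 y^2 + 2 x^2 del^2] is [- 4 t del x - 2 t^2], with no
     positive term left. *)
  set t := y - del * x.
  have t0 : 0 <= t by rewrite subr_ge0.
  have -> : y = del * x + t by rewrite /t; ring.
  have e1 : C * (x * (del * x)) <= C * ((C + 1) * x ^+ 3).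
    rewrite ler_wpM2l// mulrCA; have -> : (C + 1) * x ^+ 3 = ((C + 1) * x) * (x * x) by ring.
    by rewrite ler_wpM2r// mulr_ge0.
  have e2 : C * (x * t) <= C ^+ 2 * x ^+ 2 + t ^+ 2.
    have : 0 <= (C * x - t) ^+ 2 by exact: sqr_ge0.
    have : 0 <= C * (x * t) by rewrite !mulr_ge0.
    nra.
  have e3 : 0 <= t * (del * x) by rewrite !mulr_ge0.
  have e4 : 0 <= t ^+ 2 by exact: sqr_ge0.
  have -> : - 2 * (del * x + t) ^+ 2 + 2 * (x ^+ 2 * del ^+ 2) + C * (x * (del * x + t)) =
    - 4 * (t * (del * x)) - 2 * t ^+ 2 + C * (x * (del * x)) + C * (x * t) by ring.
  move: e1 e2 e3 e4; lra.
have h2 : C * (x * (1 + x) ^+ 2) <= 4 * C * x ^+ 3.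
  have -> : 4 * C * x ^+ 3 = C * (x * (4 * x ^+ 2)) by ring.
  by rewrite ler_wpM2l// ler_wpM2l//; nra.
have h3 : - 2 * (x ^+ 2 * gam) <= - 4 * kappa * x ^+ 4 + 2 * C * x ^+ 2.
  have : x ^+ 2 * (2 * kappa * x ^+ 2 - C) <= x ^+ 2 * gam by rewrite ler_wpM2l// sqr_ge0.
  have -> : x ^+ 2 * (2 * kappa * x ^+ 2 - C) = 2 * kappa * x ^+ 4 - C * x ^+ 2 by ring.
  by lra.
have h4 : C ^+ 2 * x ^+ 2 <= C ^+ 2 * x ^+ 3 /\ 2 * C * x ^+ 2 <= 2 * C * x ^+ 3.
  have : x ^+ 2 <= x ^+ 3 by rewrite [leRHS]exprS ler_peMl// sqr_ge0.
  by move=> h; split; rewrite ler_wpM2l// ?sqr_ge0// mulr_ge0.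
have H1 : 0 <= x ^+ 2 + s * (C2 * x ^+ 3 - 4 * kappa * x ^+ 4).
  apply: le_trans H _; rewrite fE.
  have -> : k * x ^+ 2 + s * (- 2 * y ^+ 2 + C * (x * ((1 + x) ^+ 2 + y)))
      - s * x ^+ 2 * (2 * gam - 2 * del ^+ 2) =
    k * x ^+ 2 + s * ((- 2 * y ^+ 2 + 2 * (x ^+ 2 * del ^+ 2) + C * (x * y))
      + C * (x * (1 + x) ^+ 2) + - 2 * (x ^+ 2 * gam)) by ring.
  apply: lerD; first by rewrite ler_piMl// sqr_ge0.
  rewrite ler_wpM2l// /C2.
  have -> : (C ^+ 2 + C * (C + 1) + 4 * C + 2 * C) * x ^+ 3 =
    C ^+ 2 * x ^+ 3 + C * ((C + 1) * x ^+ 3) + 4 * C * x ^+ 3 + 2 * C * x ^+ 3 by ring.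
  by move: h1 h2 h3 h4 => ? ? ? []; lra.
have xp : 0 < x ^+ 2 by rewrite exprn_gt0// (lt_le_trans ltr01).
have H2 : 0 <= 1 + s * (C2 * x - 4 * kappa * x ^+ 2).
  rewrite -(pmulr_rge0 _ xp).
  by have -> : x ^+ 2 * (1 + s * (C2 * x - 4 * kappa * x ^+ 2)) =
    x ^+ 2 + s * (C2 * x ^+ 3 - 4 * kappa * x ^+ 4) by ring.
have h5 : C2 * x <= kappa * x ^+ 2 + B.
  have : 0 <= (kappa * x - C2) ^+ 2 / kappa by rewrite divr_ge0 ?sqr_ge0// ltW.
  have -> : (kappa * x - C2) ^+ 2 / kappa = kappa * x ^+ 2 - 2 * (C2 * x) + B.
    by rewrite /B; field; exact: lt0r_neq0.
  by have c2x : 0 <= C2 * x := mulr_ge0 C20 x0; lra.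
have h6 : s * (kappa * x ^+ 2) <= 1 + lam * B.
  have h7 : s * (C2 * x - 4 * kappa * x ^+ 2) <= s * (B - kappa * x ^+ 2).
    rewrite ler_wpM2l//; have : 0 <= kappa * x ^+ 2 by rewrite mulr_ge0// ltW.
    by move: h5; lra.
  have : s * B <= lam * B by rewrite ler_wpM2r.
  by move: H2 h7; rewrite !mulrBr; lra.
rewrite fE; apply: (@le_trans _ _ ((1 + lam * B) / kappa)).
  by rewrite ler_pdivlMr//; have -> : s * x ^+ 2 * kappa = s * (kappa * x ^+ 2) by ring.
by rewrite lerDr ltW.
Qed.

(** The function [N |DA|^2 g] contributes [- 2 N y^2], which for large [N] beats every other term
    quadratic in [y], since [x] is already bounded. Here [chi] is the scaled inner product of the
    gradients of [|DA|^2] and [g]. *)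
Lemma hessian_algebra C lam M0 : 0 <= C -> 0 < lam -> 0 <= M0 ->
  exists2 N : R, 0 <= N & exists M : R, forall (k s x y z gam del chi F : R),
    k <= 1 -> 0 <= s <= lam -> 0 <= x -> 0 <= y -> 0 <= z -> 0 <= del ->
    x ^+ 2 <= M0 -> F = s * y ^+ 2 + N * x ^+ 2 ->
    del ^+ 2 <= C * x ^+ 2 -> `|gam| <= C * (1 + x ^+ 2) -> `|chi| <= 2 * (x * y * del) ->
    0 <= k * y ^+ 2
         + s * (- 2 * z ^+ 2 + C * (y * ((1 + x) ^+ 3 + (1 + x) * y + z)))
         + N * (- 2 * y ^+ 2 + C * (x * ((1 + x) ^+ 2 + y)) + x ^+ 2 * gam - 2 * chi)
         - F * (3 * gam - 6 * del ^+ 2) ->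
    F <= M.
Proof.
move=> C0 lam0 M00.
(* From [x ^+ 2 <= M0] follows [x <= m0], and likewise [del <= G + 1], without square roots. *)
pose m0 := M0 + 1; pose G := C * (1 + M0).
have m00 : 0 <= m0 by rewrite addr_ge0.
have G0 : 0 <= G by rewrite mulr_ge0// addr_ge0.
pose a1 := (1 + m0) ^+ 3; pose a2 := 1 + m0; pose a3 := (1 + m0) ^+ 2.
have a20 : 0 <= a2 by rewrite addr_ge0.
have a10 : 0 <= a1 by rewrite exprn_ge0.
have a30 : 0 <= a3 by rewrite exprn_ge0.
(* The coefficients of [y ^+ 2] outside the factor [N]. With [N = B0 + 1] exactly [- y ^+ 2] is left
   over, which bounds [y ^+ 2] by [Y]. *)
pose B0 := 1 + lam * (C ^+ 2 + C * a1 + C * a2) + lam * (9 * G).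
have B00 : 0 <= B0.
  have p1 : 0 <= lam * (C ^+ 2 + C * a1 + C * a2) := mulr_ge0 (ltW lam0)
    (addr_ge0 (addr_ge0 (sqr_ge0 C) (mulr_ge0 C0 a10)) (mulr_ge0 C0 a20)).
  have p2 : 0 <= lam * (9 * G).
    by apply: mulr_ge0; [exact: ltW|apply: mulr_ge0 => //; rewrite ler0n].
  by rewrite /B0; lra.
pose N := B0 + 1.
have N0 : 0 <= N by rewrite addr_ge0.
pose E := C * m0 + 4 * (m0 * (G + 1)).
pose E' := C * (m0 * a3) + M0 * G + M0 * (9 * G).
pose Y := lam * (C * a1) + N * (E ^+ 2 + E').
exists N => //; exists (lam * Y + N * M0) => k s x y z gam del chi F k1 /andP[s0 sl] x0 y0 z0 d0 xM FE.
move=> dC gC chiC H.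
have xm : x <= m0 by rewrite /m0; have : 0 <= (x - 1) ^+ 2 by [exact: sqr_ge0]; nra.
have gG : `|gam| <= G by rewrite (le_trans gC)// ler_wpM2l// lerD2l.
have dG : del ^+ 2 <= G by rewrite (le_trans dC)// ler_wpM2l// (le_trans xM)// lerDr.
have d1 : del <= G + 1 by have : 0 <= (del - 1) ^+ 2 by [exact: sqr_ge0]; move: dG; nra.
have y20 : 0 <= y ^+ 2 by exact: sqr_ge0.
have x20 : 0 <= x ^+ 2 by exact: sqr_ge0.
have F0 : 0 <= F by rewrite FE addr_ge0 ?mulr_ge0.
have t1 : k * y ^+ 2 <= y ^+ 2 by rewrite ler_piMl.
have y1 : y <= 1 + y ^+ 2 by have : 0 <= (y - 1) ^+ 2 by [exact: sqr_ge0]; nra.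
have t2 : s * (- 2 * z ^+ 2 + C * (y * ((1 + x) ^+ 3 + (1 + x) * y + z))) <=
    lam * (C ^+ 2 + C * a1 + C * a2) * y ^+ 2 + lam * (C * a1).
  have e1 : - 2 * z ^+ 2 + C * (y * z) <= C ^+ 2 * y ^+ 2.
    have : 0 <= (C * y - z) ^+ 2 by exact: sqr_ge0.
    have : 0 <= C * (y * z) by rewrite !mulr_ge0.
    have : 0 <= z ^+ 2 by exact: sqr_ge0.
    nra.
  have e2 : C * (y * (1 + x) ^+ 3) <= C * a1 * y ^+ 2 + C * a1.
    have -> : C * a1 * y ^+ 2 + C * a1 = C * ((1 + y ^+ 2) * a1) by ring.
    by rewrite ler_wpM2l// ler_pM ?exprn_ge0 ?addr_ge0// lerXn2r ?nnegrE ?addr_ge0// lerD2l.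
  have e3 : C * (y * ((1 + x) * y)) <= C * a2 * y ^+ 2.
    have -> : C * (y * ((1 + x) * y)) = C * (1 + x) * y ^+ 2 by ring.
    by rewrite ler_wpM2r// ler_wpM2l// lerD2l.
  have e4 : - 2 * z ^+ 2 + C * (y * ((1 + x) ^+ 3 + (1 + x) * y + z)) <=
      (C ^+ 2 + C * a1 + C * a2) * y ^+ 2 + C * a1.
    have -> : - 2 * z ^+ 2 + C * (y * ((1 + x) ^+ 3 + (1 + x) * y + z)) =
     (- 2 * z ^+ 2 + C * (y * z)) + C * (y * (1 + x) ^+ 3) + C * (y * ((1 + x) * y)) by ring.
    by move: e1 e2 e3; lra.
  have -> : lam * (C ^+ 2 + C * a1 + C * a2) * y ^+ 2 + lam * (C * a1) =
    lam * ((C ^+ 2 + C * a1 + C * a2) * y ^+ 2 + C * a1) by ring.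
  apply: (le_trans (ler_wpM2l s0 e4)); rewrite ler_wpM2r//.
  by rewrite addr_ge0 ?mulr_ge0// !addr_ge0 ?mulr_ge0 ?sqr_ge0.
have t3 : - 2 * y ^+ 2 + C * (x * ((1 + x) ^+ 2 + y)) + x ^+ 2 * gam - 2 * chi <=
    - y ^+ 2 + E ^+ 2 + (C * (m0 * a3) + M0 * G).
  have e1 : C * (x * (1 + x) ^+ 2) <= C * (m0 * a3).
    by rewrite ler_wpM2l// ler_pM ?exprn_ge0 ?addr_ge0// lerXn2r ?nnegrE ?addr_ge0// lerD2l.
  have e2 : C * (x * y) <= C * m0 * y by rewrite mulrA ler_wpM2r// ler_wpM2l.
  have e3 : x ^+ 2 * gam <= M0 * G.
    by rewrite (le_trans (ler_norm _))// normrM ger0_norm// ler_pM.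
  have e4 : - 2 * chi <= 4 * (m0 * (G + 1)) * y.
    have : - chi <= 2 * (x * y * del) by rewrite (le_trans _ chiC)// -normrN ler_norm.
    have : x * y * del <= m0 * (G + 1) * y.
      have -> : x * y * del = x * del * y by ring.
      by rewrite ler_wpM2r// ler_pM.
    lra.
  have e5 : E * y <= y ^+ 2 + E ^+ 2.
    have : 0 <= (y - E) ^+ 2 by exact: sqr_ge0.
    have : 0 <= y ^+ 2 by [].
    have : 0 <= E ^+ 2 by exact: sqr_ge0.
    nra.
  have -> : - 2 * y ^+ 2 + C * (x * ((1 + x) ^+ 2 + y)) + x ^+ 2 * gam - 2 * chi =
    - 2 * y ^+ 2 + C * (x * (1 + x) ^+ 2) + C * (x * y) + x ^+ 2 * gam + - 2 * chi by ring.
  move: e5; rewrite {1}/E mulrDl; move: e1 e2 e3 e4; lra.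
have t4 : - F * (3 * gam - 6 * del ^+ 2) <= lam * (9 * G) * y ^+ 2 + N * (M0 * (9 * G)).
  have e1 : - (3 * gam - 6 * del ^+ 2) <= 9 * G.
    by move: gG; rewrite ler_norml => /andP[]; move: dG; lra.
  have e2 : F <= lam * y ^+ 2 + N * M0 by rewrite FE lerD// ?ler_wpM2r// ler_wpM2l.
  have G9 : 0 <= 9 * G by rewrite mulr_ge0.
  have -> : lam * (9 * G) * y ^+ 2 + N * (M0 * (9 * G)) = (lam * y ^+ 2 + N * M0) * (9 * G).
    by ring.
  rewrite mulNr -mulrN; apply: (@le_trans _ _ (F * (9 * G))); first by rewrite ler_wpM2l.
  by rewrite ler_wpM2r.
have yY : y ^+ 2 <= Y.
  have t3' := ler_wpM2l N0 t3.
  have : 0 <= B0 * y ^+ 2 + lam * (C * a1)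
      + N * (- y ^+ 2 + E ^+ 2 + (C * (m0 * a3) + M0 * G)) + N * (M0 * (9 * G)).
    apply: (le_trans H); move: t1 t2 t3' t4.
    have -> : B0 * y ^+ 2 = y ^+ 2 + lam * (C ^+ 2 + C * a1 + C * a2) * y ^+ 2
      + lam * (9 * G) * y ^+ 2 by rewrite /B0; ring.
    rewrite mulNr; lra.
  have -> : B0 * y ^+ 2 + lam * (C * a1)
      + N * (- y ^+ 2 + E ^+ 2 + (C * (m0 * a3) + M0 * G)) + N * (M0 * (9 * G)) = Y - y ^+ 2.
    by rewrite /Y /E' {1}/N; have -> : N = B0 + 1 by []; ring.
  by rewrite subr_ge0.
by rewrite FE lerD// ?ler_wpM2l// ler_pM.
Qed.

End RealInequalities.

(** * Jets of the curvature and their evolution at a point *)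

Section Jets.
Variables (S : comPzRingType) (n m : nat) (D : 'I_m -> S -> S) (T : S -> S).
Variables (r : S) (nu xi : 'I_m -> S).
Hypothesis se : structure_equations n D T r nu xi.

Definition sqnorm (I : finType) (F : I -> S) : S := \sum_i F i ^+ 2.

(** The new index is prepended to the index type, so that jets of every order are families over
    finite types and share the lemmas on [sqnorm]. *)
Definition djet (I : finType) (F : I -> S) (q : 'I_m * I) : S := D q.1 (F q.2).

Definition curv_jet (q : 'I_m * 'I_m) : S := curv D nu q.1 q.2.

Lemma sqnorm_djet (I : finType) (F : I -> S) :
  sqnorm (djet F) = \sum_i grad2 D (F i) (F i).
Proof.
rewrite /sqnorm -(pair_bigA _ (fun k i => djet F (k, i) ^+ 2)) exchange_big.
by apply: eq_bigr => i _ /=; apply: eq_bigr => k _; rewrite expr2.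
Qed.

Lemma heat_sqnorm (I : finType) (F : I -> S) :
  heat D T (sqnorm F) = (\sum_i F i * heat D T (F i)) *+ 2 - sqnorm (djet F) *+ 2.
Proof.
rewrite /sqnorm (heat_sum se) -/(sqnorm (djet F)) sqnorm_djet -!sumrMnl -sumrB.
by apply: eq_bigr => i _; rewrite (heat_sqr se).
Qed.

Lemma curv2_sqnorm : curv2 D nu = sqnorm curv_jet.
Proof. by rewrite /sqnorm -(pair_bigA _ (fun a b => curv_jet (a, b) ^+ 2)). Qed.

Lemma jet2_sqnorm : jet2 D nu = sqnorm (djet curv_jet).
Proof.
rewrite /sqnorm -(pair_bigA _ (fun e q => djet curv_jet (e, q) ^+ 2)).
by apply: eq_bigr => e _; rewrite -(pair_bigA _ (fun a b => djet curv_jet (e, (a, b)) ^+ 2)).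
Qed.

Variables (R : rcfType) (ev : {rmorphism S -> R}).

Lemma ev_sqnorm (I : finType) (F : I -> S) : ev (sqnorm F) = \sum_i ev (F i) ^+ 2.
Proof. by rewrite rmorph_sum; apply: eq_bigr => i _; rewrite rmorphXn. Qed.

Lemma ev_sqnorm_ge0 (I : finType) (F : I -> S) : 0 <= ev (sqnorm F).
Proof. by rewrite ev_sqnorm; apply: sumr_ge0 => i _; exact: sqr_ge0. Qed.

Lemma ev_le_sqnorm (I : finType) (F : I -> S) i :
  `|ev (F i)| <= Num.sqrt (ev (sqnorm F)).
Proof.
rewrite -sqrtr_sqr ler_wsqrtr// ev_sqnorm (bigD1 i)//= lerDl.
by apply: sumr_ge0 => j _; exact: sqr_ge0.
Qed.

Lemma ev_grad2 f g : ev (grad2 D f g) = \sum_k ev (D k f) * ev (D k g).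
Proof. by rewrite rmorph_sum; apply: eq_bigr => k _; rewrite rmorphM. Qed.

Lemma ev_grad2_ge0 f : 0 <= ev (grad2 D f f).
Proof.
by rewrite rmorph_sum; apply: sumr_ge0 => e _; rewrite rmorphM -expr2; exact: sqr_ge0.
Qed.

Lemma ev_grad2_cauchy f g : ev (grad2 D f g) ^+ 2 <= ev (grad2 D f f) * ev (grad2 D g g).
Proof.
rewrite !ev_grad2; apply: le_trans (cauchy_schwarz _ _) _.
by rewrite le_eqVlt; apply/orP; left; apply/eqP; congr (_ * _);
  apply: eq_bigr => k _; rewrite expr2.
Qed.

Lemma ev_grad2_sqnorm (I : finType) (F : I -> S) :
  ev (grad2 D (sqnorm F) (sqnorm F)) <= 4 * (ev (sqnorm F) * ev (sqnorm (djet F))).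
Proof.
have e k : D k (sqnorm F) = (\sum_i F i * D k (F i)) *+ 2.
  rewrite (der_sum (seD se k)) -sumrMnl; apply: eq_bigr => i _.
  by rewrite (derX2 (seD se k)).
have -> : 4 * (ev (sqnorm F) * ev (sqnorm (djet F))) =
    \sum_k 4 * (ev (sqnorm F) * \sum_i ev (D k (F i)) ^+ 2).
  rewrite -!mulr_sumr; congr (_ * (_ * _)).
  by rewrite [in LHS]ev_sqnorm -(pair_bigA _ (fun k i => ev (djet F (k, i)) ^+ 2)).
rewrite rmorph_sum; apply: ler_sum => k _; rewrite rmorphM e rmorphMn rmorph_sum.
have -> : \sum_i ev (F i * D k (F i)) = \sum_i ev (F i) * ev (D k (F i)).
  by apply: eq_bigr => i _; rewrite rmorphM.
have := cauchy_schwarz (fun i => ev (F i)) (fun i => ev (D k (F i))).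
rewrite -ev_sqnorm; set P := \sum_i _ * _ => h.
have -> : P *+ 2 * (P *+ 2) = 4 * P ^+ 2 by ring.
by rewrite ler_wpM2l.
Qed.

Local Notation q := (ev (curv2 D nu)).
Local Notation h := (ev (meanc D nu)).
Local Notation u := (ev (jet2 D nu)).

Lemma curv2_ge0 : 0 <= q. Proof. by rewrite curv2_sqnorm ev_sqnorm_ge0. Qed.
Lemma trace_sq_le (F : 'I_m * 'I_m -> S) :
  ev (\sum_a F (a, a)) ^+ 2 <= m%:R * ev (sqnorm F).
Proof.
have := cauchy_schwarz (fun a : 'I_m => 1) (fun a => ev (F (a, a))).
move=> /=; under eq_bigr do rewrite mul1r.
under [X in X * _]eq_bigr do rewrite expr1n.
rewrite sumr_const card_ord rmorph_sum => h'; apply: le_trans h' _.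
have -> : ev (sqnorm F) = \sum_a \sum_b ev (F (a, b)) ^+ 2.
  by rewrite ev_sqnorm pair_bigA; apply: eq_bigr => -[].
rewrite ler_wpM2l//.
apply: ler_sum => a _; rewrite (bigD1 a)//= lerDl.
by apply: sumr_ge0 => b _; exact: sqr_ge0.
Qed.

Lemma grad_meanc_le : ev (grad2 D (meanc D nu) (meanc D nu)) <= m%:R * u.
Proof.
have -> : u = \sum_k ev (sqnorm (fun q => D k (curv_jet q))).
  rewrite jet2_sqnorm ev_sqnorm -(pair_bigA _ (fun k i => ev (djet curv_jet (k, i)) ^+ 2)).
  by apply: eq_bigr => k _; rewrite ev_sqnorm.
rewrite mulr_sumr rmorph_sum; apply: ler_sum => k _; rewrite rmorphM -expr2.
rewrite /meanc (der_sum (seD se k)).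
exact: trace_sq_le (fun q => D k (curv_jet q)).
Qed.

Lemma trace4_ge0 : 0 <= ev (trace4 D nu).
Proof.
rewrite rmorph_sum; apply: sumr_ge0 => a _; rewrite rmorph_sum; apply: sumr_ge0 => b _.
by rewrite rmorphXn; exact: sqr_ge0.
Qed.

Lemma trace4_le : ev (trace4 D nu) <= q ^+ 2.
Proof.
pose al a := \sum_d ev (curv D nu a d) ^+ 2.
have -> : q = \sum_a al a.
  rewrite rmorph_sum; apply: eq_bigr => a _; rewrite rmorph_sum; apply: eq_bigr => d _.
  by rewrite rmorphXn.
rewrite expr2 mulr_suml rmorph_sum; apply: ler_sum => a _.
rewrite mulr_sumr rmorph_sum; apply: ler_sum => b _; rewrite rmorphXn rmorph_sum.
apply: le_trans _ (cauchy_schwarz _ _).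
by rewrite le_eqVlt; apply/orP; left; apply/eqP; congr (_ ^+ 2);
  apply: eq_bigr => d _; rewrite rmorphM.
Qed.

Lemma codazzi2_ge0 : 0 <= ev (codazzi2 D r nu xi).
Proof.
rewrite rmorph_sum; apply: sumr_ge0 => e _; rewrite rmorph_sum; apply: sumr_ge0 => a _.
by rewrite rmorph_sum; apply: sumr_ge0 => b _; rewrite rmorphXn; exact: sqr_ge0.
Qed.

(** [codazzi_kato] exhibits [n + 2] times the difference of the two sides as a sum of squares. *)
Lemma kato : 3 * ev (grad2 D (meanc D nu) (meanc D nu)) <=
  (n%:R + 2) * ev (codazzi2 D r nu xi).
Proof.
have n20 : 0 < n%:R + 2 :> R by rewrite ltr_wpDl.
have : 0 <= ev ((n%:R + 2%:R) ^+ 2 * codazzi2 D r nu xi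
    - 3%:R * (n%:R + 2%:R) * \sum_e D e (meanc D nu) ^+ 2).
  rewrite -(codazzi_kato se) rmorph_sum; apply: sumr_ge0 => e _.
  rewrite rmorph_sum; apply: sumr_ge0 => a _.
  by rewrite rmorph_sum; apply: sumr_ge0 => b _; rewrite rmorphXn; exact: sqr_ge0.
have -> : \sum_e D e (meanc D nu) ^+ 2 = grad2 D (meanc D nu) (meanc D nu).
  by apply: eq_bigr => e _; rewrite expr2.
rewrite !(rmorph_nat, rmorphB, rmorphD, rmorphXn, rmorphM).
have -> : (n%:R + 2) ^+ 2 * ev (codazzi2 D r nu xi)
   - 3 * (n%:R + 2) * ev (grad2 D (meanc D nu) (meanc D nu)) =
  (n%:R + 2) * ((n%:R + 2) * ev (codazzi2 D r nu xi)
     - 3 * ev (grad2 D (meanc D nu) (meanc D nu))) by ring.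
by rewrite pmulr_rge0// subr_ge0.
Qed.

Local Notation K := (ev r ^+ 2).

Lemma ev_codazzi2 : ev (codazzi2 D r nu xi) = u - ev (trace4 D nu) *+ 2 - K * q *+ 2.
Proof. by rewrite (codazzi2E se) !(rmorphB, rmorphMn, rmorphXn, rmorphM). Qed.

Lemma ev_heat_meanc2 : ev (heat D T (meanc D nu ^+ 2)) =
  2 * (q + n%:R * K) * h ^+ 2 - 2 * ev (grad2 D (meanc D nu) (meanc D nu)).
Proof.
rewrite (heat_sqr se) (heat_meanc se) !(rmorph_nat, rmorphB, rmorphD, rmorphMn, rmorphXn, rmorphM).
ring.
Qed.

Lemma ev_heat_curv2 : ev (heat D T (curv2 D nu)) =
  2 * q ^+ 2 + 4 * K * h ^+ 2 - 2 * n%:R * K * q - 2 * ev (codazzi2 D r nu xi).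
Proof.
rewrite (heat_curv2 se) !(rmorph_nat, rmorphB, rmorphD, rmorphMn, rmorphXn, rmorphM); ring.
Qed.

Lemma grad_curv2_le : ev (grad2 D (curv2 D nu) (curv2 D nu)) <= 4 * (q * u).
Proof. by rewrite jet2_sqnorm curv2_sqnorm; exact: ev_grad2_sqnorm. Qed.

Variables (c d : S).
Hypothesis Dc : forall a, D a c = 0.
Hypothesis Dd : forall a, D a d = 0.
Hypothesis Tc : T c = 0.
Hypothesis Td : T d = 0.

(** With the constants [c] and [b + 1] this is the function [g] of the derivative estimates; with
    [a] and [b] it is minus the defect of the pinching inequality. *)
Definition pinching : S := c * meanc D nu ^+ 2 - curv2 D nu + d * r ^+ 2.

Lemma ev_heat_pinching : ev (heat D T pinching) =
  ev c * (2 * (q + n%:R * K) * h ^+ 2 - 2 * ev (grad2 D (meanc D nu) (meanc D nu)))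
  - (2 * q ^+ 2 + 4 * K * h ^+ 2 - 2 * n%:R * K * q - 2 * ev (codazzi2 D r nu xi)).
Proof.
have hc : heat D T c = 0 by exact: (heat_const se).
have gc f : grad2 D c f = 0 by rewrite /grad2 big1// => e _; rewrite Dc mul0r.
have hdr : heat D T (d * r ^+ 2) = 0.
  apply: (heat_const se) => [a|].
    by rewrite (derM (seD se a)) Dd (derX2 (seD se a)) (seDr se); ring.
  by rewrite (derM (seT se)) Td (derX2 (seT se)) (seTr se); ring.
rewrite /pinching !(heatD se) (heatN se) hdr addr0 (heatM se) hc gc mulr0 mul0rn subr0 addr0.
by rewrite rmorphB rmorphM ev_heat_meanc2 ev_heat_curv2.
Qed.

Lemma grad_pinching_le : ev (grad2 D pinching pinching) <=
  8 * (ev c ^+ 2 * h ^+ 2 * m%:R + q) * u.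
Proof.
have e k : ev (D k pinching) = 2 * ev c * h * ev (D k (meanc D nu)) - ev (D k (curv2 D nu)).
  rewrite /pinching (derD (seD se k)) (derB (seD se k)) (derM (seD se k) c) (derM (seD se k) d) !(derX2 (seD se k)).
  rewrite Dc Dd (seDr se) !(mul0r, mulr0, mul0rn, addr0, add0r).
  by rewrite rmorphB rmorphM rmorphMn rmorphM; ring.
have le1 : ev (grad2 D pinching pinching) <=
    8 * ev c ^+ 2 * h ^+ 2 * ev (grad2 D (meanc D nu) (meanc D nu))
    + 2 * ev (grad2 D (curv2 D nu) (curv2 D nu)).
  rewrite !ev_grad2 !mulr_sumr -big_split; apply: ler_sum => k _ /=.
  rewrite !e; set x := ev (D k (meanc D nu)); set y := ev (D k (curv2 D nu)).
  (* With [u = 2 c h x], the identity [(u - y)^2 + (u + y)^2 = 2 u^2 + 2 y^2] bounds the first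
     square. *)
  have : 0 <= (2 * ev c * h * x + y) ^+ 2 by exact: sqr_ge0.
  set C := ev c; set h' := h => h2.
  rewrite -subr_ge0; apply: (le_trans h2); rewrite le_eqVlt; apply/orP; left; apply/eqP; ring.
apply: (le_trans le1).
have a1 : 8 * ev c ^+ 2 * h ^+ 2 * ev (grad2 D (meanc D nu) (meanc D nu)) <=
   8 * ev c ^+ 2 * h ^+ 2 * (m%:R * u).
  apply: ler_wpM2l; last exact: grad_meanc_le.
  by apply: mulr_ge0; [apply: mulr_ge0; [exact: ler0n|]|]; exact: sqr_ge0.
have := grad_curv2_le; move: a1; nra.
Qed.

End Jets.

(** What a contact argument sees of a flow: a ring with the structure equations, an evaluation, the
    constants, and a function [pst] that is time up to a constant. Quantifying over this record
    makes the contact constants independent of the flow. *)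
Record point_solution (R : rcfType) (n m : nat) := PointSolution {
  psS : comPzRingType;
  psD : 'I_m -> psS -> psS;
  psT : psS -> psS;
  psr : psS;
  psnu : 'I_m -> psS;
  psxi : 'I_m -> psS;
  ps_se : structure_equations n psD psT psr psnu psxi;
  psev : {rmorphism psS -> R};
  pscst : R -> psS;
  ps_Dcst : forall a k, psD a (pscst k) = 0;
  ps_Tcst : forall k, psT (pscst k) = 0;
  ps_evcst : forall k, psev (pscst k) = k;
  pst : psS;
  ps_Dt : forall a, psD a pst = 0;
  ps_Tt : psT pst = 1
}.

Section ContactEstimates.
Variables (R : rcfType) (n m : nat) (a b c : R).
Hypothesis a_ge0 : 0 <= a.
Hypothesis a_lt_c : a < c.
Hypothesis b_ge0 : 0 <= b.
Hypothesis c_kato : c * (n%:R + 2) < 3.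
Local Notation pt := (point_solution R n m).
Implicit Types (p : pt).

Definition psK p := psev p (psr p) ^+ 2.
Definition psA p := curv_jet (@psD _ _ _ p) (@psnu _ _ _ p).
Definition psH p := meanc (@psD _ _ _ p) (@psnu _ _ _ p).
Definition psA2 p := curv2 (@psD _ _ _ p) (@psnu _ _ _ p).
Definition psjet2 p := sqnorm (djet (@psD _ _ _ p) (psA p)).
Definition psjet3 p := sqnorm (djet (@psD _ _ _ p) (djet (@psD _ _ _ p) (psA p))).
Definition psjet4 p :=
  sqnorm (djet (@psD _ _ _ p) (djet (@psD _ _ _ p) (djet (@psD _ _ _ p) (psA p)))).
Definition psg p := pinching (@psD _ _ _ p) (psr p) (psnu p) (pscst p c) (pscst p (b + 1)).
Definition psheat p := heat (@psD _ _ _ p) (@psT _ _ _ p).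
Definition psgrad2 p := grad2 (@psD _ _ _ p).
Definition pscodazzi p := codazzi (@psD _ _ _ p) (psr p) (psnu p) (psxi p).

Definition pinched p := 0 < psK p /\
  psev p (psA2 p) <= a * psev p (psH p) ^+ 2 + b * psK p.

Local Notation K p := (psK p).
Local Notation G p := (psev p (psg p)).
Local Notation q p := (psev p (psA2 p)).
Local Notation h p := (psev p (psH p)).
Local Notation u p := (psev p (psjet2 p)).
Local Notation v p := (psev p (psjet3 p)).
Local Notation w p := (psev p (psjet4 p)).

Let ca_gt0 : 0 < c - a. Proof. by rewrite subr_gt0. Qed.
Let c_ge0 : 0 <= c. Proof. exact: le_trans a_ge0 (ltW a_lt_c). Qed.

(** The terms after 1 come from [|A|^2 <= a H^2 + b K], [(c - a) H^2 <= g] and [K <= g]. The summand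
    1 ensures [sqrt c0 <= c0] and [sqrt K <= c0 * sqrt g]. *)
Definition c0 : R := 1 + a / (c - a) + b.
(** The share of [|nabla A|^2] left in the evolution of [g] once [c |DH|^2] has been estimated by
    [kato]. *)
Definition kappa : R := 1 - c * (n%:R + 2) / 3.

Lemma kappa_gt0 : 0 < kappa.
Proof. by rewrite /kappa subr_gt0 ltr_pdivrMr ?mul1r// ltr0n. Qed.

Lemma c0_ge1 : 1 <= c0.
Proof. by rewrite /c0 -addrA lerDl addr_ge0// divr_ge0// ltW. Qed.
Let c0_ge0 : 0 <= c0. Proof. exact: le_trans ler01 c0_ge1. Qed.

Lemma psgE p : G p = c * h p ^+ 2 - q p + (b + 1) * K p.
Proof. by rewrite /psg /pinching !(rmorphD, rmorphN, rmorphXn, rmorphM, ps_evcst). Qed.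

Lemma psg_ge p : pinched p -> (c - a) * h p ^+ 2 + K p <= G p.
Proof. by move=> [_ pp]; rewrite psgE; move: pp; lra. Qed.

Lemma psg_gt0 p : pinched p -> 0 < G p.
Proof.
move=> pp; apply: lt_le_trans (psg_ge pp); rewrite ltr_wpDl//; last by have [] := pp.
by rewrite mulr_ge0 ?sqr_ge0// ltW.
Qed.

Lemma psK_le p : pinched p -> K p <= G p.
Proof.
move=> pp; apply: le_trans (psg_ge pp); rewrite lerDr.
by rewrite mulr_ge0 ?sqr_ge0// ltW.
Qed.

Lemma psH_le p : pinched p -> h p ^+ 2 <= (c - a)^-1 * G p.
Proof.
move=> pp; rewrite mulrC ler_pdivlMr// mulrC; apply: le_trans (psg_ge pp).
by rewrite lerDl; have [/ltW] := pp.
Qed.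

Lemma psA2_le p : pinched p -> q p <= c0 * G p.
Proof.
move=> pp; have [K0 pq] := pp; apply: (le_trans pq).
have h1 : a * h p ^+ 2 <= a * ((c - a)^-1 * G p) by rewrite ler_wpM2l// psH_le.
have h2 : b * K p <= b * G p by rewrite ler_wpM2l// psK_le.
have := psg_gt0 pp; move: h1 h2; rewrite /c0; set e := (c - a)^-1.
by rewrite !mulrDl mul1r mulrA; lra.
Qed.

Lemma psA2_ge0 p : 0 <= q p. Proof. exact: curv2_ge0. Qed.
Lemma psjet2_ge0 p : 0 <= u p. Proof. exact: ev_sqnorm_ge0. Qed.
Lemma psjet3_ge0 p : 0 <= v p. Proof. exact: ev_sqnorm_ge0. Qed.
Lemma psjet4_ge0 p : 0 <= w p. Proof. exact: ev_sqnorm_ge0. Qed.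

(** The curvature scale is [sqrt g]; below, the sizes of [DA], [DDA], [DDDA] and [Dg] are divided by
    the powers of it that make them scale-invariant. *)
Definition psrho p := Num.sqrt (G p).
Definition psx p := Num.sqrt (u p) / psrho p ^+ 2.
Definition psy p := Num.sqrt (v p) / psrho p ^+ 3.
Definition psz p := Num.sqrt (w p) / psrho p ^+ 4.
Definition psdel p := Num.sqrt (psev p (psgrad2 (psg p) (psg p))) / psrho p ^+ 3.

Lemma psrho_gt0 p : pinched p -> 0 < psrho p.
Proof. by move=> pp; rewrite sqrtr_gt0 psg_gt0. Qed.

Lemma psrho2 p : pinched p -> psrho p ^+ 2 = G p.
Proof. by move=> pp; rewrite sqr_sqrtr// ltW// psg_gt0. Qed.

Lemma psx_ge0 p : pinched p -> 0 <= psx p.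
Proof. by move=> pp; rewrite divr_ge0 ?sqrtr_ge0// exprn_ge0// sqrtr_ge0. Qed.
Lemma psy_ge0 p : pinched p -> 0 <= psy p.
Proof. by move=> pp; rewrite divr_ge0 ?sqrtr_ge0// exprn_ge0// sqrtr_ge0. Qed.
Lemma psz_ge0 p : pinched p -> 0 <= psz p.
Proof. by move=> pp; rewrite divr_ge0 ?sqrtr_ge0// exprn_ge0// sqrtr_ge0. Qed.
Lemma psdel_ge0 p : pinched p -> 0 <= psdel p.
Proof. by move=> pp; rewrite divr_ge0 ?sqrtr_ge0// exprn_ge0// sqrtr_ge0. Qed.

Lemma scaledK p k t : pinched p -> psrho p ^+ k * (t / psrho p ^+ k) = t.
Proof.
by move=> pp; rewrite mulrC divfK// expf_neq0// gt_eqF// psrho_gt0.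
Qed.

Lemma psu_scale p : pinched p -> u p = psrho p ^+ 4 * psx p ^+ 2.
Proof.
move=> pp; rewrite -[LHS]sqr_sqrtr ?psjet2_ge0// -[in LHS](scaledK 2 (Num.sqrt (u p)) pp).
by rewrite -/(psx p); ring.
Qed.
Lemma psv_scale p : pinched p -> v p = psrho p ^+ 6 * psy p ^+ 2.
Proof.
move=> pp; rewrite -[LHS]sqr_sqrtr ?psjet3_ge0// -[in LHS](scaledK 3 (Num.sqrt (v p)) pp).
by rewrite -/(psy p); ring.
Qed.
Lemma psw_scale p : pinched p -> w p = psrho p ^+ 8 * psz p ^+ 2.
Proof.
move=> pp; rewrite -[LHS]sqr_sqrtr ?psjet4_ge0// -[in LHS](scaledK 4 (Num.sqrt (w p)) pp).
by rewrite -/(psz p); ring.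
Qed.
Lemma psdel_scale p : pinched p ->
  psev p (psgrad2 (psg p) (psg p)) = psrho p ^+ 6 * psdel p ^+ 2.
Proof.
move=> pp; rewrite -[LHS]sqr_sqrtr ?ev_grad2_ge0//.
rewrite -[in LHS](scaledK 3 (Num.sqrt (psev p (psgrad2 (psg p) (psg p)))) pp).
by rewrite -/(psdel p); ring.
Qed.

Lemma ps_r_le p : pinched p -> `|psev p (psr p)| <= c0 * psrho p.
Proof.
move=> pp; rewrite -sqrtr_sqr -/(psK p); apply: (@le_trans _ _ (psrho p)).
  by rewrite ler_wsqrtr// psK_le.
by rewrite ler_peMl ?c0_ge1// ltW// psrho_gt0.
Qed.

Lemma ps_A_le p e d : pinched p -> `|psev p (psD e (psnu p d))| <= c0 * psrho p.
Proof.
move=> pp; apply: le_trans (ev_le_sqnorm (psev p) (psA p) (e, d)) _.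
rewrite -curv2_sqnorm -[leRHS]ger0_norm; last by rewrite mulr_ge0// ltW// psrho_gt0.
rewrite -sqrtr_sqr ler_wsqrtr// exprMn psrho2//; apply: le_trans (psA2_le pp) _.
by rewrite ler_wpM2r ?(ltW (psg_gt0 pp))// expr2 ler_peMl// c0_ge1.
Qed.

Lemma ps_DA_le p f e d : pinched p ->
  `|psev p (psD f (psD e (psnu p d)))| <= psrho p ^+ 2 * psx p.
Proof.
move=> pp; rewrite /psx scaledK//.
exact: (ev_le_sqnorm (psev p) (djet (@psD _ _ _ p) (psA p)) (f, (e, d))).
Qed.

Lemma ps_DDA_le p k f e d : pinched p ->
  `|psev p (psD k (psD f (psD e (psnu p d))))| <= psrho p ^+ 3 * psy p.
Proof.
move=> pp; rewrite /psy scaledK//.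
exact: (ev_le_sqnorm (psev p) (djet (@psD _ _ _ p) (djet (@psD _ _ _ p) (psA p))) (k, (f, (e, d)))).
Qed.

Lemma ps_DDDA_le p l k f e d : pinched p ->
  `|psev p (psD l (psD k (psD f (psD e (psnu p d)))))| <= psrho p ^+ 4 * psz p.
Proof.
move=> pp; rewrite /psz scaledK//.
exact: (ev_le_sqnorm (psev p) (djet (@psD _ _ _ p) (djet (@psD _ _ _ p)
  (djet (@psD _ _ _ p) (psA p)))) (l, (k, (f, (e, d))))).
Qed.

Definition scaled_point p (pp : pinched p) : @flow_point R n m c0 :=
  FlowPoint (ps_se p) (psrho_gt0 pp) (psx_ge0 pp) (psy_ge0 pp) (psz_ge0 pp)
    (ps_r_le pp) (fun e d => ps_A_le e d pp) (fun f e d => ps_DA_le f e d pp)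
    (fun k f e d => ps_DDA_le k f e d pp) (fun l k f e d => ps_DDDA_le l k f e d pp).

Lemma bounded_uniform (I : finType) j i k (F : I -> forall z : @flow_point R n m c0, fpS z) :
  (forall l, bounded_order j i k (F l)) ->
  exists2 C, 0 <= C & forall l z, order_le j i k C (F l z).
Proof.
move=> h; have [C hC] := fin_all_exists h.
exists (\sum_l `|C l|); first by apply: sumr_ge0.
move=> l z; apply: order_leC (hC l z).
by rewrite (bigD1 l)//= (le_trans (ler_norm _))// lerDl sumr_ge0.
Qed.

(** The Bochner formula gives [- 2 |DDA|^2]; what remains pairs each component of [DA] with its
    image under the heat operator, controlled by [bounded_heat_Dcurv]. *)
Lemma heat_jet2_le : exists2 C, 0 <= C & forall p, pinched p ->
  psev p (psheat (psjet2 p)) <=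
  psrho p ^+ 6 * (- 2 * psy p ^+ 2 + C * (psx p * ((1 + psx p) ^+ 2 + psy p))).
Proof.
have [C C0 hC] := bounded_uniform (fun l : 'I_m * ('I_m * 'I_m) =>
  bounded_heat_Dcurv n c0_ge0 l.1 l.2.1 l.2.2).
pose N : R := #|{: 'I_m * ('I_m * 'I_m)}|%:R.
exists (N * C *+ 2); first by rewrite mulrn_wge0// mulr_ge0.
move=> p pp; have rho0 := ltW (psrho_gt0 pp).
have x0 := psx_ge0 pp; have y0 := psy_ge0 pp.
rewrite /psheat (heat_sqnorm (ps_se p)) rmorphB !rmorphMn -/(psjet3 p) psv_scale// rmorph_sum.
set W := (1 + psx p) ^+ 2 + psy p.
have : \sum_i psev p (djet (@psD _ _ _ p) (psA p) i
     * heat (@psD _ _ _ p) (@psT _ _ _ p) (djet (@psD _ _ _ p) (psA p) i)) <=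
    N * (psrho p ^+ 6 * (C * (psx p * W))).
  apply: (@le_trans _ _ (\sum_(i : 'I_m * ('I_m * 'I_m)) psrho p ^+ 6 * (C * (psx p * W)))).
    apply: ler_sum => i _; rewrite rmorphM (le_trans (ler_norm _))// normrM.
    have h1 := ps_DA_le i.1 i.2.1 i.2.2 pp.
    have h2 := order_le_ev (hC i (scaled_point pp)).
    apply: (@le_trans _ _ (psrho p ^+ 2 * psx p * (C * psrho p ^+ 4 * W))).
      by apply: ler_pM.
    by rewrite le_eqVlt; apply/orP; left; apply/eqP; ring.
  by rewrite sumr_const mulr_natl.
move: (\sum_i _) => s hs.
have -> : psrho p ^+ 6 * (- 2 * psy p ^+ 2 + N * C *+ 2 * (psx p * W)) =
  (N * (psrho p ^+ 6 * (C * (psx p * W)))) *+ 2 - (psrho p ^+ 6 * psy p ^+ 2) *+ 2 by ring.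
by rewrite lerD2r lerMn2r hs orbT.
Qed.

Lemma heat_jet3_le : exists2 C, 0 <= C & forall p, pinched p ->
  psev p (psheat (psjet3 p)) <= psrho p ^+ 8 * (- 2 * psz p ^+ 2
    + C * (psy p * ((1 + psx p) ^+ 3 + (1 + psx p) * psy p + psz p))).
Proof.
have [C C0 hC] := bounded_uniform (fun l : 'I_m * ('I_m * ('I_m * 'I_m)) =>
  bounded_heat_DDcurv n c0_ge0 l.1 l.2.1 l.2.2.1 l.2.2.2).
pose N : R := #|{: 'I_m * ('I_m * ('I_m * 'I_m))}|%:R.
exists (N * C *+ 2); first by rewrite mulrn_wge0// mulr_ge0.
move=> p pp; have rho0 := ltW (psrho_gt0 pp).
have x0 := psx_ge0 pp; have y0 := psy_ge0 pp; have z0 := psz_ge0 pp.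
rewrite /psheat (heat_sqnorm (ps_se p)) rmorphB !rmorphMn -/(psjet4 p) psw_scale// rmorph_sum.
set W := (1 + psx p) ^+ 3 + (1 + psx p) * psy p + psz p.
set F := djet _ _.
have : \sum_i psev p (F i * heat (@psD _ _ _ p) (@psT _ _ _ p) (F i)) <=
    N * (psrho p ^+ 8 * (C * (psy p * W))).
  apply: (@le_trans _ _ (\sum_(i : 'I_m * ('I_m * ('I_m * 'I_m))) psrho p ^+ 8 * (C * (psy p * W)))).
    apply: ler_sum => i _; rewrite rmorphM (le_trans (ler_norm _))// normrM.
    have h1 := ps_DDA_le i.1 i.2.1 i.2.2.1 i.2.2.2 pp.
    have h2 := order_le_ev (hC i (scaled_point pp)).
    apply: (@le_trans _ _ (psrho p ^+ 3 * psy p * (C * psrho p ^+ 5 * W))).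
      by apply: ler_pM.
    by rewrite le_eqVlt; apply/orP; left; apply/eqP; ring.
  by rewrite sumr_const mulr_natl.
move: (\sum_i _) => s hs.
have -> : psrho p ^+ 8 * (- 2 * psz p ^+ 2 + N * C *+ 2 * (psy p * W)) =
  (N * (psrho p ^+ 8 * (C * (psy p * W)))) *+ 2 - (psrho p ^+ 8 * psz p ^+ 2) *+ 2 by ring.
by rewrite lerD2r lerMn2r hs orbT.
Qed.

Lemma Dcodazzi_le : exists2 C, 0 <= C & forall p f e d k, pinched p ->
  `|psev p (psD f (pscodazzi p e d k))| <=
  C * psrho p ^+ 3 * ((1 + psx p) ^+ 2 + psy p).
Proof.
have [C C0 hC] := bounded_uniform (fun l : 'I_m * ('I_m * ('I_m * 'I_m)) =>
  bounded_D l.1 (bounded_codazzi n c0_ge0 l.2.1 l.2.2.1 l.2.2.2)).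
exists C => // p f e d k pp.
exact: order_le_ev (hC (f, (e, (d, k))) (scaled_point pp)).
Qed.

(** The gradient terms [2 |nabla A|^2 - 2 c |DH|^2] are at least [2 kappa |nabla A|^2] by [kato].
    All the others are products of two quantities among [|A|^2], [H^2] and [K], each bounded by a
    multiple of [g]. *)
Lemma heat_psg : exists2 C, 0 <= C & forall p, pinched p ->
  [/\ psrho p ^+ 4 * (2 * kappa * psx p ^+ 2 - C) <= psev p (psheat (psg p)),
      `|psev p (psheat (psg p))| <= psrho p ^+ 4 * (C * (1 + psx p ^+ 2)) &
      psdel p ^+ 2 <= C * psx p ^+ 2].
Proof.
pose e := (c - a)^-1.
have e0 : 0 <= e by rewrite invr_ge0 ltW.
have n0 : 0 <= n%:R :> R by exact: ler0n.
have m0 : 0 <= m%:R :> R by exact: ler0n.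
(* [C1] collects the losses in the lower bound, [C2] the reaction terms of the upper bound and [C3]
   the gradient bound; their sum serves for all three. *)
pose C1 := 6 * c0 ^+ 2 + 4 * c0 + 4 * e.
pose C2 := 2 * c * ((c0 + n%:R) * e) + 2 * n%:R * c0 + 2.
pose C3 := 8 * (c ^+ 2 * e * m%:R + c0).
have C10 : 0 <= C1 by rewrite /C1; have := sqr_ge0 c0; move: c0_ge0 e0; lra.
have C20 : 0 <= C2.
  have h1 : 0 <= c * ((c0 + n%:R) * e) by rewrite !mulr_ge0// addr_ge0.
  have h2 : 0 <= n%:R * c0 by rewrite mulr_ge0.
  by rewrite /C2 -!mulrA; move: h1 h2; lra.
have C30 : 0 <= C3.
  have h1 : 0 <= c ^+ 2 * e * m%:R by rewrite !mulr_ge0// sqr_ge0.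
  by rewrite /C3; move: h1 c0_ge0; lra.
exists (C1 + C2 + C3); first exact: addr_ge0 (addr_ge0 C10 C20) C30.
move=> p pp; have r0 := psrho_gt0 pp.
have u4 := psu_scale pp; have G2 := psrho2 pp; have G0 := psg_gt0 pp.
have K0 : 0 <= K p by have [/ltW] := pp.
have KG := psK_le pp; have HG := psH_le pp; have qG := psA2_le pp.
have q0 := psA2_ge0 p; have u0 := psjet2_ge0 p.
have hh0 : 0 <= h p ^+ 2 by exact: sqr_ge0.
have kp := kappa_gt0.
have kp1 : kappa <= 1.
  by rewrite /kappa lerBlDr lerDl divr_ge0 ?ler0n// mulr_ge0// addr_ge0 ?ler0n.
have heatE : psev p (psheat (psg p)) =
    c * (2 * (q p + n%:R * K p) * h p ^+ 2 - 2 * psev p (psgrad2 (psH p) (psH p)))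
  - (2 * q p ^+ 2 + 4 * K p * h p ^+ 2 - 2 * n%:R * K p * q p
     - 2 * psev p (codazzi2 (@psD _ _ _ p) (psr p) (psnu p) (psxi p))).
  by rewrite /psheat /psg (ev_heat_pinching (ps_se p))//
    ?ps_evcst ?ps_Tcst// => k; exact: ps_Dcst.
have B0 := codazzi2_ge0 (@psD _ _ _ p) (psr p) (psnu p) (psxi p) (psev p).
have kt := kato (ps_se p) (psev p).
have BE := ev_codazzi2 (ps_se p) (psev p).
have t40 := trace4_ge0 (@psD _ _ _ p) (psnu p) (psev p).
have t4q := trace4_le (@psD _ _ _ p) (psnu p) (psev p).
have g0 : 0 <= psev p (psgrad2 (psH p) (psH p)) by exact: ev_grad2_ge0.
rewrite -/(K p) -/(psA2 p) in BE t4q.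
rewrite (jet2_sqnorm (@psD _ _ _ p) (psnu p)) -/(psA p) -/(psjet2 p) in BE.
rewrite -/(psgrad2 (psH p) (psH p)) in kt.
move: heatE B0 kt BE t40 t4q g0.
set L := psev p (psheat _); set B := psev p (codazzi2 _ _ _ _).
set t4 := psev p (trace4 _ _); set gg := psev p (psgrad2 (psH p) (psH p)).
move=> LE B0 kt BE t40 t4q g0.
have cg : c * gg <= (1 - kappa) * B.
  have -> : (1 - kappa) * B = c * ((n%:R + 2) * B / 3) by rewrite /kappa; field.
  by rewrite ler_wpM2l// ler_pdivlMr ?ltr0n// mulrC.
have r4 : psrho p ^+ 4 = G p ^+ 2 by rewrite -G2; ring.
have q2 : q p ^+ 2 <= c0 ^+ 2 * G p ^+ 2 by rewrite -exprMn lerXn2r ?nnegrE ?mulr_ge0// ltW.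
have Kq : K p * q p <= c0 * G p ^+ 2.
  have -> : c0 * G p ^+ 2 = G p * (c0 * G p) by ring.
  by rewrite ler_pM.
have Kh : K p * h p ^+ 2 <= e * G p ^+ 2.
  have -> : e * G p ^+ 2 = G p * (e * G p) by ring.
  by rewrite ler_pM.
have Kq0 : 0 <= K p * q p by rewrite mulr_ge0.
have Kh0 : 0 <= K p * h p ^+ 2 by rewrite mulr_ge0.
have qK : c * ((q p + n%:R * K p) * h p ^+ 2) <= c * ((c0 + n%:R) * e) * G p ^+ 2.
  rewrite -[leRHS]mulrA ler_wpM2l//.
  have -> : (c0 + n%:R) * e * G p ^+ 2 = (c0 * G p + n%:R * G p) * (e * G p) by ring.
  apply: ler_pM => //; first by apply: addr_ge0 => //; apply: mulr_ge0.
  by apply: lerD => //; apply: ler_wpM2l.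
have qK0 : 0 <= c * ((q p + n%:R * K p) * h p ^+ 2).
  by do 2 apply: mulr_ge0 => //; apply: addr_ge0 => //; exact: mulr_ge0.
have nKq : n%:R * (K p * q p) <= n%:R * (c0 * G p ^+ 2) by rewrite ler_wpM2l.
have nKq0 : 0 <= n%:R * (K p * q p) by rewrite mulr_ge0.
(* Replaces the covariant norm of the first derivative by the ambient one, at the cost of terms of
   order [g^2]. *)
have kB : kappa * B >= kappa * u p - 2 * q p ^+ 2 - 2 * (K p * q p).
  have h1 : kappa * t4 <= q p ^+ 2 by rewrite (le_trans _ t4q)// ler_piMl.
  have h2 : kappa * (K p * q p) <= K p * q p by rewrite ler_piMl.
  by rewrite BE; move: h1 h2; lra.
have L1 : L = 2 * (c * ((q p + n%:R * K p) * h p ^+ 2)) + 2 * (n%:R * (K p * q p))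
     - 2 * q p ^+ 2 - 4 * (K p * h p ^+ 2) + 2 * B - 2 * (c * gg) by rewrite LE; ring.
have cg0 : 0 <= c * gg by rewrite mulr_ge0.
have q20 : 0 <= q p ^+ 2 by exact: sqr_ge0.
have lo : 2 * kappa * u p - C1 * G p ^+ 2 <= L.
  have -> : C1 * G p ^+ 2 = 6 * (c0 ^+ 2 * G p ^+ 2) + 4 * (c0 * G p ^+ 2)
    + 4 * (e * G p ^+ 2) by rewrite /C1; ring.
  rewrite L1; move: cg kB q2 Kq Kh qK0 nKq0; rewrite mulrBl mul1r -[2 * kappa * _]mulrA; lra.
have up : L <= C2 * G p ^+ 2 + 2 * u p.
  have -> : C2 * G p ^+ 2 = 2 * (c * ((c0 + n%:R) * e) * G p ^+ 2)
    + 2 * (n%:R * (c0 * G p ^+ 2)) + 2 * G p ^+ 2 by rewrite /C2; ring.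
  have Bu : B <= u p by rewrite BE; move: t40 Kq0; lra.
  have := sqr_ge0 (G p).
  rewrite L1; move: qK nKq cg0 q20 Kh0 Bu; lra.
have uG : u p = G p ^+ 2 * psx p ^+ 2 by rewrite u4 r4.
have x20 : 0 <= psx p ^+ 2 by exact: sqr_ge0.
split.
- rewrite r4 mulrBr; apply: le_trans lo.
  have -> : 2 * kappa * u p = G p ^+ 2 * (2 * kappa * psx p ^+ 2) by rewrite uG; ring.
  rewrite lerD2l lerN2 mulrC ler_wpM2l ?sqr_ge0// -addrA lerDl; exact: addr_ge0.
- rewrite r4 ler_norml; apply/andP; split.
    apply: le_trans lo; rewrite lerNl opprB lerBlDr.
    apply: (@le_trans _ _ (G p ^+ 2 * (C1 + C2 + C3))).
      by rewrite mulrC ler_wpM2l ?sqr_ge0// -addrA lerDl; exact: addr_ge0.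
    have -> : G p ^+ 2 * ((C1 + C2 + C3) * (1 + psx p ^+ 2)) = G p ^+ 2 * (C1 + C2 + C3)
      + G p ^+ 2 * ((C1 + C2 + C3) * psx p ^+ 2) by ring.
    rewrite -[leRHS]addrA lerDl; apply: addr_ge0.
      apply: mulr_ge0; first exact: sqr_ge0.
      by apply: mulr_ge0 => //; exact: addr_ge0 (addr_ge0 C10 C20) C30.
    by rewrite -mulrA; apply: mulr_ge0 => //; rewrite mulr_ge0// ltW.
  apply: (le_trans up); rewrite uG.
  have -> : C2 * G p ^+ 2 + 2 * (G p ^+ 2 * psx p ^+ 2) =
    G p ^+ 2 * (C2 + 2 * psx p ^+ 2) by ring.
  rewrite ler_wpM2l ?sqr_ge0// mulrDr mulr1 lerD//.
    by rewrite addrAC lerDr; exact: addr_ge0.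
  rewrite ler_wpM2r// /C2.
  have h1 : 0 <= c * ((c0 + n%:R) * e) by rewrite !mulr_ge0// addr_ge0.
  have h2 : 0 <= n%:R * c0 by rewrite mulr_ge0.
  by move: h1 h2 C10 C30; lra.
- have /= gr := grad_pinching_le (ps_se p) (psev p) (c := pscst p c) (d := pscst p (b + 1))
     (fun k => ps_Dcst p k c) (fun k => ps_Dcst p k (b + 1)).
  rewrite -/(psg p) -/(psgrad2 (psg p) (psg p)) psdel_scale// ps_evcst in gr.
  rewrite (jet2_sqnorm (@psD _ _ _ p) (psnu p)) -/(psA p) -/(psjet2 p) uG in gr.
  rewrite -/(psH p) -/(psA2 p) in gr.
  have r6 : psrho p ^+ 6 = G p ^+ 3 by rewrite -G2; ring.
  have h1 : c ^+ 2 * h p ^+ 2 * m%:R + q p <= (c ^+ 2 * e * m%:R + c0) * G p.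
    have -> : (c ^+ 2 * e * m%:R + c0) * G p = c ^+ 2 * (e * G p) * m%:R + c0 * G p by ring.
    by rewrite lerD// ler_wpM2r// ler_wpM2l// sqr_ge0.
  have h2 : G p ^+ 3 * psdel p ^+ 2 <= G p ^+ 3 * (C3 * psx p ^+ 2).
    rewrite -r6; apply: (le_trans gr); rewrite r6.
    have -> : G p ^+ 3 * (C3 * psx p ^+ 2) =
      8 * ((c ^+ 2 * e * m%:R + c0) * G p) * (G p ^+ 2 * psx p ^+ 2) by rewrite /C3; ring.
    apply: ler_wpM2r; first by apply: mulr_ge0 => //; exact: sqr_ge0.
    by apply: ler_wpM2l => //; exact: ler0n.
  move: h2; rewrite ler_pM2l ?exprn_gt0// => /le_trans; apply.
  by rewrite ler_wpM2r// lerDr; exact: addr_ge0.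
Qed.

Definition psi_gradient p (f : R) : psS p :=
  psr p ^+ 2 * pst p * psjet2 p - pscst p f * psg p ^+ 2.

Definition psi_hessian p (N f : R) : psS p :=
  psr p ^+ 2 * pst p * psjet3 p + pscst p N * (psjet2 p * psg p)
  - pscst p f * (psg p * psg p ^+ 2).

Lemma heat_scaled_time p (f : psS p) : psheat (psr p ^+ 2 * pst p * f) =
  psr p ^+ 2 * pst p * psheat f + psr p ^+ 2 * f.
Proof.
have se := ps_se p.
have Dr2 k : psD k (psr p ^+ 2) = 0 by rewrite (derX2 (seD se k)) (seDr se) mulr0 mul0rn.
have Dr2t k : psD k (psr p ^+ 2 * pst p) = 0.
  by rewrite (derM (seD se k)) Dr2 ps_Dt mul0r mulr0 addr0.
rewrite /psheat (heatM se) /grad2 big1 => [|k _]; last by rewrite Dr2t mul0r.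
have -> : heat (@psD _ _ _ p) (@psT _ _ _ p) (psr p ^+ 2 * pst p) = psr p ^+ 2.
  rewrite /heat (derM (seT se)) (derX2 (seT se)) (seTr se) ps_Tt /lap big1 => [|k _]; first by ring.
  by rewrite Dr2t (der0 (seD se k)).
by ring.
Qed.

Lemma psheatD p (f g : psS p) : psheat (f + g) = psheat f + psheat g.
Proof. exact: heatD (ps_se p) f g. Qed.

Lemma psheatB p (f g : psS p) : psheat (f - g) = psheat f - psheat g.
Proof. by rewrite /psheat (heatD (ps_se p)) (heatN (ps_se p)). Qed.

Lemma psheatM p (f g : psS p) :
  psheat (f * g) = f * psheat g + g * psheat f - psgrad2 f g *+ 2.
Proof. exact: heatM (ps_se p) f g. Qed.

Lemma heat_cstM p k (f : psS p) : psheat (pscst p k * f) = pscst p k * psheat f.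
Proof.
have se := ps_se p.
have hk : heat (@psD _ _ _ p) (@psT _ _ _ p) (pscst p k) = 0.
  by apply: (heat_const se) => [e|]; [exact: ps_Dcst|exact: ps_Tcst].
rewrite /psheat (heatM se) hk /grad2 big1 => [|e _]; last by rewrite ps_Dcst mul0r.
by rewrite mulr0 mul0rn subr0 addr0.
Qed.

Lemma heat_square p (f : psS p) : psheat (f ^+ 2) = f * psheat f *+ 2 - psgrad2 f f *+ 2.
Proof. exact: heat_sqr (ps_se p) f. Qed.

Lemma heat_cube p (f : psS p) : psheat (f * f ^+ 2) =
  f ^+ 2 * psheat f *+ 3 - f * psgrad2 f f *+ 6.
Proof.
have se := ps_se p.
rewrite /psheat (heatM se) (heat_sqr se).
have -> : grad2 (@psD _ _ _ p) f (f ^+ 2) = f * psgrad2 f f *+ 2.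
  rewrite mulr_sumr -sumrMnl; apply: eq_bigr => k _; rewrite (derX2 (seD se k)); ring.
by rewrite -/(psgrad2 f f); ring.
Qed.

Lemma ev_heat_gradient p (j hj g hg gg : psS p) f :
  psev p (psr p ^+ 2 * pst p * hj + psr p ^+ 2 * j - pscst p f * (g * hg *+ 2 - gg *+ 2)) =
  K p * psev p (pst p) * psev p hj + K p * psev p j
    - f * (psev p g * psev p hg *+ 2 - psev p gg *+ 2).
Proof. by rewrite !(rmorphB, rmorphD, rmorphN, rmorphMn, rmorphXn, rmorphM, ps_evcst). Qed.

Lemma ev_heat_hessian p (j hj k hk g hg kg gg : psS p) N f :
  psev p (psr p ^+ 2 * pst p * hj + psr p ^+ 2 * j
    + pscst p N * (k * hg + g * hk - kg *+ 2)
    - pscst p f * (g ^+ 2 * hg *+ 3 - g * gg *+ 6)) =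
  K p * psev p (pst p) * psev p hj + K p * psev p j
    + N * (psev p k * psev p hg + psev p g * psev p hk - psev p kg *+ 2)
    - f * (psev p g ^+ 2 * psev p hg *+ 3 - psev p g * psev p gg *+ 6).
Proof. by rewrite !(rmorphB, rmorphD, rmorphN, rmorphMn, rmorphXn, rmorphM, ps_evcst). Qed.

Lemma ev_psi_hessian p (j k g : psS p) N f :
  psev p (psr p ^+ 2 * pst p * j + pscst p N * (k * g) - pscst p f * (g * g ^+ 2)) =
  K p * psev p (pst p) * psev p j + N * (psev p k * psev p g)
  - f * (psev p g * psev p g ^+ 2).
Proof. by rewrite !(rmorphB, rmorphD, rmorphN, rmorphMn, rmorphXn, rmorphM, ps_evcst). Qed.

(** With [s = K (t - t0)], the zero of [psi] says [f = s x^2], and the zero of its gradient says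
    [s D|DA|^2 = 2 f g Dg]. Since the gradient of [|DA|^2] is at most [2 |DA| |DDA|], the latter
    gives [del * x <= y], and [gradient_algebra] applies. *)
Lemma contact_gradient lam : 0 < lam -> exists M, forall p f, pinched p ->
  0 < psev p (pst p) -> K p * psev p (pst p) <= lam ->
  psev p (psi_gradient p f) = 0 ->
  (forall k, psev p (psD k (psi_gradient p f)) = 0) ->
  0 <= psev p (psheat (psi_gradient p f)) -> f <= M.
Proof.
move=> lam0.
have [C1 C10 h1] := heat_jet2_le; have [C2 C20 h2] := heat_psg.
pose C := C1 + C2.
have C0 : 0 <= C by rewrite addr_ge0.
have [M HM] := gradient_algebra C0 kappa_gt0 lam0.
exists M => p f pp t0 tlam psi0 dpsi heat_psi.
have se := ps_se p.
have K0 : 0 < K p by have [] := pp.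
have G0 := psg_gt0 pp; have G2 := psrho2 pp; have r0 := psrho_gt0 pp.
pose s := K p * psev p (pst p).
have s0 : 0 < s by rewrite mulr_gt0.
pose rr := psrho p.
have sE : s * u p = f * G p ^+ 2.
  move/eqP: psi0; rewrite /psi_gradient !(rmorphD, rmorphN, rmorphXn, rmorphM, ps_evcst).
  by rewrite subr_eq0 => /eqP.
have r4 : rr ^+ 4 = G p ^+ 2 by rewrite /rr -G2; ring.
have fE : f = s * psx p ^+ 2.
  apply: (mulIf (x := G p ^+ 2)); first by rewrite expf_neq0// gt_eqF.
  by rewrite -sE psu_scale// -/rr r4; ring.
have dE k : s * psev p (psD k (psjet2 p)) = 2 * f * G p * psev p (psD k (psg p)).
  have Dr2t : psD k (psr p ^+ 2 * pst p) = 0.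
    by rewrite (derM (seD se k)) (derX2 (seD se k)) (seDr se) ps_Dt !(mul0r, mulr0, mul0rn, addr0).
  have := dpsi k; rewrite /psi_gradient (derB (seD se k)) (derM (seD se k)) Dr2t mul0r add0r.
  rewrite (derM (seD se k)) ps_Dcst mul0r add0r (derX2 (seD se k)).
  rewrite !(rmorphB, rmorphXn, rmorphMn, rmorphM, ps_evcst) => /eqP; rewrite subr_eq0 => /eqP.
  by rewrite /s /psK => ->; ring.
have dxy : psdel p * psx p <= psy p.
  have h : s ^+ 2 * psev p (psgrad2 (psjet2 p) (psjet2 p)) =
      4 * f ^+ 2 * G p ^+ 2 * psev p (psgrad2 (psg p) (psg p)).
    rewrite /psgrad2 !ev_grad2 !mulr_sumr; apply: eq_bigr => k _.
    have -> : s ^+ 2 * (psev p (psD k (psjet2 p)) * psev p (psD k (psjet2 p))) =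
      (s * psev p (psD k (psjet2 p))) ^+ 2 by ring.
    by rewrite dE; ring.
  have le1 := ler_wpM2l (sqr_ge0 s) (ev_grad2_sqnorm se (psev p) (djet (@psD _ _ _ p) (psA p))).
  rewrite -/(psjet2 p) -/(psjet3 p) -/(psgrad2 (psjet2 p) (psjet2 p)) h in le1.
  rewrite psdel_scale// psu_scale// psv_scale// -/rr fE -r4 in le1.
  have x0 := psx_ge0 pp; have y0 := psy_ge0 pp; have d0 := psdel_ge0 pp.
  have pos : 0 < 4 * s ^+ 2 * rr ^+ 10.
    by apply: mulr_gt0; [apply: mulr_gt0; [rewrite ltr0n|exact: exprn_gt0]|exact: exprn_gt0].
  have le2 : 4 * s ^+ 2 * rr ^+ 10 * (psx p ^+ 2 * (psdel p * psx p) ^+ 2) <=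
     4 * s ^+ 2 * rr ^+ 10 * (psx p ^+ 2 * psy p ^+ 2).
    by apply: le_trans (le_trans _ le1) _; rewrite le_eqVlt; apply/orP; left; apply/eqP; ring.
  move: le2; rewrite ler_pM2l//.
  have [->|xn0] := eqVneq (psx p) 0; first by rewrite mulr0.
  have xp : 0 < psx p ^+ 2 by rewrite exprn_gt0// lt_def xn0.
  by rewrite ler_pM2l// ler_pXn2r// nnegrE mulr_ge0.
have [lo up dl] := h2 p pp.
pose gam := psev p (psheat (psg p)) / rr ^+ 4.
have gamE : psev p (psheat (psg p)) = rr ^+ 4 * gam by rewrite /gam scaledK.
have r4p : 0 < rr ^+ 4 by rewrite exprn_gt0.
have r6p : 0 < rr ^+ 6 by rewrite exprn_gt0.
apply: (HM (K p / G p) s (psx p) (psy p) gam (psdel p) f) => //.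
- by rewrite ler_pdivrMr// mul1r psK_le.
- by rewrite (ltW s0).
- exact: psx_ge0.
- exact: psy_ge0.
- exact: psdel_ge0.
- by apply: (le_trans dl); rewrite ler_wpM2r ?sqr_ge0// /C lerDr.
- rewrite -(ler_pM2l r4p) -gamE; apply: le_trans lo.
  by rewrite ler_pM2l// lerD2l lerN2 /C lerDr.
have : 0 <= rr ^+ 6 * (K p / G p * psx p ^+ 2
    + s * (- 2 * psy p ^+ 2 + C * (psx p * ((1 + psx p) ^+ 2 + psy p)))
    - f * (2 * gam - 2 * psdel p ^+ 2)); last by rewrite pmulr_rge0.
apply: (le_trans heat_psi).
rewrite /psi_gradient psheatB heat_scaled_time.
rewrite heat_cstM heat_square ev_heat_gradient.
rewrite -/s gamE psdel_scale// psu_scale// -/rr -G2 -/rr.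
have j2 : psev p (psheat (psjet2 p)) <=
    rr ^+ 6 * (- 2 * psy p ^+ 2 + C * (psx p * ((1 + psx p) ^+ 2 + psy p))).
  apply: (le_trans (h1 p pp)); rewrite ler_pM2l// lerD2l ler_wpM2r ?lerDl//.
  by rewrite mulr_ge0 ?psx_ge0// addr_ge0 ?sqr_ge0// psy_ge0.
have := ler_wpM2l (ltW s0) j2; set j := psev p _; set B := - 2 * _ + _ => j2s.
have -> : rr ^+ 6 * (K p / rr ^+ 2 * psx p ^+ 2 + s * B - f * (2 * gam - 2 * psdel p ^+ 2)) =
  K p * (rr ^+ 4 * psx p ^+ 2) + s * (rr ^+ 6 * B)
  - f * (rr ^+ 2 * (rr ^+ 4 * gam) *+ 2 - (rr ^+ 6 * psdel p ^+ 2) *+ 2).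
  by field; rewrite gt_eqF.
by rewrite [X in X - _ <= _]addrC lerD2r lerD2l.
Qed.

(** The product [|DA|^2 g] brings in the inner product of the gradients of its factors, which
    Cauchy-Schwarz bounds by [2 x y del] after scaling; the zero of [psi] expresses [f] by [x] and
    [y], and [hessian_algebra] applies. *)
Lemma contact_hessian lam M0 : 0 < lam -> 0 <= M0 ->
  exists2 N, 0 <= N & exists M, forall p f, pinched p ->
  0 <= psev p (pst p) -> K p * psev p (pst p) <= lam ->
  u p <= M0 * G p ^+ 2 ->
  psev p (psi_hessian p N f) = 0 ->
  0 <= psev p (psheat (psi_hessian p N f)) -> f <= M.
Proof.
move=> lam0 M00.
have [C1 C10 h1] := heat_jet2_le; have [C2 C20 h2] := heat_psg.
have [C3 C30 h3] := heat_jet3_le.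
pose C := C1 + C2 + C3.
have C0 : 0 <= C by rewrite !addr_ge0.
have [N N0 [M HM]] := hessian_algebra C0 lam0 M00.
exists N => //; exists M => p f pp t0 tlam uM psi0 heat_psi.
have se := ps_se p.
have K0 : 0 < K p by have [] := pp.
have G0 := psg_gt0 pp; have G2 := psrho2 pp; have r0 := psrho_gt0 pp.
pose s := K p * psev p (pst p).
have s0 : 0 <= s by rewrite mulr_ge0// ltW.
pose rr := psrho p.
have x0 := psx_ge0 pp; have y0 := psy_ge0 pp; have z0 := psz_ge0 pp.
have d0 := psdel_ge0 pp.
have fE : f = s * psy p ^+ 2 + N * psx p ^+ 2.
  move/eqP: psi0; rewrite /psi_hessian ev_psi_hessian.
  rewrite subr_eq0 => /eqP; rewrite -/s psu_scale// psv_scale// -/rr -G2 -/rr => e.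
  apply: (mulIf (x := rr ^+ 6)); first by rewrite expf_neq0// gt_eqF.
  have -> : f * rr ^+ 6 = f * (rr ^+ 2 * (rr ^+ 2) ^+ 2) by ring.
  by rewrite -e; ring.
have xM : psx p ^+ 2 <= M0.
  have r4p : 0 < rr ^+ 4 by rewrite exprn_gt0.
  by rewrite -(ler_pM2l r4p) -psu_scale// (le_trans uM)// -G2 -/rr mulrC -exprM.
have [_ up dl] := h2 p pp.
pose gam := psev p (psheat (psg p)) / rr ^+ 4.
have gamE : psev p (psheat (psg p)) = rr ^+ 4 * gam by rewrite /gam scaledK.
pose chi := psev p (psgrad2 (psjet2 p) (psg p)) / rr ^+ 8.
have chiE : psev p (psgrad2 (psjet2 p) (psg p)) = rr ^+ 8 * chi by rewrite /chi scaledK.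
have r4p : 0 < rr ^+ 4 by rewrite exprn_gt0.
have r6p : 0 < rr ^+ 6 by rewrite exprn_gt0.
have r8p : 0 < rr ^+ 8 by rewrite exprn_gt0.
apply: (HM (K p / G p) s (psx p) (psy p) (psz p) gam (psdel p) chi f) => //.
- by rewrite ler_pdivrMr// mul1r psK_le.
- by rewrite s0.
- by apply: (le_trans dl); rewrite ler_wpM2r ?sqr_ge0// /C addrAC lerDr addr_ge0.
- rewrite -(ler_pM2l r4p) -[X in X * `|gam|]gtr0_norm// -normrM -gamE.
  apply: (le_trans up); rewrite ler_pM2l// ler_wpM2r ?addr_ge0 ?sqr_ge0//.
  by rewrite /C addrAC lerDr addr_ge0.
- have cs := ev_grad2_cauchy (@psD _ _ _ p) (psev p) (psjet2 p) (psg p).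
  have le1 := ev_grad2_sqnorm se (psev p) (djet (@psD _ _ _ p) (psA p)).
  rewrite -/(psjet2 p) -/(psjet3 p) in le1.
  rewrite -!/(psgrad2 _ _) chiE psdel_scale// in cs.
  have le2 : (rr ^+ 8 * chi) ^+ 2 <= (rr ^+ 8 * (2 * (psx p * psy p * psdel p))) ^+ 2.
    apply: (le_trans cs).
    have r6d : 0 <= psrho p ^+ 6 * psdel p ^+ 2 by rewrite mulr_ge0 ?sqr_ge0// ltW.
    apply: (le_trans (ler_wpM2r r6d le1)).
    by rewrite psu_scale// psv_scale// -/rr le_eqVlt; apply/orP; left; apply/eqP; ring.
  have B0 : 0 <= 2 * (psx p * psy p * psdel p) := mulr_ge0 (ler0n _ 2) (mulr_ge0 (mulr_ge0 x0 y0) d0).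
  have := ler_norm_sqr (mulr_ge0 (ltW r8p) B0) le2.
  rewrite normrM (gtr0_norm r8p) ler_pM2l// => chi_le; exact: chi_le.
have : 0 <= rr ^+ 8 * (K p / G p * psy p ^+ 2
    + s * (- 2 * psz p ^+ 2 + C * (psy p * ((1 + psx p) ^+ 3 + (1 + psx p) * psy p + psz p)))
    + N * (- 2 * psy p ^+ 2 + C * (psx p * ((1 + psx p) ^+ 2 + psy p)) + psx p ^+ 2 * gam - 2 * chi)
    - f * (3 * gam - 6 * psdel p ^+ 2)); last by rewrite pmulr_rge0.
apply: (le_trans heat_psi).
rewrite /psi_hessian psheatB psheatD heat_scaled_time.
rewrite !heat_cstM heat_cube psheatM ev_heat_hessian.
rewrite -/s gamE chiE psdel_scale// psu_scale// psv_scale// -/rr -G2 -/rr.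
have j2 : psev p (psheat (psjet2 p)) <=
    rr ^+ 6 * (- 2 * psy p ^+ 2 + C * (psx p * ((1 + psx p) ^+ 2 + psy p))).
  apply: (le_trans (h1 p pp)); rewrite ler_pM2l// lerD2l ler_wpM2r//.
    by rewrite mulr_ge0// addr_ge0 ?sqr_ge0.
  by rewrite /C -addrA lerDl addr_ge0.
have j3 : psev p (psheat (psjet3 p)) <= rr ^+ 8 * (- 2 * psz p ^+ 2
    + C * (psy p * ((1 + psx p) ^+ 3 + (1 + psx p) * psy p + psz p))).
  apply: (le_trans (h3 p pp)); rewrite ler_pM2l// lerD2l ler_wpM2r//.
    apply: mulr_ge0 => //; apply: addr_ge0 => //.
    by apply: addr_ge0; [apply: exprn_ge0|apply: mulr_ge0 => //]; exact: addr_ge0.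
  by rewrite /C lerDr addr_ge0.
have r2 : 0 <= rr ^+ 2 by exact: sqr_ge0.
have := ler_wpM2l s0 j3; have := ler_wpM2l N0 (ler_wpM2l r2 j2).
set J3 := psev p (psheat (psjet3 p)); set J2 := psev p (psheat (psjet2 p)).
set B2 := - 2 * psy p ^+ 2 + _; set B3 := - 2 * psz p ^+ 2 + _ => j2s j3s.
have -> : rr ^+ 8 * (K p / rr ^+ 2 * psy p ^+ 2 + s * B3
     + N * (B2 + psx p ^+ 2 * gam - 2 * chi) - f * (3 * gam - 6 * psdel p ^+ 2)) =
  K p * (rr ^+ 6 * psy p ^+ 2) + s * (rr ^+ 8 * B3)
  + (N * (rr ^+ 2 * (rr ^+ 6 * B2)) + N * (rr ^+ 4 * psx p ^+ 2 * (rr ^+ 4 * gam)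
       - (rr ^+ 8 * chi) *+ 2))
  - f * ((rr ^+ 2) ^+ 2 * (rr ^+ 4 * gam) *+ 3 - rr ^+ 2 * (rr ^+ 6 * psdel p ^+ 2) *+ 6).
  by field; rewrite gt_eqF.
move: j2s j3s; rewrite !mulrDr; lra.
Qed.

End ContactEstimates.

(** * Covariant derivatives in components *)

Section TupleSums.
Variable S : comPzRingType.

Lemma sum_tuple_cons (I : finType) r (F : r.+1.-tuple I -> S) :
  \sum_(s : r.+1.-tuple I) F s = \sum_i \sum_(s : r.-tuple I) F (cons_tuple i s).
Proof.
rewrite pair_bigA /= (reindex (fun p : I * r.-tuple I => cons_tuple p.1 p.2)) //=.
exists (fun s => (thead s, behead_tuple s)) => [[i s] _|s _] /=.
  by congr (_, _); apply: val_inj.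
by rewrite [RHS]tuple_eta; apply: val_inj.
Qed.

Lemma sum_tuple0 (I : finType) (F : 0.-tuple I -> S) :
  \sum_(s : 0.-tuple I) F s = F [tuple].
Proof. by rewrite (big_pred1 [tuple])// => s; apply/esym/eqP; rewrite [LHS]tuple0. Qed.

Lemma prod_sum_tuple (I : finType) r (F : 'I_r -> I -> S) :
  \sum_(s : r.-tuple I) \prod_a F a (tnth s a) = \prod_a \sum_i F a i.
Proof.
rewrite bigA_distr_bigA /= (reindex (fun s : r.-tuple I => [ffun a => tnth s a])) /=.
  by apply: eq_bigr => s _; apply: eq_bigr => a _; rewrite ffunE.
exists (fun f : {ffun 'I_r -> I} => [tuple f a | a < r]) => [s _|f _].
  by apply: eq_from_tnth => a; rewrite tnth_mktuple ffunE.
by apply/ffunP => a; rewrite ffunE tnth_mktuple.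
Qed.

Variables (n m r : nat) (gi : 'I_n -> 'I_n -> S) (J : 'I_n -> 'I_m -> S).

(** The pullback of an ambient covariant tensor under the immersion with Jacobian [J]. *)
Definition pull (t : r.-tuple 'I_m -> S) (s : r.-tuple 'I_n) : S :=
  \sum_(w : r.-tuple 'I_m) (\prod_a J (tnth s a) (tnth w a)) * t w.

(** The indices contract separately. The inverse metric between two Jacobian entries is the
    tangential projection ([sum_frame_jac]), so norms of pullbacks can be read off in ambient
    components. *)
Lemma norm_pull (t : r.-tuple 'I_m -> S) :
  \sum_(s : r.-tuple 'I_n) \sum_(s' : r.-tuple 'I_n)
    (\prod_a gi (tnth s a) (tnth s' a)) * pull t s * pull t s' =
  \sum_(w : r.-tuple 'I_m) \sum_(w' : r.-tuple 'I_m)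
    (\prod_a \sum_i \sum_j gi i j * J i (tnth w a) * J j (tnth w' a)) * t w * t w'.
Proof.
have e (w w' : r.-tuple 'I_m) :
    \prod_a \sum_i \sum_j gi i j * J i (tnth w a) * J j (tnth w' a) =
    \sum_(s : r.-tuple 'I_n) \sum_(s' : r.-tuple 'I_n)
      (\prod_a gi (tnth s a) (tnth s' a)) * (\prod_a J (tnth s a) (tnth w a))
      * (\prod_a J (tnth s' a) (tnth w' a)).
  rewrite -prod_sum_tuple; apply: eq_bigr => s _.
  rewrite -prod_sum_tuple; apply: eq_bigr => s' _.
  by rewrite -!big_split.
under [RHS]eq_bigr do under eq_bigr do rewrite e !mulr_suml.
under [RHS]eq_bigr do under eq_bigr do under eq_bigr do rewrite !mulr_suml.
rewrite [RHS](eq_bigr (fun w => \sum_s \sum_(w' : r.-tuple 'I_m) \sum_(s' : r.-tuple 'I_n)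
      (\prod_a gi (tnth s a) (tnth s' a)) * (\prod_a J (tnth s a) (tnth w a))
      * (\prod_a J (tnth s' a) (tnth w' a)) * t w * t w')); last first.
  by move=> w _; rewrite exchange_big.
rewrite [RHS]exchange_big; apply: eq_bigr => s _ /=.
under [RHS]eq_bigr do rewrite exchange_big.
rewrite [RHS]exchange_big; apply: eq_bigr => s' _ /=.
transitivity (\sum_w (\prod_a gi (tnth s a) (tnth s' a))
    * ((\prod_a J (tnth s a) (tnth w a)) * t w) * pull t s').
  by rewrite -mulr_suml -mulr_sumr.
by apply: eq_bigr => w _; rewrite mulr_sumr; apply: eq_bigr => w' _; ring.
Qed.

End TupleSums.

Section CovariantDerivatives.
Variables (S : comPzRingType) (n m : nat) (d : 'I_n -> S -> S) (T : S -> S).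
Variables (r ri : S) (X nu : 'I_m -> S) (gi : 'I_n -> 'I_n -> S).
Hypothesis cf : coordinate_flow d T r ri X nu gi.

Let dd := cf_d cf.
Local Notation D := (tgrad d X gi).
Local Notation xi := (unit_pos r X).
Local Notation A := (curv D nu).
Let se := flow_structure_equations cf.

Definition jac i a : S := d i (X a).
(** The Christoffel symbols as tangential components of [d k (d i X)]; [gamma_metric] identifies
    them with the expression in the metric. *)
Definition gamma l k i : S := \sum_c frame d X gi l c * d k (d i (X c)).
Definition sffS i j : S := \sum_b d i (nu b) * d j (X b).

Local Notation J := jac.

Lemma jac_grad i f : \sum_a J i a * D a f = d i f.
Proof. exact: d_tgrad cf i f. Qed.

Lemma d_jac k i a : d k (J i a) = \sum_l gamma l k i * J l a
  + nu a * (\sum_c nu c * d k (J i c)) + xi a * (\sum_c xi c * d k (J i c)).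
Proof.
rewrite [LHS](tangent_decomposition cf (fun b => d k (J i b)) a); congr (_ + _ + _).
have -> : \sum_l gamma l k i * J l a =
    \sum_c (\sum_l frame d X gi l c * J l a) * d k (J i c).
  under eq_bigr do rewrite mulr_suml.
  rewrite exchange_big; apply: eq_bigr => c _; rewrite mulr_suml.
  by apply: eq_bigr => l _; rewrite /J; ring.
have -> : \sum_j frame d X gi j a * (\sum_c d j (X c) * d k (J i c)) =
   \sum_c (\sum_j frame d X gi j a * J j c) * d k (J i c).
  under eq_bigr do rewrite mulr_sumr.
  rewrite exchange_big; apply: eq_bigr => c _; rewrite mulr_suml.
  by apply: eq_bigr => l _; rewrite /J; ring.
apply: eq_bigr => c _; congr (_ * _).
rewrite -![\sum_j frame d X gi j _ * _]/(D _ (X _)) !(D_X cf).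
by rewrite eq_sym; ring.
Qed.

Lemma sffS_pull i j : sffS i j = \sum_a \sum_b J i a * J j b * A a b.
Proof.
rewrite /sffS exchange_big; apply: eq_bigr => b _ /=.
rewrite -(jac_grad i (nu b)) mulr_suml; apply: eq_bigr => a _; rewrite /curv /J; ring.
Qed.

(** Against a tangential [y] the normal part of [d k (J i a)] in the Gauss formula [d_jac]
    disappears; the tangential part is the connection term that a covariant derivative subtracts. *)
Lemma d_sum_jac k i (y : 'I_m -> S) :
  \sum_a nu a * y a = 0 -> \sum_a xi a * y a = 0 ->
  d k (\sum_a J i a * y a) = \sum_l gamma l k i * (\sum_a J l a * y a)
    + \sum_a J i a * d k (y a).
Proof.
move=> y1 y2; rewrite (der_sum (dd k)).
under eq_bigr do rewrite (derM (dd k)).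
rewrite big_split; congr (_ + _).
have -> : \sum_a d k (J i a) * y a = \sum_a (\sum_l gamma l k i * J l a) * y a
   + (\sum_c nu c * d k (J i c)) * (\sum_a nu a * y a)
   + (\sum_c xi c * d k (J i c)) * (\sum_a xi a * y a).
  rewrite [X in _ + X + _]mulr_sumr [X in _ + X]mulr_sumr -!big_split /=.
  by apply: eq_bigr => a _; rewrite {1}d_jac; ring.
rewrite y1 y2 !mulr0 !addr0.
under eq_bigr do rewrite mulr_suml.
rewrite exchange_big; apply: eq_bigr => l _; rewrite mulr_sumr.
by apply: eq_bigr => a _; rewrite mulrA.
Qed.

(** Nesting the sums, which agrees with [pull] by [pull_tup2], lets [d_sum_jac] act on one index at
    a time. *)
Definition pull2 (t : 'I_m -> 'I_m -> S) i j : S := \sum_a J i a * \sum_b J j b * t a b.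
Definition pull3 (t : 'I_m -> 'I_m -> 'I_m -> S) k i j : S :=
  \sum_e J k e * pull2 (t e) i j.
Definition pull4 (t : 'I_m -> 'I_m -> 'I_m -> 'I_m -> S) f k i j : S :=
  \sum_e J f e * pull3 (t e) k i j.

Definition covd2 (t : 'I_n -> 'I_n -> S) k i j : S :=
  d k (t i j) - \sum_l gamma l k i * t l j - \sum_l gamma l k j * t i l.
Definition covd3 (t : 'I_n -> 'I_n -> 'I_n -> S) f k i j : S :=
  d f (t k i j) - \sum_l gamma l f k * t l i j - \sum_l gamma l f i * t k l j
  - \sum_l gamma l f j * t k i l.

Lemma pull2_tangent (t : 'I_m -> 'I_m -> S) (y : 'I_m -> S) j :
  (forall b, \sum_a y a * t a b = 0) -> \sum_a y a * (\sum_b J j b * t a b) = 0.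
Proof.
move=> h; under eq_bigr do rewrite mulr_sumr.
rewrite exchange_big big1// => b _ /=.
by rewrite -[RHS](mulr0 (J j b)) -[in RHS](h b) mulr_sumr; apply: eq_bigr => a _; ring.
Qed.

Lemma d_pull2 (t : 'I_m -> 'I_m -> S) k i j :
  (forall b, \sum_a nu a * t a b = 0) -> (forall b, \sum_a xi a * t a b = 0) ->
  (forall a, \sum_b nu b * t a b = 0) -> (forall a, \sum_b xi b * t a b = 0) ->
  d k (pull2 t i j) = \sum_l gamma l k i * pull2 t l j + \sum_l gamma l k j * pull2 t i l
    + pull2 (fun a b => d k (t a b)) i j.
Proof.
move=> n1 x1 n2 x2; rewrite /pull2 d_sum_jac; [|exact: pull2_tangent..].
rewrite -addrA; congr (_ + _).
under eq_bigr do rewrite (d_sum_jac _ _ (n2 _) (x2 _)) mulrDr.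
rewrite big_split; congr (_ + _).
under eq_bigr do rewrite mulr_sumr.
rewrite exchange_big; apply: eq_bigr => l _; rewrite mulr_sumr.
by apply: eq_bigr => a _; ring.
Qed.

Lemma pull_grad2 (t : 'I_m -> 'I_m -> S) k i j :
  pull2 (fun a b => d k (t a b)) i j = pull3 (fun e a b => D e (t a b)) k i j.
Proof.
rewrite /pull3 /pull2; under [RHS]eq_bigr do rewrite mulr_sumr.
rewrite [RHS]exchange_big; apply: eq_bigr => a _ /=.
under [RHS]eq_bigr do rewrite mulrCA mulr_sumr.
rewrite -mulr_sumr exchange_big; congr (_ * _); apply: eq_bigr => b _ /=.
rewrite -(jac_grad k (t a b)) mulr_sumr; apply: eq_bigr => e _; ring.
Qed.

(** For a tensor tangential in both indices, [d_pull2] produces exactly the two connection terms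
    that [covd2] subtracts. *)
Lemma covd2_pull (t : 'I_m -> 'I_m -> S) k i j :
  (forall b, \sum_a nu a * t a b = 0) -> (forall b, \sum_a xi a * t a b = 0) ->
  (forall a, \sum_b nu b * t a b = 0) -> (forall a, \sum_b xi b * t a b = 0) ->
  covd2 (pull2 t) k i j = pull3 (fun e a b => D e (t a b)) k i j.
Proof. by move=> *; rewrite /covd2 d_pull2// pull_grad2; ring. Qed.

Lemma pull2_0 (t : 'I_m -> 'I_m -> S) i j :
  (forall a b, t a b = 0) -> pull2 t i j = 0.
Proof.
by move=> t0; rewrite /pull2 big1// => a _; rewrite big1 ?mulr0// => b _; rewrite t0 mulr0.
Qed.

Lemma pull3_tangent (t : 'I_m -> 'I_m -> 'I_m -> S) (y : 'I_m -> S) i j :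
  (forall a b, \sum_e y e * t e a b = 0) -> \sum_e y e * pull2 (t e) i j = 0.
Proof.
move=> h; have -> : \sum_e y e * pull2 (t e) i j = pull2 (fun a b => \sum_e y e * t e a b) i j.
  rewrite /pull2; under eq_bigr do rewrite mulr_sumr.
  rewrite exchange_big; apply: eq_bigr => a _ /=.
  under eq_bigr do rewrite mulrCA mulr_sumr.
  rewrite -mulr_sumr exchange_big; congr (_ * _); apply: eq_bigr => b _ /=.
  by rewrite mulr_sumr; apply: eq_bigr => e _; ring.
exact: pull2_0.
Qed.

Lemma covd3_pull (t : 'I_m -> 'I_m -> 'I_m -> S) f k i j :
  (forall a b, \sum_e nu e * t e a b = 0) -> (forall a b, \sum_e xi e * t e a b = 0) ->
  (forall e b, \sum_a nu a * t e a b = 0) -> (forall e b, \sum_a xi a * t e a b = 0) ->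
  (forall e a, \sum_b nu b * t e a b = 0) -> (forall e a, \sum_b xi b * t e a b = 0) ->
  covd3 (pull3 t) f k i j = pull4 (fun e e' a b => D e (t e' a b)) f k i j.
Proof.
move=> n0 x0 n1 x1 n2 x2.
have -> : pull4 (fun e e' a b => D e (t e' a b)) f k i j =
    \sum_e J k e * pull2 (fun a b => d f (t e a b)) i j.
  rewrite /pull4 /pull3; under eq_bigr do rewrite mulr_sumr.
  rewrite exchange_big; apply: eq_bigr => e _ /=.
  rewrite pull_grad2 /pull3 mulr_sumr; apply: eq_bigr => e' _; ring.
have dE : d f (pull3 t k i j) = \sum_l gamma l f k * pull3 t l i j
    + (\sum_l gamma l f i * pull3 t k l j + \sum_l gamma l f j * pull3 t k i l
    + \sum_e J k e * pull2 (fun a b => d f (t e a b)) i j).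
  rewrite [in LHS]/pull3 d_sum_jac; [|exact: pull3_tangent..].
  congr (_ + _).
  have swap (y : 'I_n -> S) (z : 'I_n -> 'I_m -> S) :
      \sum_e J k e * (\sum_l y l * z l e) = \sum_l y l * (\sum_e J k e * z l e).
    under eq_bigr do rewrite mulr_sumr.
    rewrite exchange_big; apply: eq_bigr => l _; rewrite mulr_sumr.
    by apply: eq_bigr => e _; ring.
  rewrite /pull3 -(swap (fun l => gamma l f i) (fun l e => pull2 (t e) l j)).
  rewrite -(swap (fun l => gamma l f j) (fun l e => pull2 (t e) i l)) -!big_split.
  apply: eq_bigr => e _ /=; rewrite d_pull2//; ring.
by rewrite /covd3 dE; ring.
Qed.

(** [D e (A a b)] is not tangential, so [covd3_pull] does not apply to it. Its normal parts are
    killed by the Jacobian, hence it can be replaced by the tangential tensor [codazzi] before the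
    second covariant derivative is taken. *)
Lemma pull_codazzi k i j :
  pull3 (fun e a b => D e (A a b)) k i j = pull3 (codazzi D r nu xi) k i j.
Proof.
have Jnu l : \sum_a J l a * nu a = 0.
  by rewrite -[RHS](cf_nudX cf l); apply: eq_bigr => a _; rewrite mulrC.
have Jxi l : \sum_a J l a * xi a = 0.
  rewrite -[RHS](mulr0 r) -[in RHS](X_dX cf l) mulr_sumr; apply: eq_bigr => a _.
  by rewrite /J /unit_pos; ring.
apply: eq_bigr => e _; congr (_ * _); rewrite /pull2.
have E a : \sum_b J j b * codazzi D r nu xi e a b = \sum_b J j b * D e (A a b)
   + nu a * (\sum_b J j b * curv_sq D nu e b) + curv_sq D nu e a * (\sum_b J j b * nu b)
   + r * (xi a * (\sum_b J j b * A e b) + A e a * (\sum_b J j b * xi b)).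
  rewrite !mulr_sumr -!big_split mulr_sumr -!big_split; apply: eq_bigr => b _ /=.
  by rewrite /codazzi; ring.
under [RHS]eq_bigr do rewrite E Jnu Jxi !mulr0 !addr0.
have -> : \sum_a J i a * (\sum_b J j b * D e (A a b)
    + nu a * (\sum_b J j b * curv_sq D nu e b) + r * (xi a * (\sum_b J j b * A e b))) =
  \sum_a J i a * (\sum_b J j b * D e (A a b))
  + (\sum_b J j b * curv_sq D nu e b) * (\sum_a J i a * nu a)
  + r * (\sum_b J j b * A e b) * (\sum_a J i a * xi a).
  rewrite [X in _ = _ + X + _]mulr_sumr [X in _ = _ + X]mulr_sumr -!big_split.
  by apply: eq_bigr => a _ /=; ring.
by rewrite Jnu Jxi !mulr0 !addr0.
Qed.

Lemma covd_covd_sff f k i j :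
  covd3 (covd2 sffS) f k i j =
  pull4 (fun e e' a b => D e (codazzi D r nu xi e' a b)) f k i j.
Proof.
have sffE i' j' : sffS i' j' = pull2 A i' j'.
  rewrite sffS_pull /pull2; apply: eq_bigr => a _; rewrite mulr_sumr.
  by apply: eq_bigr => b _; rewrite mulrA.
have c1 a : \sum_b nu b * A a b = 0.
  by rewrite -[RHS](nu_curv se a); apply: eq_bigr => b _; rewrite (curvC se).
have c2 a : \sum_b xi b * A a b = 0.
  by rewrite -[RHS](xi_curv se a); apply: eq_bigr => b _; rewrite (curvC se).
have covE k' i' j' : covd2 sffS k' i' j' = pull3 (codazzi D r nu xi) k' i' j'.
  rewrite -pull_codazzi -covd2_pull//; [|exact: nu_curv se|exact: xi_curv se].
  rewrite /covd2 sffE; congr (_ - _ - _).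
    by apply: eq_bigr => l _; rewrite sffE.
  by apply: eq_bigr => l _; rewrite sffE.
rewrite -covd3_pull.
- rewrite /covd3 covE; congr (_ - _ - _ - _); apply: eq_bigr => l _; by rewrite covE.
- move=> a b; rewrite -[RHS](sum_nu_codazzi se a b); apply: eq_bigr => e _.
  by rewrite (codazziCl se).
- move=> a b; rewrite -[RHS](sum_xi_codazzi se a b); apply: eq_bigr => e _.
  by rewrite (codazziCl se).
- exact: sum_nu_codazzi se.
- exact: sum_xi_codazzi se.
- move=> e a; rewrite -[RHS](sum_nu_codazzi se e a); apply: eq_bigr => b _.
  by rewrite (codazziCr se).
- move=> e a; rewrite -[RHS](sum_xi_codazzi se e a); apply: eq_bigr => b _.
  by rewrite (codazziCr se).
Qed.

End CovariantDerivatives.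

Section TupleComponents.
Variable I : Type.

(** Passes from the curried components of the calculations to the tuple indices of [tensor]. *)
Definition tup2 (T : Type) (t : I -> I -> T) (s : 2.-tuple I) : T :=
  t (thead s) (thead (behead_tuple s)).
Definition tup3 (T : Type) (t : I -> I -> I -> T) (s : 3.-tuple I) : T :=
  tup2 (t (thead s)) (behead_tuple s).
Definition tup4 (T : Type) (t : I -> I -> I -> I -> T) (s : 4.-tuple I) : T :=
  tup3 (t (thead s)) (behead_tuple s).

Lemma tnth_behead_tuple r (s : r.+1.-tuple I) a : tnth (behead_tuple s) a = tnth s (lift ord0 a).
Proof.
by rewrite (tnth_nth (thead s)) [RHS](tnth_nth (thead s)) /= nth_behead.
Qed.

Lemma thead_cons r i (s : r.-tuple I) : thead (cons_tuple i s) = i.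
Proof. by []. Qed.

Lemma behead_cons r i (s : r.-tuple I) : behead_tuple (cons_tuple i s) = s.
Proof. exact: val_inj. Qed.

Lemma tnth_ord_max2 (s : 2.-tuple I) : tnth s ord_max = thead (behead_tuple s).
Proof. by rewrite /thead tnth_behead_tuple; congr tnth; apply: val_inj. Qed.

End TupleComponents.

Section PullRecursion.
Variables (S : comPzRingType) (n m : nat) (J : 'I_n -> 'I_m -> S).

Lemma pullS r (t : r.+1.-tuple 'I_m -> S) (s : r.+1.-tuple 'I_n) :
  pull J t s = \sum_e J (thead s) e * pull J (fun w => t (cons_tuple e w)) (behead_tuple s).
Proof.
rewrite /pull sum_tuple_cons; apply: eq_bigr => e _; rewrite mulr_sumr.
apply: eq_bigr => w _; rewrite big_ord_recl mulrA; congr (_ * _ * _).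
by apply: eq_bigr => a _; rewrite -!tnth_behead_tuple behead_cons.
Qed.

Lemma pull0 (t : 0.-tuple 'I_m -> S) (s : 0.-tuple 'I_n) : pull J t s = t [tuple].
Proof. by rewrite /pull sum_tuple0 big_ord0 mul1r. Qed.

Lemma pull_tup2 (t : 'I_m -> 'I_m -> S) s :
  pull J (tup2 t) s = tup2 (fun i j => \sum_a J i a * \sum_b J j b * t a b) s.
Proof.
rewrite pullS; apply: eq_bigr => a _; rewrite pullS; congr (_ * _).
by apply: eq_bigr => b _; rewrite pull0 /tup2 behead_cons !thead_cons.
Qed.

Lemma pull_tup4 (t : 'I_m -> 'I_m -> 'I_m -> 'I_m -> S) s :
  pull J (tup4 t) s = tup4 (fun l k i j => \sum_f J l f * \sum_e J k e *
     \sum_a J i a * \sum_b J j b * t f e a b) s.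
Proof.
rewrite pullS; apply: eq_bigr => f _; congr (_ * _).
rewrite pullS; apply: eq_bigr => e _; congr (_ * _).
apply: etrans (pull_tup2 (t f e) _); apply: eq_bigr => w _; congr (_ * _).
by rewrite /tup4 /tup3 !behead_cons !thead_cons.
Qed.

End PullRecursion.

Lemma trace_sffS (S : comPzRingType) (n m : nat) (d : 'I_n -> S -> S) (X nu : 'I_m -> S)
    (gi : 'I_n -> 'I_n -> S) : (forall i j, gi i j = gi j i) ->
  \sum_i \sum_j gi i j * sffS d X nu j i = meanc (tgrad d X gi) nu.
Proof.
move=> giC; rewrite /meanc /curv /tgrad /frame exchange_big.
have -> : \sum_j \sum_i gi i j * sffS d X nu j i =
   \sum_j \sum_a (\sum_i gi j i * d i (X a)) * d j (nu a).
  apply: eq_bigr => j _.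
  rewrite (eq_bigr (fun i => \sum_a gi j i * d i (X a) * d j (nu a))).
    by rewrite exchange_big; apply: eq_bigr => a _; rewrite mulr_suml.
  move=> i _; rewrite /sffS mulr_sumr; apply: eq_bigr => a _.
  by rewrite (giC i j); ring.
by rewrite exchange_big.
Qed.

Section FlowTensors.
Variables (S : comPzRingType) (n m : nat) (d : 'I_n -> S -> S) (T : S -> S).
Variables (r ri : S) (X nu : 'I_m -> S) (gi : 'I_n -> 'I_n -> S).
Hypothesis cf : coordinate_flow d T r ri X nu gi.

Local Notation D := (tgrad d X gi).
Local Notation xi := (unit_pos r X).
Local Notation A := (curv D nu).
Let se := flow_structure_equations cf.

Lemma sum_frame_jac a b :
  \sum_i \sum_j gi i j * jac d X i a * jac d X j b = proj nu xi a b.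
Proof.
rewrite -[RHS](D_X cf a b) /tgrad.
rewrite exchange_big; apply: eq_bigr => j _ /=; rewrite /frame mulr_suml.
by apply: eq_bigr => i _; rewrite (cf_giC cf) /jac; ring.
Qed.

(** The projections produced by [norm_pull] act trivially on [A], which is tangential in both
    indices. *)
Lemma norm_sff : \sum_(s : 2.-tuple 'I_n) \sum_(s' : 2.-tuple 'I_n)
    (\prod_a gi (tnth s a) (tnth s' a)) * tup2 (sffS d X nu) s * tup2 (sffS d X nu) s'
  = curv2 D nu.
Proof.
have e s : tup2 (sffS d X nu) s = pull (jac d X) (tup2 A) s.
  rewrite pull_tup2 /tup2 (sffS_pull cf).
  by apply: eq_bigr => a _; rewrite mulr_sumr; apply: eq_bigr => b _; rewrite mulrA.
under eq_bigr do under eq_bigr do rewrite !e.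
rewrite norm_pull sum_tuple_cons; apply: eq_bigr => a _.
rewrite sum_tuple_cons; apply: eq_bigr => b _; rewrite sum_tuple0.
rewrite sum_tuple_cons.
under eq_bigr do rewrite sum_tuple_cons.
under eq_bigr do under eq_bigr do rewrite sum_tuple0.
have c1 (y : 'I_m -> S) b' : \sum_c y c * A c b' = 0 -> \sum_c y c * A b' c = 0.
  by move=> h; apply: etrans h; apply: eq_bigr => c _; rewrite (curvC se).
have p1 a' b' : \sum_c proj nu xi a' c * A c b' = A a' b'.
  by apply: (proj_tangent (y := fun c => A c b')); [exact: nu_curv se b'|exact: xi_curv se b'].
have p2 a' b' : \sum_c proj nu xi a' c * A b' c = A b' a'.
  apply: (proj_tangent (y := fun c => A b' c)); apply: c1.
    exact: nu_curv se b'.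
  exact: xi_curv se b'.
have -> : \sum_a' \sum_b' (\prod_i0 \sum_i \sum_j gi i j
     * jac d X i (tnth (cons_tuple a (cons_tuple b [tuple])) i0)
     * jac d X j (tnth (cons_tuple a' (cons_tuple b' [tuple])) i0))
     * tup2 A (cons_tuple a (cons_tuple b [tuple]))
     * tup2 A (cons_tuple a' (cons_tuple b' [tuple])) =
   \sum_a' \sum_b' A a b * (proj nu xi a a' * (proj nu xi b b' * A a' b')).
  apply: eq_bigr => a' _; apply: eq_bigr => b' _.
  rewrite !big_ord_recl big_ord0 mulr1 -!tnth_behead_tuple !behead_cons.
  rewrite -!/(thead _) !thead_cons !sum_frame_jac /tup2 !behead_cons !thead_cons; ring.
under eq_bigr do rewrite -mulr_sumr -mulr_sumr p2.
by rewrite -mulr_sumr p1 expr2.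
Qed.

(** The derivative of [codazzi] has normal components, so the projections stay; [slice_nabla2A2_le]
    only bounds their entries. *)
Lemma norm_covd_covd_sff :
  let c4 := tup4 (covd3 d X gi (covd2 d X gi (sffS d X nu))) in
  let t4 := tup4 (fun f e a b => D f (codazzi D r nu xi e a b)) in
  \sum_(s : 4.-tuple 'I_n) \sum_(s' : 4.-tuple 'I_n)
    (\prod_a gi (tnth s a) (tnth s' a)) * c4 s * c4 s'
  = \sum_(w : 4.-tuple 'I_m) \sum_(w' : 4.-tuple 'I_m)
    (\prod_a proj nu xi (tnth w a) (tnth w' a)) * t4 w * t4 w'.
Proof.
move=> c4 t4.
have e s : c4 s = pull (jac d X) t4 s by rewrite pull_tup4 /c4 /tup4 /tup3 /tup2 (covd_covd_sff cf).
under eq_bigr do under eq_bigr do rewrite !e.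
rewrite norm_pull; apply: eq_bigr => w _; apply: eq_bigr => w' _; congr (_ * _ * _).
by apply: eq_bigr => a _; rewrite sum_frame_jac.
Qed.

(** Koszul's formula, doubled so that no division by 2 takes place in the ring; the unwanted second
    derivatives of [X] cancel because the [d i] commute. *)
Lemma gamma_metric l k i : gamma d X gi l k i *+ 2 = \sum_j gi l j *
  (d k (\sum_b d i (X b) * d j (X b)) + d i (\sum_b d k (X b) * d j (X b))
   - d j (\sum_b d k (X b) * d i (X b))).
Proof.
have e a b c : d a (\sum_b0 d b (X b0) * d c (X b0)) =
    \sum_b0 (d a (d b (X b0)) * d c (X b0)) + \sum_b0 (d b (X b0) * d a (d c (X b0))).
  rewrite (der_sum (cf_d cf a)) -big_split; apply: eq_bigr => b0 _.
  by rewrite (derM (cf_d cf a)).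
rewrite /gamma /frame.
under eq_bigr do rewrite mulr_suml.
rewrite exchange_big -sumrMnl; apply: eq_bigr => j _ /=.
rewrite !e -!big_split -sumrB mulr_sumr -sumrMnl; apply: eq_bigr => b _ /=.
by rewrite (cf_dC cf j k) (cf_dC cf j i) (cf_dC cf i k); ring.
Qed.

End FlowTensors.

(** * Time slices *)

Section Slices.
Variables (R : realType) (n : nat).
Local Notation V := 'rV[R]_n.
Local Notation E := (V * R)%type.

Definition slice (O : opens E) (t : R) : set V := [set w | oset O (w, t)].

Lemma pairr_continuous (t : R) (w : V) : {for w, continuous (fun w => (w, t) : E)}.
Proof.
rewrite /prop_for /continuous_at; apply: (@cvg_pair _ _ _ (nbhs w) (nbhs w) (nbhs t) _ _ _ id (cst t)).
  exact: cvg_id.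
exact: cvg_cst.
Qed.

Lemma slice_open O t : open (slice O t).
Proof. by apply: open_comp (oset_open O) => w _; exact: pairr_continuous. Qed.

Lemma slice_quotient (G : normedModType R) (F : E -> G) (v u : V) (t : R) :
  (fun h : R => h^-1 *: ((F \o shift (u, t)) (h *: ((v, 0) : E)) - F (u, t)))
  = (fun h : R => h^-1 *: (((fun w => F (w, t)) \o shift u) (h *: v) - F (u, t))).
Proof.
apply/funext => h; congr (_ *: (F _ - _)).
by rewrite -[LHS]/(h *: v + u, h *: 0 + t) scaler0 add0r.
Qed.

Lemma derive_slice (G : normedModType R) (F : E -> G) (v u : V) (t : R) :
  'D_(v, 0) F (u, t) = 'D_v (fun w => F (w, t)) u.
Proof. by rewrite /derive slice_quotient. Qed.

Lemma derivable_slice (G : normedModType R) (F : E -> G) (v u : V) (t : R) :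
  derivable F (u, t) (v, 0) -> derivable (fun w => F (w, t)) u v.
Proof. by rewrite /derivable slice_quotient. Qed.

Lemma smooth_slice (G : normedModType R) (O : opens E) (F : E -> G) t :
  smooth_open (oset O) F -> smooth_open (slice O t) (fun w => F (w, t)).
Proof.
move=> sF; apply: (@smooth_open_coind _ _ _
  (fun h => exists2 F : E -> G, smooth_open (oset O) F & h = fun w => F (w, t))).
- exact: slice_open.
- move=> _ [{sF}F sF ->] u Ou; split.
    apply: (@continuous_comp _ _ _ (fun w => (w, t)) F); first exact: pairr_continuous.
    exact: smooth_open_cont sF Ou.
  by move=> v; apply: derivable_slice; exact: smooth_open_derivable sF Ou.
- move=> _ v [{sF}F sF ->]; exists (fun w => 'D_(v, 0) F (w, t)).
    by exists ('D_(v, 0) F) => //; exact: smooth_open_derive sF.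
  by move=> u _; rewrite derive_slice.
- by exists F.
Qed.

End Slices.

Arguments slice_open {R n} O t.
Arguments smooth_slice {R n G O F} t _.

Section SliceGeometry.
Variables (R : realType) (n : nat) (O : opens ('rV[R]_n * R)%type).
Local Notation V := 'rV[R]_n.
Local Notation m := n.+2.
Variables (F N : V * R -> 'rV[R]_m).
Hypothesis ip : immersed_pair O F N.
Variables (t : R) (f nu : V -> 'rV[R]_m).
Local Notation U := (slice O t).
Hypothesis fE : forall w, U w -> f w = F (w, t).
Hypothesis nuE : forall w, U w -> nu w = N (w, t).
Local Notation S := (smooth_fun O).
Local Notation d := (fun i => @sder R _ O (sdir R i)).
Local Notation X := (posS ip).
Local Notation gi := (fun i j => invmetS ip i j).
Local Notation D := (tgrad d X gi).

Lemma slice_eq (f0 : V -> R) (phi : S) : (forall w, U w -> f0 w = phi (w, t)) ->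
  forall i w, U w -> partial i f0 w = sder (sdir R i) phi (w, t).
Proof.
move=> h i w Uw; apply: (etrans _ (esym (sderE (sdir R i) phi Uw))).
apply: (etrans _ (esym (derive_slice _ _ _ _))).
exact: (@derive_eq_on R V (Opens (slice_open O t)) f0 (fun w => phi (w, t)) _ w Uw h).
Qed.

Lemma slice_smooth_pos : smooth_open U f.
Proof.
apply: (@smooth_open_eq _ _ _ U (fun w => F (w, t)) f (slice_open O t) _
  (smooth_slice t (ip_F ip))) => w Uw.
by rewrite fE.
Qed.

Lemma slice_smooth_nor : smooth_open U nu.
Proof.
apply: (@smooth_open_eq _ _ _ U (fun w => N (w, t)) nu (slice_open O t) _
  (smooth_slice t (ip_N ip))) => w Uw.
by rewrite nuE.
Qed.

Lemma slice_pos b w : U w -> f w 0 b = X b (w, t).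
Proof. by move=> Uw; rewrite fE// /posS smkE. Qed.
Lemma slice_nor b w : U w -> nu w 0 b = norS ip b (w, t).
Proof. by move=> Uw; rewrite nuE// /norS smkE. Qed.

Lemma slice_jac_pos i b w : U w -> 'J f w i b = sder (sdir R i) (X b) (w, t).
Proof.
move=> Uw; apply: (etrans (jacobianE i b (slice_open O t) slice_smooth_pos Uw)).
exact: (slice_eq (f0 := fun y => f y 0 b) (@slice_pos b)).
Qed.

Lemma slice_jac_nor i b w : U w -> 'J nu w i b = sder (sdir R i) (norS ip b) (w, t).
Proof.
move=> Uw; apply: (etrans (jacobianE i b (slice_open O t) slice_smooth_nor Uw)).
exact: (slice_eq (f0 := fun y => nu y 0 b) (@slice_nor b)).
Qed.

Lemma slice_metS i j w : U w -> metric f w i j = metS ip i j (w, t).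
Proof.
move=> Uw; rewrite [in LHS]mxE [metS ip i j]mxE (smooth_fun_sum _ _ _ Uw); apply: eq_bigr => b _.
by rewrite (smooth_funM _ _ Uw) [_^T _ _]mxE !slice_jac_pos.
Qed.

Lemma slice_metric w : U w -> metric f w = met F (w, t).
Proof.
move=> Uw; apply/matrixP => i j; rewrite slice_metS// -(metS_val ip Uw).
by rewrite [RHS]mxE.
Qed.

Lemma slice_invmetric i j w : U w -> invmx (metric f w) i j = gi i j (w, t).
Proof. by move=> Uw; rewrite slice_metric// (invmetSE ip). Qed.

(** The tangential gradient for plain functions on a time slice: it depends on the immersion alone
    and not on a smooth extension to an open set of space-time. *)
Definition sgrad (h : V -> 'rV[R]_m) a (f0 : V -> R) (w : V) : R :=
  \sum_i (\sum_j invmx (metric h w) i j * partial j (fun y => h y 0 a) w) * partial i f0 w.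

Lemma slice_grad (f0 : V -> R) (phi : S) a : (forall w, U w -> f0 w = phi (w, t)) ->
  forall w, U w -> sgrad f a f0 w = D a phi (w, t).
Proof.
move=> h w Uw; rewrite /tgrad (smooth_fun_sum _ _ _ Uw); apply: eq_bigr => i _.
rewrite (smooth_funM _ _ Uw) (slice_eq h i Uw); congr (_ * _).
rewrite /frame (smooth_fun_sum _ _ _ Uw); apply: eq_bigr => j _.
by rewrite (smooth_funM _ _ Uw) slice_invmetric// (slice_eq (@slice_pos a) j Uw).
Qed.

Lemma slice_sff i j w : U w -> sff_mx f nu w i j = sffS d X (norS ip) i j (w, t).
Proof.
move=> Uw; rewrite mxE /sffS (smooth_fun_sum _ _ _ Uw); apply: eq_bigr => b _.
rewrite (smooth_funM _ _ Uw) [_^T _ _]mxE; congr (_ * _).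
  exact: slice_jac_nor.
exact: slice_jac_pos.
Qed.

Lemma slice_mean_curv w : U w -> mean_curv f nu w = meanc D (norS ip) (w, t).
Proof.
move=> Uw; rewrite -(trace_sffS d X (norS ip) (invmetS_sym ip)).
rewrite (smooth_fun_sum _ _ _ Uw); apply: eq_bigr => i _.
rewrite mxE (smooth_fun_sum _ _ _ Uw); apply: eq_bigr => j _.
by rewrite (smooth_funM _ _ Uw) slice_invmetric// slice_sff.
Qed.

Lemma slice_tensor_norm2 r (T : tensor R n r) (TS : r.-tuple 'I_n -> S) w : U w ->
  (forall s, T s w = TS s (w, t)) ->
  tensor_norm2 f T w = (\sum_(s : r.-tuple 'I_n) \sum_(s' : r.-tuple 'I_n)
    (\prod_a gi (tnth s a) (tnth s' a)) * TS s * TS s') (w, t).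
Proof.
move=> Uw h; rewrite (smooth_fun_sum _ _ _ Uw); apply: eq_bigr => s _.
rewrite (smooth_fun_sum _ _ _ Uw); apply: eq_bigr => s' _.
rewrite !(smooth_funM _ _ Uw) !h; congr (_ * _ * _).
rewrite -[RHS]/(sev Uw _) rmorph_prod; apply: eq_bigr => a _.
by rewrite slice_invmetric.
Qed.

Lemma slice_christoffel k i j w : U w ->
  (forall l c e, gamma d X gi l c e *+ 2 = \sum_j gi l j *
  (d c (\sum_b d e (X b) * d j (X b)) + d e (\sum_b d c (X b) * d j (X b))
   - d j (\sum_b d c (X b) * d e (X b)))) ->
  christoffel f k i j w = gamma d X gi k i j (w, t).
Proof.
move=> Uw g2; have := congr1 (fun h : S => h (w, t)) (g2 k i j).
rewrite (smooth_funMn _ _ Uw) -mulr_natl => e.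
have two0 : (2%:R : R) != 0 by rewrite pnatr_eq0.
apply: (mulfI two0); apply: (etrans _ (esym e)); rewrite /christoffel mulrA mulfV ?pnatr_eq0// mul1r.
rewrite (smooth_fun_sum _ _ _ Uw); apply: eq_bigr => l _.
rewrite (smooth_funM _ _ Uw) slice_invmetric//; congr (_ * _).
rewrite (smooth_funD _ _ Uw) (smooth_funD _ _ Uw) (smooth_funN _ Uw).
have p i' j' k' : partial k' (fun w0 => metric f w0 i' j') w =
    sder (sdir R k') (\sum_b d i' (X b) * d j' (X b)) (w, t).
  apply: slice_eq => // y Uy; rewrite slice_metS// /metS mxE; by [].
by rewrite !p.
Qed.

End SliceGeometry.

Section FlowSlice.
Variables (R : realType) (n : nat) (K : R) (O : opens ('rV[R]_n * R)%type).
Local Notation V := 'rV[R]_n.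
Local Notation m := n.+2.
Variables (F N : V * R -> 'rV[R]_m).
Hypothesis fl : chart_flow K O F N.
Variables (t : R) (f nu : V -> 'rV[R]_m).
Local Notation U := (slice O t).
Hypothesis fE : forall w, U w -> f w = F (w, t).
Hypothesis nuE : forall w, U w -> nu w = N (w, t).
Local Notation S := (smooth_fun O).
Local Notation ip := (fl_pair fl).
Local Notation d := (fun i => @sder R _ O (sdir R i)).
Local Notation X := (posS ip).
Local Notation gi := (fun i j => invmetS ip i j).
Local Notation D := (tgrad d X gi).
Local Notation xi := (unit_pos (scst O (Num.sqrt K)) X).
Let cf := chart_coordinate_flow fl.

Lemma tup2E (T : Type) (I : Type) (h : I -> I -> T) s :
  tup2 h s = h (tnth s ord0) (tnth s (lift ord0 ord0)).
Proof. by rewrite /tup2 /thead tnth_behead_tuple. Qed.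

Lemma tup3E (T : Type) (I : Type) (h : I -> I -> I -> T) s :
  tup3 h s = h (tnth s ord0) (tnth s (lift ord0 ord0)) (tnth s (lift ord0 (lift ord0 ord0))).
Proof. by rewrite /tup3 tup2E !tnth_behead_tuple. Qed.

Lemma slice_sff_tup2 s w : U w -> sff f nu s w = tup2 (sffS d X (norS ip)) s (w, t).
Proof.
move=> Uw; apply: (etrans (slice_sff ip fE nuE (tnth s ord0) (tnth s ord_max) Uw)).
by rewrite tnth_ord_max2.
Qed.

Lemma slice_A2 w : U w -> tensor_norm2 f (sff f nu) w = curv2 D (norS ip) (w, t).
Proof.
move=> Uw; rewrite -(norm_sff cf).
by apply: (slice_tensor_norm2 ip fE Uw) => s; exact: slice_sff_tup2.
Qed.

Lemma slice_gamma k i j w : U w -> christoffel f k i j w = gamma d X gi k i j (w, t).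
Proof. by move=> Uw; apply: (slice_christoffel fE k i j Uw) => l c e; exact: (gamma_metric cf). Qed.

Lemma slice_covd2 (T : tensor R n 2) (TS : 'I_n -> 'I_n -> S) :
  (forall s w, U w -> T s w = tup2 TS s (w, t)) ->
  forall s w, U w -> covd f T s w = tup3 (covd2 d X gi TS) s (w, t).
Proof.
move=> h s w Uw; rewrite /covd !big_ord_recl big_ord0 addr0 tup3E /covd2.
rewrite (smooth_funD _ _ Uw) (smooth_funD _ _ Uw) !(smooth_funN _ Uw) opprD addrA.
congr (_ - _ - _).
- apply: (slice_eq (O := O) (t := t)) Uw => y Uy; rewrite (h _ _ Uy) tup2E !tnth_behead_tuple.
  by [].
- rewrite (smooth_fun_sum _ _ _ Uw); apply: eq_bigr => l _.
  rewrite (smooth_funM _ _ Uw) (slice_gamma _ _ _ Uw) (h _ _ Uw) tup2E !tnth_mktuple/= !tnth_behead_tuple.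
  by [].
- rewrite (smooth_fun_sum _ _ _ Uw); apply: eq_bigr => l _.
  rewrite (smooth_funM _ _ Uw) (slice_gamma _ _ _ Uw) (h _ _ Uw) tup2E !tnth_mktuple/= !tnth_behead_tuple.
  by [].
Qed.

Lemma slice_covd3 (T : tensor R n 3) (TS : 'I_n -> 'I_n -> 'I_n -> S) :
  (forall s w, U w -> T s w = tup3 TS s (w, t)) ->
  forall s w, U w -> covd f T s w = tup4 (covd3 d X gi TS) s (w, t).
Proof.
move=> h s w Uw; rewrite /covd !big_ord_recl big_ord0 addr0 /tup4 tup3E !tnth_behead_tuple.
rewrite /covd3 !(smooth_funD _ _ Uw) !(smooth_funN _ Uw) !opprD !addrA.
congr (_ - _ - _ - _).
- apply: (slice_eq (O := O) (t := t)) Uw => y Uy; rewrite (h _ _ Uy) tup3E !tnth_behead_tuple.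
  by [].
- rewrite (smooth_fun_sum _ _ _ Uw); apply: eq_bigr => l _.
  rewrite (smooth_funM _ _ Uw) (slice_gamma _ _ _ Uw) (h _ _ Uw) tup3E !tnth_mktuple/= !tnth_behead_tuple.
  by [].
- rewrite (smooth_fun_sum _ _ _ Uw); apply: eq_bigr => l _.
  rewrite (smooth_funM _ _ Uw) (slice_gamma _ _ _ Uw) (h _ _ Uw) tup3E !tnth_mktuple/= !tnth_behead_tuple.
  by [].
- rewrite (smooth_fun_sum _ _ _ Uw); apply: eq_bigr => l _.
  rewrite (smooth_funM _ _ Uw) (slice_gamma _ _ _ Uw) (h _ _ Uw) tup3E !tnth_mktuple/= !tnth_behead_tuple.
  by [].
Qed.

Lemma unit_entry_le1 (y : 'I_m -> S) a w (Uw : U w) :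
  \sum_b y b * y b = 1 -> `|sev Uw (y a)| <= 1.
Proof.
move=> /(congr1 (sev Uw)); rewrite rmorph_sum rmorph1 => e.
rewrite -(@expr_le1 _ 2)// -normrX ger0_norm ?sqr_ge0// -e (bigD1 a)// rmorphM -expr2 lerDl.
by apply: sumr_ge0 => b _; rewrite rmorphM -expr2 sqr_ge0.
Qed.

(** As [nu] and [xi] are unit vectors, each entry of the projection is at most 3 in absolute value;
    four indices give [3^4 = 81] for each pair of tuples. *)
Lemma slice_nabla2A2_le w (B : R) : U w ->
  (forall a e b k, `|D a (codazzi D (scst O (Num.sqrt K)) (norS ip) xi e b k) (w, t)| <= B) ->
  tensor_norm2 f (covd f (covd f (sff f nu))) w
    <= 81 * #|{: 4.-tuple 'I_m}|%:R ^+ 2 * B ^+ 2.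
Proof.
move=> Uw hB.
rewrite (slice_tensor_norm2 ip fE Uw (TS := tup4 (covd3 d X gi (covd2 d X gi (sffS d X (norS ip))))));
  last first.
  move=> s; apply: (slice_covd3 _ _ Uw) => s' y Uy; apply: (slice_covd2 _ _ Uy) => s'' z Uz.
  exact: slice_sff_tup2.
rewrite (norm_covd_covd_sff cf) -[X in X <= _]/(sev Uw _) rmorph_sum.
have se := flow_structure_equations cf.
have p3 a b : `|sev Uw (proj (norS ip) xi a b)| <= 3.
  rewrite /proj !rmorphB (rmorphM _ (norS ip a)) (rmorphM _ (xi a) (xi b)) rmorph_nat.
  have n1 c := unit_entry_le1 c Uw (se_nunu se).
  have x1 c := unit_entry_le1 c Uw (se_xixi se).
  apply: le_trans (ler_normB _ _) _.
  apply: (@le_trans _ _ (`|(a == b)%:R| + `|sev Uw (norS ip a) * sev Uw (norS ip b)|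
      + `|sev Uw (xi a) * sev Uw (xi b)|)).
    by apply: lerD; [exact: ler_normB|exact: lexx].
  have -> : (3 : R) = 1 + 1 + 1 by ring.
  apply: lerD; last by rewrite normrM mulr_ile1.
  apply: lerD; last by rewrite normrM mulr_ile1.
  by case: (a == b); rewrite ?normr1 ?normr0.
have -> : 81 * #|{: 4.-tuple 'I_m}|%:R ^+ 2 * B ^+ 2 =
    \sum_(s : 4.-tuple 'I_m) \sum_(s' : 4.-tuple 'I_m) 3 ^+ 4 * B * B.
  by rewrite !sumr_const -mulrnA -[RHS]mulr_natl natrM; ring.
apply: ler_sum => s _; rewrite rmorph_sum; apply: ler_sum => s' _.
rewrite !rmorphM rmorph_prod; apply: le_trans (ler_norm _) _; rewrite !normrM.
have tB x : `|sev Uw (tup4 (fun a e b k => D a (codazzi D (scst O (Num.sqrt K)) (norS ip) xi e b k)) x)| <= B.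
  exact: hB.
apply: ler_pM; [by apply: mulr_ge0; exact: normr_ge0|exact: normr_ge0| |exact: tB].
apply: ler_pM; [exact: normr_ge0|exact: normr_ge0| |exact: tB].
rewrite normr_prod; apply: (@le_trans _ _ (\prod_(a < 4) 3)).
  by apply: ler_prod => a _; rewrite normr_ge0 p3.
by rewrite prodr_const card_ord.
Qed.

End FlowSlice.

(** * Change of chart *)

Lemma congruence_inverse (R : comUnitRingType) n (B G g : 'M[R]_n) :
  B *m g *m B^T \in unitmx -> G *m (B *m g *m B^T) = 1%:M ->
  B^T *m G *m B = invmx g.
Proof.
move=> ug Gg; have [ub gu] : B \in unitmx /\ g \in unitmx.
  by move: ug; rewrite unitmx_mul => /andP[]; rewrite unitmx_mul => /andP[].
have uT : B^T \in unitmx by rewrite unitmx_tr.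
have e : B^T *m G *m B *m g = 1%:M.
  rewrite -[LHS]mulmx1 -(mulmxV uT) mulmxA.
  have -> : B^T *m G *m B *m g *m B^T = B^T *m (G *m (B *m g *m B^T)) by rewrite !mulmxA.
  by rewrite Gg mulmx1.
by rewrite -[LHS]mulmx1 -(mulmxV gu) mulmxA e mul1mx.
Qed.

Section ChartChange.
Variables (R : realType) (n : nat).
Local Notation V := 'rV[R]_n.
Local Notation m := n.+2.
Variables (O O' : opens (V * R)%type) (F N F' N' : V * R -> 'rV[R]_m).
Hypotheses (ip : immersed_pair O F N) (ip' : immersed_pair O' F' N').
Variables (t s : R) (W : set V) (tau : V -> V).
Hypothesis oW : open W.
Hypothesis stau : smooth_open W tau.
Hypothesis WO : forall w, W w -> slice O t w.
Hypothesis WO' : forall w, W w -> slice O' t (tau w).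
Hypothesis Ftau : forall w, W w -> F (w, t) = F' (tau w, t).
Hypothesis Ntau : forall w, W w -> N (w, t) = s *: N' (tau w, t).
Local Notation S := (smooth_fun O).
Local Notation S' := (smooth_fun O').
Local Notation d := (fun i => @sder R _ O (sdir R i)).
Local Notation d' := (fun i => @sder R _ O' (sdir R i)).
Local Notation D := (tgrad d (posS ip) (fun i j => invmetS ip i j)).
Local Notation D' := (tgrad d' (posS ip') (fun i j => invmetS ip' i j)).

(** The factor [c] records the change of sign of the normal between the two charts. The relation
    concerns a single time slice. *)
Definition related (c : R) (phi : S) (phi' : S') :=
  forall w, W w -> phi (w, t) = c * phi' (tau w, t).

Definition jtau w : 'M[R]_n :=
  \matrix_(i, j) 'D_(delta_mx 0 i : V) (fun y => tau y 0 j) w.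

Lemma related_der (phi : S) (phi' : S') i w : related 1 phi phi' -> W w ->
  d i phi (w, t) = \sum_j jtau w i j * d' j phi' (tau w, t).
Proof.
move=> rel Ww.
have e1 : 'D_(delta_mx 0 i : V) (fun y => phi (y, t)) w = d i phi (w, t).
  by apply: (slice_eq (O := O) (t := t)) => //; exact: WO.
rewrite -e1.
have -> : 'D_(delta_mx 0 i : V) (fun y => phi (y, t)) w =
    'D_(delta_mx 0 i : V) ((fun y => phi' (y, t)) \o tau) w.
  apply: (@derive_eq_on R V (Opens oW)) => // y Wy; rewrite -[RHS]mul1r; exact: rel.
have sphi := smooth_slice t (smooth_fun_smooth phi').
rewrite (derive_compE (delta_mx 0 i) oW (slice_open O' t) stau sphi Ww (WO' Ww)).
apply: eq_bigr => j _; rewrite [jtau w i j]mxE; congr (_ * _).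
exact: (slice_eq (O := O') (t := t) (f0 := fun y => phi' (y, t)) (fun _ _ => erefl) j (WO' Ww)).
Qed.

Lemma related_pos b : related 1 (posS ip b) (posS ip' b).
Proof.
move=> w Ww; rewrite mul1r /posS !smkE; [|exact: WO'|exact: WO].
by rewrite Ftau.
Qed.

Lemma related_met w : W w -> met F (w, t) = jtau w *m met F' (tau w, t) *m (jtau w)^T.
Proof.
move=> Ww; apply/matrixP => i k.
rewrite -(metS_val ip (WO Ww)) -(metS_val ip' (WO' Ww)) [LHS]mxE [metS ip i k]mxE /sev (smooth_fun_sum _ _ _ (WO Ww)).
have e b i' : d i' (posS ip b) (w, t) =
    \sum_j jtau w i' j * d' j (posS ip' b) (tau w, t).
  exact: related_der (related_pos b) Ww.
have eM b : (d i (posS ip b) * d k (posS ip b)) (w, t) =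
    (\sum_j jtau w i j * d' j (posS ip' b) (tau w, t))
    * (\sum_j jtau w k j * d' j (posS ip' b) (tau w, t)).
  by rewrite (smooth_funM _ _ (WO Ww)); congr (_ * _); exact: e.
rewrite (eq_bigr _ (fun b _ => eM b)).
rewrite [RHS]mxE.
transitivity (\sum_l \sum_j \sum_b jtau w i j * d' j (posS ip' b) (tau w, t)
   * (jtau w k l * d' l (posS ip' b) (tau w, t))).
  rewrite [RHS](eq_bigr (fun l => \sum_b \sum_j jtau w i j * d' j (posS ip' b) (tau w, t)
   * (jtau w k l * d' l (posS ip' b) (tau w, t)))) => [|l _]; last by rewrite exchange_big.
  rewrite exchange_big; apply: eq_bigr => b _ /=; rewrite mulr_sumr.
  by apply: eq_bigr => l _; rewrite mulr_suml.
apply: eq_bigr => l _; rewrite [(_ *m _) i l]mxE mulr_suml; apply: eq_bigr => j _.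
rewrite [map_mx _ _ j l]mxE [metS ip' j l]mxE (smooth_fun_sum _ _ _ (WO' Ww)) mulr_sumr mulr_suml.
apply: eq_bigr => b _; rewrite [(jtau w)^T l k]mxE (smooth_funM _ _ (WO' Ww)); ring.
Qed.

(** The differential, the Jacobian and the metric all transform by [jtau], which cancels in the
    product of differential, inverse metric and Jacobian by [congruence_inverse]. *)
Lemma related_grad1 (phi : S) (phi' : S') a : related 1 phi phi' ->
  related 1 (D a phi) (D' a phi').
Proof.
move=> rel w Ww; rewrite mul1r.
have Ow := WO Ww; have Ow' := WO' Ww.
pose J : 'M[R]_(n, m) := \matrix_(i, b) d i (posS ip b) (w, t).
pose J' : 'M[R]_(n, m) := \matrix_(i, b) d' i (posS ip' b) (tau w, t).
pose p : 'rV[R]_n := \row_i d i phi (w, t).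
pose p' : 'rV[R]_n := \row_i d' i phi' (tau w, t).
have JB : J = jtau w *m J'.
  apply/matrixP => i b; rewrite [LHS]mxE (related_der i (related_pos b) Ww) [RHS]mxE.
  by apply: eq_bigr => j _; rewrite [J' j b]mxE.
have pB : p = p' *m (jtau w)^T.
  apply/rowP => i; rewrite [LHS]mxE (related_der i rel Ww) [RHS]mxE.
  by apply: eq_bigr => j _; rewrite [(jtau w)^T j i]mxE [p' 0 j]mxE mulrC.
have gB := related_met Ww.
have ug := ip_met ip Ow.
have GB : (jtau w)^T *m invmx (met F (w, t)) *m jtau w = invmx (met F' (tau w, t)).
  by apply: congruence_inverse; rewrite -gB// mulVmx.
have DE : D a phi (w, t) = (p *m invmx (met F (w, t)) *m J) 0 a.
  rewrite /tgrad (smooth_fun_sum _ _ _ Ow) -mulmxA [RHS]mxE; apply: eq_bigr => i _.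
  rewrite (smooth_funM _ _ Ow) [p 0 i]mxE mulrC; congr (_ * _).
  rewrite /frame (smooth_fun_sum _ _ _ Ow) [RHS]mxE; apply: eq_bigr => j _.
  by rewrite (smooth_funM _ _ Ow) (invmetSE ip _ _ Ow) [J j a]mxE.
have DE' : D' a phi' (tau w, t) = (p' *m invmx (met F' (tau w, t)) *m J') 0 a.
  rewrite /tgrad (smooth_fun_sum _ _ _ Ow') -mulmxA [RHS]mxE; apply: eq_bigr => i _.
  rewrite (smooth_funM _ _ Ow') [p' 0 i]mxE mulrC; congr (_ * _).
  rewrite /frame (smooth_fun_sum _ _ _ Ow') [RHS]mxE; apply: eq_bigr => j _.
  by rewrite (smooth_funM _ _ Ow') (invmetSE ip' _ _ Ow') [J' j a]mxE.
by rewrite DE DE' -GB JB pB !mulmxA.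
Qed.

(** Absorbing the factor into [phi'] reduces [related_grad] to the factor 1. *)
Lemma related_scst c (phi : S) (phi' : S') :
  related c phi phi' <-> related 1 phi (scst O' c * phi').
Proof.
by split=> h w Ww; have := h w Ww; rewrite (smooth_funM _ _ (WO' Ww)) (scstE c (WO' Ww)) mul1r.
Qed.

Lemma related_grad c (phi : S) (phi' : S') a : related c phi phi' ->
  related c (D a phi) (D' a phi').
Proof.
move=> /related_scst h0; have h := related_grad1 a h0; apply/related_scst => w Ww.
rewrite h//; congr (_ * _).
rewrite /tgrad mulr_sumr; congr (smooth_fun_val _ _); apply: eq_bigr => i _.
by rewrite sderM sder_cst mul0r add0r mulrCA.
Qed.

Lemma related_nor b : related s (norS ip b) (norS ip' b).
Proof.
move=> w Ww; rewrite /norS !smkE; [|exact: WO'|exact: WO].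
by rewrite Ntau// mxE.
Qed.

Hypothesis s2 : s ^+ 2 = 1.

Lemma related_sqnorm (I : finType) (P : I -> S) (P' : I -> S') :
  (forall i, related s (P i) (P' i)) -> related 1 (sqnorm P) (sqnorm P').
Proof.
move=> h w Ww; rewrite mul1r (smooth_fun_sum _ _ _ (WO Ww)) (smooth_fun_sum _ _ _ (WO' Ww)).
apply: eq_bigr => i _; rewrite (smooth_funX _ _ (WO Ww)) (smooth_funX _ _ (WO' Ww)).
by rewrite h// exprMn s2 mul1r.
Qed.

Local Notation A := (curv_jet D (norS ip)).
Local Notation A' := (curv_jet D' (norS ip')).

Lemma related_curv q : related s (A q) (A' q).
Proof. exact: related_grad (related_nor _). Qed.

Lemma related_djet (I : finType) (P : I -> S) (P' : I -> S') :
  (forall i, related s (P i) (P' i)) -> forall q, related s (djet D P q) (djet D' P' q).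
Proof. by move=> h q; exact: related_grad (h _). Qed.

Lemma related_meanc2 : related 1 (meanc D (norS ip) ^+ 2) (meanc D' (norS ip') ^+ 2).
Proof.
move=> w Ww; rewrite mul1r (smooth_funX _ _ (WO Ww)) (smooth_funX _ _ (WO' Ww)).
have -> : meanc D (norS ip) (w, t) = s * meanc D' (norS ip') (tau w, t).
  rewrite (smooth_fun_sum _ _ _ (WO Ww)) (smooth_fun_sum _ _ _ (WO' Ww)) mulr_sumr.
  by apply: eq_bigr => a _; exact: (related_curv (a, a)).
by rewrite exprMn s2 mul1r.
Qed.

End ChartChange.

(** * Local charts of the flow *)

Lemma gram_unitmx (R : realFieldType) n m (J : 'M[R]_(n, m)) :
  row_free J -> J *m J^T \in unitmx.
Proof.
move=> fJ; rewrite -row_free_unit -kermx_eq0; apply/rowV0P => v /sub_kermxP vJ.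
have vJ0 : v *m J = 0.
  have e : (v *m J) *m (v *m J)^T = 0.
    by rewrite trmx_mul mulmxA -(mulmxA v) vJ mul0mx.
  have /matrixP/(_ 0 0) := e; rewrite [in RHS]mxE mxE => e0.
  apply/rowP => j; rewrite [RHS]mxE; apply/eqP; rewrite -sqrf_eq0; apply/eqP.
  move: e0; under eq_bigr do rewrite [_^T _ _]mxE -expr2.
  by move=> /psumr_eq0P; apply => // i _; exact: sqr_ge0.
by apply: (row_free_inj fJ); rewrite vJ0 mul0mx.
Qed.

Section NonvanishingSet.
Variables (R : realType) (E : normedModType R) (O : opens E) (f : smooth_fun O).

Lemma nonvanishing_open : open (oset O `&` [set x | f x != 0]).
Proof.
rewrite openE => x [Ox fx]; rewrite /interior/=.
have cf := smooth_open_cont (smooth_fun_smooth f) Ox.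
have nO : nbhs x (oset O) by apply: open_nbhs_nbhs; split => //; exact: oset_open.
have nf : nbhs x [set y | f y != 0] by exact: (cvgr_neq0 _ cf fx).
exact: filterI nO nf.
Qed.

End NonvanishingSet.

(** Turns the time derivative within [[0, T)] into a two-sided one at interior times. *)
Lemma shift_within (R : realType) (A : set R) (t : R) : nbhs t A ->
  (fun h : R => h + t) @ 0^' --> within A t^'.
Proof.
move=> nA P tP.
have nP : nbhs t (fun s => s != t -> A s -> P s) by exact: tP.
have /nbhs_ballP[e /= e0 B] : nbhs t ((fun s => s != t -> A s -> P s) `&` A) by exact: filterI.
exists e => //= h he h0.
have [|P1 A1] := B (h + t).
  by move: he; rewrite -!ball_normE/= opprD addrCA subrr addr0 sub0r.
by apply: P1 => //; rewrite -subr_eq0 addrK.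
Qed.

Section LocalCharts.
Variables (R : realType) (n : nat) (K : R) (M : closedManifold R n) (T : \bar R).
Variables (X : R -> M -> 'rV[R]_n.+2) (nu : R -> normals M).
Hypothesis K_gt0 : 0 < K.
Hypothesis flow : is_mcf K T X nu.
Local Notation V := 'rV[R]_n.
Local Notation E := (V * R)%type.
Local Notation m := n.+2.

Definition chart_pos (c : chart R n M) (z : E) : 'rV[R]_m := X z.2 (param c z.1).
Definition chart_nor (c : chart R n M) (z : E) : 'rV[R]_m := nu z.2 c (param c z.1).

(** [F] and [N] are smooth extensions of the flow near a point of space-time, possibly to negative
    times; only at times in [[0, T)] do they agree with it. *)
Record local_pair (c : chart R n M) (O : opens E) (F N : E -> 'rV[R]_m) : Prop := LocalPair {
  lp_pair : immersed_pair O F N;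
  lp_codom : forall z, oset O z -> (coord c @` dom c) z.1;
  lp_pos : forall z, oset O z -> times T z.2 -> F z = chart_pos c z;
  lp_nor : forall z, oset O z -> times T z.2 -> N z = chart_nor c z
}.

Lemma local_pair_exists c t p : atlas c -> times T t -> dom c p ->
  exists (O : opens E) F N, local_pair c O F N /\ oset O (coord c p, t).
Proof.
move=> ac tT cp; have [smooth geom _] := flow.
have [sX sN] := smooth c ac.
have Up : (coord c @` dom c) (coord c p) by exists p.
have [W1 [F [oW1 W1z sF Fe]]] := sX (coord c p, t) (conj Up tT).
have [W2 [N [oW2 W2z sN' Ne]]] := sN (coord c p, t) (conj Up tT).
have oU : open [set z : E | (coord c @` dom c) z.1].
  have := @open_comp E V fst (coord c @` dom c); apply; last exact: open_codom.
  by move=> z _; exact: cvg_fst.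
have oO0 : open ((W1 `&` W2) `&` [set z : E | (coord c @` dom c) z.1]).
  by do 2 apply: openI => //.
pose O0 := Opens oO0.
have sF0 : smooth_open (oset O0) F by apply: smooth_openS sF => z [[]].
have sN0 : smooth_open (oset O0) N by apply: smooth_openS sN' => z [[]].
pose pos b : smooth_fun O0 := smk (O := O0) (smooth_open_coord b oO0 sF0).
pose gS : 'M[smooth_fun O0]_n :=
  \matrix_(i, j) \sum_b sder (sdir R i) (pos b) * sder (sdir R j) (pos b).
have gSE z (Oz : oset O0 z) : map_mx (sev Oz) gS = met F z.
  apply/matrixP => i j; rewrite mxE mxE [RHS]mxE /sev (smooth_fun_sum _ _ _ Oz).
  apply: eq_bigr => b _; rewrite (smooth_funM _ _ Oz).
  have dE k : sder (sdir R k) (pos b) z = 'D_(sdir R k) (fun y => F y 0 b) z.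
    apply: (etrans (sderE (sdir R k) (pos b) Oz)).
    by apply: (derive_eq_on (O := O0)) Oz _ => y Oy; exact: smkE.
  by rewrite !dE.
have detE z (Oz : oset O0 z) : (\det gS) z = \det (met F z).
  by rewrite -(gSE z Oz) det_map_mx.
(* The extension need not be an immersion everywhere on [O0]; it becomes one on the subset where the
   metric determinant does not vanish. *)
pose O := Opens (nonvanishing_open (\det gS)).
have OO0 : oset O `<=` oset O0 by move=> z [].
have Oz : oset O (coord c p, t).
  have O0z : oset O0 (coord c p, t) by [].
  split => //=; rewrite (detE _ O0z).
  have [[_ im] _] := geom t tT; have [sf rf] := im c ac.
  have oU' : open (coord c @` dom c) by exact: open_codom.
  have metE : met F (coord c p, t) = 'J (X t \o param c) (coord c p) *m ('J (X t \o param c) (coord c p))^T.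
    apply/matrixP => i j; rewrite mxE [RHS]mxE; apply: eq_bigr => b _.
    have JE k : 'J (X t \o param c) (coord c p) k b = 'D_(sdir R k) (fun y => F y 0 b) (coord c p, t).
      rewrite (jacobianE k b oU' sf Up); apply: (etrans _ (esym (derive_slice _ _ _ _))).
      apply: (@derive_eq_on R V (Opens (slice_open O0 t))) => [|w [[W1w _] Uw]]; first exact: O0z.
      by rewrite /= Fe.
    by rewrite [_^T _ _]mxE !JE.
  by rewrite metE -unitfE -unitmxE; apply: gram_unitmx; exact: rf.
exists O, F, N; split => //; split.
- split.
  + exact: (smooth_openS OO0 sF0).
  + exact: (smooth_openS OO0 sN0).
  + by move=> z [ O0z d0]; rewrite unitmxE unitfE -(detE z O0z).
- by move=> z [[_ Uz] _].
- by move=> z [[[ W1z' _] Uz] _] zT; apply: Fe.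
- by move=> z [[[_ W2z'] Uz] _] zT; apply: Ne.
Qed.

Definition open_times : set R := [set t | 0 < t /\ (t%:E < T)%E].

Lemma open_timesT t : open_times t -> times T t.
Proof. by move=> [t0 tT]; split => //; exact: ltW. Qed.

Lemma open_times_open : open open_times.
Proof.
have -> : open_times = [set t | 0 < t] `&` [set t : R | (t%:E < T)%E].
  by apply/seteqP; split => t.
apply: openI; first exact: open_gt.
case: T => [r| |].
- have -> : [set t : R | (t%:E < r%:E)%E] = [set t | t < r].
    by apply/seteqP; split => t /=; rewrite lte_fin.
  exact: open_lt.
- have -> : [set t : R | (t%:E < +oo)%E] = setT.
    by apply/seteqP; split => t //= _; exact: ltry.
  exact: openT.
- have -> : [set t : R | (t%:E < -oo)%E] = set0.
    by apply/seteqP; split => t.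
  exact: open0.
Qed.

(** The geometric relations and the evolution equation of the extension are inherited from the flow
    at times where both agree in a whole neighbourhood, hence the restriction to positive times. *)
Record local_flow (c : chart R n M) (O : opens E) (F N : E -> 'rV[R]_m) : Prop := LocalFlow {
  lf_pair : local_pair c O F N;
  lf_flow : chart_flow K O F N;
  lf_times : forall z, oset O z -> open_times z.2
}.

Lemma local_pair_slices c O F N t : local_pair c O F N -> times T t ->
  (forall w, slice O t w -> (X t \o param c) w = F (w, t)) /\
  (forall w, slice O t w -> (nu t c \o param c) w = N (w, t)).
Proof.
by move=> lp tT; split => w Ow; apply/esym; [exact: (lp_pos lp Ow tT)|exact: (lp_nor lp Ow tT)].
Qed.

Lemma local_time_derivative c O F N z b : atlas c -> local_pair c O F N -> oset O z ->
  open_times z.2 -> 'D_(tdir R n) (fun y => F y 0 b) z =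
    - Hc (X z.2) (nu z.2) c (param c z.1) * N z 0 b.
Proof.
move=> ac lp Oz zt; have [_ _ mcf] := flow; have zT := open_timesT zt.
have [q cq qz] := lp_codom lp Oz.
have cp : dom c (param c z.1) by rewrite -qz coordK.
have lim := mcf z.2 zT c (param c z.1) ac cp.
have nbT : nbhs (z.2 : R) (times T).
  apply: (@filterS R (nbhs (z.2 : R)) _ _ _ open_timesT).
  by apply: open_nbhs_nbhs; split => //; exact: open_times_open.
have sh := shift_within nbT.
have lim2 := cvg_comp _ _ sh lim.
have dF : derivable (fun y => F y 0 b) z (tdir R n).
  exact: smooth_open_derivable (smooth_open_coord b (oset_open O) (ip_F (lp_pair lp))) Oz.
have lim3 : h^-1 *: (F (h *: tdir R n + z) 0 b - F z 0 b) @[h --> 0^'] -->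
    (- Hc (X z.2) (nu z.2) c (param c z.1) *: nu z.2 c (param c z.1)) 0 b.
  have lim4 := cvg_comp _ _ lim2 (@coord_continuous R 1 m 0 b _).
  apply: cvg_trans lim4; apply: near_eq_cvg.
  have cl : (fun h : R => h *: tdir R n + z) @ 0 --> z.
    rewrite -[X in _ --> X]add0r -(scale0r (tdir R n)); apply: cvgD; last exact: cvg_cst.
    exact: scalel_continuous.
  have nO : nbhs z (oset O) by apply: open_nbhs_nbhs; split => //; exact: oset_open.
  have near0 : nbhs (0 : R) (fun h : R => oset O (h *: tdir R n + z)) by exact: cl nO.
  have ct : (fun h : R => h + z.2) @ 0 --> z.2.
    rewrite -[X in _ --> X]add0r; apply: cvgD; [exact: cvg_id|exact: cvg_cst].
  have nT : nbhs z.2 open_times by apply: open_nbhs_nbhs; split => //; exact: open_times_open.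
  have nearT : nbhs (0 : R) (fun h : R => open_times (h + z.2)) by exact: ct nT.
  apply: cvg_within; apply: filterS2 near0 nearT => h Oh /open_timesT Th.
  have hz : h *: tdir R n + z = (z.1, h + z.2).
    by rewrite -[LHS]/(h *: 0 + z.1, h *: 1 + z.2) scaler0 add0r -[h *: 1]/(h * 1) mulr1.
  rewrite /= addrK [LHS]mxE [in LHS]mxE [in LHS]mxE; congr (_ * _).
  rewrite (lp_pos lp Oz zT) (lp_pos lp Oh); last by rewrite hz.
  by rewrite hz.
have -> : - Hc (X z.2) (nu z.2) c (param c z.1) * N z 0 b =
    (- Hc (X z.2) (nu z.2) c (param c z.1) *: nu z.2 c (param c z.1)) 0 b.
  by rewrite [RHS]mxE (lp_nor lp Oz zT).
exact: cvg_lim lim3.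
Qed.

Lemma local_pairS c (O O' : opens E) F N : oset O' `<=` oset O ->
  local_pair c O F N -> local_pair c O' F N.
Proof.
move=> OO [[sF sN mu] cod pos nor]; split.
- split; [exact: (smooth_openS OO sF)|exact: (smooth_openS OO sN)|].
  by move=> z /OO Oz; exact: mu.
- by move=> z /OO Oz; exact: cod.
- by move=> z /OO Oz; exact: pos.
- by move=> z /OO Oz; exact: nor.
Qed.

Lemma local_pair_point c O F N z : local_pair c O F N -> oset O z ->
  dom c (param c z.1) /\ coord c (param c z.1) = z.1.
Proof. by move=> lp Oz; have [q cq <-] := lp_codom lp Oz; rewrite coordK. Qed.

Lemma trace_sffE (O : opens E) (F N : E -> 'rV[R]_m) (ip : immersed_pair O F N) z : oset O z ->
  meanc (tgrad (fun i => @sder R _ O (sdir R i)) (posS ip) (fun i j => invmetS ip i j))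
    (norS ip) z = trace_sff F N z.
Proof.
move=> Oz; rewrite (smooth_fun_sum _ _ _ Oz); apply: eq_bigr => a _.
rewrite (smooth_fun_sum _ _ _ Oz); apply: eq_bigr => i _.
rewrite (smooth_funM _ _ Oz) (sder_norS ip _ _ Oz); congr (_ * _).
rewrite (smooth_fun_sum _ _ _ Oz); apply: eq_bigr => j _.
by rewrite (smooth_funM _ _ Oz) (sder_posS ip _ _ Oz) (invmetSE ip _ _ Oz).
Qed.

Lemma local_Hc c O F N (lp : local_pair c O F N) z : oset O z -> times T z.2 ->
  Hc (X z.2) (nu z.2) c (param c z.1) =
  meanc (tgrad (fun i => @sder R _ O (sdir R i)) (posS (lp_pair lp))
    (fun i j => invmetS (lp_pair lp) i j)) (norS (lp_pair lp)) z.
Proof.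
move=> Oz zT; have [fE nuE] := local_pair_slices lp zT.
have [_ cK] := local_pair_point lp Oz.
have Uz : slice O z.2 z.1 by rewrite /slice/= -surjective_pairing.
rewrite /Hc cK; apply: (etrans (slice_mean_curv (lp_pair lp) fE nuE Uz)).
by rewrite -surjective_pairing.
Qed.

Lemma local_flow_exists c t p : atlas c -> open_times t -> dom c p ->
  exists (O : opens E) F N, local_flow c O F N /\ oset O (coord c p, t).
Proof.
move=> ac ot cp; have [_ geom _] := flow.
have [ O1 [F [N [lp1 Oz1]]]] := local_pair_exists ac (open_timesT ot) cp.
have oO : open (oset O1 `&` (@snd V R @^-1` open_times)).
  apply: openI (oset_open O1) _.
  have := @open_comp E R snd open_times; apply; last exact: open_times_open.
  by move=> z _; exact: cvg_snd.
pose O := Opens oO.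
have lp : local_pair c O F N by apply: local_pairS lp1 => z [].
have zt z : oset O z -> open_times z.2 by move=> [].
exists O, F, N; split; last by [].
split => //; pose ip := lp_pair lp; split => //.
- move=> z Oz; have zT := open_timesT (zt z Oz); have [[sph _] _] := geom z.2 zT.
  by rewrite (lp_pos lp Oz zT); exact: sph.
- move=> z Oz; have zT := open_timesT (zt z Oz); have [_ un] := geom z.2 zT.
  have [cq _] := local_pair_point lp Oz; have [_ /(_ _ cq)[n1 _ _]] := un c ac.
  by rewrite (lp_nor lp Oz zT).
- move=> z Oz; have zT := open_timesT (zt z Oz); have [_ un] := geom z.2 zT.
  have [cq _] := local_pair_point lp Oz; have [_ /(_ _ cq)[_ n2 _]] := un c ac.
  by rewrite (lp_nor lp Oz zT) (lp_pos lp Oz zT).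
- move=> z i Oz; have zT := open_timesT (zt z Oz); have [_ un] := geom z.2 zT.
  have [cq cK] := local_pair_point lp Oz; have [_ /(_ _ cq)[_ _ n3]] := un c ac.
  have [fE nuE] := local_pair_slices lp zT.
  have Uz : slice O z.2 z.1 by rewrite /slice/= -surjective_pairing.
  move: n3; rewrite cK => /matrixP/(_ 0 i); rewrite [RHS]mxE mxE => n3.
  apply: etrans n3; apply: eq_bigr => b _; rewrite (lp_nor lp Oz zT) [_^T _ _]mxE.
  rewrite (slice_jac_pos ip fE i b Uz); congr (_ * _).
  by rewrite -surjective_pairing (sder_posS ip _ _ Oz).
- move=> z b Oz; rewrite (local_time_derivative b ac lp Oz (zt z Oz)).
  by rewrite (local_Hc lp Oz (open_timesT (zt z Oz))) (trace_sffE _ Oz).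
Qed.

End LocalCharts.

Lemma mulmx_dotp (R : realType) m (x y : 'rV[R]_m) : x *m y^T = (dotp x y)%:M.
Proof.
apply/matrixP => i j; rewrite !ord1 !mxE/=.
by apply: eq_bigr => c _; rewrite mxE.
Qed.

(** * Uniqueness of the normal up to sign *)

Section Normals.
Variables (R : realType) (n : nat) (K : R) (M : closedManifold R n).
Local Notation V := 'rV[R]_n.
Local Notation m := n.+2.
Variables (F : M -> 'rV[R]_m) (nu : normals M).
Hypothesis K_gt0 : 0 < K.
Hypothesis imm : is_immersion K F.
Hypothesis unor : is_unit_normal F nu.

Lemma position_tangent (c : chart R n M) p : atlas c -> dom c p ->
  F p *m ('J (F \o param c) (coord c p))^T = 0.
Proof.
move=> ac cp; have [sph im] := imm; have [sf _] := im c ac.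
have oU : open (coord c @` dom c) by exact: open_codom.
have Up : (coord c @` dom c) (coord c p) by exists p.
pose O := Opens oU.
pose pos b : smooth_fun O := smk (O := O) (smooth_open_coord b oU sf).
have posE b w : oset O w -> pos b w = F (param c w) 0 b by exact: smkE.
have FF : \sum_b pos b * pos b = scst O K^-1.
  apply: smooth_fun_eq => y Oy; rewrite (scstE _ Oy) (smooth_fun_sum _ _ _ Oy).
  apply: (etrans _ (sph (param c y))).
  by apply: eq_bigr => b _; rewrite (smooth_funM _ _ Oy) !(posE _ _ Oy).
apply/rowP => i; rewrite mxE [RHS]mxE.
have hd : derivation (@sder R V O (delta_mx 0 i)).
  by split=> f g; [exact: sderD|exact: sderM].
have := congr1 (fun g => sder (delta_mx 0 i) g (coord c p)) FF.
have -> : sder (delta_mx 0 i) (\sum_b pos b * pos b)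
    = (\sum_b pos b * sder (delta_mx 0 i) (pos b)) *+ 2.
  rewrite (der_sum hd) -sumrMnl; apply: eq_bigr => b _.
  by rewrite (derM hd); ring.
rewrite sder_cst (smooth_fun0 (O := O) Up) (smooth_funMn (O := O) _ _ Up).
move=> /eqP; rewrite mulrn_eq0/= => /eqP e.
apply: etrans e; rewrite (smooth_fun_sum (O := O) _ _ _ Up); apply: eq_bigr => b _.
rewrite (smooth_funM (O := O) _ _ Up) (posE _ _ Up) coordK//; congr (_ * _).
rewrite [LHS]mxE (jacobianE i b oU sf Up); apply: (etrans _ (esym (sderE (O := O) (delta_mx 0 i) (pos b) Up))).
by apply: (derive_eq_on (O := O)) Up _ => y Oy; rewrite (posE _ _ Oy).
Qed.

Definition overlap (c c' : chart R n M) : set V := coord c @` (dom c `&` dom c').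

Lemma overlap_open (c c' : chart R n M) : open (overlap c c').
Proof.
have oU : open (coord c @` dom c) by exact: open_codom.
rewrite openE => _ [p [cp c'p] <-]; rewrite /interior/=.
have Up : (coord c @` dom c) (coord c p) by exists p.
have nU : nbhs (coord c p) (coord c @` dom c) by exact: open_nbhs_nbhs.
have nD : nbhs (coord c p) (param c @^-1` dom c').
  apply: (param_cont Up); rewrite coordK//.
  by apply: open_nbhs_nbhs; split => //; exact: open_dom.
apply: filterS2 nU nD => _ [q cq <-] /=; rewrite coordK// => c'q.
by exists q.
Qed.

Lemma overlapP (c c' : chart R n M) w : overlap c c' w ->
  [/\ dom c (param c w), dom c' (param c w), coord c (param c w) = w &
    param c' (coord c' (param c w)) = param c w].
Proof. by move=> [p [cp c'p] <-]; rewrite !coordK. Qed.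

Definition transition (c c' : chart R n M) (w : V) : V := coord c' (param c w).

Lemma jacobian_transition (c c' : chart R n M) w : atlas c -> atlas c' -> overlap c c' w ->
  'J (F \o param c) w = jtau (transition c c') w *m 'J (F \o param c') (transition c c' w).
Proof.
move=> ac ac' Ow; have [_ im] := imm; have [sf _] := im c ac; have [sf' _] := im c' ac'.
have oU : open (coord c @` dom c) by exact: open_codom.
have oU' : open (coord c' @` dom c') by exact: open_codom.
have [cw c'w cK c'K] := overlapP Ow.
have Uw : (coord c @` dom c) w by exists (param c w).
have Uw' : (coord c' @` dom c') (transition c c' w) by exists (param c w).
have oV := @overlap_open c c'.
apply/matrixP => i b; rewrite (jacobianE i b oU sf Uw) [RHS]mxE.
have -> : 'D_(delta_mx 0 i : V) (fun y => (F \o param c) y 0 b) w =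
    'D_(delta_mx 0 i : V) ((fun y => (F \o param c') y 0 b) \o transition c c') w.
  apply: (@derive_eq_on R V (Opens oV)) => // y Oy /=.
  by have [_ _ _ yK] := overlapP Oy; rewrite /transition yK.
rewrite (derive_compE (delta_mx 0 i) oV oU' (atlas_compat ac ac')
  (smooth_open_coord b oU' sf') Ow Uw').
by apply: eq_bigr => j _; rewrite [jtau _ w i j]mxE (jacobianE j b oU' sf' Uw').
Qed.

(** The tangential projection and the position vector are common to both normals, so
    [projection_decomposition] gives them the same rank one projection; applying it to [nu c p]
    gives the proportionality. *)
Lemma unit_normal_unique (c c' : chart R n M) p : atlas c -> atlas c' -> dom c p -> dom c' p ->
  nu c p = dotp (nu c p) (nu c' p) *: nu c' p /\ dotp (nu c p) (nu c' p) ^+ 2 = 1.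
Proof.
move=> ac ac' cp c'p; have [sph im] := imm.
have Op : overlap c c' (coord c p) by exists p.
have [_ /(_ p cp) rf] := im c ac.
have [_ /(_ p cp)[nn nF nJ]] := unor ac.
have [_ /(_ p c'p)[nn' nF' nJ']] := unor ac'.
have tE : transition c c' (coord c p) = coord c' p by rewrite /transition coordK.
have JE := jacobian_transition ac ac' Op; rewrite tE in JE.
have nJ2 : nu c' p *m ('J (F \o param c) (coord c p))^T = 0.
  by rewrite JE trmx_mul mulmxA nJ' mul0mx.
have xJ := position_tangent ac cp.
set J := 'J _ _ in rf nJ nJ2 xJ.
have uG := gram_unitmx rf.
have GT : (invmx (J *m J^T))^T = invmx (J *m J^T) by rewrite trmx_inv trmx_mul trmxK.
pose xi := Num.sqrt K *: F p.
have xx : xi *m xi^T = 1%:M.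
  rewrite linearZ /= -scalemxAl -scalemxAr mulmx_dotp sph scalerA -expr2.
  by rewrite sqr_sqrtr ?ltW// scale_scalar_mx mulfV ?gt_eqF.
have dec (y : 'rV[R]_m) : dotp y y = 1 -> dotp y (F p) = 0 -> y *m J^T = 0 ->
    J^T *m invmx (J *m J^T) *m J = 1%:M - y^T *m y - xi^T *m xi.
  move=> yy yF yJ.
  apply: (@projection_decomposition _ _ J (invmx (J *m J^T)) y xi _ GT _ xx _ yJ _).
  - exact: mulVmx uG.
  - by rewrite mulmx_dotp yy.
  - by rewrite linearZ /= -scalemxAr mulmx_dotp yF raddf0 scaler0.
  - by rewrite -scalemxAl xJ scaler0.
have e : (nu c p)^T *m nu c p = (nu c' p)^T *m nu c' p.
  have := dec _ nn nF nJ; rewrite (dec _ nn' nF' nJ2) => /addIr /addrI /oppr_inj.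
  by [].
have nE : nu c p = dotp (nu c p) (nu c' p) *: nu c' p.
  have e1 : nu c p *m ((nu c p)^T *m nu c p) = nu c p by rewrite mulmxA mulmx_dotp nn mul1mx.
  by rewrite -{1}e1 e mulmxA mulmx_dotp mul_scalar_mx.
split => //; set s := dotp _ _ in nE *.
have sE (x : 'rV[R]_m) : dotp (s *: x) (s *: x) = s ^+ 2 * dotp x x.
  by rewrite /dotp mulr_sumr; apply: eq_bigr => b _; rewrite !mxE; ring.
by apply: etrans nn; rewrite [in RHS]nE sE nn' mulr1.
Qed.

End Normals.

(** * Chart-independent quantities *)

Lemma continuous_rsum (R : realType) (U : topologicalType) (I : Type) (r : seq I)
    (f : I -> U -> R) x : (forall i, {for x, continuous (f i)}) ->
  {for x, continuous (fun y => \sum_(i <- r) f i y)}.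
Proof.
move=> cf; elim: r => [|i r IH].
  have -> : (fun y => \sum_(i <- [::]) f i y) = cst 0.
    by apply/funext => y; rewrite big_nil.
  exact: cst_continuous.
have -> : (fun y => \sum_(j <- i :: r) f j y) = f i + (fun y => \sum_(j <- r) f j y).
  by apply/funext => y; rewrite big_cons.
exact: continuousD.
Qed.

(** The quantities that are needed as functions on the whole manifold: all are even in the normal,
    so they do not depend on the chart. *)
Variant jet_kind := MeanCurv2 | Curv2 | Jet2 | Jet3.

Section SliceJets.
Variables (R : realType) (n : nat).
Local Notation V := 'rV[R]_n.
Local Notation E := (V * R)%type.
Local Notation m := n.+2.

Section Raw.
Variables f nu : V -> 'rV[R]_m.

Definition sjet0 (q : 'I_m * 'I_m) : V -> R := sgrad f q.1 (fun w => nu w 0 q.2).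
Definition sjet (I : Type) (P : I -> V -> R) (q : 'I_m * I) : V -> R := sgrad f q.1 (P q.2).
Definition ssq (I : finType) (P : I -> V -> R) (w : V) : R := \sum_i P i w ^+ 2.

Definition kval (k : jet_kind) : V -> R :=
  match k with
  | MeanCurv2 => fun w => (\sum_a sjet0 (a, a) w) ^+ 2
  | Curv2 => ssq sjet0
  | Jet2 => ssq (sjet sjet0)
  | Jet3 => ssq (sjet (sjet sjet0))
  end.

End Raw.

Variables (O : opens E) (F N : E -> 'rV[R]_m).
Hypothesis ip : immersed_pair O F N.
Local Notation D := (tgrad (fun i => @sder R _ O (sdir R i)) (posS ip) (fun i j => invmetS ip i j)).

Definition kS (k : jet_kind) : smooth_fun O :=
  match k with
  | MeanCurv2 => meanc D (norS ip) ^+ 2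
  | Curv2 => curv2 D (norS ip)
  | Jet2 => sqnorm (djet D (curv_jet D (norS ip)))
  | Jet3 => sqnorm (djet D (djet D (curv_jet D (norS ip))))
  end.

Variables (t : R) (f nu : V -> 'rV[R]_m).
Local Notation U := (slice O t).
Hypothesis fE : forall w, U w -> f w = F (w, t).
Hypothesis nuE : forall w, U w -> nu w = N (w, t).

Lemma sjet0E q w : U w -> sjet0 f nu q w = curv_jet D (norS ip) q (w, t).
Proof. by move=> Uw; exact: (slice_grad ip fE q.1 (slice_nor ip nuE q.2) Uw). Qed.

Lemma sjetE (I : Type) (P : I -> V -> R) (PS : I -> smooth_fun O) :
  (forall i w, U w -> P i w = PS i (w, t)) ->
  forall q w, U w -> sjet f P q w = D q.1 (PS q.2) (w, t).
Proof. by move=> h q w Uw; exact: (slice_grad ip fE q.1 (h q.2) Uw). Qed.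

Lemma ssqE (I : finType) (P : I -> V -> R) (PS : I -> smooth_fun O) :
  (forall i w, U w -> P i w = PS i (w, t)) ->
  forall w, U w -> ssq P w = sqnorm PS (w, t).
Proof.
move=> h w Uw; rewrite (smooth_fun_sum _ _ _ Uw); apply: eq_bigr => i _.
by rewrite (smooth_funX _ _ Uw) h.
Qed.

Lemma kvalE k w : U w -> kval f nu k w = kS k (w, t).
Proof.
move=> Uw; case: k.
- rewrite (smooth_funX _ _ Uw); congr (_ ^+ _).
  rewrite (smooth_fun_sum _ _ _ Uw); apply: eq_bigr => a _; exact: (sjet0E (a, a) Uw).
- rewrite /= curv2_sqnorm; exact: (ssqE sjet0E Uw).
- exact: (ssqE (sjetE sjet0E) Uw).
- exact: (ssqE (sjetE (sjetE sjet0E)) Uw).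
Qed.

End SliceJets.

Section GlobalJets.
Variables (R : realType) (n : nat) (K : R) (M : closedManifold R n) (T : \bar R).
Variables (X : R -> M -> 'rV[R]_n.+2) (nu : R -> normals M).
Hypothesis K_gt0 : 0 < K.
Hypothesis flow : is_mcf K T X nu.
Local Notation V := 'rV[R]_n.
Local Notation E := (V * R)%type.
Local Notation m := n.+2.
Local Notation local_pair := (local_pair T X nu).

Definition chart_jet (c : chart R n M) (k : jet_kind) (y : M * R) : R :=
  kval (X y.2 \o param c) (nu y.2 c \o param c) k (coord c y.1).

Lemma chart_jet_local c O F N (lp : local_pair c O F N) k p t : dom c p -> times T t ->
  oset O (coord c p, t) -> chart_jet c k (p, t) = kS (lp_pair lp) k (coord c p, t).
Proof.
by move=> cp tT Oz; have [fE nuE] := local_pair_slices lp tT; exact: (kvalE _ fE nuE).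
Qed.

Lemma transition_near (c c' : chart R n M) p (B : set V) : dom c p -> dom c' p ->
  open B -> B (coord c' p) -> nbhs (coord c p) (fun w => B (transition c c' w)).
Proof.
move=> cp c'p oB Bp; have Up : (coord c @` dom c) (coord c p) by exists p.
have nB : nbhs (coord c' p) B by exact: open_nbhs_nbhs.
have nC : nbhs p (coord c' @^-1` B) by apply: (coord_cont c'p).
by have := param_cont Up; rewrite /prop_for /continuous_at coordK// => h; exact: h nC.
Qed.

(** The normals of the two charts differ by a sign that is continuous, hence locally constant; on a
    neighbourhood [W] where it is constant, the relations between the charts can be
    differentiated. *)
Lemma chart_jet_invariant c c' k p t : atlas c -> atlas c' -> times T t -> dom c p -> dom c' p ->
  chart_jet c k (p, t) = chart_jet c' k (p, t).
Proof.
move=> ac ac' tT cp c'p; have [_ geom _] := flow; have [im un] := geom t tT.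
have [ O [F [N [lp Oz]]]] := local_pair_exists flow ac tT cp.
have [ O' [F' [N' [lp' Oz']]]] := local_pair_exists flow ac' tT c'p.
pose tau := transition c c'.
have pt : overlap c c' (coord c p) by exists p.
(* The sign, written as the inner product of the extended normals so that it is a continuous
   function of [w]. *)
pose sg (w : V) := \sum_b N (w, t) 0 b * N' (tau w, t) 0 b.
pose good (w : V) := [/\ overlap c c' w, slice O t w & slice O' t (tau w)].
have good_normal w : good w -> N (w, t) = sg w *: N' (tau w, t) /\ sg w ^+ 2 = 1.
  move=> [ow Ow Ow']; have [cw c'w cK c'K] := overlapP ow.
  have [e1 e2] := unit_normal_unique K_gt0 im un ac ac' cw c'w.
  rewrite /sg (lp_nor lp Ow tT) (lp_nor lp' Ow' tT) /chart_nor/= /tau /transition c'K.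
  by split; [exact: e1|exact: e2].
have nbad : nbhs (coord c p) good.
  have n1 : nbhs (coord c p) (overlap c c') by apply: open_nbhs_nbhs; split => //; exact: overlap_open.
  have n2 : nbhs (coord c p) (slice O t) by apply: open_nbhs_nbhs; split => //; exact: slice_open.
  have n3 : nbhs (coord c p) (fun w => slice O' t (tau w)).
    by apply: transition_near => //; exact: slice_open.
  have n12 : nbhs (coord c p) (overlap c c' `&` slice O t) by exact: filterI.
  by apply: filterS2 n12 n3 => w [].
pose s := sg (coord c p).
have s2 : s ^+ 2 = 1.
  by have [_] := good_normal _ (nbhs_singleton nbad).
have c1 b : {for coord c p, continuous (fun w => N (w, t) 0 b)}.
  apply: (smooth_open_cont (U := slice O t)) => //.
  exact: smooth_slice (smooth_open_coord b (oset_open O) (ip_N (lp_pair lp))).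
have c2 b : {for coord c p, continuous (fun w => N' (tau w, t) 0 b)}.
  apply: (@continuous_comp _ _ _ tau (fun w => N' (w, t) 0 b)).
    by apply: (smooth_open_cont (atlas_compat ac ac')).
  apply: (smooth_open_cont (U := slice O' t)).
    exact: smooth_slice (smooth_open_coord b (oset_open O') (ip_N (lp_pair lp'))).
  by rewrite /tau /slice/= /transition coordK.
have csg : {for coord c p, continuous sg}.
  by apply: continuous_rsum => b; exact: (continuousM (c1 b) (c2 b)).
have nsg : nbhs (coord c p) (fun w => sg w * s > 0).
  have cs : {for coord c p, continuous (fun w => sg w * s)}.
    by apply: continuousM => //; exact: cst_continuous.
  have s0 : 0 < sg (coord c p) * s by rewrite -expr2 s2.
  have h := cvgr_gt _ cs; exact: h _ s0.
pose W := interior (fun w => good w /\ sg w = s).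
have Wp : W (coord c p).
  apply: filterS2 nbad nsg => w gw sw; split => //.
  have [_ w2] := good_normal w gw.
  have : (sg w - s) * (sg w + s) = 0 by rewrite -subr_sqr w2 s2 subrr.
  move=> /eqP; rewrite mulf_eq0 => /orP[/eqP /subr0_eq//|/eqP /addr0_eq e].
  move: sw; rewrite -e mulrN -expr2 w2; lra.
have WS : forall w, W w -> good w /\ sg w = s by exact: interior_subset.
have oW : open W by exact: open_interior.
have stau : smooth_open W tau.
  by apply: smooth_openS (atlas_compat ac ac') => w /WS[[]].
have WO w : W w -> slice O t w by move=> /WS[[]].
have WO' w : W w -> slice O' t (tau w) by move=> /WS[[]].
have Ft w : W w -> F (w, t) = F' (tau w, t).
  move=> Ww; have [[ow Ow Ow'] _] := WS w Ww; have [_ _ _ c'K] := overlapP ow.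
  by rewrite (lp_pos lp Ow tT) (lp_pos lp' Ow' tT) /chart_pos/= /tau /transition c'K.
have Nt w : W w -> N (w, t) = s *: N' (tau w, t).
  by move=> Ww; have [gw <-] := WS w Ww; have [] := good_normal w gw.
have tp : tau (coord c p) = coord c' p by rewrite /tau /transition coordK.
rewrite (chart_jet_local lp k cp tT Oz) (chart_jet_local lp' k c'p tT Oz') -tp.
rewrite -[RHS]mul1r.
have relA := related_curv (lp_pair lp) (lp_pair lp') oW stau WO WO' Ft Nt.
have reld := related_djet (lp_pair lp) (lp_pair lp') oW stau WO WO' Ft.
case: k.
- exact: (related_meanc2 (lp_pair lp) (lp_pair lp') oW stau WO WO' Ft Nt s2 Wp).
- rewrite /= !curv2_sqnorm; exact: (related_sqnorm WO WO' s2 relA Wp).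
- exact: (related_sqnorm WO WO' s2 (reld s _ _ _ relA) Wp).
- exact: (related_sqnorm WO WO' s2 (reld s _ _ _ (reld s _ _ _ relA)) Wp).
Qed.

Definition chart_at (p : M) : chart R n M := s2val (cid2 (atlas_cover p)).

Lemma chart_at_atlas p : atlas (chart_at p).
Proof. exact: (s2valP (cid2 (atlas_cover p))). Qed.
Lemma chart_at_dom p : dom (chart_at p) p.
Proof. exact: (s2valP' (cid2 (atlas_cover p))). Qed.

Definition global_jet (k : jet_kind) (y : M * R) : R := chart_jet (chart_at y.1) k y.

Lemma global_jetE c k p t : atlas c -> dom c p -> times T t ->
  global_jet k (p, t) = chart_jet c k (p, t).
Proof.
move=> ac cp tT; apply: chart_jet_invariant => //; [exact: chart_at_atlas|exact: chart_at_dom].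
Qed.

(** The chart selected by [global_jet] varies with the point. By invariance it can be frozen near
    [y], where the jet then coincides, at times of the flow, with a smooth function of
    space-time. *)
Lemma global_jet_continuous k (A : set (M * R)) y : (forall z, A z -> times T z.2) -> A y ->
  global_jet k @ within A (nbhs y) --> global_jet k y.
Proof.
move=> AT Ay; case: y Ay => p t Ay; have tT := AT _ Ay.
have ac := chart_at_atlas p; have cp := chart_at_dom p; set c := chart_at p in ac cp.
have [ O [F [N [lp Oz]]]] := local_pair_exists flow ac tT cp.
pose g (y : M * R) := kS (lp_pair lp) k (coord c y.1, y.2).
have cz : (fun y : M * R => (coord c y.1, y.2)) @ (p, t) --> (coord c p, t).
  apply: (@cvg_pair _ _ _ (nbhs (p, t)) (nbhs (coord c p)) (nbhs t) _ _ _
    (fun y : M * R => coord c y.1) snd); last exact: cvg_snd.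
  apply: (@cvg_comp _ _ _ fst (coord c) (nbhs (p, t)) (nbhs p)); first exact: cvg_fst.
  exact: coord_cont cp.
have cg : g @ (p, t) --> g (p, t).
  apply: (@cvg_comp _ _ _ (fun y : M * R => (coord c y.1, y.2)) (kS (lp_pair lp) k)
    (nbhs (p, t)) (nbhs (coord c p, t))); first exact: cz.
  exact: smooth_open_cont (smooth_fun_smooth (kS (lp_pair lp) k)) Oz.
have nO : nbhs (p, t) (fun y : M * R => oset O (coord c y.1, y.2)).
  by apply: cz; apply: open_nbhs_nbhs; split => //; exact: oset_open.
have nc : nbhs (p, t) (fun y : M * R => dom c y.1).
  have nd : nbhs p (dom c) by apply: open_nbhs_nbhs; split => //; exact: open_dom.
  have cf : (fst : M * R -> M) @ nbhs (p, t) --> p by exact: cvg_fst.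
  exact: cf nd.
have -> : global_jet k (p, t) = g (p, t) by exact: chart_jet_local.
have cg' : g @ within A (nbhs (p, t)) --> g (p, t).
  by apply: cvg_trans cg; apply: cvg_app; exact: cvg_within.
apply: cvg_trans cg'; apply: near_eq_cvg; rewrite /within/=.
apply: filterS2 nO nc => -[q r] /= Oq cq /AT rT.
by rewrite (global_jetE k ac cq rT); apply/esym; exact: chart_jet_local.
Qed.

End GlobalJets.

(** * The maximum principle *)

Section Contact.
Variables (R : realType) (n : nat).
Local Notation V := 'rV[R]_n.
Local Notation E := (V * R)%type.
Local Notation m := n.+2.
Variables (O : opens E).
Local Notation S := (smooth_fun O).
Local Notation d := (fun i => @sder R _ O (sdir R i)).

Lemma sder_slice (psi : S) (v : V) z : oset O z ->
  sder (v, 0) psi z = 'D_v (fun w => psi (w, z.2)) z.1.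
Proof.
case: z => u t Oz; apply: (etrans (sderE (v, 0) psi Oz)).
exact: derive_slice.
Qed.

Lemma sder_direction (psi : S) (v : V) :
  sder (v, 0) psi = \sum_i scst O (v 0 i) * d i psi.
Proof.
apply: smooth_fun_eq => z Oz; have Uz : slice O z.2 z.1 by case: z Oz.
apply: (etrans (sder_slice psi v Oz)); rewrite (smooth_fun_sum _ _ _ Oz).
rewrite (derive_directionE v (slice_open O z.2) (smooth_slice z.2 (smooth_fun_smooth psi)) Uz).
apply: eq_bigr => i _; rewrite (smooth_funM _ _ Oz) (scstE _ Oz); congr (_ * _).
by apply/esym; exact: (sder_slice psi (delta_mx 0 i) Oz).
Qed.

Variables (psi : S) (z : E) (t0 : R).
Hypothesis Oz : oset O z.
Hypothesis t0z : t0 < z.2.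
Hypothesis psi0 : psi z = 0.
Hypothesis psi_le : forall y, oset O y -> t0 <= y.2 <= z.2 -> psi y <= 0.

Let Uz : slice O z.2 z.1. Proof. by case: z Oz. Qed.

Lemma contact_space (v : V) : sder (v, 0) psi z = 0 /\ sder (v, 0) (sder (v, 0) psi) z <= 0.
Proof.
pose g w := psi (w, z.2).
have sg : smooth_open (slice O z.2) g := smooth_slice z.2 (smooth_fun_smooth psi).
have [|e1 e2] := local_max_derive v (slice_open O z.2) sg Uz.
  move=> w Uw; rewrite /g -surjective_pairing psi0; apply: psi_le => //=.
  by rewrite lexx ltW.
split; first by apply: (etrans (sder_slice psi v Oz)).
apply: le_trans e2; rewrite le_eqVlt; apply/orP; left; apply/eqP.
apply: (etrans (sder_slice (sder (v, 0) psi) v Oz)).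
apply: (@derive_eq_on R V (Opens (slice_open O z.2))) => // w Uw.
exact: (sder_slice psi v (z := (w, z.2)) Uw).
Qed.

(** [psi <= 0] is known only up to the time of [z]; a negative time derivative would make [psi]
    positive shortly before. *)
Lemma contact_time : 0 <= sder (tdir R n) psi z.
Proof.
rewrite leNgt; apply/negP => neg.
have lE : sder (tdir R n) psi z = 'D_(tdir R n) psi z by exact: sderE.
have dpsi : derivable psi z (tdir R n) by exact: smooth_open_derivable (smooth_fun_smooth psi) Oz.
rewrite lE in neg.
have lim : h^-1 *: ((psi \o shift z) (h *: tdir R n) - psi z) @[h --> 0^'] --> 'D_(tdir R n) psi z.
  exact: dpsi.
have n1 : \forall h \near (0 : R)^', h^-1 *: ((psi \o shift z) (h *: tdir R n) - psi z) < 0.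
  have h := cvgr_lt _ lim; exact: h _ neg.
have cl : (fun h : R => h *: tdir R n + z) @ 0 --> z.
  rewrite -[X in _ --> X]add0r -(scale0r (tdir R n)); apply: cvgD; last exact: cvg_cst.
  exact: scalel_continuous.
have nO : nbhs z (oset O) by apply: open_nbhs_nbhs; split => //; exact: oset_open.
have near0 : nbhs (0 : R) (fun h : R => oset O (h *: tdir R n + z)) by exact: cl nO.
have n1' : nbhs (0 : R) (fun h => h != 0 ->
  h^-1 *: ((psi \o shift z) (h *: tdir R n) - psi z) < 0) by exact: n1.
have /nbhs_ballP[e /= e0 B] : nbhs (0 : R) ((fun h : R => oset O (h *: tdir R n + z)) `&`
  (fun h => h != 0 -> h^-1 *: ((psi \o shift z) (h *: tdir R n) - psi z) < 0)).
  exact: filterI.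
pose s := Num.min e (z.2 - t0) / 2.
have m0 : 0 < Num.min e (z.2 - t0) by rewrite lt_min e0 subr_gt0.
have s0 : 0 < s by rewrite divr_gt0.
have sm : s < Num.min e (z.2 - t0) by rewrite ltr_pdivrMr// mulr_natr mulr2n ltrDl.
move: sm; rewrite lt_min => /andP[se st].
have [] := B (- s).
  by rewrite -ball_normE/= sub0r opprK gtr0_norm.
move=> Os q; have := q; rewrite oppr_eq0 gt_eqF// => /(_ isT).
rewrite /= psi0 subr0 -[_ *: _]/(_ * _) invrN mulNr oppr_lt0.
rewrite pmulr_rgt0 ?invr_gt0// ltNge => /negP; apply; apply: psi_le Os _.
have -> : (- s *: tdir R n + z).2 = z.2 - s.
  by rewrite -[LHS]/(- s * 1 + z.2) mulr1 addrC.
by apply/andP; split; move: s0 st; lra.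
Qed.

Variables (F N : E -> 'rV[R]_m).
Hypothesis ip : immersed_pair O F N.
Local Notation X := (posS ip).
Local Notation gi := (fun i j => invmetS ip i j).
Local Notation D := (tgrad d X gi).

Lemma contact_grad a : D a psi z = 0.
Proof.
rewrite /tgrad (smooth_fun_sum _ _ _ Oz) big1// => i _; rewrite (smooth_funM _ _ Oz).
by have [-> _] := contact_space (delta_mx 0 i); rewrite mulr0.
Qed.

(** The direction [v] freezes the coefficients of [D a] at [z]. As the first derivatives of [psi]
    vanish there, differentiating the coefficients contributes nothing, and [D a (D a psi)] is the
    second derivative along [v]. *)
Lemma contact_hess a : D a (D a psi) z <= 0.
Proof.
pose v : V := \row_i frame d X gi i a z.
have [_] := contact_space v; apply: le_trans; rewrite le_eqVlt; apply/orP; left; apply/eqP.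
rewrite !sder_direction /tgrad !(smooth_fun_sum _ _ _ Oz); apply: eq_bigr => i _.
rewrite !(smooth_funM _ _ Oz) (scstE _ Oz) [v 0 i]mxE; congr (_ * _).
have hd : derivation (@sder R E O (sdir R i)) by split=> f g; [exact: sderD|exact: sderM].
rewrite !(der_sum hd) !(smooth_fun_sum _ _ _ Oz); apply: eq_bigr => j _.
rewrite !(derM hd) !(smooth_funD _ _ Oz) !(smooth_funM _ _ Oz) (scstE _ Oz) sder_cst.
have [-> _] := contact_space (delta_mx 0 j).
by rewrite mulr0 (smooth_fun0 Oz) mul0r !add0r [v 0 j]mxE.
Qed.

Lemma contact_heat : 0 <= heat D (sder (tdir R n)) psi z.
Proof.
rewrite /heat (smooth_funD _ _ Oz) (smooth_funN _ Oz) subr_ge0.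
apply: le_trans contact_time; rewrite /lap (smooth_fun_sum _ _ _ Oz).
by apply: sumr_le0 => a _; exact: contact_hess.
Qed.

End Contact.

Section TimeFunction.
Variables (R : realType) (n : nat) (O : opens ('rV[R]_n * R)%type).
Local Notation E := ('rV[R]_n * R)%type.

Lemma time_derive (z v : E) (c : R) : is_derive z v (fun y : E => y.2 - c) v.2.
Proof.
have lim : h^-1 *: (((fun y : E => y.2 - c) \o shift z) (h *: v) - (z.2 - c)) @[h --> 0^'] --> v.2.
  apply: cvg_near_cst; rewrite near_withinE; apply: filterE => h h0.
  rewrite -[LHS]/(h^-1 * (h * v.2 + z.2 - c - (z.2 - c))).
  have -> : h * v.2 + z.2 - c - (z.2 - c) = h * v.2 by ring.
  by rewrite mulKf.
by constructor; [exact: cvgP lim|exact: cvg_lim lim].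
Qed.

Lemma time_smooth (c : R) : smooth_open (oset O) (fun y : E => y.2 - c).
Proof.
apply: (@smooth_open_coind _ _ _
  (fun h => (exists c : R, h = fun y : E => y.2 - c) \/ (exists c : R, h = cst c))).
- exact: oset_open.
- move=> _ [[k ->]|[k ->]] z Oz; split.
  + by apply: cvgD; [exact: cvg_snd|exact: cvg_cst].
  + by move=> v; have [] := time_derive z v k.
  + exact: cvg_cst.
  + by move=> v; exact: derivable_cst.
- move=> _ v [[k ->]|[k ->]].
    exists (cst v.2); first by right; exists v.2.
    by move=> z _; have [_ ->] := time_derive z v k.
  exists (cst 0); first by right; exists 0.
  by move=> z _; rewrite derive_cst.
- by left; exists c.
Qed.

Definition stime (c : R) : smooth_fun O := smk (time_smooth c).

Lemma stimeE c z : oset O z -> stime c z = z.2 - c.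
Proof. exact: smkE. Qed.

Lemma sder_stime v c : sder v (stime c) = scst O v.2.
Proof.
apply: smooth_fun_eq => z Oz; rewrite (scstE _ Oz); apply: (etrans (sderE v (stime c) Oz)).
have [_ <-] := time_derive z v c.
by apply: (derive_eq_on (O := O)) Oz _ => y Oy; exact: stimeE.
Qed.

End TimeFunction.

Section FlowPoint.
Variables (R : realType) (n : nat) (K : R) (O : opens ('rV[R]_n * R)%type).
Local Notation E := ('rV[R]_n * R)%type.
Local Notation m := n.+2.
Variables (F N : E -> 'rV[R]_m).
Hypothesis fl : chart_flow K O F N.
Local Notation ip := (fl_pair fl).
Local Notation S := (smooth_fun O).
Local Notation D := (tgrad (fun i => @sder R _ O (sdir R i)) (posS ip) (fun i j => invmetS ip i j)).
Local Notation r := (scst O (Num.sqrt K)).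
Local Notation xi := (unit_pos r (posS ip)).
Let se : structure_equations n D (sder (tdir R n)) r (norS ip) xi :=
  flow_structure_equations (chart_coordinate_flow fl).

Lemma flow_D_cst a k : D a (scst O k) = 0.
Proof. by rewrite /tgrad big1// => i _; rewrite sder_cst mulr0. Qed.
Lemma flow_T_cst k : sder (tdir R n) (scst O k) = 0. Proof. exact: sder_cst. Qed.
Lemma flow_D_time a c : D a (stime O c) = 0.
Proof.
rewrite /tgrad big1// => i _; rewrite sder_stime -[scst O _]/(0 : S) mulr0//.
Qed.
Lemma flow_T_time c : sder (tdir R n) (stime O c) = 1.
Proof. by rewrite sder_stime. Qed.

Variables (z : E) (Oz : oset O z) (t0 : R).

Lemma flow_ev_cst k : sev Oz (scst O k) = k. Proof. exact: scstE. Qed.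

Definition flow_pt : point_solution R n m :=
  @PointSolution R n m S D (sder (tdir R n)) r (norS ip) xi se
    (sev Oz : {rmorphism S -> R}) (scst O) flow_D_cst flow_T_cst flow_ev_cst
    (stime O t0) (fun a => flow_D_time a t0) (flow_T_time t0).

Lemma flow_pt_K : psK flow_pt = K.
Proof. by rewrite /psK -[psev _ _]/(scst O (Num.sqrt K) z) (scstE _ Oz) sqr_sqrtr// ltW// (fl_K fl). Qed.
Lemma flow_pt_t : psev flow_pt (pst flow_pt) = z.2 - t0.
Proof. exact: stimeE. Qed.
Lemma flow_pt_H2 : psev flow_pt (psH flow_pt) ^+ 2 = kS ip MeanCurv2 z.
Proof. by rewrite /kS (smooth_funX _ _ Oz). Qed.
Lemma flow_pt_A2 : psev flow_pt (psA2 flow_pt) = kS ip Curv2 z.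
Proof. by []. Qed.
Lemma flow_pt_jet2 : psev flow_pt (psjet2 flow_pt) = kS ip Jet2 z.
Proof. by []. Qed.
Lemma flow_pt_jet3 : psev flow_pt (psjet3 flow_pt) = kS ip Jet3 z.
Proof. by []. Qed.

End FlowPoint.

Section MaximumPrinciple.
Variables (R : realType) (n : nat) (K : R) (M : closedManifold R n) (T : \bar R).
Variables (X : R -> M -> 'rV[R]_n.+2) (nu : R -> normals M).
Hypothesis K_gt0 : 0 < K.
Hypothesis flow : is_mcf K T X nu.
Local Notation V := 'rV[R]_n.
Local Notation E := (V * R)%type.
Local Notation m := n.+2.
Local Notation J := (global_jet X nu).

Definition slab (t0 t1 : R) : set (M * R) := [set: M] `*` [set` `[t0, t1]].

Lemma slabP t0 t1 (y : M * R) : slab t0 t1 y <-> t0 <= y.2 <= t1.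
Proof. by split=> [[_] | h]; [|split => //]; rewrite /= ?in_itv. Qed.

Lemma slab_times t0 t1 : 0 <= t0 -> (t1%:E < T)%E -> forall y, slab t0 t1 y -> times T y.2.
Proof.
move=> t00 t1T y /slabP/andP[h1 h2]; split; first exact: le_trans h1.
by apply: le_lt_trans t1T; rewrite lee_fin.
Qed.

Lemma slab_max (Phi : M * R -> R) t0 t1 y0 : slab t0 t1 y0 ->
  (forall y, slab t0 t1 y -> Phi @ within (slab t0 t1) (nbhs y) --> Phi y) ->
  exists2 y, slab t0 t1 y & forall y', slab t0 t1 y' -> Phi y' <= Phi y.
Proof.
move=> y0A cPhi.
have cA : compact (slab t0 t1).
  by apply: compact_setX; [exact: compact_carrier|exact: segment_compact].
have [||y] := @compact_EVT_max _ R Phi (slab t0 t1) _ cA.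
- by exists y0.
- by apply/subspace_continuousP.
- by rewrite inE => yA h; exists y => // y' y'A; apply: h; rewrite inE.
Qed.

Lemma flow_near (y : M * R) : open_times T y.2 ->
  exists (O : opens E) F N (lf : local_flow K T X nu (chart_at y.1) O F N),
    oset O (coord (chart_at y.1) y.1, y.2) /\
    forall k z, oset O z -> J k (param (chart_at y.1) z.1, z.2) = kS (fl_pair (lf_flow lf)) k z.
Proof.
move=> yT; have ac := chart_at_atlas y.1; have cy := chart_at_dom y.1.
have [ O [F [N [lf Oz]]]] := local_flow_exists K_gt0 flow ac yT cy.
exists O, F, N, lf; split => // k z Ozz; have zT := open_timesT (lf_times lf Ozz).
have [cp cK] := local_pair_point (lf_pair lf) Ozz.
have Oz2 : oset O (coord (chart_at y.1) (param (chart_at y.1) z.1), z.2).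
  by rewrite cK -surjective_pairing.
rewrite (global_jetE K_gt0 flow k ac cp zT) (chart_jet_local (lf_pair lf) k cp zT Oz2).
(* [kS] takes the proof of [immersed_pair] as an argument; the two proofs that occur are equal. *)
have -> : lp_pair (lf_pair lf) = fl_pair (lf_flow lf) by exact: Prop_irrelevance.
have -> : (coord (chart_at y.1) (param (chart_at y.1) z.1), z.2) = z.
  by rewrite cK -surjective_pairing.
exact: erefl.
Qed.

Lemma J_continuous t0 t1 k y : 0 <= t0 -> (t1%:E < T)%E -> slab t0 t1 y ->
  J k @ within (slab t0 t1) (nbhs y) --> J k y.
Proof. by move=> t00 t1T yA; apply: (global_jet_continuous K_gt0 flow) => //; exact: slab_times. Qed.

Lemma time_continuous t0 t1 c (y : M * R) :
  (fun y : M * R => y.2 - c) @ within (slab t0 t1) (nbhs y) --> y.2 - c.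
Proof.
apply: cvg_trans (_ : (fun y : M * R => y.2 - c) @ nbhs y --> y.2 - c).
  by apply: cvg_app; exact: cvg_within.
by apply: cvgD; [exact: cvg_snd|exact: cvg_cst].
Qed.

Lemma J_ge0 k y : 0 <= J k y.
Proof.
rewrite /global_jet /chart_jet; case: k; [exact: sqr_ge0|..];
  by apply: sumr_ge0 => i _; exact: sqr_ge0.
Qed.

End MaximumPrinciple.

(** * Preservation of pinching *)

Section PinchingPoint.
Variables (R : realType) (n m : nat) (S : comPzRingType) (D : 'I_m -> S -> S) (T : S -> S).
Variables (r : S) (nu xi : 'I_m -> S).
Hypothesis se : structure_equations n D T r nu xi.
Variables (ev : {rmorphism S -> R}) (sa sb : S).
Hypothesis Da : forall e, D e sa = 0.
Hypothesis Db : forall e, D e sb = 0.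
Hypothesis Ta : T sa = 0.
Hypothesis Tb : T sb = 0.
Local Notation a := (ev sa).
Local Notation b := (ev sb).
Local Notation K := (ev r ^+ 2).
Local Notation q := (ev (curv2 D nu)).
Local Notation h := (ev (meanc D nu)).
Hypothesis a_ge0 : 0 <= a.
Hypothesis a_kato : a * (n%:R + 2) <= 3.
Hypothesis b_ge0 : 0 <= b.
Hypothesis b_le : b <= n%:R.
Hypothesis ab : a * (b - 2 * n%:R) + 2 <= 0.

(** With [P = q - a h^2 - b K], the difference of the two sides is [2 K (n - b) P + 2 K^2 (n - b) b
    - 2 K h^2 (a (b - 2 n) + 2) + 2 (|nabla A|^2 - a |DH|^2)]. The conditions on [a] and [b] make
    each summand nonnegative, the last one by [kato]. *)
Lemma heat_pinching_le : 0 <= q - a * h ^+ 2 - b * K ->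
  - ev (heat D T (pinching D r nu sa sb)) <= 2 * q * (q - a * h ^+ 2 - b * K).
Proof.
move=> P0; rewrite (ev_heat_pinching se ev Da Db Ta Tb).
have kt := kato se ev.
set G := ev (grad2 _ _ _) in kt *; set B := ev (codazzi2 _ _ _ _) in kt *.
have B0 : 0 <= B by exact: codazzi2_ge0.
have G0 : 0 <= G by exact: ev_grad2_ge0.
have aG : a * G <= B.
  have := ler_wpM2l a_ge0 kt; have := ler_wpM2r B0 a_kato; lra.
have K0 : 0 <= K by exact: sqr_ge0.
have nb : 0 <= n%:R - b by rewrite subr_ge0.
have h0 : 0 <= h ^+ 2 by exact: sqr_ge0.
have t1 := mulr_ge0 (mulr_ge0 K0 nb) P0.
have t2 := mulr_ge0 (mulr_ge0 K0 K0) (mulr_ge0 nb b_ge0).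
have ab' : 0 <= - (a * (b - 2 * n%:R) + 2) by rewrite oppr_ge0.
have t3 := mulr_ge0 (mulr_ge0 K0 h0) ab'.
have tB : 0 <= B - a * G by rewrite subr_ge0.
rewrite -subr_ge0.
have -> : 2 * q * (q - a * h ^+ 2 - b * K)
    - - (a * (2 * (q + n%:R * K) * h ^+ 2 - 2 * G)
      - (2 * q ^+ 2 + 4 * K * h ^+ 2 - 2 * n%:R * K * q - 2 * B)) =
  2 * (K * (n%:R - b) * (q - a * h ^+ 2 - b * K)) + 2 * (K * K * ((n%:R - b) * b))
  + 2 * (K * h ^+ 2 * - (a * (b - 2 * n%:R) + 2)) + 2 * (B - a * G) by ring.
by rewrite !addr_ge0// mulr_ge0.
Qed.

End PinchingPoint.

Section PinchingPreserved.
Variables (R : realType) (n : nat) (K : R) (M : closedManifold R n) (T : \bar R).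
Variables (X : R -> M -> 'rV[R]_n.+2) (nu : R -> normals M).
Hypothesis K_gt0 : 0 < K.
Hypothesis flow : is_mcf K T X nu.
Local Notation V := 'rV[R]_n.
Local Notation E := (V * R)%type.
Local Notation m := n.+2.
Local Notation J := (global_jet X nu).
Variables (a b : R).
Hypothesis a_ge0 : 0 <= a.
Hypothesis a_kato : a * (n%:R + 2) <= 3.
Hypothesis b_ge0 : 0 <= b.
Hypothesis b_le : b <= n%:R.
Hypothesis ab : a * (b - 2 * n%:R) + 2 <= 0.

Definition defect (y : M * R) : R := J Curv2 y - a * J MeanCurv2 y - b * K.

(** The reaction term is at most [L] times the defect. The barrier [phi] is linear in time with
    slope [2 L + 1] and stays below 2 on so short a window; a positive maximum [f] of [defect / phi]
    would give [f (2 L + 1) <= 2 L f]. *)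
Lemma defect_window (s s' L : R) : 0 <= s -> (s'%:E < T)%E -> 0 <= L ->
  (forall y, slab s s' y -> 2 * J Curv2 y <= L) -> (2 * L + 1) * (s' - s) <= 1 ->
  (forall p, defect (p, s) <= 0) -> forall y, slab s s' y -> defect y <= 0.
Proof.
move=> s0 s'T L0 hL short init y1 y1A; rewrite leNgt; apply/negP => y1pos.
pose phi (y : M * R) : R := 1 + (2 * L + 1) * (y.2 - s).
have L1 : 0 <= 2 * L + 1 by rewrite addr_ge0// mulr_ge0.
have phi_ge1 y : slab s s' y -> 1 <= phi y.
  by move=> /slabP/andP[h1 _]; rewrite lerDl mulr_ge0// subr_ge0.
have phi_gt0 y : slab s s' y -> 0 < phi y by move=> /phi_ge1; apply: lt_le_trans.
have phi_le2 y : slab s s' y -> phi y <= 2.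
  move=> /slabP/andP[_ h1]; rewrite -[2]/(1 + 1) lerD2l; apply: le_trans short.
  by rewrite ler_wpM2l// lerD2r.
have cPhi y : slab s s' y -> (fun y => defect y / phi y) @ within (slab s s') (nbhs y)
    --> defect y / phi y.
  move=> yA; have cJ k := J_continuous (k := k) K_gt0 flow s0 s'T yA.
  apply: cvgM.
    apply: cvgB; last exact: cvg_cst.
    by apply: cvgB; [exact: cJ|apply: cvgM; [exact: cvg_cst|exact: cJ]].
  apply: cvgV; first by rewrite gt_eqF// phi_gt0.
  by apply: cvgD; [exact: cvg_cst|apply: cvgM; [exact: cvg_cst|exact: time_continuous]].
have [y yA ymax] := slab_max y1A cPhi.
pose f := defect y / phi y.
have f0 : 0 < f by apply: lt_le_trans (ymax _ y1A); rewrite divr_gt0// phi_gt0.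
have dy : defect y = f * phi y by rewrite /f divfK// gt_eqF// phi_gt0.
have dy0 : 0 < defect y by rewrite dy mulr_gt0// phi_gt0.
have sy : s < y.2.
  have /slabP/andP[h1 h2] := yA; rewrite lt_neqAle h1 andbT; apply/eqP => e.
  by move: dy0; rewrite ltNge (surjective_pairing y) -e init.
have oy : open_times T y.2.
  split; first exact: le_lt_trans sy.
  by have [] := slab_times s0 s'T yA.
have [ O [F [N [lf [Oz JE]]]]] := flow_near K_gt0 flow oy.
set c := chart_at y.1 in lf Oz JE.
pose fl := lf_flow lf; pose ip := fl_pair fl.
pose z : E := (coord c y.1, y.2).
have zy : (param c z.1, z.2) = y by rewrite /z /= coordK -?surjective_pairing//; exact: chart_at_dom.
pose D := tgrad (fun i => @sder R _ O (sdir R i)) (posS ip) (fun i j => invmetS ip i j).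
pose r := scst O (Num.sqrt K).
have se : structure_equations n D (sder (tdir R n)) r (norS ip) (unit_pos r (posS ip)).
  exact: flow_structure_equations (chart_coordinate_flow fl).
pose pin := pinching D r (norS ip) (scst O a) (scst O b).
pose w := scst O f + scst O (f * (2 * L + 1)) * stime O s.
pose psi := - pin - w.
have r2 x (Ox : oset O x) : (r x) ^+ 2 = K by rewrite (scstE _ Ox) sqr_sqrtr// ltW.
have pinE x (Ox : oset O x) : - pin x = defect (param c x.1, x.2).
  rewrite /pin /pinching (smooth_funD _ _ Ox) (smooth_funD _ _ Ox) (smooth_funN _ Ox).
  rewrite (smooth_funM (scst O a) _ Ox) (smooth_funM (scst O b) _ Ox) (smooth_funX r _ Ox).
  rewrite r2// !(scstE _ Ox) /defect !(JE _ _ Ox) /kS; ring.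
have psiE x (Ox : oset O x) : psi x = defect (param c x.1, x.2) - f * phi (param c x.1, x.2).
  rewrite /psi (smooth_funD _ _ Ox) !(smooth_funN _ Ox) pinE//; congr (_ - _).
  rewrite /w (smooth_funD _ _ Ox) (smooth_funM _ _ Ox) !(scstE _ Ox) (stimeE _ Ox) /phi /=.
  ring.
have psi0 : psi z = 0 by rewrite psiE// zy dy subrr.
have psi_le x : oset O x -> s <= x.2 <= z.2 -> psi x <= 0.
  move=> Ox /andP[x1 x2]; rewrite psiE// subr_le0.
  have xA : slab s s' (param c x.1, x.2).
    apply/slabP; rewrite /= x1 (le_trans x2)//.
    by have /slabP/andP[] := yA.
  by rewrite -ler_pdivrMr ?phi_gt0//; exact: ymax.
have := contact_heat Oz sy psi0 psi_le ip.
have heat_w : heat D (sder (tdir R n)) w = scst O (f * (2 * L + 1)).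
  have Dc k e : D e (scst O k) = 0 by exact: (flow_D_cst fl e k).
  have Dt e : D e (stime O s) = 0 by exact: (flow_D_time fl e s).
  have Dw e : D e w = 0.
    by rewrite /w (derD (seD se e)) (derM (seD se e)) !Dc Dt mul0r mulr0 !addr0.
  rewrite /heat /lap big1 => [|e _]; last by rewrite Dw (der0 (seD se e)).
  rewrite subr0 /w sderD sderM !sder_cst sder_stime add0r mul0r add0r.
  by rewrite -[scst O _.2]/(1 : smooth_fun O) mulr1.
rewrite /psi (heatD se) !(heatN se) heat_w (smooth_funD _ _ Oz) !(smooth_funN _ Oz) (scstE _ Oz).
have q_le : 2 * J Curv2 y <= L by exact: hL.
pose ev : {rmorphism smooth_fun O -> R} := sev Oz.
have evK : ev r ^+ 2 = K by exact: r2.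
have hp := @heat_pinching_le R n m _ D (sder (tdir R n)) r (norS ip) _ se
  ev (scst O a) (scst O b)
  (fun e => flow_D_cst fl e a) (fun e => flow_D_cst fl e b) (sder_cst O (tdir R n) a) (sder_cst O (tdir R n) b).
have eva : ev (scst O a) = a by exact: scstE.
have evb : ev (scst O b) = b by exact: scstE.
have JEz k : J k y = kS ip k z by have := JE k z Oz; rewrite zy.
have evq : ev (curv2 D (norS ip)) = J Curv2 y by rewrite JEz.
have evh : ev (meanc D (norS ip)) ^+ 2 = J MeanCurv2 y.
  by rewrite JEz /kS (smooth_funX _ _ Oz).
rewrite eva evb evK evq evh in hp.
have := hp a_ge0 a_kato b_ge0 b_le ab (ltW dy0).
rewrite -/(defect y) -[ev _]/(heat D (sder (tdir R n)) pin z).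
move=> h1 h2; have h3 : f * (2 * L + 1) <= 2 * J Curv2 y * defect y by lra.
have h4 : 2 * J Curv2 y * defect y <= L * (f * 2).
  apply: ler_pM; rewrite ?mulr_ge0 ?J_ge0//; first exact: ltW.
  by rewrite dy ler_pM2l// phi_le2.
by move: h3 h4 f0; lra.
Qed.

(** The length [1 / (2 L + 1)] of a window depends only on the maximum of [|A|^2] up to time [t1],
    so finitely many windows reach [t1]. *)
Lemma pinching_preserved : (forall p, defect (p, 0) <= 0) ->
  forall y, times T y.2 -> defect y <= 0.
Proof.
move=> init [p1 t1] [/= t10 t1T].
have pA : slab 0 t1 (p1, t1) by apply/slabP; rewrite /= t10 lexx.
have [y2 y2A y2max] := slab_max pA (fun y yA => J_continuous (k := Curv2) K_gt0 flow (lexx 0) t1T yA).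
pose L := 2 * J Curv2 y2.
have L0 : 0 <= L by rewrite mulr_ge0// J_ge0.
have L1 : 0 < 2 * L + 1 by rewrite ltr_wpDl// mulr_ge0.
pose eps := (2 * L + 1)^-1.
have e0 : 0 < eps by rewrite invr_gt0.
have steps k : forall p t, 0 <= t <= t1 -> t <= k%:R * eps -> defect (p, t) <= 0.
  elim: k => [|k IH] p t /andP[t0 tt1].
    rewrite mul0r => t0'; have -> : t = 0 by apply/eqP; rewrite eq_le t0 t0'.
    exact: init.
  move=> tk; have [tk1|tk1] := leP t (k%:R * eps); first by apply: IH; rewrite ?t0.
  have k0 : 0 <= k%:R * eps by rewrite mulr_ge0// ltW.
  apply: (@defect_window (k%:R * eps) t L) => //.
  - by apply: le_lt_trans t1T; rewrite lee_fin.
  - move=> y /slabP/andP[h1 h2]; rewrite /L ler_pM2l//; apply: y2max; apply/slabP.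
    by rewrite (le_trans k0)//= (le_trans h2).
  - rewrite mulrC -ler_pdivlMr// div1r -/eps.
    by move: tk; rewrite -natr1 mulrDl mul1r; lra.
  - by move=> q; apply: IH => //; rewrite k0 (le_trans (ltW tk1)).
  - by apply/slabP; rewrite /= lexx ltW.
have [k hk] : exists k : nat, t1 <= k%:R * eps.
  exists (Num.bound (t1 / eps)); rewrite -ler_pdivrMr//; apply: ltW.
  by apply: archi_boundP; rewrite divr_ge0// ltW.
by apply: (steps k) hk; rewrite t10 lexx.
Qed.

End PinchingPreserved.

(** * Gradient and Hessian estimates *)

Lemma ev_psi_gradient (R : rcfType) (n m : nat) (p : point_solution R n m) (j g : psS p) f :
  psev p (psr p ^+ 2 * pst p * j - pscst p f * g ^+ 2) =
  psK p * psev p (pst p) * psev p j - f * psev p g ^+ 2.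
Proof. by rewrite !(rmorphB, rmorphXn, rmorphM, ps_evcst). Qed.

Section RatioBound.
Variables (R : realType) (n : nat) (M : closedManifold R n).

(** Taking for [f] the maximum of [P / Q] makes [P - f Q] nonpositive on the slab with a zero at the
    maximum point, so that a contact estimate bounds this very [f]. *)
Lemma ratio_bound (P Q : M * R -> R) (t0 t1 B : R) :
  (forall y, slab t0 t1 y -> P @ within (slab t0 t1) (nbhs y) --> P y) ->
  (forall y, slab t0 t1 y -> Q @ within (slab t0 t1) (nbhs y) --> Q y) ->
  (forall y, slab t0 t1 y -> 0 < Q y) ->
  (forall y f, slab t0 t1 y -> P y = f * Q y ->
    (forall y', slab t0 t1 y' -> P y' <= f * Q y') -> f <= B) ->
  forall y, slab t0 t1 y -> P y <= B * Q y.
Proof.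
move=> cP cQ Q0 h y1 y1A.
have cPhi y : slab t0 t1 y -> (fun y => P y / Q y) @ within (slab t0 t1) (nbhs y) --> P y / Q y.
  move=> yA; apply: cvgM; first exact: cP.
  by apply: cvgV; [rewrite gt_eqF// Q0|exact: cQ].
have [y yA ymax] := slab_max y1A cPhi.
have fB : P y / Q y <= B.
  apply: (h y) => //; first by rewrite divfK// gt_eqF// Q0.
  by move=> y' y'A; rewrite -ler_pdivrMr ?Q0//; exact: ymax.
by rewrite -ler_pdivrMr ?Q0//; exact: le_trans (ymax _ y1A) fB.
Qed.

End RatioBound.

Section ParabolicEstimates.
Variables (R : realType) (n : nat) (K : R) (M : closedManifold R n) (T : \bar R).
Variables (X : R -> M -> 'rV[R]_n.+2) (nu : R -> normals M).
Hypothesis K_gt0 : 0 < K.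
Hypothesis flow : is_mcf K T X nu.
Local Notation V := 'rV[R]_n.
Local Notation E := (V * R)%type.
Local Notation m := n.+2.
Local Notation J := (global_jet X nu).
Variables (a b c : R).
Hypothesis a_ge0 : 0 <= a.
Hypothesis a_lt_c : a < c.
Hypothesis b_ge0 : 0 <= b.
Hypothesis pinch : forall y, times T y.2 -> J Curv2 y <= a * J MeanCurv2 y + b * K.

Definition gpinch (y : M * R) : R := c * J MeanCurv2 y - J Curv2 y + (b + 1) * K.

Lemma gpinch_gt0 y : times T y.2 -> 0 < gpinch y.
Proof.
move=> /pinch h; have H0 : 0 <= (c - a) * J MeanCurv2 y.
  by rewrite mulr_ge0 ?J_ge0// subr_ge0 ltW.
by rewrite /gpinch; move: h H0 K_gt0; lra.
Qed.

Section AtPoint.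
Variables (O : opens E) (F N : E -> 'rV[R]_m) (fl : chart_flow K O F N).
Variables (c0 : chart R n M) (z : E) (Oz : oset O z) (t0 : R).
Hypothesis JE : forall k, J k (param c0 z.1, z.2) = kS (fl_pair fl) k z.
Local Notation p := (flow_pt fl Oz t0).
Local Notation y := (param c0 z.1, z.2).

Lemma point_pinched : times T z.2 -> pinched a b p.
Proof.
move=> zT; rewrite /pinched flow_pt_K flow_pt_A2 flow_pt_H2 -!JE; split => //.
exact: (pinch (y := y)).
Qed.

Lemma point_g : psev p (psg b c p) = gpinch y.
Proof. by rewrite psgE flow_pt_K flow_pt_A2 flow_pt_H2 -!JE. Qed.

Lemma point_gradient f : psev p (psi_gradient b c p f) =
  K * (y.2 - t0) * J Jet2 y - f * gpinch y ^+ 2.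
Proof.
rewrite /psi_gradient ev_psi_gradient flow_pt_K flow_pt_t point_g JE.
by [].
Qed.

Lemma point_hessian Nn f : psev p (psi_hessian b c p Nn f) =
  K * (y.2 - t0) * J Jet3 y + Nn * (J Jet2 y * gpinch y) - f * gpinch y ^+ 3.
Proof.
rewrite /psi_hessian ev_psi_hessian flow_pt_K flow_pt_t point_g !JE -exprS.
by [].
Qed.

End AtPoint.

Variables (t0 t1 lam : R).
Hypothesis t0_ge0 : 0 <= t0.
Hypothesis t1T : (t1%:E < T)%E.
Hypothesis lam_le : K * (t1 - t0) <= lam.
Local Notation A := (@slab R n M t0 t1).

Let cJ k y (yA : A y) := J_continuous (k := k) K_gt0 flow t0_ge0 t1T yA.

Lemma gpinch_continuous y : A y -> gpinch @ within A (nbhs y) --> gpinch y.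
Proof.
move=> yA; apply: cvgD; last exact: cvg_cst.
by apply: cvgB; [apply: cvgM; [exact: cvg_cst|exact: cJ]|exact: cJ].
Qed.

Lemma slab_gpinch_gt0 y : A y -> 0 < gpinch y.
Proof. by move=> yA; apply: gpinch_gt0; exact: (slab_times t0_ge0 t1T yA). Qed.

Lemma slab_lam y : A y -> K * (y.2 - t0) <= lam.
Proof.
move=> /slabP/andP[_ h]; apply: le_trans lam_le.
by rewrite ler_pM2l// lerD2r.
Qed.

Lemma slab_open_times y : A y -> t0 < y.2 -> open_times T y.2.
Proof.
move=> yA ty; split; first exact: le_lt_trans ty.
by have [] := slab_times t0_ge0 t1T yA.
Qed.

Lemma gradient_window Mg :
  (forall (p : point_solution R n m) f, pinched a b p ->
    0 < psev p (pst p) -> psK p * psev p (pst p) <= lam ->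
    psev p (psi_gradient b c p f) = 0 ->
    (forall k, psev p (psD k (psi_gradient b c p f)) = 0) ->
    0 <= psev p (psheat (psi_gradient b c p f)) -> f <= Mg) ->
  forall y, A y -> K * (y.2 - t0) * J Jet2 y <= Num.max Mg 0 * gpinch y ^+ 2.
Proof.
move=> HM.
apply: (@ratio_bound R n M (fun y => K * (y.2 - t0) * J Jet2 y) (fun y => gpinch y ^+ 2) t0 t1).
- move=> y yA; apply: cvgM; last exact: cJ.
  by apply: cvgM; [exact: cvg_cst|exact: time_continuous].
- move=> y yA; rewrite expr2; apply: cvgM; exact: gpinch_continuous.
- by move=> y yA; rewrite exprn_gt0// slab_gpinch_gt0.
move=> y f yA fE fmax; rewrite le_max.
have g0 : 0 < gpinch y ^+ 2 by rewrite exprn_gt0// slab_gpinch_gt0.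
(* At the initial time the factor [y.2 - t0] forces [f = 0], which accounts for the 0 in
   [Num.max Mg 0]. *)
have [ty|ty] := leP y.2 t0.
  have -> : f = 0.
    have ty' : y.2 = t0 by apply/eqP; rewrite eq_le ty; have /slabP/andP[] := yA.
    have : f * gpinch y ^+ 2 = 0 by rewrite -fE ty' subrr mulr0 mul0r.
    by move=> /eqP; rewrite mulf_eq0 (gt_eqF g0) orbF => /eqP.
  by rewrite lexx orbT.
apply/orP; left.
have [ O [F [N [lf [Oz JE]]]]] := flow_near K_gt0 flow (slab_open_times yA ty).
set c0 := chart_at y.1 in lf Oz JE.
pose fl := lf_flow lf.
pose z : E := (coord c0 y.1, y.2).
have zy : (param c0 z.1, z.2) = y.
  by rewrite /z /= coordK -?surjective_pairing//; exact: chart_at_dom.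
pose p := flow_pt fl Oz t0.
pose psi : smooth_fun O := psi_gradient b c p f.
have psiE x (Ox : oset O x) : psi x =
    K * (x.2 - t0) * J Jet2 (param c0 x.1, x.2) - f * gpinch (param c0 x.1, x.2) ^+ 2.
  exact: (@point_gradient O F N fl c0 x Ox t0 (fun k => JE k x Ox) f).
have psi0 : psi z = 0 by rewrite (psiE z Oz) zy fE subrr.
have psi_le x : oset O x -> t0 <= x.2 <= z.2 -> psi x <= 0.
  move=> Ox /andP[x1 x2]; rewrite (psiE x Ox) subr_le0.
  apply: (fmax (param c0 x.1, x.2)); apply/slabP; rewrite /= x1 (le_trans x2)//.
  by have /slabP/andP[] := yA.
apply: (HM p).
- by apply: (@point_pinched O F N fl c0 z Oz t0 (fun k => JE k z Oz)); exact: (slab_times t0_ge0 t1T yA).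
- by rewrite flow_pt_t subr_gt0.
- by rewrite flow_pt_K flow_pt_t; exact: slab_lam yA.
- exact: psi0.
- by move=> k; exact: (contact_grad Oz ty psi0 psi_le (fl_pair fl) k).
- exact: (contact_heat Oz ty psi0 psi_le (fl_pair fl)).
Qed.

Lemma hessian_window M0 Nh Mh : 0 <= Nh ->
  (forall (p : point_solution R n m) f, pinched a b p ->
    0 <= psev p (pst p) -> psK p * psev p (pst p) <= lam ->
    psev p (psjet2 p) <= M0 * psev p (psg b c p) ^+ 2 ->
    psev p (psi_hessian b c p Nh f) = 0 ->
    0 <= psev p (psheat (psi_hessian b c p Nh f)) -> f <= Mh) ->
  (forall y, A y -> J Jet2 y <= M0 * gpinch y ^+ 2) ->
  forall y, A y -> K * (y.2 - t0) * J Jet3 y <= Num.max Mh (Nh * M0) * gpinch y ^+ 3.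
Proof.
move=> N0 HM hM0 y1 y1A.
suff h : K * (y1.2 - t0) * J Jet3 y1 + Nh * (J Jet2 y1 * gpinch y1)
    <= Num.max Mh (Nh * M0) * gpinch y1 ^+ 3.
  apply: le_trans h; rewrite lerDl; apply: mulr_ge0 => //.
  by apply: mulr_ge0; [exact: J_ge0|rewrite ltW// slab_gpinch_gt0].
move: y1 y1A.
apply: (@ratio_bound R n M (fun y => K * (y.2 - t0) * J Jet3 y + Nh * (J Jet2 y * gpinch y))
  (fun y => gpinch y ^+ 3) t0 t1).
- move=> y yA; apply: cvgD.
    apply: cvgM; last exact: cJ.
    by apply: cvgM; [exact: cvg_cst|exact: time_continuous].
  apply: cvgM; first exact: cvg_cst.
  by apply: cvgM; [exact: cJ|exact: gpinch_continuous].
- move=> y yA; apply: (@cvgM _ _ _ _ gpinch (fun y => gpinch y ^+ 2)).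
    exact: gpinch_continuous.
  by apply: cvgM; exact: gpinch_continuous.
- by move=> y yA; rewrite exprn_gt0// slab_gpinch_gt0.
move=> y f yA fE fmax; rewrite le_max.
have g0 : 0 < gpinch y by rewrite slab_gpinch_gt0.
(* At the initial time only the term with [Nh] is left, and the gradient bound gives
   [f <= Nh * M0]. *)
have [ty|ty] := leP y.2 t0.
  apply/orP; right.
  have ty' : y.2 = t0 by apply/eqP; rewrite eq_le ty; have /slabP/andP[] := yA.
  have g3 : 0 < gpinch y ^+ 3 by rewrite exprn_gt0.
  rewrite -(ler_pM2r g3) -fE ty' subrr mulr0 mul0r add0r.
  have -> : Nh * M0 * gpinch y ^+ 3 = Nh * (M0 * gpinch y ^+ 2 * gpinch y) by ring.
  by rewrite ler_wpM2l// ler_pM2r// hM0.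
apply/orP; left.
have [ O [F [N [lf [Oz JE]]]]] := flow_near K_gt0 flow (slab_open_times yA ty).
set c0 := chart_at y.1 in lf Oz JE.
pose fl := lf_flow lf.
pose z : E := (coord c0 y.1, y.2).
have zy : (param c0 z.1, z.2) = y.
  by rewrite /z /= coordK -?surjective_pairing//; exact: chart_at_dom.
pose p := flow_pt fl Oz t0.
pose psi : smooth_fun O := psi_hessian b c p Nh f.
have psiE x (Ox : oset O x) : psi x =
    K * (x.2 - t0) * J Jet3 (param c0 x.1, x.2)
    + Nh * (J Jet2 (param c0 x.1, x.2) * gpinch (param c0 x.1, x.2))
    - f * gpinch (param c0 x.1, x.2) ^+ 3.
  exact: (@point_hessian O F N fl c0 x Ox t0 (fun k => JE k x Ox) Nh f).
have psi0 : psi z = 0 by rewrite (psiE z Oz) zy fE subrr.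
have psi_le x : oset O x -> t0 <= x.2 <= z.2 -> psi x <= 0.
  move=> Ox /andP[x1 x2]; rewrite (psiE x Ox) subr_le0.
  apply: (fmax (param c0 x.1, x.2)); apply/slabP; rewrite /= x1 (le_trans x2)//.
  by have /slabP/andP[] := yA.
have JEz k : J k y = kS (fl_pair fl) k z by have := JE k z Oz; rewrite zy.
apply: (HM p).
- by apply: (@point_pinched O F N fl c0 z Oz t0 (fun k => JE k z Oz)); exact: (slab_times t0_ge0 t1T yA).
- by rewrite flow_pt_t subr_ge0 ltW.
- by rewrite flow_pt_K flow_pt_t; exact: slab_lam yA.
- rewrite flow_pt_jet2 (@point_g O F N fl c0 z Oz t0 (fun k => JE k z Oz)) zy -JEz.
  exact: hM0.
- exact: psi0.
- exact: (contact_heat Oz ty psi0 psi_le (fl_pair fl)).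
Qed.

End ParabolicEstimates.

Lemma small_time (R : realType) (T : \bar R) (e : R) : (0 < T)%E -> 0 < e ->
  exists2 t : R, 0 < t < e & (t%:E < T)%E.
Proof.
move=> T0 e0; case: T T0 => [r| |] //.
- rewrite lte_fin => r0; exists (Num.min e r / 2).
    have m0 : 0 < Num.min e r by rewrite lt_min e0.
    rewrite divr_gt0//= ltr_pdivrMr//.
    apply: (@le_lt_trans _ _ e); first by rewrite ge_min lexx.
    by rewrite mulr_natr mulr2n ltrDl.
  rewrite lte_fin ltr_pdivrMr//.
  apply: (@le_lt_trans _ _ r); first by rewrite ge_min lexx orbT.
  by rewrite mulr_natr mulr2n ltrDl.
- move=> _; exists (e / 2); last exact: ltry.
  by rewrite divr_gt0//= ltr_pdivrMr// mulr_natr mulr2n ltrDl.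
Qed.

Section Curvatures.
Variables (R : realType) (n : nat) (K : R) (M : closedManifold R n) (T : \bar R).
Variables (X : R -> M -> 'rV[R]_n.+2) (nu : R -> normals M).
Hypothesis K_gt0 : 0 < K.
Hypothesis T_gt0 : (0 < T)%E.
Hypothesis flow : is_mcf K T X nu.
Local Notation V := 'rV[R]_n.
Local Notation E := (V * R)%type.
Local Notation m := n.+2.
Local Notation J := (global_jet X nu).
Variables (c : chart R n M) (p : M).
Hypothesis ac : atlas c.
Hypothesis cp : dom c p.

Lemma jet_Hc t : times T t -> J MeanCurv2 (p, t) = Hc (X t) (nu t) c p ^+ 2.
Proof.
move=> tT; have [ O [F [N [lp Oz]]]] := local_pair_exists flow ac tT cp.
rewrite (global_jetE K_gt0 flow _ ac cp tT) (chart_jet_local lp _ cp tT Oz) /kS.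
apply: (etrans (smooth_funX _ _ Oz)); rewrite -[in RHS](coordK cp).
exact: (congr1 (fun x => x ^+ 2) (esym (local_Hc lp Oz tT))).
Qed.

Lemma jet_A2_gt0 t : open_times T t -> J Curv2 (p, t) = A2 (X t) (nu t) c p.
Proof.
move=> ot; have tT := open_timesT ot.
have [ O [F [N [lf Oz]]]] := local_flow_exists K_gt0 flow ac ot cp.
have [fE nuE] := local_pair_slices (lf_pair lf) tT.
rewrite (global_jetE K_gt0 flow _ ac cp tT) (chart_jet_local (lf_pair lf) _ cp tT Oz).
apply/esym; apply: (etrans (slice_A2 (lf_flow lf) fE nuE Oz)).
have -> : lp_pair (lf_pair lf) = fl_pair (lf_flow lf) by exact: Prop_irrelevance.
exact: erefl.
Qed.

(** [slice_A2] rests on the flow equations, which the extension is known to satisfy only at positive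
    times. Both sides extend to continuous functions of time, and they agree at positive times
    arbitrarily close to 0. *)
Lemma jet_A2_0 : J Curv2 (p, 0) = A2 (X 0) (nu 0) c p.
Proof.
have T0 : times T 0 by split; [exact: lexx|].
have [ O [F [N [lp Oz]]]] := local_pair_exists flow ac T0 cp.
pose ip := lp_pair lp.
pose A2S : smooth_fun O := \sum_(s : 2.-tuple 'I_n) \sum_(s' : 2.-tuple 'I_n)
  (\prod_a invmetS ip (tnth s a) (tnth s' a))
  * tup2 (sffS (fun i => @sder R _ O (sdir R i)) (posS ip) (norS ip)) s
  * tup2 (sffS (fun i => @sder R _ O (sdir R i)) (posS ip) (norS ip)) s'.
have A2E t : times T t -> oset O (coord c p, t) -> A2 (X t) (nu t) c p = A2S (coord c p, t).
  move=> tT Ot; have [fE nuE] := local_pair_slices lp tT.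
  apply: (slice_tensor_norm2 ip fE Ot) => s.
  apply: (etrans (slice_sff ip fE nuE (tnth s ord0) (tnth s ord_max) Ot)).
  by rewrite tnth_ord_max2.
have JE t : times T t -> oset O (coord c p, t) -> J Curv2 (p, t) = kS ip Curv2 (coord c p, t).
  by move=> tT Ot; rewrite (global_jetE K_gt0 flow _ ac cp tT); exact: chart_jet_local.
pose d := kS ip Curv2 - A2S.
have dE t : oset O (coord c p, t) -> d (coord c p, t) =
    kS ip Curv2 (coord c p, t) - A2S (coord c p, t).
  by move=> Ot; rewrite /d (smooth_funD _ _ Ot) (smooth_funN _ Ot).
suff : d (coord c p, 0) = 0.
  by rewrite (dE 0 Oz) -(JE 0 T0 Oz) -(A2E 0 T0 Oz) => /subr0_eq.
apply/eqP; apply/negPn/negP => d0.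
have nd := open_nbhs_nbhs (conj (nonvanishing_open d) (conj Oz d0)).
have ct : (fun t : R => (coord c p, t) : E) @ 0 --> (coord c p, 0 : R).
  apply: (@cvg_pair _ _ _ (nbhs (0 : R)) (nbhs (coord c p)) (nbhs (0 : R)) _ _ _ (cst (coord c p)) id).
    exact: cvg_cst.
  exact: cvg_id.
have /nbhs_ballP[e /= e0 B] : nbhs (0 : R)
    (fun t : R => (oset O `&` [set x | d x != 0]) (coord c p, t)) by exact: ct nd.
have [t /andP[t0 te] tT] := small_time T_gt0 e0.
have [Ot] : (oset O `&` [set x | d x != 0]) (coord c p, t).
  by apply: B; rewrite -ball_normE/= sub0r normrN gtr0_norm.
have ot : open_times T t by [].
move=> /eqP; apply; apply: (etrans (dE t Ot)).
rewrite -(JE t (open_timesT ot) Ot) -(A2E t (open_timesT ot) Ot).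
by rewrite (jet_A2_gt0 ot) subrr.
Qed.

Variables (a b cc : R).
Hypothesis a_ge0 : 0 <= a.
Hypothesis a_lt_c : a < cc.
Hypothesis b_ge0 : 0 <= b.
Hypothesis pinch : forall y, times T y.2 -> J Curv2 y <= a * J MeanCurv2 y + b * K.
Local Notation g := (gpinch K X nu b cc).

Lemma nabla2A2_le C M1 M2 t : 0 <= C -> 0 <= M1 -> 0 <= M2 ->
  (forall (q : point_solution R n m) f e d k, pinched a b q ->
    `|psev q (psD f (pscodazzi q e d k))| <=
    C * psrho b cc q ^+ 3 * ((1 + psx b cc q) ^+ 2 + psy b cc q)) ->
  open_times T t -> J Jet2 (p, t) <= M1 * g (p, t) ^+ 2 ->
  J Jet3 (p, t) <= M2 * g (p, t) ^+ 3 ->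
  nabla2A2 (X t) (nu t) c p <= 81 * #|{: 4.-tuple 'I_m}|%:R ^+ 2 *
    (C * ((1 + Num.sqrt M1) ^+ 2 + Num.sqrt M2)) ^+ 2 * g (p, t) ^+ 3.
Proof.
move=> C0 M10 M20 hC ot h2 h3; have tT := open_timesT ot.
have [ O [F [N [lf Oz]]]] := local_flow_exists K_gt0 flow ac ot cp.
pose fl := lf_flow lf.
have [fE nuE] := local_pair_slices (lf_pair lf) tT.
pose z : E := (coord c p, t).
have JE k : J k (param c z.1, z.2) = kS (fl_pair fl) k z.
  rewrite /z /= coordK// (global_jetE K_gt0 flow _ ac cp tT).
  rewrite (chart_jet_local (lf_pair lf) _ cp tT Oz).
  by have -> : lp_pair (lf_pair lf) = fl_pair (lf_flow lf) by exact: Prop_irrelevance.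
have zy : (param c z.1, z.2) = (p, t) by rewrite /z /= coordK.
pose q := flow_pt fl Oz 0.
have pq : pinched a b q by exact: (@point_pinched R n K M T X nu K_gt0 a b pinch O F N fl c z Oz 0 JE).
have gq : psev q (psg b cc q) = g (p, t).
  by rewrite (@point_g R n K M X nu b cc O F N fl c z Oz 0 JE) zy.
have g0 : 0 < g (p, t) by rewrite -gq; exact: (psg_gt0 a_lt_c pq).
have JEz k : J k (p, t) = kS (fl_pair fl) k z by rewrite -zy.
have rho2 : psrho b cc q ^+ 2 = g (p, t) by rewrite (psrho2 a_lt_c pq).
have rho0 : 0 < psrho b cc q by exact: (psrho_gt0 a_lt_c pq).
have x_le : psx b cc q <= Num.sqrt M1.
  rewrite /psx rho2 ler_pdivrMr// -(ger0_norm (ltW g0)) -sqrtr_sqr -sqrtrM//.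
  by rewrite ler_wsqrtr// flow_pt_jet2 -JEz.
have y_le : psy b cc q <= Num.sqrt M2.
  rewrite /psy ler_pdivrMr ?exprn_gt0//.
  rewrite -(ger0_norm (ltW (exprn_gt0 3 rho0))) -sqrtr_sqr -sqrtrM//.
  by rewrite ler_wsqrtr// flow_pt_jet3 -JEz -exprM mulnC exprM rho2.
pose B := C * ((1 + Num.sqrt M1) ^+ 2 + Num.sqrt M2).
have x0 : 0 <= psx b cc q by exact: (psx_ge0 cc pq).
have bound f e d k : `|psev q (psD f (pscodazzi q e d k))| <= psrho b cc q ^+ 3 * B.
  apply: (le_trans (hC q f e d k pq)); rewrite /B [psrho b cc q ^+ 3 * _]mulrCA -mulrA.
  rewrite ler_wpM2l// ler_wpM2l ?exprn_ge0 ?(ltW rho0)//.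
  have s0 : 0 <= Num.sqrt M1 := sqrtr_ge0 _.
  apply: lerD => //; apply: lerXn2r; rewrite ?nnegrE ?lerD2l//; exact: addr_ge0.
have -> : 81 * #|{: 4.-tuple 'I_m}|%:R ^+ 2 * B ^+ 2 * g (p, t) ^+ 3 =
    81 * #|{: 4.-tuple 'I_m}|%:R ^+ 2 * (psrho b cc q ^+ 3 * B) ^+ 2.
  by rewrite -rho2; ring.
have hN := @slice_nabla2A2_le R n K O F N fl t _ _ fE nuE (coord c p) (psrho b cc q ^+ 3 * B) Oz.
apply: hN => f e d k. exact: bound.
Qed.

End Curvatures.

(** * Choice of constants and conclusion *)

Lemma sum_cube_le (R : realFieldType) (x y : R) : 0 <= x -> 0 <= y ->
  (x + y) ^+ 3 <= 4 * (x ^+ 3 + y ^+ 3).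
Proof.
move=> x0 y0; rewrite -subr_ge0.
have -> : 4 * (x ^+ 3 + y ^+ 3) - (x + y) ^+ 3 = 3 * ((x + y) * (x - y) ^+ 2) by ring.
by rewrite mulr_ge0// mulr_ge0 ?addr_ge0// sqr_ge0.
Qed.

(** [a (n + 2) < 3] amounts to [2 n + 3 alpha > 8], and [b < 4 <= n]. The last condition holds with
    equality, since [b - 2 n = - 2 / a]. *)
Lemma pinching_constants (R : realFieldType) (n : nat) (alpha : R) :
  (4 <= n)%N -> 0 < alpha < 1 ->
  let a := (n%:R - 2 + alpha)^-1 in let b := 2 * (2 - alpha) in
  [/\ 0 <= a, a * (n%:R + 2) < 3, 0 <= b, b <= n%:R & a * (b - 2 * n%:R) + 2 <= 0].
Proof.
move=> hn /andP[al0 al1] a b.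
have n4 : 4 <= n%:R :> R by rewrite (ler_nat _ 4).
have d0 : 0 < n%:R - 2 + alpha by lra.
split.
- by rewrite invr_ge0 ltW.
- by rewrite mulrC ltr_pdivrMr//; lra.
- by rewrite /b; lra.
- by rewrite /b; lra.
- have -> : b - 2 * n%:R = - 2 * (n%:R - 2 + alpha) by rewrite /b; ring.
  by rewrite mulrCA mulVf ?gt_eqF// mulr1 addNr.
Qed.

(** [Theta >= 0] makes [Lambda0] nonnegative, so the right-hand side of the defining equation
    exceeds 1. *)
Lemma waiting_time_gt0 (R : realType) (n : nat) (alpha Theta lambda0 : R) :
  (4 <= n)%N -> 0 < alpha < 1 -> 0 <= Theta ->
  expR (2 * n%:R * lambda0) = 1 + n%:R / (n%:R + Lambda0 n alpha Theta) -> 0 < lambda0.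
Proof.
move=> hn hal Th0 he; have [a0 _ b0 _ _] := pinching_constants hn hal.
have n0 : 0 < n%:R :> R by rewrite ltr0n; apply: leq_trans hn.
have L0 : 0 <= Lambda0 n alpha Theta.
  by rewrite /Lambda0; apply: mulr_ge0 => //; apply: addr_ge0 => //; exact: mulr_ge0.
have : 1 < expR (2 * n%:R * lambda0).
  by rewrite he ltrDl divr_gt0// ltr_wpDr.
by rewrite expR_gt1 pmulr_rgt0// mulr_gt0.
Qed.

Theorem theorem4p11 (R : realType) (n : nat) (alpha V Theta lambda0 : R)
    (hn : (4 <= n)%N) (halpha : 0 < alpha < 1)
    (hlambda0 : expR (2 * n%:R * lambda0)
                = 1 + n%:R / (n%:R + Lambda0 n alpha Theta)) :
  exists C : R,
    forall (K : R) (M : closedManifold R n) (T : \bar R)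
      (X : R -> M -> 'rV[R]_n.+2) (nu : R -> normals M),
      0 < K -> (0 < T)%E ->
      is_mcf K T X nu ->
      in_class K alpha V Theta (X 0) (nu 0) ->
      forall (t : R) (c : chart R n M) (p : M),
        lambda0 * K^-1 <= t -> (t%:E < T)%E -> atlas c -> dom c p ->
        nabla2A2 (X t) (nu t) c p
          <= C * (Hc (X t) (nu t) c p ^+ 6 + K ^+ 3).
Proof.
have [a_ge0 a_kato b_ge0 b_le ab] := pinching_constants hn halpha.
set a := (n%:R - 2 + alpha)^-1 in a_ge0 a_kato ab.
set b := 2 * (2 - alpha) in b_ge0 b_le ab.
(* A member of the class that has a point satisfies [0 <= H^2 <= Theta K] there. *)
have Theta_ge0 K (M : closedManifold R n) (F : M -> 'rV[R]_n.+2) (nu : normals M)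
    (c : chart R n M) (p : M) : 0 < K -> in_class K alpha V Theta F nu -> atlas c -> dom c p -> 0 <= Theta.
  move=> K0 [_ _ _ hTh] ac cp; have h := hTh c p ac cp.
  have : 0 <= Theta * K by exact: le_trans (sqr_ge0 _) h.
  by rewrite pmulr_lge0.
(* A point of a hypersurface in the class would force [lambda0 > 0]; in the opposite case the claim
   is vacuous and the constant 0 serves. *)
have [lam00|lam00] := ltP 0 lambda0; last first.
  exists 0 => K M T X nu K0 T0 flow cls t c p _ _ ac cp.
  by have := waiting_time_gt0 hn halpha (Theta_ge0 _ _ _ _ _ _ K0 cls ac cp) hlambda0; rewrite ltNge lam00.
have n2 : 0 < n%:R + 2 :> R by rewrite ltr_wpDl.
(* The midpoint; any value strictly between [a] and [3 / (n + 2)] would serve. *)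
pose cc := (a + 3 / (n%:R + 2)) / 2.
have a3 : a < 3 / (n%:R + 2) by rewrite ltr_pdivlMr.
have a_lt_c : a < cc by rewrite /cc ltr_pdivlMr//; move: a3; set e := 3 / _; lra.
have c_kato : cc * (n%:R + 2) < 3.
  by rewrite -ltr_pdivlMr// /cc ltr_pdivrMr//; move: a3; set e := 3 / _; lra.
have c_ge0 : 0 <= cc := le_trans a_ge0 (ltW a_lt_c).
(* [K] times the length of a window. The factor [K (t - t0)] of the estimates equals [lam] at the
   end of a window, hence the divisions by [lam] in [M1] and [M2]. *)
pose lam := lambda0 / 3.
have lam0 : 0 < lam by rewrite divr_gt0.
have [Mg HMg] := contact_gradient n.+2 a_ge0 a_lt_c b_ge0 c_kato lam0.
pose M1 := Num.max Mg 0 / lam.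
have M10 : 0 <= M1 by rewrite divr_ge0 ?le_max ?lexx ?orbT// ltW.
have [Nh Nh0 [Mh HMh]] := contact_hessian n.+2 a_ge0 a_lt_c b_ge0 c_kato lam0 M10.
pose M2 := Num.max Mh (Nh * M1) / lam.
have M20 : 0 <= M2.
  by rewrite divr_ge0 ?(ltW lam0)// le_max mulr_ge0 ?orbT.
have [C C0 HC] := Dcodazzi_le n n.+2 a_ge0 a_lt_c b_ge0.
pose C1 := 81 * #|{: 4.-tuple 'I_n.+2}|%:R ^+ 2 *
  (C * ((1 + Num.sqrt M1) ^+ 2 + Num.sqrt M2)) ^+ 2.
have C10 : 0 <= C1 by rewrite /C1 mulr_ge0 ?sqr_ge0// mulr_ge0// sqr_ge0.
exists (C1 * (4 * (cc ^+ 3 + (b + 1) ^+ 3))).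
move=> K M T X nu K0 T0 flow cls t c p tlow tT ac cp.
have pinch y : times T y.2 -> global_jet X nu Curv2 y <= a * global_jet X nu MeanCurv2 y + b * K.
  move=> yT; have d0 : defect K X nu a b y <= 0.
    apply: (pinching_preserved K0 flow a_ge0 (ltW a_kato) b_ge0 b_le ab) => // q.
    have aq := chart_at_atlas q; have dq := chart_at_dom q.
    have T00 : times T 0 by split; [exact: lexx|].
    rewrite /defect (jet_A2_0 K0 T0 flow aq dq) (jet_Hc K0 flow aq dq T00).
    by have [_ h _ _] := cls; rewrite subr_le0; exact: h.
  by move: d0; rewrite /defect -addrA -opprD subr_le0.
pose del := lam / K.
have del0 : 0 < del by rewrite divr_gt0.
have Kdel : K * del = lam by rewrite mulrC divfK// gt_eqF.
have t3 : 3 * del <= t.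
  apply: le_trans tlow; rewrite /del /lam le_eqVlt; apply/orP; left; apply/eqP.
  by field; rewrite gt_eqF.
pose g := gpinch K X nu b cc.
(* The window slides so as to end at [y]. The bound therefore holds at all times from [2 * del] on,
   in particular throughout the window [[t - del, t]] used for the second derivatives. *)
have hJ2 (y : M * R) : 2 * del <= y.2 -> (y.2%:E < T)%E -> global_jet X nu Jet2 y <= M1 * g y ^+ 2.
  move=> y2 yT; have y10 : 0 <= y.2 - del by move: y2 del0; lra.
  have yA : @slab R n M (y.2 - del) y.2 y by apply/slabP; rewrite lexx andbT; move: del0; lra.
  have short : K * (y.2 - (y.2 - del)) <= lam by rewrite subKr Kdel.
  have := gradient_window K0 flow a_lt_c pinch y10 yT short HMg yA.
  by rewrite subKr Kdel mulrC -ler_pdivlMr// mulrAC.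
have hJ3 : global_jet X nu Jet3 (p, t) <= M2 * g (p, t) ^+ 3.
  have y10 : 0 <= t - del by move: t3 del0; lra.
  have yA : @slab R n M (t - del) t (p, t) by apply/slabP; rewrite /= lexx andbT; move: del0; lra.
  have short : K * (t - (t - del)) <= lam by rewrite subKr Kdel.
  have hA y : @slab R n M (t - del) t y -> global_jet X nu Jet2 y <= M1 * g y ^+ 2.
    move=> /slabP/andP[h1 h2]; apply: hJ2; first by move: t3 h1; lra.
    by apply: le_lt_trans tT; rewrite lee_fin.
  have := hessian_window K0 flow a_lt_c pinch y10 tT short Nh0 HMh hA yA.
  by rewrite /= subKr Kdel mulrC -ler_pdivlMr// mulrAC.
have ot : open_times T t by split => //; move: t3 del0; lra.
have h2 : global_jet X nu Jet2 (p, t) <= M1 * g (p, t) ^+ 2.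
  by apply: hJ2 => //=; move: t3 del0; lra.
have nabla := nabla2A2_le K0 flow ac cp a_lt_c pinch C0 M10 M20 HC ot h2 hJ3.
apply: (le_trans nabla); rewrite -[X in _ <= X]mulrA; apply: (ler_wpM2l C10).
have H2 := jet_Hc K0 flow ac cp (open_timesT ot).
set h := Hc _ _ _ _ in H2 *.
have g0 : 0 < g (p, t) by apply: (gpinch_gt0 K0 a_lt_c pinch); exact: (open_timesT ot).
have gle : g (p, t) <= cc * h ^+ 2 + (b + 1) * K.
  by rewrite /g /gpinch H2; have := J_ge0 X nu Curv2 (p, t); lra.
have K0' := ltW K0; have b10 : 0 <= b + 1 by rewrite addr_ge0.
have x0 : 0 <= cc * h ^+ 2 by rewrite mulr_ge0// sqr_ge0.
have y0 : 0 <= (b + 1) * K by rewrite mulr_ge0.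
apply: (@le_trans _ _ ((cc * h ^+ 2 + (b + 1) * K) ^+ 3)).
  by apply: lerXn2r; rewrite ?nnegrE//; [exact: ltW|exact: addr_ge0].
apply: (le_trans (sum_cube_le x0 y0)).
rewrite -[X in _ <= X]mulrA; apply: ler_wpM2l => //.
have h60 : 0 <= h ^+ 6 by rewrite (exprM h 2 3) exprn_ge0// sqr_ge0.
have K30 : 0 <= K ^+ 3 by rewrite exprn_ge0.
have c30 : 0 <= cc ^+ 3 by rewrite exprn_ge0.
have b30 : 0 <= (b + 1) ^+ 3 by rewrite exprn_ge0.
rewrite -subr_ge0.
have -> : (cc ^+ 3 + (b + 1) ^+ 3) * (h ^+ 6 + K ^+ 3)
    - ((cc * h ^+ 2) ^+ 3 + ((b + 1) * K) ^+ 3)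
  = cc ^+ 3 * K ^+ 3 + (b + 1) ^+ 3 * h ^+ 6 by ring.
by rewrite addr_ge0// mulr_ge0.
Qed.
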